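(* Let $N\in\mathbb{N}$, let $k\in -2\mathbb{N}$ (so $k\le -2$ is even) and let $m\in\mathbb{N}$. Let $H_{k,m}:=H_{k,m}^++H_{k,m}^-$, where $H_{k,m}^\pm$ are the functions defined in the context below. Then $H_{k,m}(\tau)$ converges for all $\tau\in\mathbb{H}\cup(-\mathbb{H})$. Furthermore, if $\tau\in\mathbb{H}$ then $$H_{k,m}(\tau)=F_{k,-m}(\tau),$$ and if $\tau\in-\mathbb{H}$ then $$H_{k,m}(\tau)=m^{1-k}\left(\mathcal{E}_{P_{2-k,m}}(-\tau)-\frac{(4\pi)^{1-k}}{(-k)!}\,P^{*}_{2-k,-m}(-\tau)\right).$$
   Context: Notation: $\mathbb{H}$ is the upper half-plane, $-\mathbb{H}$ the lower half-plane; $\tau=u+iv$, $q:=e^{2\pi i\tau}$, $e(x):=e^{2\pi i x}$, $\zeta_c^{b}:=e^{2\pi i b/c}$. For $c\in\mathbb{N}$, $\sum_{d \pmod c^*}$ runs over residues $d$ modulo $c$ with $\gcd(d,c)=1$, and $\bar d$ denotes the inverse of $d$ modulo $c$. The Kloosterman sum is $K(a,b;c):=\sum_{d\pmod c^*}e\left(\frac{a\bar d+bd}{c}\right)$. Sums $\sum_{c>0,\,N\mid c}$ run over positive multiples of $N$. Incomplete gamma function: $\Gamma(s,y):=\int_y^\infty t^{s-1}e^{-t}\,dt$ for $y>0$; for a positive integer $s$ it is extended to all real $y$ by $\Gamma(s,y)=(s-1)!\,e^{-y}\sum_{j=0}^{s-1}y^j/j!$. Normalized: $\Gamma^*(s,y):=\Gamma(s,y)/\Gamma(s)$.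 Polylogarithm: $\mathrm{Li}_s(w):=\sum_{n\ge1}w^n/n^s$ for $|w|<1$; for $s$ a negative integer, $\mathrm{Li}_s$ is a rational function of $w$ (namely $\mathrm{Li}_{-n}(w)=(w\frac{d}{dw})^n\frac{w}{1-w}$) and is understood as such for all $w\neq1$. Modular objects on $\Gamma_0(N)$: for $\gamma=\begin{pmatrix}a&b\\c&d\end{pmatrix}$, $(\varphi|_\kappa\gamma)(\tau):=(c\tau+d)^{-\kappa}\varphi\left(\frac{a\tau+b}{c\tau+d}\right)$, and $\Gamma_\infty:=\{\pm\begin{pmatrix}1&n\\0&1\end{pmatrix}:n\in\mathbb{Z}\}$. For even $\kappa>2$ and $\ell\in\mathbb{Z}\setminus\{0\}$, the Poincaré series is $P_{\kappa,\ell}(\tau):=\sum_{\gamma\in\Gamma_\infty\backslash\Gamma_0(N)}(q^\ell)|_\kappa\gamma$; its Fourier expansion at $i\infty$ has the form $\sum_n c(n)q^n$ with zero constant term (for $\ell>0$ it is a cusp form; for $\ell<0$ a weakly holomorphic form $q^{\ell}+\sum_{n\ge1}c(n)q^n$). For $f(\tau)=\sum_n c_f(n)q^n$ of weight $\kappa$ with $c_f(0)=0$, define the Eichler integral $\mathcal{E}_f(\tau):=\sum_{n\ne0}\frac{c_f(n)}{n^{\kappa-1}}q^n$ and the non-holomorphic Eichler integral $f^*(\tau):=-(4\pi)^{1-\kappa}\sum_{n\ne0}\frac{\overline{c_f(n)}}{n^{\kappa-1}}\Gamma(\kappa-1,4\pi nv)q^{-n}$. These are applied with $\kappa=2-k$.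 The Maass–Poincaré series is $F_{k,-m}(\tau):=\sum_{\gamma\in\Gamma_\infty\backslash\Gamma_0(N)}\phi|_k\gamma(\tau)$ with seed $\phi(\tau):=\bigl(1-\Gamma^*(1-k,4\pi m v)\bigr)q^{-m}$ (a harmonic Maass form of weight $k$). Auxiliary series: for $c\in\mathbb{N}$, $\alpha^+_{m,c}(s):=\sum_{j\ge0}\frac{1}{(j+1-k)!}\left(\frac{2\pi\sqrt m}{c}\right)^{2j+1-k}s^{-j-1}$ and $\alpha^-_{m,c}(s):=\sum_{j\ge0}\frac{(-1)^j}{(j+1-k)!}\left(\frac{2\pi\sqrt m}{c}\right)^{2j+1-k}s^{-j-1}$. For $\tau\in\mathbb{H}\cup(-\mathbb{H})$ and $\gcd(c,d)=1$ set $\phi^+_{k,m}(c,d;\tau):=\frac{1}{2\pi i}\int_{|s|=r}\frac{\alpha^+_{m,c}(s)e^s}{1-e^s\zeta_c^dq}\,ds$, $\phi^-_{k,m}(c,d;\tau):=\frac{1}{2\pi i}\int_1^\infty t^{-k}\int_{|s|=r}\alpha^-_{m,c}(s)\,\mathrm{Li}_{k-1}\!\left(e^{s-4\pi vt}\zeta_c^{-d}q^{-1}\right)ds\,dt$, where $r=r(\tau)>0$ is taken sufficiently small (in particular $r<2\pi|v|$, and so that $|e^{s}q|$ stays on the same side of $1$ as $|q|$ for $|s|\le r$). Let $a^+_{k,-m}(0):=\frac{(2\pi)^{2-k}(-1)^{\frac k2+1}(-m)^{1-k}}{(1-k)!}\sum_{c>0,\,N\mid c}\frac{K(-m,0;c)}{c^{2-k}}$.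 Define $$H^+_{k,m}(\tau):=q^{-m}+a^+_{k,-m}(0)+2\pi(-1)^{\frac k2}m^{\frac{1-k}{2}}\sum_{c>0,\,N\mid c}\frac1c\sum_{d\pmod c^*}e\left(\frac{-m\bar d+d}{c}+\tau\right)\phi^+_{k,m}(c,d;\tau),$$ $$H^-_{k,m}(\tau):=-\Gamma^*(1-k,4\pi mv)q^{-m}+\frac{2\pi(-1)^{\frac k2}(4\pi v)^{1-k}}{(-k)!}m^{\frac{1-k}{2}}\sum_{c>0,\,N\mid c}\frac1c\sum_{d\pmod c^*}e\left(\frac{-m\bar d}{c}\right)\phi^-_{k,m}(c,d;\tau).$$ *)

(* Defs.v *)
From Stdlib Require Import Reals ZArith Lia.
From Coquelicot Require Import Coquelicot.

Open Scope R_scope.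

Definition Cexp (z : C) : C :=
  (exp (Re z) * cos (Im z), exp (Re z) * sin (Im z)).

Definition e2pi (z : C) : C := Cexp (Cmult (0, 2 * PI) z).

Definition qpow (l : Z) (tau : C) : C := e2pi (Cmult (RtoC (IZR l)) tau).

Definition zeta (c : nat) (b : Z) : C := e2pi (RtoC (IZR b / INR c)).

Definition Cpowz (z : C) (n : Z) : C :=
  match n with
  | Z0 => RtoC 1
  | Zpos p => Cpow z (Pos.to_nat p)
  | Zneg p => Cinv (Cpow z (Pos.to_nat p))
  end.

Fixpoint fsum (n : nat) (f : nat -> C) : C :=
  match n with
  | O => RtoC 0
  | S n' => Cplus (fsum n' f) (f n')
  end.

Definition CSeries (a : nat -> C) : C :=
  (Series (fun n => Re (a n)), Series (fun n => Im (a n))).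

Definition ex_Cseries (a : nat -> C) : Prop :=
  @ex_series R_AbsRing C_R_NormedModule a.

Definition sum_mult (N : nat) (g : nat -> C) : C :=
  CSeries (fun n => g (N * S n)%nat).

Definition sum_nonzero (g : Z -> C) : C :=
  Cplus (CSeries (fun j => g (Z.of_nat (S j))))
        (CSeries (fun j => g (- Z.of_nat (S j))%Z)).

Definition is_inv_pair (c d x : nat) : bool :=
  (Nat.eqb (Nat.gcd d c) 1 && Nat.eqb ((d * x) mod c) (1 mod c))%bool.

Definition sum_units (c : nat) (f : nat -> nat -> C) : C :=
  fsum c (fun d => fsum c (fun x => if is_inv_pair c d x then f d x else RtoC 0)).

Definition Kloosterman (a b : Z) (c : nat) : C :=
  sum_units c (fun d x => e2pi (RtoC ((IZR a * INR x + IZR b * INR d) / INR c))).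

(* (1/(2 pi i)) \oint_{|s| = r} g(s) ds, circle parametrized s = r e^{i theta} *)
Definition contour (r : R) (g : C -> C) : C :=
  Cmult (RtoC (/ (2 * PI)))
    (RInt (V := C_R_CompleteNormedModule)
       (fun th => let s : C := (r * cos th, r * sin th) in Cmult (g s) s) 0 (2 * PI)).

(* Gamma(s, y) for positive integer s, for all real y:
   (s-1)! e^{-y} sum_{j=0}^{s-1} y^j / j! *)
Definition GammaInc (s : nat) (y : R) : R :=
  INR (fact (s - 1)) * exp (- y) * sum_f_R0 (fun j => y ^ j / INR (fact j)) (s - 1).

Definition GammaStar (s : nat) (y : R) : R := GammaInc s y / INR (fact (s - 1)).

(* Coefficients obtained by iterating theta = w d/dw on u = w/(1-w):
   theta u^{j+1} = (j+1) (u^{j+1} + u^{j+2}), so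
   (w d/dw)^n (w/(1-w)) = sum_j licoef n j * u^{j+1}. *)
Fixpoint licoef (n j : nat) : nat :=
  match n with
  | O => match j with O => 1%nat | S _ => 0%nat end
  | S n' => ((j + 1) * licoef n' j +
             match j with O => 0%nat | S j' => j * licoef n' j' end)%nat
  end.

(* Li_{-n}(w) = (w d/dw)^n (w/(1-w)), as a rational function of w (w <> 1) *)
Definition Li_neg (n : nat) (w : C) : C :=
  let u := Cdiv w (Cminus (RtoC 1) w) in
  fsum (S n) (fun j => Cmult (RtoC (INR (licoef n j))) (Cpow u (S j))).

Definition alpha_plus (k : Z) (m c : nat) (s : C) : C :=
  CSeries (fun j =>
    Cmult (RtoC (/ INR (fact (Z.to_nat (Z.of_nat j + 1 - k))) *
                 (2 * PI * sqrt (INR m) / INR c) ^ Z.to_nat (2 * Z.of_nat j + 1 - k)))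
          (Cinv (Cpow s (S j)))).

Definition alpha_minus (k : Z) (m c : nat) (s : C) : C :=
  CSeries (fun j =>
    Cmult (RtoC ((-1) ^ j / INR (fact (Z.to_nat (Z.of_nat j + 1 - k))) *
                 (2 * PI * sqrt (INR m) / INR c) ^ Z.to_nat (2 * Z.of_nat j + 1 - k)))
          (Cinv (Cpow s (S j)))).

Definition phi_plus (k : Z) (m : nat) (r : R) (c d : nat) (tau : C) : C :=
  contour r (fun s =>
    Cdiv (Cmult (alpha_plus k m c s) (Cexp s))
         (Cminus (RtoC 1) (Cmult (Cmult (Cexp s) (zeta c (Z.of_nat d))) (qpow 1 tau)))).

Definition phi_minus_integrand (k : Z) (m : nat) (r : R) (c d : nat) (tau : C) (t : R) : C :=
  Cmult (RtoC (t ^ Z.to_nat (- k)))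
    (contour r (fun s =>
       Cmult (alpha_minus k m c s)
             (Li_neg (Z.to_nat (1 - k))
                (Cmult (Cmult (Cexp (Cminus s (RtoC (4 * PI * Im tau * t))))
                              (zeta c (- Z.of_nat d)))
                       (qpow (-1) tau))))).

Definition phi_minus (k : Z) (m : nat) (r : R) (c d : nat) (tau : C) : C :=
  RInt_gen (V := C_R_CompleteNormedModule)
    (phi_minus_integrand k m r c d tau) (at_point 1) (Rbar_locally p_infty).

Definition aplus0_term (k : Z) (m : nat) (c : nat) : C :=
  Cdiv (Kloosterman (- Z.of_nat m) 0 c) (RtoC (INR c ^ Z.to_nat (2 - k))).

Definition aplus0 (N : nat) (k : Z) (m : nat) : C :=
  Cmult (RtoC ((2 * PI) ^ Z.to_nat (2 - k) * powerRZ (-1) (k / 2 + 1) *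
               (- INR m) ^ Z.to_nat (1 - k) / INR (fact (Z.to_nat (1 - k)))))
        (sum_mult N (aplus0_term k m)).

Definition Hplus_term (k : Z) (m : nat) (r : R) (tau : C) (c : nat) : C :=
  Cmult (RtoC (/ INR c))
    (sum_units c (fun d x =>
       Cmult (Cmult (e2pi (RtoC ((- INR m * INR x + INR d) / INR c))) (qpow 1 tau))
             (phi_plus k m r c d tau))).

Definition Hplus (N : nat) (k : Z) (m : nat) (r : R) (tau : C) : C :=
  Cplus (Cplus (qpow (- Z.of_nat m) tau) (aplus0 N k m))
        (Cmult (RtoC (2 * PI * powerRZ (-1) (k / 2) * Rpower (INR m) ((1 - IZR k) / 2)))
               (sum_mult N (Hplus_term k m r tau))).

Definition Hminus_term (k : Z) (m : nat) (r : R) (tau : C) (c : nat) : C :=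
  Cmult (RtoC (/ INR c))
    (sum_units c (fun d x =>
       Cmult (e2pi (RtoC (- INR m * INR x / INR c))) (phi_minus k m r c d tau))).

Definition Hminus (N : nat) (k : Z) (m : nat) (r : R) (tau : C) : C :=
  Cplus (Copp (Cmult (RtoC (GammaStar (Z.to_nat (1 - k)) (4 * PI * INR m * Im tau)))
                     (qpow (- Z.of_nat m) tau)))
        (Cmult (RtoC (2 * PI * powerRZ (-1) (k / 2) * (4 * PI * Im tau) ^ Z.to_nat (1 - k)
                      / INR (fact (Z.to_nat (- k))) * Rpower (INR m) ((1 - IZR k) / 2)))
               (sum_mult N (Hminus_term k m r tau))).

Definition Hkm (N : nat) (k : Z) (m : nat) (r : R) (tau : C) : C :=
  Cplus (Hplus N k m r tau) (Hminus N k m r tau).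

Definition mobius (a b c d : Z) (tau : C) : C :=
  Cdiv (Cplus (Cmult (RtoC (IZR a)) tau) (RtoC (IZR b)))
       (Cplus (Cmult (RtoC (IZR c)) tau) (RtoC (IZR d))).

Definition slash (kappa : Z) (f : C -> C) (a b c d : Z) (tau : C) : C :=
  Cmult (Cpowz (Cplus (Cmult (RtoC (IZR c)) tau) (RtoC (IZR d))) (- kappa))
        (f (mobius a b c d tau)).

(* Sum over gamma in Gamma_infty \ Gamma_0(N) of F(gamma), F given on matrix entries.
   Representatives: the identity, and for c > 0 with N | c, d in Z, the unique
   [a b; c d] with 0 <= a < c, ad - bc = 1 (exists iff gcd(c,d) = 1).
   The sum is taken as the iterated sum over c (increasing), then d in Z. *)
Definition coset_sum (N : nat) (F : Z -> Z -> Z -> Z -> C) : C :=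
  let G (c d : Z) : C :=
    fsum (Z.to_nat c) (fun a0 =>
      let a := Z.of_nat a0 in
      if Z.eqb ((a * d - 1) mod c)%Z 0%Z then F a ((a * d - 1) / c)%Z c d else RtoC 0) in
  Cplus (F 1%Z 0%Z 0%Z 1%Z)
    (CSeries (fun n =>
       let c := Z.of_nat (N * S n) in
       Cplus (CSeries (fun j => G c (Z.of_nat j)))
             (CSeries (fun j => G c (- Z.of_nat (S j))%Z)))).

Definition poincare (N : nat) (kappa l : Z) (tau : C) : C :=
  coset_sum N (fun a b c d => slash kappa (qpow l) a b c d tau).

Definition maass_seed (k : Z) (m : nat) (tau : C) : C :=
  Cmult (RtoC (1 - GammaStar (Z.to_nat (1 - k)) (4 * PI * INR m * Im tau)))
        (qpow (- Z.of_nat m) tau).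

Definition maass_poincare (N : nat) (k : Z) (m : nat) (tau : C) : C :=
  coset_sum N (fun a b c d => slash k (maass_seed k m) a b c d tau).

Definition fourier_coeff (f : C -> C) (n : Z) : C :=
  RInt (V := C_R_CompleteNormedModule)
    (fun u => Cmult (f (u, 1)) (qpow (- n) (u, 1))) 0 1.

Definition eichler (kappa : Z) (f : C -> C) (tau : C) : C :=
  sum_nonzero (fun n =>
    Cmult (Cdiv (fourier_coeff f n) (RtoC (powerRZ (IZR n) (kappa - 1)))) (qpow n tau)).

Definition nh_eichler (kappa : Z) (f : C -> C) (tau : C) : C :=
  Cmult (RtoC (- powerRZ (4 * PI) (1 - kappa)))
    (sum_nonzero (fun n =>
       Cmult (Cmult (Cdiv (Cconj (fourier_coeff f n)) (RtoC (powerRZ (IZR n) (kappa - 1))))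
                    (RtoC (GammaInc (Z.to_nat (kappa - 1)) (4 * PI * IZR n * Im tau))))
             (qpow (- n) tau))).

(* Main.v *)
Require Import Defs.
From Stdlib Require Import Reals ZArith Lia Lra.
From Coquelicot Require Import Coquelicot.
Open Scope R_scope.

(** Both half-planes reduce to the Lipschitz formula
    [sum_{l in Z} (w + l)^(-s) = (-2 pi i)^s / (s-1)! * sum_n n^(s-1) e(n w)].
    It is obtained by Tannery's theorem from the distribution relation
    [sum_{j mod Q} Li_{1-s}(e((w+j)/Q)) = Q^s Li_{1-s}(e(w))] as [Q] tends to infinity.

    Write [w = tau + d/c] and [A = 2 pi i m / c^2]. Expanding in powers of [A], the term of the
    Maass-Poincare series attached to [(c, d)] is, up to a root of unity, a sum over [M] of
    [w^(-(M+1))] minus its Taylor polynomial of order [-k] at [conj w].  Each such difference is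
    summed over the translates of [w] by the Lipschitz formula; the Taylor polynomial is what
    produces the incomplete gamma function. The contour integrals on the other side are computed
    by expanding the geometric series, or the polylogarithm, inside or outside the unit disc
    according to the sign of [Im tau]; this yields the same Bessel series.  In the lower half-plane
    the Fourier coefficients of the Poincare series come from the same summation formula, and the
    sums over [c] and [n] are exchanged by absolute convergence. *)

(** * Absolutely convergent complex series *)

(** The obstacle is the exponent one: the sum of 1/(w+l) over the integers does not converge
    absolutely, so no exchange of sums applies to it. The Taylor polynomial cures this, since its
    leading term 1/(conj w + l) makes the difference O(|w+l|^-2). The price is a constant: the
    finite sums modulo Q contain u + conj u + 1 with u = x/(1-x), and the summand 1, divided by Q,
    vanishes termwise while its total stays 1. This is where the constant term a^+(0) comes from in
    the upper half-plane. In the lower half-plane the expansion outside the unit disc starts with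
    exponent 0 and produces a^+(0) with the opposite sign, so that it cancels, as it must, Eichler
    integrals having no constant term. Sums over c need only the trivial bound for Kloosterman sums:
    the Bessel factor supplies c^(k-1), which against c^2 pairs and the factor 1/c leaves c^k <=
    c^-2; this is where k <= -2 enters. [Series] being a total function, every value is carried
    together with a proof of absolute convergence. *)

Lemma C_eq (z w : C) : Re z = Re w -> Im z = Im w -> z = w.
Proof. destruct z, w; simpl; intros; subst; reflexivity. Qed.

Lemma im_le_Cmod (z : C) : Rabs (Im z) <= Cmod z.
Proof.
  eapply Rle_trans; [apply (Rmax_r (Rabs (fst z)))|apply Rmax_Cmod].
Qed.

Lemma Cmod_le_abs (z : C) : Cmod z <= Rabs (Re z) + Rabs (Im z).
Proof.
  replace z with (Cplus (RtoC (Re z)) (Cmult Ci (RtoC (Im z)))) at 1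
    by (apply C_eq; simpl; ring).
  eapply Rle_trans; [apply Cmod_triangle|].
  rewrite Cmod_mult, Cmod_Ci, !Cmod_R; lra.
Qed.

Fixpoint rsum (n : nat) (a : nat -> R) : R :=
  match n with O => 0 | S n' => rsum n' a + a n' end.

Lemma rsum_sum_n (a : nat -> R) (n : nat) : sum_n a n = rsum (S n) a.
Proof.
  induction n as [|n IH].
  - rewrite sum_O; simpl; ring.
  - rewrite sum_Sn, IH; reflexivity.
Qed.

Lemma is_series_rsum (a : nat -> R) (l : R) :
  is_series a l <-> is_lim_seq (fun n => rsum n a) l.
Proof.
  rewrite (is_lim_seq_incr_1 (fun n => rsum n a)).
  split; intros H.
  - apply is_lim_seq_ext with (2 := H); intros; apply rsum_sum_n.
  - apply is_lim_seq_ext with (v := fun n => sum_n a n) in H; [exact H|].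
    intros; symmetry; apply rsum_sum_n.
Qed.

Lemma Re_fsum n f : Re (fsum n f) = rsum n (fun i => Re (f i)).
Proof. induction n as [|n IH]; simpl; [|rewrite <- IH]; reflexivity. Qed.

Lemma Im_fsum n f : Im (fsum n f) = rsum n (fun i => Im (f i)).
Proof. induction n as [|n IH]; simpl; [|rewrite <- IH]; reflexivity. Qed.

Lemma fsum_ext n f g : (forall i, (i < n)%nat -> f i = g i) -> fsum n f = fsum n g.
Proof.
  intros H; induction n as [|n IH]; simpl; [reflexivity|].
  rewrite IH, H; auto.
Qed.

Lemma fsum_plus n f g :
  fsum n (fun i => Cplus (f i) (g i)) = Cplus (fsum n f) (fsum n g).
Proof. induction n as [|n IH]; simpl; [|rewrite IH]; ring. Qed.

Lemma fsum_scal n z f : fsum n (fun i => Cmult z (f i)) = Cmult z (fsum n f).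
Proof. induction n as [|n IH]; simpl; [|rewrite IH]; ring. Qed.

Lemma fsum_0 n : fsum n (fun _ => RtoC 0) = RtoC 0.
Proof. induction n as [|n IH]; simpl; [|rewrite IH]; ring. Qed.

Lemma fsum_conj n f : Cconj (fsum n f) = fsum n (fun i => Cconj (f i)).
Proof.
  induction n as [|n IH]; simpl; [|rewrite Cplus_conj, IH; reflexivity].
  apply C_eq; simpl; ring.
Qed.

Lemma Cmod_fsum_le n f b :
  (forall i, (i < n)%nat -> Cmod (f i) <= b i) -> Cmod (fsum n f) <= rsum n b.
Proof.
  intros H; induction n as [|n IH]; simpl; [rewrite Cmod_0; lra|].
  eapply Rle_trans; [apply Cmod_triangle|].
  apply Rplus_le_compat; auto.
Qed.

Lemma rsum_const n x : rsum n (fun _ => x) = INR n * x.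
Proof. induction n as [|n IH]; [simpl; ring|]. rewrite S_INR; simpl; rewrite IH; ring. Qed.

Lemma rsum_le n a b : (forall i, (i < n)%nat -> a i <= b i) -> rsum n a <= rsum n b.
Proof.
  intros H; induction n as [|n IH]; simpl; [lra|].
  apply Rplus_le_compat; auto.
Qed.

Lemma rsum_ext n a b : (forall i, (i < n)%nat -> a i = b i) -> rsum n a = rsum n b.
Proof.
  intros H; induction n as [|n IH]; simpl; [reflexivity|]. rewrite IH, H; auto.
Qed.

(** Componentwise, to match [CSeries], which is a pair of real [Series]. *)
Definition clim (u : nat -> C) (l : C) : Prop :=
  is_lim_seq (fun n => Re (u n)) (Re l) /\ is_lim_seq (fun n => Im (u n)) (Im l).

Lemma clim_ext u v l : (forall n, u n = v n) -> clim u l -> clim v l.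
Proof.
  intros H [H1 H2]; split; [eapply is_lim_seq_ext, H1|eapply is_lim_seq_ext, H2];
    intros; simpl; rewrite H; reflexivity.
Qed.

Lemma clim_ext_loc u v l : eventually (fun n => u n = v n) -> clim u l -> clim v l.
Proof.
  intros [N H] [H1 H2]; split; [eapply is_lim_seq_ext_loc, H1|eapply is_lim_seq_ext_loc, H2];
    exists N; intros; simpl; rewrite H; auto.
Qed.

Lemma clim_unique u l1 l2 : clim u l1 -> clim u l2 -> l1 = l2.
Proof.
  intros [H1 H2] [H3 H4].
  apply is_lim_seq_unique in H1, H2, H3, H4.
  rewrite H1 in H3; rewrite H2 in H4.
  injection H3; injection H4; intros; apply C_eq; assumption.
Qed.

Lemma clim_const z : clim (fun _ => z) z.
Proof. split; apply is_lim_seq_const. Qed.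

Lemma clim_plus u v l1 l2 :
  clim u l1 -> clim v l2 -> clim (fun n => Cplus (u n) (v n)) (Cplus l1 l2).
Proof.
  intros [H1 H2] [H3 H4]; split; simpl; apply is_lim_seq_plus'; assumption.
Qed.

Lemma clim_mult u v l1 l2 :
  clim u l1 -> clim v l2 -> clim (fun n => Cmult (u n) (v n)) (Cmult l1 l2).
Proof.
  intros [H1 H2] [H3 H4]; split; simpl;
    [apply is_lim_seq_minus'|apply is_lim_seq_plus'];
    apply is_lim_seq_mult'; assumption.
Qed.

Lemma clim_pow u l p : clim u l -> clim (fun n => Cpow (u n) p) (Cpow l p).
Proof.
  intros H; induction p as [|p IH]; simpl; [apply clim_const|].
  apply clim_mult; assumption.
Qed.

Lemma clim_conj u l : clim u l -> clim (fun n => Cconj (u n)) (Cconj l).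
Proof.
  intros [H1 H2]; split; simpl; [exact H1|].
  apply (is_lim_seq_opp _ (Im l)); exact H2.
Qed.

Lemma clim_inv u l : l <> RtoC 0 -> clim u l -> clim (fun n => Cinv (u n)) (Cinv l).
Proof.
  intros Hl [H1 H2].
  assert (Hd : Re l ^ 2 + Im l ^ 2 <> 0).
  { rewrite <- Cmod2_alt. apply pow_nonzero.
    apply Cmod_gt_0 in Hl; lra. }
  assert (Hs : is_lim_seq (fun n => Re (u n) ^ 2 + Im (u n) ^ 2) (Re l ^ 2 + Im l ^ 2)).
  { simpl; apply is_lim_seq_plus'; repeat apply is_lim_seq_mult';
      try assumption; apply is_lim_seq_const. }
  split; unfold Cinv; simpl.
  - apply is_lim_seq_div'; assumption.
  - apply is_lim_seq_div'; [|assumption|assumption].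
    apply (is_lim_seq_opp _ (Im l)); assumption.
Qed.

Lemma clim_fsum c (u : nat -> nat -> C) (l : nat -> C) :
  (forall d, (d < c)%nat -> clim (u d) (l d)) ->
  clim (fun n => fsum c (fun d => u d n)) (fsum c l).
Proof.
  intros H; induction c as [|c IH]; simpl; [apply clim_const|].
  apply clim_plus; auto.
Qed.

Lemma clim_Cmod u l : clim u l -> is_lim_seq (fun n => Cmod (Cminus (u n) l)) 0.
Proof.
  intros [H1 H2].
  apply is_lim_seq_le_le with (u := fun _ => 0)
    (w := fun n => Rabs (Re (u n) - Re l) + Rabs (Im (u n) - Im l)).
  - intros n; split; [apply Cmod_ge_0|].
    exact (Cmod_le_abs (Cminus (u n) l)).
  - apply is_lim_seq_const.
  - replace (Finite 0) with (Finite (Rabs (Re l - Re l) + Rabs (Im l - Im l)))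
      by (f_equal; rewrite !Rminus_diag, Rabs_R0; ring).
    apply is_lim_seq_plus'; apply (is_lim_seq_abs _ (Finite (_ - _)));
      apply is_lim_seq_minus'; try assumption; apply is_lim_seq_const.
Qed.

Lemma Cmod_clim u l : is_lim_seq (fun n => Cmod (Cminus (u n) l)) 0 -> clim u l.
Proof.
  intros H.
  assert (G : forall (p : C -> R) , (forall z, Rabs (p z) <= Cmod z) ->
     (forall z w, p (Cminus z w) = p z - p w) ->
     is_lim_seq (fun n => p (u n)) (p l)).
  { intros p Hp Hm.
    apply is_lim_seq_ext with (u := fun n => p (Cminus (u n) l) + p l).
    { intros n; rewrite Hm; ring. }
    replace (Finite (p l)) with (Finite (0 + p l)) by (f_equal; ring).
    apply is_lim_seq_plus'; [|apply is_lim_seq_const].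
    apply is_lim_seq_abs_0.
    apply is_lim_seq_le_le with (u := fun _ => 0) (w := fun n => Cmod (Cminus (u n) l));
      [|apply is_lim_seq_const|exact H].
    intros n; split; [apply Rabs_pos|apply Hp]. }
  split; apply G; try apply re_le_Cmod; try apply im_le_Cmod; reflexivity.
Qed.

(** Absolute convergence and value are kept together: [Series] returns a value for divergent series
    too, and every exchange of limits below needs the absolute part. *)
Definition has_csum (a : nat -> C) (l : C) : Prop :=
  ex_series (fun n => Cmod (a n)) /\ clim (fun n => fsum n a) l.

Lemma clim_fsum_series a l :
  clim (fun n => fsum n a) l ->
  is_series (fun n => Re (a n)) (Re l) /\ is_series (fun n => Im (a n)) (Im l).
Proof.
  intros [H1 H2]; split; apply is_series_rsum.
  - eapply is_lim_seq_ext, H1; intros; apply Re_fsum.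
  - eapply is_lim_seq_ext, H2; intros; apply Im_fsum.
Qed.

Lemma CSeries_clim a l : clim (fun n => fsum n a) l -> CSeries a = l.
Proof.
  intros H; apply clim_fsum_series in H as [H1 H2].
  apply C_eq; simpl; apply is_series_unique; assumption.
Qed.

Lemma CSeries_eq a l : has_csum a l -> CSeries a = l.
Proof. intros [_ H]; apply CSeries_clim, H. Qed.

Lemma ex_Cseries_has_csum a l : has_csum a l -> ex_Cseries a.
Proof.
  intros [H _]; unfold ex_Cseries.
  apply (@ex_series_le R_AbsRing C_R_CompleteNormedModule a (fun n => Cmod (a n))).
  2: exact H.
  intros n; rewrite Cmod_norm; apply Rle_refl.
Qed.

Lemma ex_series_Rle (a b : nat -> R) :
  (forall n, 0 <= a n <= b n) -> ex_series b -> ex_series a.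
Proof.
  intros H Hb; apply (ex_series_le (V := R_CompleteNormedModule) a b); [|exact Hb].
  intros n; change (Rabs (a n) <= b n); rewrite Rabs_pos_eq; apply H.
Qed.

Lemma ex_series_scal_R x (a : nat -> R) : ex_series a -> ex_series (fun n => x * a n).
Proof. exact (ex_series_scal x a). Qed.

Lemma is_series_scal_R x (a : nat -> R) l : is_series a l -> is_series (fun n => x * a n) (x * l).
Proof. exact (is_series_scal x a l). Qed.

Lemma has_csum_CSeries a (b : nat -> R) :
  (forall n, Cmod (a n) <= b n) -> ex_series b -> has_csum a (CSeries a).
Proof.
  intros H Hb.
  assert (Ha : ex_series (fun n => Cmod (a n))).
  { apply ex_series_Rle with (2 := Hb); intros; split; [apply Cmod_ge_0|apply H]. }
  split; [exact Ha|].
  split.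
  - apply is_lim_seq_ext with (fun n => rsum n (fun i => Re (a i))).
    { intros; symmetry; apply Re_fsum. }
    apply is_series_rsum, Series_correct, ex_series_Rabs.
    apply ex_series_Rle with (2 := Ha); intros; split; [apply Rabs_pos|apply re_le_Cmod].
  - apply is_lim_seq_ext with (fun n => rsum n (fun i => Im (a i))).
    { intros; symmetry; apply Im_fsum. }
    apply is_series_rsum, Series_correct, ex_series_Rabs.
    apply ex_series_Rle with (2 := Ha); intros; split; [apply Rabs_pos|apply im_le_Cmod].
Qed.

Lemma has_csum_unique a l1 l2 : has_csum a l1 -> has_csum a l2 -> l1 = l2.
Proof. intros [_ H1] [_ H2]; eapply clim_unique; eassumption. Qed.

Lemma has_csum_ext a b l : (forall n, a n = b n) -> has_csum a l -> has_csum b l.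
Proof.
  intros H [H1 H2]; split.
  - eapply ex_series_ext, H1; intros; simpl; rewrite H; reflexivity.
  - eapply clim_ext, H2; intros; apply fsum_ext; auto.
Qed.

Lemma has_csum_eq a l l' : has_csum a l -> l = l' -> has_csum a l'.
Proof. intros H <-; exact H. Qed.

Lemma has_csum_plus a b l1 l2 : has_csum a l1 -> has_csum b l2 ->
  has_csum (fun n => Cplus (a n) (b n)) (Cplus l1 l2).
Proof.
  intros [H1 H2] [H3 H4]; split.
  - apply ex_series_Rle with (fun n => Cmod (a n) + Cmod (b n)).
    + intros; split; [apply Cmod_ge_0|apply Cmod_triangle].
    + exact (ex_series_plus _ _ H1 H3).
  - eapply clim_ext; [|apply (clim_plus _ _ _ _ H2 H4)].
    intros n; symmetry; apply fsum_plus.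
Qed.

Lemma has_csum_scal z a l : has_csum a l ->
  has_csum (fun n => Cmult z (a n)) (Cmult z l).
Proof.
  intros [H1 H2]; split.
  - apply ex_series_ext with (fun n => scal (Cmod z) (Cmod (a n))).
    + intros; rewrite Cmod_mult; reflexivity.
    + exact (ex_series_scal (Cmod z) _ H1).
  - eapply clim_ext; [|apply (clim_mult _ _ _ _ (clim_const z) H2)].
    intros n; symmetry; apply fsum_scal.
Qed.

Lemma has_csum_opp a l : has_csum a l -> has_csum (fun n => Copp (a n)) (Copp l).
Proof.
  intros H; apply (has_csum_scal (RtoC (-1))) in H.
  replace (Copp l) with (Cmult (RtoC (-1)) l) by ring.
  eapply has_csum_ext, H; intros; simpl; ring.
Qed.

Lemma has_csum_conj a l : has_csum a l -> has_csum (fun n => Cconj (a n)) (Cconj l).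
Proof.
  intros [H1 H2]; split.
  - eapply ex_series_ext, H1; intros; symmetry; apply Cmod_conj.
  - eapply clim_ext; [|apply clim_conj, H2]; intros; apply fsum_conj.
Qed.

Lemma has_csum_0 : has_csum (fun _ => RtoC 0) (RtoC 0).
Proof.
  split.
  - exists 0; apply is_series_rsum.
    apply is_lim_seq_ext with (fun _ => 0); [|apply is_lim_seq_const].
    intros n; rewrite Cmod_0, rsum_const; ring.
  - apply clim_ext with (2 := clim_const _); intros; symmetry; apply fsum_0.
Qed.

Lemma has_csum_fsum c (a : nat -> nat -> C) (l : nat -> C) :
  (forall d, (d < c)%nat -> has_csum (a d) (l d)) ->
  has_csum (fun n => fsum c (fun d => a d n)) (fsum c l).
Proof.
  intros H; induction c as [|c IH]; simpl; [apply has_csum_0|].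
  apply has_csum_plus; auto.
Qed.

Lemma fsum_S n f : fsum (S n) f = Cplus (f O) (fsum n (fun i => f (S i))).
Proof.
  induction n as [|n IH]; [simpl; ring|].
  change (Cplus (fsum (S n) f) (f (S n)) = Cplus (f O) (Cplus (fsum n (fun i => f (S i))) (f (S n)))).
  rewrite IH; ring.
Qed.

Lemma has_csum_tail a l : has_csum a l ->
  has_csum (fun n => a (S n)) (Cminus l (a O)).
Proof.
  intros [H1 H2]; split.
  - apply ex_series_incr_1 in H1; exact H1.
  - assert (H3 : clim (fun n => fsum (S n) a) l).
    { destruct H2 as [H2 H3]; split.
      - apply (is_lim_seq_incr_1 (fun n => Re (fsum n a))); assumption.
      - apply (is_lim_seq_incr_1 (fun n => Im (fsum n a))); assumption. }
    eapply clim_ext; [|apply (clim_plus _ _ _ _ H3 (clim_const (Copp (a O))))].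
    intros n; cbv beta; rewrite (fsum_S n a); ring.
Qed.

Lemma has_csum_cons a l : has_csum (fun n => a (S n)) l ->
  has_csum a (Cplus (a O) l).
Proof.
  intros [H1 H2]; split.
  - apply ex_series_incr_1; exact H1.
  - assert (H3 : clim (fun n => fsum (S n) a) (Cplus (a O) l)).
    { eapply clim_ext; [|apply (clim_plus _ _ _ _ (clim_const (a O)) H2)].
      intros n; rewrite fsum_S; ring. }
    destruct H3 as [H3 H4]; split.
    + apply (is_lim_seq_incr_1 (fun n => Re (fsum n a))); assumption.
    + apply (is_lim_seq_incr_1 (fun n => Im (fsum n a))); assumption.
Qed.

Lemma has_csum_Cmod_le a l (b : nat -> R) B :
  has_csum a l -> (forall n, Cmod (a n) <= b n) -> is_series b B -> Cmod l <= B.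
Proof.
  intros [_ H] Hb HB.
  apply is_series_rsum in HB.
  assert (H0 := clim_Cmod _ _ H).
  assert (H1 : is_lim_seq (fun n => Cmod (Cminus (fsum n a) l) + rsum n b) (0 + B))
    by (apply is_lim_seq_plus'; assumption).
  rewrite Rplus_0_l in H1.
  refine (is_lim_seq_le (fun _ => Cmod l) _ (Cmod l) B _ (is_lim_seq_const _) H1).
  intros n.
  apply Rle_trans with (Cmod (Cminus (fsum n a) l) + Cmod (fsum n a)).
  - rewrite <- (Cmod_opp (Cminus _ _)).
    eapply Rle_trans; [|apply Cmod_triangle]. right; f_equal; ring.
  - apply Rplus_le_compat_l, Cmod_fsum_le; auto.
Qed.

Lemma Cmod_CSeries_le a (b : nat -> R) B :
  (forall n, Cmod (a n) <= b n) -> is_series b B -> Cmod (CSeries a) <= B.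
Proof.
  intros H HB; eapply has_csum_Cmod_le; [|exact H|exact HB].
  apply has_csum_CSeries with b; [exact H|exists B; exact HB].
Qed.

Lemma CSeries_ext a b : (forall n, a n = b n) -> CSeries a = CSeries b.
Proof.
  intros H; apply C_eq; simpl; apply Series_ext; intros; rewrite H; reflexivity.
Qed.

(** * Tannery's theorem and Fubini *)

(** The dominating series is cut where its tail drops below eps/2; the remaining finite head tends
    to 0 term by term. *)
Lemma tannery_R (d : nat -> nat -> R) (M : nat -> R) :
  eventually (fun n => forall j, 0 <= d n j <= M j) -> ex_series M ->
  (forall j, is_lim_seq (fun n => d n j) 0) ->
  is_lim_seq (fun n => Series (d n)) 0.
Proof.
  intros [n0 Hd] HM Hl.
  assert (HM0 : forall j, 0 <= M j) by (intros j; destruct (Hd n0 (Nat.le_refl _) j); lra).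
  assert (Hhead : forall J, is_lim_seq (fun n => rsum J (d n)) 0).
  { induction J as [|J IH]; simpl; [apply is_lim_seq_const|].
    replace (Finite 0) with (Finite (0 + 0)) by (f_equal; ring).
    apply is_lim_seq_plus'; auto. }
  apply is_lim_seq_spec; intros eps.
  assert (HS := proj1 (is_series_rsum _ _) (Series_correct _ HM)).
  assert (Hpos : 0 < eps / 2) by (destruct eps; simpl; lra).
  apply is_lim_seq_spec in HS; destruct (HS (mkposreal _ Hpos)) as [J HJ].
  specialize (HJ (S J) (Nat.le_succ_diag_r J)); simpl in HJ.
  specialize (Hhead (S J)); apply is_lim_seq_spec in Hhead.
  destruct (Hhead (mkposreal _ Hpos)) as [n1 Hn1]; simpl in Hn1.
  exists (max n0 n1); intros n Hn.
  specialize (Hn1 n ltac:(lia)); specialize (Hd n ltac:(lia)).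
  assert (Hex : ex_series (d n)) by (apply ex_series_Rle with M; auto).
  assert (Hr : forall a, sum_f_R0 a J = rsum (S J) a).
  { intros a; rewrite <- rsum_sum_n, sum_n_Reals; reflexivity. }
  assert (E1 := Series_incr_n (d n) (S J) ltac:(lia) Hex).
  assert (E2 := Series_incr_n M (S J) ltac:(lia) HM).
  simpl pred in *; rewrite Hr in E1, E2; simpl rsum in *.
  assert (L : Series (fun k => d n (S J + k)%nat) <= Series (fun k => M (S J + k)%nat)).
  { apply Series_le; [auto|]. apply (ex_series_incr_n M (S J)); exact HM. }
  assert (P : 0 <= Series (d n)).
  { rewrite <- (Rmult_0_l (Series (fun _ => 0))), <- Series_scal_l.
    apply Series_le; [|exact Hex]. intros; specialize (Hd n2); lra. }
  rewrite Rminus_0_r in *; rewrite Rabs_pos_eq by exact P.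
  apply Rabs_def2 in HJ; apply Rabs_def2 in Hn1. lra.
Qed.

(** Dominated convergence, reduced to [tannery_R] for the moduli |f n j - g j|, which are dominated
    by 2 M j because the bound M passes to the limit g. *)
Lemma tannery (f : nat -> nat -> C) (g : nat -> C) (M : nat -> R) (S : nat -> C) (L : C) :
  eventually (fun n => forall j, Cmod (f n j) <= M j) -> ex_series M ->
  (forall j, clim (fun n => f n j) (g j)) ->
  eventually (fun n => has_csum (f n) (S n)) -> clim S L ->
  has_csum g L.
Proof.
  intros [n0 Hf] HM Hl [n1 HS] HL.
  assert (Hg : forall j, Cmod (g j) <= M j).
  { intros j. assert (Hj := clim_Cmod _ _ (Hl j)).
    assert (H1 : is_lim_seq (fun n => Cmod (Cminus (f n j) (g j)) + M j) (0 + M j))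
      by (apply is_lim_seq_plus'; [exact Hj|apply is_lim_seq_const]).
    rewrite Rplus_0_l in H1.
    refine (is_lim_seq_le_loc (fun _ => Cmod (g j)) _ (Cmod (g j)) (M j) _ (is_lim_seq_const _) H1).
    exists n0; intros n Hn.
    apply Rle_trans with (Cmod (Cminus (f n j) (g j)) + Cmod (f n j));
      [|specialize (Hf n Hn j); lra].
    rewrite <- (Cmod_opp (Cminus _ _)).
    eapply Rle_trans; [|apply Cmod_triangle]. right; f_equal; ring. }
  assert (Hgs := has_csum_CSeries g M Hg HM).
  replace L with (CSeries g); [exact Hgs|].
  apply (clim_unique S); [|exact HL].
  apply Cmod_clim.
  apply is_lim_seq_le_le_loc with (u := fun _ => 0)
    (w := fun n => Series (fun j => Cmod (Cminus (f n j) (g j)))).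
  - exists (max n0 n1); intros n Hn; split; [apply Cmod_ge_0|].
    specialize (HS n ltac:(lia)).
    assert (HD := has_csum_plus _ _ _ _ HS (has_csum_opp _ _ Hgs)).
    eapply has_csum_Cmod_le; [exact HD|intros; apply Rle_refl|].
    apply Series_correct, HD.
  - apply is_lim_seq_const.
  - apply tannery_R with (M := fun j => M j + M j).
    + exists n0; intros n Hn j; split; [apply Cmod_ge_0|].
      eapply Rle_trans; [apply Cmod_triangle|]. rewrite Cmod_opp.
      apply Rplus_le_compat; auto.
    + exact (ex_series_plus _ _ HM HM).
    + intros j; apply clim_Cmod, Hl.
Qed.

Lemma rsum_le_Series (D : nat -> R) n :
  (forall j, 0 <= D j) -> ex_series D -> rsum n D <= Series D.
Proof.
  intros H0 HD.
  assert (H := proj1 (is_series_rsum _ _) (Series_correct _ HD)).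
  apply (is_lim_seq_incr_compare (fun n => rsum n D)); [exact H|].
  intros k; simpl; specialize (H0 k); lra.
Qed.

(** Fubini as a case of Tannery: the partial sum over J columns, read as a series in i, is dominated
    by B i times the sum of D, and its limit in J is the row sum. A majorant in product form
    suffices for every application. *)
Lemma has_csum_swap (a : nat -> nat -> C) (B D : nat -> R) r c L :
  (forall i j, Cmod (a i j) <= B i * D j) ->
  (forall i, 0 <= B i) -> (forall j, 0 <= D j) -> ex_series B -> ex_series D ->
  (forall i, has_csum (a i) (r i)) -> (forall j, has_csum (fun i => a i j) (c j)) ->
  has_csum r L -> has_csum c L.
Proof.
  intros Ha HB0 HD0 HB HD Hr Hc HL.
  assert (Hcs : has_csum c (CSeries c)).
  { apply has_csum_CSeries with (fun j => Series B * D j).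
    - intros j; eapply has_csum_Cmod_le; [apply Hc| |].
      + intros i; apply Ha.
      + apply (is_series_scal_r (D j)), Series_correct, HB.
    - exact (ex_series_scal (Series B) D HD). }
  assert (HX : has_csum r (CSeries c)).
  { refine (tannery (fun J i => fsum J (a i)) r (fun i => B i * Series D)
             (fun J => fsum J c) (CSeries c) _ _ _ _ _).
    - exists O; intros J _ i.
      eapply Rle_trans; [apply Cmod_fsum_le; intros; apply Ha|].
      replace (rsum J (fun j => B i * D j)) with (B i * rsum J D).
      2:{ clear; induction J as [|J IH]; simpl; [|rewrite <- IH]; ring. }
      apply Rmult_le_compat_l; [auto|]. apply rsum_le_Series; assumption.
    - apply ex_series_scal_r, HB.
    - intros i; apply Hr.
    - exists O; intros J _. apply has_csum_fsum; auto.
    - apply Hcs. }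
  rewrite (has_csum_unique _ _ _ HL HX); exact Hcs.
Qed.

Lemma clim_subseq u l (k : nat -> nat) :
  filterlim k eventually eventually -> clim u l -> clim (fun n => u (k n)) l.
Proof.
  intros Hk [H1 H2]; split.
  - exact (is_lim_seq_subseq (fun n => Re (u n)) (Re l) k Hk H1).
  - exact (is_lim_seq_subseq (fun n => Im (u n)) (Im l) k Hk H2).
Qed.

(** (n + (c-1-d)) / c counts the indices i < n congruent to d modulo c; the induction follows the
    moment at which this count jumps. *)
Lemma fsum_dilute (b : nat -> C) c d n : (d < c)%nat ->
  fsum n (fun i => if Nat.eqb (i mod c) d then b (i / c)%nat else RtoC 0)
  = fsum ((n + (c - 1 - d)) / c)%nat b.
Proof.
  intros Hd; induction n as [|n IH].
  - rewrite Nat.div_small by lia; reflexivity.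
  - simpl fsum at 1; rewrite IH.
    assert (E := Nat.div_mod_eq n c).
    assert (Hm := Nat.mod_upper_bound n c ltac:(lia)).
    set (q := (n / c)%nat) in *; set (p := (n mod c)%nat) in *.
    destruct (Nat.eqb_spec p d) as [Hp|Hp].
    + replace ((n + (c - 1 - d)) / c)%nat with q
        by (apply Nat.div_unique with (p + (c - 1 - d))%nat; nia).
      replace ((S n + (c - 1 - d)) / c)%nat with (S q)
        by (apply Nat.div_unique with 0%nat; nia).
      reflexivity.
    + destruct (Nat.lt_ge_cases p d) as [Hlt|Hge].
      * replace ((n + (c - 1 - d)) / c)%nat with q
          by (apply Nat.div_unique with (p + (c - 1 - d))%nat; nia).
        replace ((S n + (c - 1 - d)) / c)%nat with q
          by (apply Nat.div_unique with (S p + (c - 1 - d))%nat; nia).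
        ring.
      * replace ((n + (c - 1 - d)) / c)%nat with (S q)
          by (apply Nat.div_unique with (p - 1 - d)%nat; nia).
        replace ((S n + (c - 1 - d)) / c)%nat with (S q)
          by (apply Nat.div_unique with (p - d)%nat; nia).
        ring.
Qed.

(** Inserting zeros only repeats partial sums, so the new partial sums are the old ones along a map
    tending to infinity; the same holds for the moduli. This is how a series is placed on one
    residue class modulo c. *)
Lemma has_csum_dilute (b : nat -> C) L c d : (d < c)%nat -> has_csum b L ->
  has_csum (fun i => if Nat.eqb (i mod c) d then b (i / c)%nat else RtoC 0) L.
Proof.
  intros Hd [H1 H2].
  assert (Hk : filterlim (fun n => ((n + (c - 1 - d)) / c)%nat) eventually eventually).
  { intros P [N HN]; exists (N * c)%nat; intros n Hn; apply HN.
    apply Nat.div_le_lower_bound; nia. }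
  split.
  - assert (H3 : has_csum (fun n => RtoC (Cmod (b n))) (CSeries (fun n => RtoC (Cmod (b n))))).
    { apply has_csum_CSeries with (2 := H1); intros.
      rewrite Cmod_R, Rabs_pos_eq; [lra|apply Cmod_ge_0]. }
    destruct H3 as [_ H3]. apply (clim_subseq _ _ _ Hk) in H3.
    eapply clim_ext in H3; [|intros n; symmetry; apply (fsum_dilute _ c d n Hd)].
    apply clim_fsum_series in H3 as [H3 _].
    eexists; eapply is_series_ext, H3.
    intros n; simpl; destruct (Nat.eqb (n mod c) d); simpl; [reflexivity|].
    rewrite Cmod_0; reflexivity.
  - apply (clim_subseq _ _ _ Hk) in H2.
    eapply clim_ext, H2; intros n; symmetry; apply fsum_dilute, Hd.
Qed.

(** * The complex exponential *)

Lemma Cexp_plus z w : Cexp (Cplus z w) = Cmult (Cexp z) (Cexp w).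
Proof.
  unfold Cexp; apply C_eq; simpl; unfold Re, Im;
    rewrite exp_plus, ?cos_plus, ?sin_plus; ring.
Qed.

Lemma Cexp_0 : Cexp (RtoC 0) = RtoC 1.
Proof. unfold Cexp; apply C_eq; simpl; rewrite exp_0, ?cos_0, ?sin_0; ring. Qed.

Lemma Cmod_Cexp z : Cmod (Cexp z) = exp (Re z).
Proof.
  destruct z as [x y]; unfold Cmod, Cexp, Re, Im; simpl fst; simpl snd.
  transitivity (sqrt (exp x ^ 2)); [f_equal|apply sqrt_pow2; left; apply exp_pos].
  generalize (sin2_cos2 y); unfold Rsqr; intros H.
  transitivity (exp x * exp x * (sin y * sin y + cos y * cos y)); [ring|rewrite H; ring].
Qed.

Lemma Cexp_neq_0 z : Cexp z <> RtoC 0.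
Proof. apply Cmod_gt_0; rewrite Cmod_Cexp; apply exp_pos. Qed.

Lemma Cexp_opp z : Cexp (Copp z) = Cinv (Cexp z).
Proof.
  assert (E : Cmult (Cexp (Copp z)) (Cexp z) = RtoC 1).
  { rewrite <- Cexp_plus, <- Cexp_0; f_equal; ring. }
  transitivity (Cmult (Cmult (Cexp (Copp z)) (Cexp z)) (Cinv (Cexp z)));
    [field; apply Cexp_neq_0|rewrite E; ring].
Qed.

Lemma Cexp_pow z n : Cpow (Cexp z) n = Cexp (Cmult (RtoC (INR n)) z).
Proof.
  induction n as [|n IH].
  - simpl; rewrite <- Cexp_0; f_equal; ring.
  - rewrite Cpow_S, IH, <- Cexp_plus, S_INR, RtoC_plus; f_equal; ring.
Qed.

Lemma Cexp_conj z : Cconj (Cexp z) = Cexp (Cconj z).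
Proof. unfold Cexp; apply C_eq; simpl; unfold Re, Im; rewrite ?cos_neg, ?sin_neg; ring. Qed.

Lemma Cexp_2pi n : Cexp (0, 2 * PI * IZR n) = RtoC 1.
Proof.
  assert (H : forall p : nat, Cexp (0, 2 * PI * INR p) = RtoC 1).
  { intros p; unfold Cexp; apply C_eq; simpl; rewrite exp_0.
    - replace (2 * PI * INR p) with (0 + 2 * INR p * PI) by ring.
      rewrite cos_period, cos_0; ring.
    - replace (2 * PI * INR p) with (0 + 2 * INR p * PI) by ring.
      rewrite sin_period, sin_0; ring. }
  destruct (Z.le_gt_cases 0 n) as [Hn|Hn].
  - rewrite <- (Z2Nat.id n Hn), <- INR_IZR_INZ; apply H.
  - replace (0, 2 * PI * IZR n) with (Copp (0, 2 * PI * INR (Z.to_nat (- n)))).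
    + rewrite Cexp_opp, H; field; apply C1_nz.
    + apply C_eq; simpl; [ring|].
      rewrite INR_IZR_INZ, Z2Nat.id, opp_IZR by lia; ring.
Qed.

Lemma is_series_exp x : is_series (fun n => x ^ n / INR (fact n)) (exp x).
Proof.
  assert (H := proj1 (is_pseries_R _ _ _) (is_exp_Reals x)).
  eapply is_series_ext, H; intros n; simpl; unfold Rdiv; ring.
Qed.

Lemma pow_fact_le_exp y j : 0 <= y -> y ^ j / INR (fact j) <= exp y.
Proof.
  intros Hy; eapply Rle_trans; [|apply (exp_ge_taylor y j Hy)].
  destruct j as [|j]; [simpl; lra|].
  rewrite tech5.
  assert (0 <= sum_f_R0 (fun k => y ^ k / INR (fact k)) j); [|lra].
  apply cond_pos_sum; intros k. apply Rdiv_le_0_compat; [apply pow_le, Hy|apply INR_fact_lt_0].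
Qed.

Lemma CV_radius_infinite_of_bounded (a : nat -> R) :
  (forall r, exists M, forall n, Rabs (a n * r ^ n) <= M) ->
  forall t, Rbar_lt (Rabs t) (CV_radius a).
Proof.
  intros H t. apply Rbar_lt_le_trans with (Finite (Rabs t + 1)); [simpl; lra|].
  destruct (CV_radius_bounded a) as [Hub _]; apply Hub, H.
Qed.

Lemma exp_le x y : x <= y -> exp x <= exp y.
Proof. intros [H| ->]; [left; apply exp_increasing, H|lra]. Qed.

Lemma Re_div_R z x : x <> 0 -> Re (Cdiv z (RtoC x)) = Re z / x.
Proof. intros H; unfold Cdiv; rewrite <- RtoC_inv, re_scal_r by exact H; reflexivity. Qed.

Lemma Im_div_R z x : x <> 0 -> Im (Cdiv z (RtoC x)) = Im z / x.
Proof. intros H; unfold Cdiv; rewrite <- RtoC_inv, im_scal_r by exact H; reflexivity. Qed.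

(** A + iB solves f' = (x+iy) f with f(0) = 1. The combinations in [K1] and [K2] are the real and
    imaginary parts of exp(-(x+iy)t) f(t), whose derivative vanishes. *)
Lemma rotation_ode (x y : R) (A B : R -> R) :
  (forall t, is_derive A t (x * A t - y * B t)) ->
  (forall t, is_derive B t (y * A t + x * B t)) -> A 0 = 1 -> B 0 = 0 ->
  A 1 = exp x * cos y /\ B 1 = exp x * sin y.
Proof.
  intros Da Db HA0 HB0.
  assert (K1 : 1 = exp (- x) * (cos y * A 1 + sin y * B 1)).
  { assert (E : exp (- (x * 0)) * (cos (y * 0) * A 0 + sin (y * 0) * B 0) =
      exp (- (x * 1)) * (cos (y * 1) * A 1 + sin (y * 1) * B 1)).
    { apply (eq_is_derive (fun t => exp (- (x * t)) * (cos (y * t) * A t + sin (y * t) * B t)) 0 1); [|lra].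
      intros t _. assert (ex_derive A t) by (eexists; apply Da).
      assert (ex_derive B t) by (eexists; apply Db).
      auto_derive; [tauto|].
      change (fun x0 => A x0) with A; change (fun x0 => B x0) with B.
      rewrite (is_derive_unique _ _ _ (Da t)), (is_derive_unique _ _ _ (Db t)).
      unfold zero; simpl; ring. }
    rewrite HA0, HB0, !Rmult_0_r, !Rmult_1_r, Ropp_0, exp_0, cos_0 in E.
    rewrite <- E; ring. }
  assert (K2 : 0 = exp (- x) * (cos y * B 1 - sin y * A 1)).
  { assert (E : exp (- (x * 0)) * (cos (y * 0) * B 0 - sin (y * 0) * A 0) =
      exp (- (x * 1)) * (cos (y * 1) * B 1 - sin (y * 1) * A 1)).
    { apply (eq_is_derive (fun t => exp (- (x * t)) * (cos (y * t) * B t - sin (y * t) * A t)) 0 1); [|lra].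
      intros t _. assert (ex_derive A t) by (eexists; apply Da).
      assert (ex_derive B t) by (eexists; apply Db).
      auto_derive; [tauto|].
      change (fun x0 => A x0) with A; change (fun x0 => B x0) with B.
      rewrite (is_derive_unique _ _ _ (Da t)), (is_derive_unique _ _ _ (Db t)).
      unfold zero; simpl; ring. }
    rewrite HA0, HB0, !Rmult_0_r, !Rmult_1_r, Ropp_0, exp_0, sin_0 in E.
    rewrite <- E; ring. }
  assert (Hcs := sin2_cos2 y); unfold Rsqr in Hcs.
  assert (He : exp x * exp (- x) = 1) by (rewrite <- exp_plus, Rplus_opp_r, exp_0; reflexivity).
  split.
  - transitivity (exp x * exp (- x) * (sin y * sin y + cos y * cos y) * A 1);
      [rewrite He, Hcs; ring|].
    transitivity (exp x * (cos y * (exp (- x) * (cos y * A 1 + sin y * B 1))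
       - sin y * (exp (- x) * (cos y * B 1 - sin y * A 1)))); [ring|].
    rewrite <- K1, <- K2; ring.
  - transitivity (exp x * exp (- x) * (sin y * sin y + cos y * cos y) * B 1);
      [rewrite He, Hcs; ring|].
    transitivity (exp x * (sin y * (exp (- x) * (cos y * A 1 + sin y * B 1))
       + cos y * (exp (- x) * (cos y * B 1 - sin y * A 1)))); [ring|].
    rewrite <- K1, <- K2; ring.
Qed.

(** [Cexp] is built from exp, cos and sin, so its power series is identified through a differential
    equation: the real and imaginary parts of the sum of z^n t^n/n! are real power series in t that
    satisfy the hypotheses of [rotation_ode], and t = 1 gives the claim. *)
Lemma has_csum_Cexp z : has_csum (fun n => Cdiv (Cpow z n) (RtoC (INR (fact n)))) (Cexp z).
Proof.
  assert (Hfc : forall n, RtoC (INR (fact n)) <> RtoC 0).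
  { intros n H; apply RtoC_inj in H; revert H; apply INR_fact_neq_0. }
  assert (Hm : forall n, Cmod (Cdiv (Cpow z n) (RtoC (INR (fact n)))) = Cmod z ^ n / INR (fact n)).
  { intros n. rewrite Cmod_div, Cmod_pow, Cmod_R, Rabs_pos_eq; auto; apply pos_INR. }
  assert (Hs : has_csum (fun n => Cdiv (Cpow z n) (RtoC (INR (fact n))))
     (CSeries (fun n => Cdiv (Cpow z n) (RtoC (INR (fact n)))))).
  { apply has_csum_CSeries with (fun n => Cmod z ^ n / INR (fact n)).
    - intros; rewrite Hm; lra.
    - eexists; apply is_series_exp. }
  replace (Cexp z) with (CSeries (fun n => Cdiv (Cpow z n) (RtoC (INR (fact n))))); [exact Hs|].
  set (a := fun n => Re (Cpow z n) / INR (fact n)).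
  set (b := fun n => Im (Cpow z n) / INR (fact n)).
  set (x := Re z); set (y := Im z).
  assert (Hbd : forall p : C -> R, (forall w, Rabs (p w) <= Cmod w) ->
     forall r, exists M, forall n, Rabs (p (Cpow z n) / INR (fact n) * r ^ n) <= M).
  { intros p Hp r; exists (exp (Cmod z * Rabs r)); intros n.
    eapply Rle_trans; [|apply (pow_fact_le_exp _ n)].
    2: apply Rmult_le_pos; [apply Cmod_ge_0|apply Rabs_pos].
    unfold Rdiv; rewrite Rpow_mult_distr, !Rabs_mult, Rabs_inv, <- RPow_abs.
    rewrite (Rabs_pos_eq (INR _)) by apply pos_INR.
    specialize (Hp (Cpow z n)); rewrite Cmod_pow in Hp.
    replace (Cmod z ^ n * Rabs r ^ n * / INR (fact n))
      with (Cmod z ^ n * / INR (fact n) * Rabs r ^ n) by ring.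
    apply Rmult_le_compat_r; [apply pow_le, Rabs_pos|].
    apply Rmult_le_compat_r; [left; apply Rinv_0_lt_compat, INR_fact_lt_0|exact Hp]. }
  assert (Ra := CV_radius_infinite_of_bounded a (Hbd Re re_le_Cmod)).
  assert (Rb := CV_radius_infinite_of_bounded b (Hbd Im im_le_Cmod)).
  assert (Ea : forall t, ex_series (fun n => a n * t ^ n)).
  { intros t; apply ex_series_Rabs, CV_disk_inside, Ra. }
  assert (Eb : forall t, ex_series (fun n => b n * t ^ n)).
  { intros t; apply ex_series_Rabs, CV_disk_inside, Rb. }
  assert (Da : forall t, is_derive (PSeries a) t (x * PSeries a t - y * PSeries b t)).
  { intros t; replace (x * PSeries a t - y * PSeries b t) with (PSeries (PS_derive a) t);
      [apply is_derive_PSeries, Ra|].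
    unfold PSeries; rewrite <- !Series_scal_l, <- Series_minus.
    - apply Series_ext; intros n. unfold PS_derive, a, b.
      rewrite fact_simpl, mult_INR, Cpow_S; simpl Re; fold x; fold y.
      unfold x, y, Re, Im; field; split; [apply INR_fact_neq_0|apply not_0_INR; lia].
    - exact (ex_series_scal x _ (Ea t)).
    - exact (ex_series_scal y _ (Eb t)). }
  assert (Db : forall t, is_derive (PSeries b) t (y * PSeries a t + x * PSeries b t)).
  { intros t; replace (y * PSeries a t + x * PSeries b t) with (PSeries (PS_derive b) t);
      [apply is_derive_PSeries, Rb|].
    unfold PSeries; rewrite <- !Series_scal_l, <- Series_plus.
    - apply Series_ext; intros n. unfold PS_derive, a, b.
      rewrite fact_simpl, mult_INR, Cpow_S; simpl Im; fold x; fold y.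
      unfold x, y, Re, Im; field; split; [apply INR_fact_neq_0|apply not_0_INR; lia].
    - exact (ex_series_scal y _ (Ea t)).
    - exact (ex_series_scal x _ (Eb t)). }
  destruct (rotation_ode x y (PSeries a) (PSeries b) Da Db) as [HA HB].
  { rewrite PSeries_0; unfold a; simpl; field. }
  { rewrite PSeries_0; unfold b; simpl; field. }
  unfold Cexp; fold x y; rewrite <- HA, <- HB.
  unfold PSeries, CSeries; f_equal; apply Series_ext; intros n;
    rewrite pow1, Rmult_1_r; unfold a, b; [apply Re_div_R|apply Im_div_R];
    apply INR_fact_neq_0.
Qed.

(** * Integrals of complex-valued functions *)

Definition is_CInt (f : R -> C) (a b : R) (l : C) : Prop :=
  is_RInt (fun t => Re (f t)) a b (Re l) /\ is_RInt (fun t => Im (f t)) a b (Im l).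

Lemma is_CInt_is_RInt f a b l :
  is_CInt f a b l -> @is_RInt C_R_NormedModule f a b l.
Proof.
  intros [H1 H2]; destruct l as [l1 l2].
  exact (is_RInt_fct_extend_pair (U := R_NormedModule) (V := R_NormedModule) f a b l1 l2 H1 H2).
Qed.

Lemma is_CInt_RInt f a b l :
  is_CInt f a b l -> RInt (V := C_R_CompleteNormedModule) f a b = l.
Proof. intros H; apply is_RInt_unique; apply is_CInt_is_RInt, H. Qed.

Lemma is_CInt_ext f g a b l : (forall t, f t = g t) -> is_CInt f a b l -> is_CInt g a b l.
Proof.
  intros H [H1 H2]; split; [eapply is_RInt_ext, H1|eapply is_RInt_ext, H2];
    intros; simpl; rewrite H; reflexivity.
Qed.

Lemma is_CInt_scal z f a b l : is_CInt f a b l ->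
  is_CInt (fun t => Cmult z (f t)) a b (Cmult z l).
Proof.
  intros [H1 H2]; split; simpl.
  - apply (is_RInt_minus (V := R_NormedModule)
      (fun t => Re z * Re (f t)) (fun t => Im z * Im (f t)));
      [apply (is_RInt_scal _ _ _ (Re z) _ H1)|apply (is_RInt_scal _ _ _ (Im z) _ H2)].
  - apply (is_RInt_plus (V := R_NormedModule)
      (fun t => Re z * Im (f t)) (fun t => Im z * Re (f t)));
      [apply (is_RInt_scal _ _ _ (Re z) _ H2)|apply (is_RInt_scal _ _ _ (Im z) _ H1)].
Qed.

Lemma is_CInt_plus f g a b l1 l2 : is_CInt f a b l1 -> is_CInt g a b l2 ->
  is_CInt (fun t => Cplus (f t) (g t)) a b (Cplus l1 l2).
Proof.
  intros [H1 H2] [H3 H4]; split; simpl.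
  - exact (is_RInt_plus (V := R_NormedModule) _ _ _ _ _ _ H1 H3).
  - exact (is_RInt_plus (V := R_NormedModule) _ _ _ _ _ _ H2 H4).
Qed.

(** Weierstrass test. The majorant is asked at every real t and not only on [a, b], because the
    limit theorem for integrals used here works with uniform convergence on the whole line; an
    integrand bounded on an interval only has to be truncated first. *)
Lemma is_RInt_Series (f : nat -> R -> R) (I M : nat -> R) a b :
  (forall n, is_RInt (f n) a b (I n)) ->
  (forall n t, Rabs (f n t) <= M n) -> ex_series M ->
  is_RInt (fun t => Series (fun n => f n t)) a b (Series I).
Proof.
  intros HI HM Hex.
  assert (HM0 : forall n, 0 <= M n).
  { intros n; eapply Rle_trans; [apply Rabs_pos|apply (HM n 0)]. }
  assert (Habs : forall t, ex_series (fun n => Rabs (f n t))).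
  { intros t; apply ex_series_Rle with (2 := Hex); intros; split; [apply Rabs_pos|apply HM]. }
  destruct (filterlim_RInt (V := R_CompleteNormedModule)
    (fun N t => rsum N (fun n => f n t)) a b eventually _
    (fun t => Series (fun n => f n t)) (fun N => rsum N I)) as [If [H1 H2]].
  - intros N; induction N as [|N IH]; simpl.
    + assert (H := is_RInt_const (V := R_NormedModule) a b 0).
      unfold scal in H; simpl in H; unfold mult in H; simpl in H.
      rewrite Rmult_0_r in H; exact H.
    + exact (is_RInt_plus (V := R_NormedModule) _ _ _ _ _ _ IH (HI N)).
  - intros P [eps HP].
    assert (HS := proj1 (is_series_rsum _ _) (Series_correct _ Hex)).
    apply is_lim_seq_spec in HS; destruct (HS eps) as [N0 HN0].
    exists (S N0); intros N HN; apply HP; intros t.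
    specialize (HN0 N ltac:(lia)).
    change (Rabs (rsum N (fun n => f n t) - Series (fun n => f n t)) < eps).
    destruct N as [|N]; [lia|].
    assert (E1 := Series_incr_n (fun n => f n t) (S N) ltac:(lia) (ex_series_Rabs _ (Habs t))).
    assert (E2 := Series_incr_n M (S N) ltac:(lia) Hex).
    simpl pred in *. rewrite <- sum_n_Reals, rsum_sum_n in E1, E2.
    apply Rle_lt_trans with (Rabs (Series (fun k => f (S N + k)%nat t)));
      [rewrite E1, <- Rabs_Ropp; right; f_equal; ring|].
    rewrite E2 in HN0.
    eapply Rle_lt_trans; [apply Series_Rabs, (ex_series_incr_n (fun n => Rabs (f n t)) (S N)), Habs|].
    eapply Rle_lt_trans; [apply (Series_le _ (fun k => M (S N + k)%nat))|].
    + intros k; split; [apply Rabs_pos|apply HM].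
    + apply (ex_series_incr_n M (S N)); exact Hex.
    + apply Rabs_def2 in HN0. lra.
  - replace (Series I) with If; [exact H2|].
    symmetry; apply is_series_unique, is_series_rsum; exact H1.
Qed.

Lemma is_CInt_CSeries (f : nat -> R -> C) (I : nat -> C) (M : nat -> R) a b :
  (forall n, is_CInt (f n) a b (I n)) ->
  (forall n t, Cmod (f n t) <= M n) -> ex_series M ->
  is_CInt (fun t => CSeries (fun n => f n t)) a b (CSeries I).
Proof.
  intros HI HM Hex; split.
  - refine (is_RInt_Series (fun n t => Re (f n t)) (fun n => Re (I n)) M a b (fun n => proj1 (HI n)) _ Hex).
    intros; eapply Rle_trans; [apply re_le_Cmod|apply HM].
  - refine (is_RInt_Series (fun n t => Im (f n t)) (fun n => Im (I n)) M a b (fun n => proj2 (HI n)) _ Hex).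
    intros; eapply Rle_trans; [apply im_le_Cmod|apply HM].
Qed.

Lemma is_CInt_Cexp_period (n : Z) (T : R) : T <> 0 ->
  is_CInt (fun t => Cexp (0, IZR n * (2 * PI / T * t))) 0 T
    (if Z.eqb n 0 then RtoC T else RtoC 0).
Proof.
  intros HT; destruct (Z.eqb_spec n 0) as [->|Hn].
  - eapply is_CInt_ext.
    { intros t; symmetry.
      replace (0, 0 * (2 * PI / T * t)) with (RtoC 0) by (apply C_eq; simpl; ring).
      apply Cexp_0. }
    split; simpl.
    + replace T with (scal (T - 0) 1) at 2 by (unfold scal; simpl; unfold mult; simpl; ring).
      apply (is_RInt_const (V := R_NormedModule)).
    + replace 0 with (scal (T - 0) 0) at 2 by (unfold scal; simpl; unfold mult; simpl; ring).
      apply (is_RInt_const (V := R_NormedModule)).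
  - apply not_0_IZR in Hn.
    assert (Hpi := PI_neq0).
    assert (E := Cexp_2pi n).
    assert (Ec : cos (IZR n * (2 * PI / T * T)) = 1 /\ sin (IZR n * (2 * PI / T * T)) = 0).
    { replace (IZR n * (2 * PI / T * T)) with (2 * PI * IZR n) by (field; exact HT).
      unfold Cexp in E; simpl in E; rewrite exp_0 in E.
      injection E; intros; lra. }
    destruct Ec as [Ec Es].
    split; simpl; rewrite exp_0.
    + evar_last.
      { apply (is_RInt_derive (V := R_CompleteNormedModule)
         (fun t => sin (IZR n * (2 * PI / T * t)) / (IZR n * (2 * PI / T)))).
        - intros t _; auto_derive; [auto|]. field. auto.
        - intros t _; apply (ex_derive_continuous (V := R_NormedModule)); auto_derive; auto. }
      unfold minus, plus, opp; simpl. rewrite Es, !Rmult_0_r, sin_0. field; auto.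
    + evar_last.
      { apply (is_RInt_derive (V := R_CompleteNormedModule)
         (fun t => - cos (IZR n * (2 * PI / T * t)) / (IZR n * (2 * PI / T)))).
        - intros t _; auto_derive; [auto|]. field. auto.
        - intros t _; apply (ex_derive_continuous (V := R_NormedModule)); auto_derive; auto. }
      unfold minus, plus, opp; simpl. rewrite Ec, !Rmult_0_r, cos_0. field; auto.
Qed.

(** * Contour integrals *)

Definition circle (r th : R) : C := (r * cos th, r * sin th).

(** On the circle ds = i s dtheta, so the factor i of 1/(2 pi i) disappears and 2 pi times the value
    is an integral over theta. *)
Definition is_contour (r : R) (g : C -> C) (l : C) : Prop :=
  is_CInt (fun th => Cmult (g (circle r th)) (circle r th)) 0 (2 * PI)
    (Cmult (RtoC (2 * PI)) l).

Lemma contour_eq r g l : is_contour r g l -> contour r g = l.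
Proof.
  intros H; unfold contour.
  transitivity (Cmult (RtoC (/ (2 * PI))) (RInt (V := C_R_CompleteNormedModule)
    (fun th => Cmult (g (circle r th)) (circle r th)) 0 (2 * PI))); [reflexivity|].
  rewrite (is_CInt_RInt _ _ _ _ H).
  rewrite Cmult_assoc, <- RtoC_mult, Rinv_l by (generalize PI_RGT_0; lra).
  ring.
Qed.

Lemma is_contour_ext r f g l :
  (forall th, f (circle r th) = g (circle r th)) -> is_contour r f l -> is_contour r g l.
Proof.
  intros H; apply is_CInt_ext; intros; rewrite H; reflexivity.
Qed.

Lemma is_contour_scal r z g l :
  is_contour r g l -> is_contour r (fun s => Cmult z (g s)) (Cmult z l).
Proof.
  intros H; unfold is_contour in *.
  replace (Cmult (RtoC (2 * PI)) (Cmult z l)) with (Cmult z (Cmult (RtoC (2 * PI)) l)) by ring.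
  eapply is_CInt_ext; [|apply (is_CInt_scal z), H]. intros; simpl; ring.
Qed.

Lemma circle_polar r th : circle r th = Cmult (RtoC r) (Cexp (0, th)).
Proof. unfold circle, Cexp; apply C_eq; simpl; rewrite exp_0; ring. Qed.

Lemma Cmod_circle r th : 0 < r -> Cmod (circle r th) = r.
Proof.
  intros Hr; rewrite circle_polar, Cmod_mult, Cmod_R, Cmod_Cexp; simpl.
  rewrite exp_0, Rabs_pos_eq; lra.
Qed.

Lemma circle_neq_0 r th : 0 < r -> circle r th <> RtoC 0.
Proof. intros Hr; apply Cmod_gt_0; rewrite Cmod_circle; assumption. Qed.

Lemma is_contour_CSeries r (g : nat -> C -> C) (l : nat -> C) (M : nat -> R) :
  0 < r -> (forall n, is_contour r (g n) (l n)) ->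
  (forall n th, Cmod (g n (circle r th)) <= M n) -> ex_series M -> has_csum l (CSeries l) ->
  is_contour r (fun s => CSeries (fun n => g n s)) (CSeries l).
Proof.
  intros Hr HI HM Hex Hl; unfold is_contour in *.
  rewrite <- (CSeries_eq _ _ (has_csum_scal (RtoC (2 * PI)) _ _ Hl)).
  eapply is_CInt_ext; [|apply is_CInt_CSeries with (M := fun n => M n * r)].
  2: exact HI.
  - intros th; cbv beta.
    assert (Hs := has_csum_CSeries _ _ (fun n => HM n th) Hex).
    rewrite (Cmult_comm (CSeries _)).
    rewrite <- (CSeries_eq _ _ (has_csum_scal (circle r th) _ _ Hs)).
    apply CSeries_ext; intros; ring.
  - intros n th; cbv beta; rewrite Cmod_mult, Cmod_circle by exact Hr.
    apply Rmult_le_compat_r; [lra|apply HM].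
  - apply ex_series_scal_r, Hex.
Qed.

Lemma has_csum_single j z : has_csum (fun i => if Nat.eqb i j then z else RtoC 0) z.
Proof.
  assert (F : forall n, fsum n (fun i => if Nat.eqb i j then z else RtoC 0)
     = if Nat.ltb j n then z else RtoC 0).
  { induction n as [|n IH]; [reflexivity|]. simpl fsum; rewrite IH.
    destruct (Nat.ltb_spec j n), (Nat.ltb_spec j (S n)), (Nat.eqb_spec n j); try lia; ring. }
  assert (G : clim (fun n => fsum n (fun i => if Nat.eqb i j then z else RtoC 0)) z).
  { apply clim_ext_loc with (2 := clim_const z); exists (S j); intros n Hn.
    rewrite F; destruct (Nat.ltb_spec j n); [reflexivity|lia]. }
  split; [|exact G].
  exists (Cmod z); apply is_series_rsum.
  apply is_lim_seq_ext_loc with (fun _ => Cmod z); [|apply is_lim_seq_const].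
  exists (S j); intros n Hn. revert Hn; induction n as [|n IH]; intros Hn; [lia|].
  simpl. destruct (Nat.eqb_spec n j) as [->|Hne].
  - assert (E : forall k, (k <= j)%nat -> rsum k (fun i => Cmod (if Nat.eqb i j then z else RtoC 0)) = 0).
    { induction k as [|k IHk]; intros; simpl; [reflexivity|]. rewrite IHk by lia.
      destruct (Nat.eqb_spec k j); [lia|]. rewrite Cmod_0; ring. }
    rewrite E by lia; ring.
  - rewrite <- IH by lia. rewrite Cmod_0; ring.
Qed.

Lemma is_contour_monomial r i j : 0 < r ->
  is_contour r (fun s => Cmult (Cpow s i) (Cinv (Cpow s (S j))))
    (if Nat.eqb i j then RtoC 1 else RtoC 0).
Proof.
  intros Hr; unfold is_contour.
  assert (HT : 2 * PI <> 0) by (generalize PI_RGT_0; lra).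
  assert (Hrc : RtoC r <> RtoC 0) by (intros H; apply RtoC_inj in H; lra).
  assert (H := is_CInt_scal (Cdiv (Cpow (RtoC r) i) (Cpow (RtoC r) j)) _ _ _ _
     (is_CInt_Cexp_period (Z.of_nat i - Z.of_nat j) (2 * PI) HT)).
  replace (Cmult (RtoC (2 * PI)) (if Nat.eqb i j then RtoC 1 else RtoC 0)) with
   (Cmult (Cdiv (Cpow (RtoC r) i) (Cpow (RtoC r) j))
     (if Z.eqb (Z.of_nat i - Z.of_nat j) 0 then RtoC (2 * PI) else RtoC 0)).
  - eapply is_CInt_ext, H; intros th; cbv beta.
    rewrite circle_polar, !Cpow_mult_l, !Cpow_S, !Cexp_pow.
    replace (0, IZR (Z.of_nat i - Z.of_nat j) * (2 * PI / (2 * PI) * th))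
      with (Cplus (Cmult (RtoC (INR i)) (0, th)) (Copp (Cmult (RtoC (INR j)) (0, th)))).
    2:{ rewrite minus_IZR, <- !INR_IZR_INZ. apply C_eq; simpl; field; apply PI_neq0. }
    rewrite Cexp_plus, Cexp_opp.
    field; repeat split; auto using Cexp_neq_0, Cpow_nz.
  - destruct (Nat.eqb_spec i j) as [->|Hne].
    + rewrite Z.sub_diag; simpl Z.eqb; cbv iota. field; apply Cpow_nz, Hrc.
    + destruct (Z.eqb_spec (Z.of_nat i - Z.of_nat j) 0); [lia|]. ring.
Qed.

Lemma Cmod_inv_pow_circle r th j : 0 < r ->
  Cmod (Cinv (Cpow (circle r th) j)) = / r ^ j.
Proof.
  intros Hr; rewrite Cmod_inv, Cmod_pow, Cmod_circle; auto.
  apply Cpow_nz, circle_neq_0, Hr.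
Qed.

(** Residue of e^(lam s)/s^(j+1): the exponential series is integrated termwise and orthogonality
    keeps the index i = j only. *)
Lemma is_contour_exp r (lam : R) j : 0 < r ->
  is_contour r (fun s => Cmult (Cinv (Cpow s (S j))) (Cexp (Cmult (RtoC lam) s)))
    (RtoC (lam ^ j / INR (fact j))).
Proof.
  intros Hr.
  assert (Hf : forall n, INR (fact n) <> 0) by apply INR_fact_neq_0.
  assert (Hl : has_csum (fun i => Cmult (RtoC (lam ^ i / INR (fact i)))
        (if Nat.eqb i j then RtoC 1 else RtoC 0)) (RtoC (lam ^ j / INR (fact j)))).
  { eapply has_csum_ext; [|apply (has_csum_single j)].
    intros i; simpl; destruct (Nat.eqb_spec i j) as [->|]; ring. }
  rewrite <- (CSeries_eq _ _ Hl).
  eapply is_contour_ext; [|apply is_contour_CSeries with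
    (g := fun i s => Cmult (RtoC (lam ^ i / INR (fact i))) (Cmult (Cpow s i) (Cinv (Cpow s (S j)))))
    (M := fun i => (Rabs lam * r) ^ i / INR (fact i) * / r ^ S j)].
  - intros th; cbv beta. apply CSeries_eq.
    eapply has_csum_ext; [|apply has_csum_scal, has_csum_Cexp].
    intros i; cbv beta. unfold Cdiv, Rdiv.
    rewrite Cpow_mult_l, RtoC_mult, RtoC_inv, RtoC_pow by auto. ring.
  - exact Hr.
  - intros i; apply is_contour_scal, is_contour_monomial, Hr.
  - intros i th; right. rewrite !Cmod_mult, Cmod_inv_pow_circle, Cmod_pow, Cmod_circle by exact Hr.
    rewrite Cmod_R; unfold Rdiv; rewrite Rabs_mult, Rabs_inv, <- RPow_abs, Rpow_mult_distr.
    rewrite (Rabs_pos_eq (INR _)) by apply pos_INR. ring.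
  - apply ex_series_scal_r. eexists; apply is_series_exp.
  - rewrite (CSeries_eq _ _ Hl); exact Hl.
Qed.

Lemma Re_scal_le lam s : Re (Cmult (RtoC lam) s) <= Rabs lam * Cmod s.
Proof.
  rewrite re_scal_l. eapply Rle_trans; [apply Rle_abs|].
  rewrite Rabs_mult; apply Rmult_le_compat_l; [apply Rabs_pos|apply re_le_Cmod].
Qed.

(* For the coefficients of alpha^+ and alpha^- and lam = +-n this is, up to a power of n,
   the Bessel function I or J of the Fourier expansions. *)
Definition borel (co : nat -> R) (lam : R) : C :=
  CSeries (fun j => Cmult (RtoC (co j)) (RtoC (lam ^ j / INR (fact j)))).

(** |lam|^j/j! is at most exp(|lam| r)/r^j for every r > 0. Hence the Borel transform of a Laurent
    series that converges absolutely on |s| = r grows at most like exp(|lam| r), which makes it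
    summable against e(nw) as soon as r < 2 pi Im w. *)
Lemma borel_term_le r (co : nat -> R) lam j : 0 < r ->
  Cmod (Cmult (RtoC (co j)) (RtoC (lam ^ j / INR (fact j))))
  <= exp (Rabs lam * r) * r * (Rabs (co j) * / r ^ S j).
Proof.
  intros Hr. rewrite Cmod_mult, !Cmod_R. unfold Rdiv at 1.
  rewrite Rabs_mult, Rabs_inv, <- RPow_abs, (Rabs_pos_eq (INR _)) by apply pos_INR.
  assert (Hrj : 0 < r ^ j) by (apply pow_lt, Hr).
  assert (Hf := INR_fact_lt_0 j).
  replace (exp (Rabs lam * r) * r * (Rabs (co j) * / r ^ S j))
    with (Rabs (co j) * (exp (Rabs lam * r) * / r ^ j)) by (simpl; field; split; lra).
  apply Rmult_le_compat_l; [apply Rabs_pos|].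
  assert (H := pow_fact_le_exp (Rabs lam * r) j).
  apply (Rmult_le_reg_r (r ^ j)); [exact Hrj|].
  replace (exp (Rabs lam * r) * / r ^ j * r ^ j) with (exp (Rabs lam * r)) by (field; lra).
  eapply Rle_trans; [|apply H, Rmult_le_pos; [apply Rabs_pos|lra]].
  rewrite Rpow_mult_distr; right; field; lra.
Qed.

Lemma has_csum_borel r co lam : 0 < r -> ex_series (fun j => Rabs (co j) * / r ^ S j) ->
  has_csum (fun j => Cmult (RtoC (co j)) (RtoC (lam ^ j / INR (fact j)))) (borel co lam).
Proof.
  intros Hr Hco. apply has_csum_CSeries with (1 := fun j => borel_term_le r co lam j Hr).
  exact (ex_series_scal (exp (Rabs lam * r) * r) _ Hco).
Qed.

Lemma Cmod_borel_le r co lam A : 0 < r -> is_series (fun j => Rabs (co j) * / r ^ S j) A ->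
  Cmod (borel co lam) <= exp (Rabs lam * r) * r * A.
Proof.
  intros Hr HA. apply Cmod_CSeries_le with (1 := fun j => borel_term_le r co lam j Hr).
  exact (is_series_scal (exp (Rabs lam * r) * r) _ _ HA).
Qed.

Lemma is_contour_laurent_exp r (co : nat -> R) lam : 0 < r ->
  ex_series (fun j => Rabs (co j) * / r ^ S j) ->
  is_contour r (fun s => Cmult (CSeries (fun j => Cmult (RtoC (co j)) (Cinv (Cpow s (S j)))))
                               (Cexp (Cmult (RtoC lam) s)))
    (borel co lam).
Proof.
  intros Hr Hco.
  assert (Hb := has_csum_borel r co lam Hr Hco).
  eapply is_contour_ext; [|apply is_contour_CSeries with
    (g := fun j s => Cmult (RtoC (co j)) (Cmult (Cinv (Cpow s (S j))) (Cexp (Cmult (RtoC lam) s))))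
    (M := fun j => Rabs (co j) * / r ^ S j * exp (Rabs lam * r))].
  - intros th; cbv beta.
    assert (Hs : has_csum (fun j => Cmult (RtoC (co j)) (Cinv (Cpow (circle r th) (S j))))
      (CSeries (fun j => Cmult (RtoC (co j)) (Cinv (Cpow (circle r th) (S j)))))).
    { apply has_csum_CSeries with (2 := Hco); intros j; right.
      rewrite Cmod_mult, Cmod_R, Cmod_inv_pow_circle; auto. }
    rewrite (Cmult_comm _ (Cexp _)), <- (CSeries_eq _ _ (has_csum_scal _ _ _ Hs)).
    apply CSeries_ext; intros j; ring.
  - exact Hr.
  - intros j; apply is_contour_scal, is_contour_exp, Hr.
  - intros j th. rewrite !Cmod_mult, Cmod_R, Cmod_inv_pow_circle, Cmod_Cexp by exact Hr.
    rewrite <- Rmult_assoc. apply Rmult_le_compat_l.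
    + apply Rmult_le_pos; [apply Rabs_pos|]. left; apply Rinv_0_lt_compat, pow_lt, Hr.
    + apply exp_le. rewrite <- (Cmod_circle r th Hr) at 2. apply Re_scal_le.
  - apply ex_series_scal_r, Hco.
  - exact Hb.
Qed.

(** Common core of the four contour evaluations: against the Laurent series each exponential e^(lam
    s) of the kernel gives a [borel] value. The weighted summability of b serves both the termwise
    integration and the summation of the results. *)
Lemma is_contour_laurent_series r (co : nat -> R) (b : nat -> C) (lam : nat -> R) : 0 < r ->
  ex_series (fun j => Rabs (co j) * / r ^ S j) ->
  ex_series (fun n => Cmod (b n) * exp (Rabs (lam n) * r)) ->
  is_contour r (fun s => Cmult (CSeries (fun j => Cmult (RtoC (co j)) (Cinv (Cpow s (S j)))))
                   (CSeries (fun n => Cmult (b n) (Cexp (Cmult (RtoC (lam n)) s)))))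
    (CSeries (fun n => Cmult (b n) (borel co (lam n)))).
Proof.
  intros Hr [A HA] Hb.
  assert (Hco : ex_series (fun j => Rabs (co j) * / r ^ S j)) by (exists A; exact HA).
  assert (Hexp : forall n th, Cmod (Cexp (Cmult (RtoC (lam n)) (circle r th))) <= exp (Rabs (lam n) * r)).
  { intros; rewrite Cmod_Cexp; apply exp_le.
    rewrite <- (Cmod_circle r th Hr) at 2. apply Re_scal_le. }
  assert (Hal : forall th, Cmod (CSeries (fun j => Cmult (RtoC (co j)) (Cinv (Cpow (circle r th) (S j))))) <= A).
  { intros th; apply Cmod_CSeries_le with (2 := HA); intros j; right.
    rewrite Cmod_mult, Cmod_R, Cmod_inv_pow_circle; auto. }
  eapply is_contour_ext; [|apply is_contour_CSeries with
    (g := fun n s => Cmult (b n) (Cmult (CSeries (fun j => Cmult (RtoC (co j)) (Cinv (Cpow s (S j)))))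
                                  (Cexp (Cmult (RtoC (lam n)) s))))
    (M := fun n => Cmod (b n) * exp (Rabs (lam n) * r) * A)].
  - intros th; cbv beta.
    assert (Hs : has_csum (fun n => Cmult (b n) (Cexp (Cmult (RtoC (lam n)) (circle r th))))
      (CSeries (fun n => Cmult (b n) (Cexp (Cmult (RtoC (lam n)) (circle r th)))))).
    { apply has_csum_CSeries with (2 := Hb); intros n.
      rewrite Cmod_mult; apply Rmult_le_compat_l; [apply Cmod_ge_0|apply Hexp]. }
    rewrite <- (CSeries_eq _ _ (has_csum_scal _ _ _ Hs)).
    apply CSeries_ext; intros j; ring.
  - exact Hr.
  - intros n; apply is_contour_scal, is_contour_laurent_exp; assumption.
  - intros n th. rewrite !Cmod_mult.
    replace (Cmod (b n) * exp (Rabs (lam n) * r) * A)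
      with (Cmod (b n) * (A * exp (Rabs (lam n) * r))) by ring.
    apply Rmult_le_compat_l; [apply Cmod_ge_0|].
    apply Rmult_le_compat; auto using Cmod_ge_0.
  - apply ex_series_scal_r, Hb.
  - apply has_csum_CSeries with (fun n => Cmod (b n) * exp (Rabs (lam n) * r) * (r * A)).
    + intros n; rewrite Cmod_mult, Rmult_assoc.
      apply Rmult_le_compat_l; [apply Cmod_ge_0|].
      rewrite <- Rmult_assoc; apply Cmod_borel_le; assumption.
    + apply ex_series_scal_r, Hb.
Qed.

(** * Polylogarithms of negative integer order *)

Lemma has_csum_geom w : Cmod w < 1 -> has_csum (fun n => Cpow w n) (Cinv (Cminus (RtoC 1) w)).
Proof.
  intros Hw.
  assert (H1 : Cminus (RtoC 1) w <> RtoC 0).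
  { intros H. assert (E : w = RtoC 1).
    { transitivity (Cminus (RtoC 1) (Cminus (RtoC 1) w)); [ring|rewrite H; ring]. }
    rewrite E, Cmod_1 in Hw; lra. }
  assert (Hz : clim (fun n => Cpow w n) (RtoC 0)).
  { apply Cmod_clim. apply is_lim_seq_ext with (fun n => Cmod w ^ n).
    - intros n; rewrite <- Cmod_pow; f_equal; ring.
    - apply is_lim_seq_geom. rewrite Rabs_pos_eq; [exact Hw|apply Cmod_ge_0]. }
  split.
  - apply ex_series_ext with (fun n => Cmod w ^ n); [intros; rewrite Cmod_pow; reflexivity|].
    apply ex_series_geom; rewrite Rabs_pos_eq; [exact Hw|apply Cmod_ge_0].
  - replace (Cinv (Cminus (RtoC 1) w)) with
      (Cmult (Cinv (Cminus (RtoC 1) w)) (Cplus (RtoC 1) (Cmult (RtoC (-1)) (RtoC 0)))) by ring.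
    eapply clim_ext; [|apply clim_mult; [apply clim_const|apply clim_plus;
       [apply clim_const|apply clim_mult; [apply clim_const|exact Hz]]]].
    intros n; simpl. induction n as [|n IH].
    + simpl; ring.
    + simpl fsum; rewrite <- IH; simpl; field; exact H1.
Qed.

Lemma ex_series_poly_geom p rho : 0 <= rho < 1 ->
  ex_series (fun i => INR (S i) ^ p * rho ^ i).
Proof.
  (* exp d <= 1/(1-d), so this d gives rho exp d < 1, while (i+1)^p is at most p!/d^p times
     exp((i+1) d). *)
  intros Hr. set (d := (1 - rho) / 2).
  assert (Hd : 0 < d < 1) by (unfold d; lra).
  assert (He : exp d <= / (1 - d)).
  { assert (H := exp_ineq1_le (- d)). rewrite <- (Rinv_inv (exp d)), <- exp_Ropp.
    apply Rinv_le_contravar; lra. }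
  assert (Hq : 0 <= rho * exp d < 1).
  { split; [apply Rmult_le_pos; [lra|left; apply exp_pos]|].
    apply Rle_lt_trans with (rho * / (1 - d)); [apply Rmult_le_compat_l; lra|].
    apply (Rmult_lt_reg_r (1 - d)); [lra|]. rewrite Rmult_assoc, Rinv_l by lra.
    unfold d; lra. }
  apply ex_series_Rle with (fun i => (INR (fact p) * / d ^ p * exp d) * (rho * exp d) ^ i).
  - intros i. split; [apply Rmult_le_pos; apply pow_le; [apply pos_INR|lra]|].
    assert (H := pow_fact_le_exp (INR (S i) * d) p).
    assert (Hp : 0 <= INR (S i) * d) by (apply Rmult_le_pos; [apply pos_INR|lra]).
    specialize (H Hp).
    rewrite Rpow_mult_distr. replace (INR (fact p) * / d ^ p * exp d * (rho ^ i * exp d ^ i))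
      with ((INR (fact p) * / d ^ p * (exp d * exp d ^ i)) * rho ^ i) by ring.
    apply Rmult_le_compat_r; [apply pow_le; lra|].
    replace (exp d * exp d ^ i) with (exp (INR (S i) * d)).
    + assert (Hf := INR_fact_lt_0 p).
      assert (Hdp : 0 < d ^ p) by (apply pow_lt; lra).
      apply (Rmult_le_reg_r (d ^ p * / INR (fact p))).
      { apply Rmult_lt_0_compat; [exact Hdp|apply Rinv_0_lt_compat, Hf]. }
      eapply Rle_trans; [|eapply Rle_trans; [exact H|]]; right.
      * rewrite Rpow_mult_distr; field; lra.
      * field; lra.
    + change (exp d * exp d ^ i) with (exp d ^ S i). clear; induction (S i) as [|n IH].
      * simpl; rewrite Rmult_0_l, exp_0; reflexivity.
      * rewrite S_INR, Rmult_plus_distr_r, exp_plus, IH, Rmult_1_l; simpl; ring.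
  - apply ex_series_scal_R.
    apply ex_series_geom; rewrite Rabs_pos_eq; lra.
Qed.

(** * Binomial coefficients and the coefficients of the polylogarithm *)

Fixpoint bin (n k : nat) : nat :=
  match k, n with
  | O, _ => 1
  | S _, O => 0
  | S k', S n' => bin n' k' + bin n' (S k')
  end%nat.

Lemma bin_SS n k : bin (S n) (S k) = (bin n k + bin n (S k))%nat.
Proof. reflexivity. Qed.

Lemma bin_0_r n : bin n 0 = 1%nat.
Proof. destruct n; reflexivity. Qed.

Lemma bin_gt n k : (n < k)%nat -> bin n k = 0%nat.
Proof.
  revert k; induction n as [|n IH]; intros [|k] H; try lia; [reflexivity|].
  rewrite bin_SS, !IH by lia; reflexivity.
Qed.

Lemma bin_absorb n k : (S k * bin (S n) (S k) = S n * bin n k)%nat.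
Proof.
  revert k; induction n as [|n IH]; intros k.
  - destruct k as [|k]; [reflexivity|]. rewrite bin_SS, !bin_gt by lia; simpl; lia.
  - destruct k as [|k].
    + rewrite bin_SS, !bin_0_r. specialize (IH 0%nat). rewrite bin_0_r in IH. nia.
    + rewrite (bin_SS (S n)), (bin_SS n k).
      assert (H1 := IH k); assert (H2 := IH (S k)).
      rewrite (bin_SS n k) in H1. rewrite (bin_SS n (S k)) in H2.
      rewrite (bin_SS n (S k)). nia.
Qed.

Lemma bin_step i j : (S j * bin (i + j) (S j) = i * bin (i + j) j)%nat.
Proof. assert (H := bin_absorb (i + j) j); rewrite bin_SS in H; nia. Qed.

Lemma bin_le_pow n k : (bin n k <= S n ^ k)%nat.
Proof.
  revert k; induction n as [|n IH]; intros [|k].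
  - simpl; lia.
  - rewrite bin_gt by lia; apply Nat.le_0_l.
  - rewrite bin_0_r; simpl; lia.
  - rewrite bin_SS. assert (H1 := IH k); assert (H2 := IH (S k)).
    assert (H3 : (S n ^ k <= S (S n) ^ k)%nat) by (apply Nat.pow_le_mono_l; lia).
    simpl Nat.pow in *. nia.
Qed.

Lemma bin_fact i j : (bin (i + j) j * (fact i * fact j) = fact (i + j))%nat.
Proof.
  revert i; induction j as [|j IH]; intros i.
  - rewrite bin_0_r, Nat.add_0_r; simpl; lia.
  - replace (i + S j)%nat with (S (i + j)) by lia.
    assert (H := bin_absorb (i + j) j). rewrite (fact_simpl j), (fact_simpl (i + j)), <- IH.
    transitivity ((S j * bin (S (i + j)) (S j)) * (fact i * fact j))%nat; [ring|rewrite H; ring].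
Qed.

Lemma licoef_gt n j : (n < j)%nat -> licoef n j = 0%nat.
Proof.
  revert j; induction n as [|n IH]; intros [|j] H; try lia; [reflexivity|].
  simpl; rewrite !IH by lia; lia.
Qed.

Lemma licoef_diag n : licoef n n = fact n.
Proof.
  induction n as [|n IH]; [reflexivity|].
  simpl licoef; rewrite licoef_gt, IH by lia; simpl; lia.
Qed.

Lemma rsum_S n a : rsum (S n) a = a O + rsum n (fun i => a (S i)).
Proof.
  induction n as [|n IH]; [simpl; ring|].
  change (rsum (S n) a + a (S n) = a O + (rsum n (fun i => a (S i)) + a (S n))).
  rewrite IH; ring.
Qed.

Lemma rsum_plus n a b : rsum n (fun i => a i + b i) = rsum n a + rsum n b.
Proof. induction n as [|n IH]; simpl; [|rewrite IH]; ring. Qed.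

Lemma rsum_scal n x a : rsum n (fun i => x * a i) = x * rsum n a.
Proof. induction n as [|n IH]; simpl; [|rewrite IH]; ring. Qed.

(** The recursion for [licoef] comes from theta u^(j+1) = (j+1)(u^(j+1) + u^(j+2)); here it is
    transposed onto the test sequence b. Any cutoff B > n captures all nonzero coefficients, which
    keeps the inductions free of exact ranges. *)
Lemma licoef_step B n (b : nat -> R) : (n < B)%nat ->
  rsum (S B) (fun j => INR (licoef (S n) j) * b j)
  = rsum B (fun j => INR (licoef n j) * (INR (S j) * (b j + b (S j)))).
Proof.
  intros HB.
  transitivity (rsum (S B) (fun j => INR (licoef n j) * (INR (S j) * b j)) +
     rsum (S B) (fun j => match j with O => 0 | S j' => INR (licoef n j') * (INR (S j') * b (S j')) end)).
  - rewrite <- rsum_plus. apply rsum_ext; intros j _.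
    cbn [licoef]. destruct j as [|j].
    + rewrite !plus_INR, !mult_INR, !plus_INR; simpl; ring.
    + rewrite !plus_INR, !mult_INR, !plus_INR, !S_INR; simpl; ring.
  - rewrite (rsum_S B (fun j => match j with O => _ | S _ => _ end)).
    cbn [rsum]. rewrite (licoef_gt n B) by exact HB. simpl (INR 0).
    rewrite Rmult_0_l, Rplus_0_r, Rplus_0_l, <- rsum_plus.
    apply rsum_ext; intros; ring.
Qed.

(** C(i,j) is the coefficient of w^(i+1) in u^(j+1), u = w/(1-w), so the identity compares
    coefficients in theta^n u: theta multiplies w^(i+1) by i+1. In the induction this is the
    absorption rule (j+1) C(i+1,j+1) = (i+1) C(i,j). *)
Lemma licoef_bin n i B : (n < B)%nat ->
  rsum B (fun j => INR (licoef n j) * INR (bin i j)) = INR (S i) ^ n.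
Proof.
  revert B; induction n as [|n IH]; intros B HB; (destruct B as [|B]; [lia|]).
  - rewrite rsum_S. simpl (licoef 0 0). rewrite bin_0_r.
    rewrite (rsum_ext B _ (fun _ => 0)) by (intros; simpl; ring).
    rewrite rsum_const; simpl; ring.
  - rewrite licoef_step by lia.
    rewrite (rsum_ext B _ (fun j => INR (S i) * (INR (licoef n j) * INR (bin i j)))).
    + rewrite rsum_scal, IH by lia; reflexivity.
    + intros j _. rewrite <- plus_INR, <- bin_SS, <- !mult_INR.
      rewrite bin_absorb. f_equal; lia.
Qed.

(** The same comparison at infinity: u = -1/(1 - 1/w), the coefficient of w^(-i) in u^(j+1) is
    (-1)^(j+1) C(i+j,j), and theta multiplies w^(-i) by -i. A common factor -1 has been removed. *)
Lemma licoef_bin_neg n i B : (n < B)%nat ->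
  rsum B (fun j => INR (licoef n j) * ((-1) ^ j * INR (bin (i + j) j))) = (-1) ^ n * INR i ^ n.
Proof.
  revert B; induction n as [|n IH]; intros B HB; (destruct B as [|B]; [lia|]).
  - rewrite rsum_S. simpl (licoef 0 0). rewrite bin_0_r.
    rewrite (rsum_ext B _ (fun _ => 0)) by (intros; simpl; ring).
    rewrite rsum_const; simpl; ring.
  - rewrite licoef_step by lia.
    rewrite (rsum_ext B _ (fun j => (- INR i) * (INR (licoef n j) * ((-1) ^ j * INR (bin (i + j) j))))).
    + rewrite rsum_scal, IH by lia; simpl; ring.
    + intros j _. replace (i + S j)%nat with (S (i + j)) by lia.
      rewrite bin_SS, plus_INR.
      assert (H := f_equal INR (bin_step i j)). rewrite !mult_INR in H.
      transitivity (- (INR (licoef n j) * (-1) ^ j * (INR (S j) * INR (bin (i + j) (S j)))));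
        [simpl pow; ring|rewrite H; ring].
Qed.

(** Pascal's rule gives the fixed-point equation T = w (u^(j+1) + T), u = w/(1-w), for the series T
    belonging to j+1, and it is solved for T. Absolute convergence of T has to be known
    beforehand. *)
Lemma has_csum_shifted_geom_pow w j : Cmod w < 1 ->
  has_csum (fun i => Cmult (RtoC (INR (bin i j))) (Cpow w (S i)))
    (Cpow (Cdiv w (Cminus (RtoC 1) w)) (S j)).
Proof.
  intros Hw.
  assert (H1 : Cminus (RtoC 1) w <> RtoC 0).
  { intros H. assert (E : w = RtoC 1).
    { transitivity (Cminus (RtoC 1) (Cminus (RtoC 1) w)); [ring|rewrite H; ring]. }
    rewrite E, Cmod_1 in Hw; lra. }
  induction j as [|j IH].
  - eapply has_csum_eq; [eapply has_csum_ext; [|apply (has_csum_scal w), has_csum_geom, Hw]|].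
    + intros i; simpl; rewrite bin_0_r; simpl; ring.
    + simpl; unfold Cdiv; ring.
  - set (T := CSeries (fun i => Cmult (RtoC (INR (bin i (S j)))) (Cpow w (S i)))).
    assert (HT : has_csum (fun i => Cmult (RtoC (INR (bin i (S j)))) (Cpow w (S i))) T).
    { apply has_csum_CSeries with (fun i => INR (S i) ^ (S j) * Cmod w ^ i).
      - intros i; rewrite Cmod_mult, Cmod_pow, Cmod_R, Rabs_pos_eq by apply pos_INR.
        apply Rmult_le_compat; [apply pos_INR|apply pow_le, Cmod_ge_0| |].
        + rewrite <- pow_INR; apply le_INR, bin_le_pow.
        + simpl; rewrite <- (Rmult_1_l (Cmod w ^ i)) at 2.
          apply Rmult_le_compat_r; [apply pow_le, Cmod_ge_0|lra].
      - apply ex_series_poly_geom; split; [apply Cmod_ge_0|exact Hw]. }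
    assert (E : Cminus T (RtoC 0) = Cmult w (Cplus (Cpow (Cdiv w (Cminus (RtoC 1) w)) (S j)) T)).
    { eapply has_csum_unique.
      - eapply has_csum_eq; [apply has_csum_tail, HT|].
        cbv beta; rewrite bin_gt by lia; simpl; ring.
      - eapply has_csum_ext; [|apply (has_csum_scal w), (has_csum_plus _ _ _ _ IH HT)].
        intros i; cbv beta; rewrite bin_SS, plus_INR, RtoC_plus, (Cpow_S w (S i)); ring. }
    eapply has_csum_eq; [exact HT|].
    apply (f_equal (fun z => Cdiv (Cminus z (Cmult w T)) (Cminus (RtoC 1) w))) in E.
    rewrite (Cpow_S _ (S j)). set (P := Cpow (Cdiv w (Cminus (RtoC 1) w)) (S j)) in *.
    transitivity (Cdiv (Cminus (Cminus T 0) (Cmult w T)) (Cminus (RtoC 1) w));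
      [field; exact H1|rewrite E; field; exact H1].
Qed.

(** Same device as for the powers of w/(1-w): Pascal's rule gives T = (1-z)^(-(j+1)) + z T for the
    series T belonging to j+1. *)
Lemma has_csum_inv_pow z j : Cmod z < 1 ->
  has_csum (fun i => Cmult (RtoC (INR (bin (i + j) j))) (Cpow z i))
    (Cpow (Cinv (Cminus (RtoC 1) z)) (S j)).
Proof.
  intros Hw.
  assert (H1 : Cminus (RtoC 1) z <> RtoC 0).
  { intros H. assert (E : z = RtoC 1).
    { transitivity (Cminus (RtoC 1) (Cminus (RtoC 1) z)); [ring|rewrite H; ring]. }
    rewrite E, Cmod_1 in Hw; lra. }
  induction j as [|j IH].
  - eapply has_csum_eq; [eapply has_csum_ext; [|apply has_csum_geom, Hw]|].
    + intros i; simpl; rewrite bin_0_r; simpl; ring.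
    + simpl; ring.
  - set (T := CSeries (fun i => Cmult (RtoC (INR (bin (i + S j) (S j)))) (Cpow z i))).
    assert (HT : has_csum (fun i => Cmult (RtoC (INR (bin (i + S j) (S j)))) (Cpow z i)) T).
    { apply has_csum_CSeries with (fun i => INR (S (S j)) ^ S j * (INR (S i) ^ (S j) * Cmod z ^ i)).
      - intros i; rewrite Cmod_mult, Cmod_pow, Cmod_R, Rabs_pos_eq by apply pos_INR.
        rewrite <- Rmult_assoc.
        apply Rmult_le_compat_r; [apply pow_le, Cmod_ge_0|].
        rewrite <- Rpow_mult_distr, <- mult_INR, <- pow_INR.
        apply le_INR. etransitivity; [apply bin_le_pow|]. apply Nat.pow_le_mono_l; nia.
      - apply ex_series_scal_R, ex_series_poly_geom; split; [apply Cmod_ge_0|exact Hw]. }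
    assert (E : T = Cplus (Cpow (Cinv (Cminus (RtoC 1) z)) (S j)) (Cmult z T)).
    { apply (has_csum_unique _ _ _ HT).
      assert (Hz : has_csum (fun i => match i with O => RtoC 0 | S i' =>
          Cmult z (Cmult (RtoC (INR (bin (i' + S j) (S j)))) (Cpow z i')) end) (Cmult z T)).
      { eapply has_csum_eq; [apply has_csum_cons; exact (has_csum_scal z _ _ HT)|]. cbv beta iota; ring. }
      eapply has_csum_ext; [|apply (has_csum_plus _ _ _ _ IH Hz)].
      intros [|i]; cbv beta iota.
      - simpl Nat.add. rewrite bin_SS, (bin_gt j (S j)), Nat.add_0_r by lia. ring.
      - replace (S i + S j)%nat with (S (S i + j)) by lia. rewrite bin_SS, plus_INR, RtoC_plus.
        replace (i + S j)%nat with (S i + j)%nat by lia. rewrite (Cpow_S z i); ring. }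
    eapply has_csum_eq; [exact HT|].
    rewrite (Cpow_S _ (S j)). set (P := Cpow (Cinv (Cminus (RtoC 1) z)) (S j)) in *.
    transitivity (Cdiv (Cminus T (Cmult z T)) (Cminus (RtoC 1) z));
      [field; exact H1|rewrite E at 1; field; exact H1].
Qed.

Lemma fsum_RtoC n a : fsum n (fun i => RtoC (a i)) = RtoC (rsum n a).
Proof. induction n as [|n IH]; simpl; [|rewrite IH, <- RtoC_plus]; reflexivity. Qed.

Lemma has_csum_Li_neg n w : Cmod w < 1 ->
  has_csum (fun i => Cmult (RtoC (INR (S i) ^ n)) (Cpow w (S i))) (Li_neg n w).
Proof.
  intros Hw. unfold Li_neg.
  eapply has_csum_ext; [|apply has_csum_fsum; intros j _; apply (has_csum_scal (RtoC (INR (licoef n j)))),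
    (has_csum_shifted_geom_pow w j Hw)].
  intros i; cbv beta. rewrite <- (licoef_bin n i (S n)) by lia.
  rewrite <- fsum_RtoC, Cmult_comm, <- fsum_scal. apply fsum_ext; intros j _.
  rewrite RtoC_mult; ring.
Qed.

(** Inversion Li_{-n}(w) = (-1)^(n+1) Li_{-n}(1/w), with sign +1 because n is odd. The expansion in
    1/w obtained from [licoef_bin_neg] starts at i = 0, where 0^n = 0, so passing to the tail loses
    nothing. *)
Lemma has_csum_Li_neg_inv n w : Nat.Odd n -> 1 < Cmod w ->
  has_csum (fun i => Cmult (RtoC (INR (S i) ^ n)) (Cpow (Cinv w) (S i))) (Li_neg n w).
Proof.
  intros Hn Hw.
  assert (Hw0 : w <> RtoC 0) by (apply Cmod_gt_0; lra).
  assert (Hz : Cmod (Cinv w) < 1).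
  { rewrite Cmod_inv by exact Hw0. rewrite <- Rinv_1. apply Rinv_lt_contravar; lra. }
  assert (Hw1 : Cminus w (RtoC 1) <> RtoC 0).
  { intros H. assert (E : w = RtoC 1).
    { transitivity (Cplus (RtoC 1) (Cminus w (RtoC 1))); [ring|rewrite H; ring]. }
    rewrite E, Cmod_1 in Hw; lra. }
  assert (Hu : Cdiv w (Cminus (RtoC 1) w) = Cmult (RtoC (-1)) (Cinv (Cminus (RtoC 1) (Cinv w)))).
  { assert (Hw2 : Cminus (RtoC 1) w <> RtoC 0).
    { intros H; apply Hw1. transitivity (Copp (Cminus (RtoC 1) w)); [ring|rewrite H; ring]. }
    field; repeat split; auto. }
  assert (Hodd : (-1) ^ n = -1).
  { destruct Hn as [p ->]. rewrite Nat.add_1_r; apply pow_1_odd. }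
  assert (H : has_csum (fun i => Cmult (RtoC (INR i ^ n)) (Cpow (Cinv w) i)) (Li_neg n w)).
  { unfold Li_neg. rewrite Hu.
    eapply has_csum_ext; [|apply has_csum_fsum; intros j _;
      eapply has_csum_eq; [apply (has_csum_scal (RtoC (INR (licoef n j) * (-1) ^ S j))),
      (has_csum_inv_pow (Cinv w) j Hz)|
      rewrite Cpow_mult_l, RtoC_mult, <- Cmult_assoc, <- RtoC_pow; reflexivity]].
    intros i; cbv beta.
    replace (INR i ^ n) with (- ((-1) ^ n * INR i ^ n)) by (rewrite Hodd; ring).
    rewrite <- (licoef_bin_neg n i (S n)) by lia.
    rewrite RtoC_opp, <- fsum_RtoC.
    replace (Cmult (Copp (fsum (S n) (fun j => RtoC (INR (licoef n j) * ((-1) ^ j * INR (bin (i + j) j))))))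
              (Cpow (Cinv w) i))
      with (Cmult (Copp (Cpow (Cinv w) i))
             (fsum (S n) (fun j => RtoC (INR (licoef n j) * ((-1) ^ j * INR (bin (i + j) j)))))) by ring.
    rewrite <- fsum_scal. apply fsum_ext; intros j _.
    simpl pow. rewrite !RtoC_mult; ring. }
  eapply has_csum_eq; [exact (has_csum_tail _ _ H)|].
  destruct Hn as [p ->]. cbv beta; simpl (INR 0). rewrite pow_i by lia. ring.
Qed.

(** * Sums over the integers and the Lipschitz summation formula *)

Lemma e2pi_plus z w : e2pi (Cplus z w) = Cmult (e2pi z) (e2pi w).
Proof. unfold e2pi; rewrite <- Cexp_plus; f_equal; ring. Qed.

Lemma e2pi_opp z : e2pi (Copp z) = Cinv (e2pi z).
Proof. unfold e2pi; rewrite <- Cexp_opp; f_equal; ring. Qed.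

Lemma e2pi_pow z n : Cpow (e2pi z) n = e2pi (Cmult (RtoC (INR n)) z).
Proof. unfold e2pi; rewrite Cexp_pow; f_equal; ring. Qed.

Lemma e2pi_IZR n : e2pi (RtoC (IZR n)) = RtoC 1.
Proof.
  unfold e2pi; rewrite <- (Cexp_2pi n); f_equal; apply C_eq; simpl; ring.
Qed.

Lemma e2pi_INR n : e2pi (RtoC (INR n)) = RtoC 1.
Proof. rewrite INR_IZR_INZ; apply e2pi_IZR. Qed.

Lemma e2pi_neq_0 z : e2pi z <> RtoC 0.
Proof. apply Cexp_neq_0. Qed.

Lemma Cmod_e2pi z : Cmod (e2pi z) = exp (- (2 * PI * Im z)).
Proof. unfold e2pi; rewrite Cmod_Cexp; f_equal; simpl; unfold Im; ring. Qed.

Lemma Cmod_e2pi_R x : Cmod (e2pi (RtoC x)) = 1.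
Proof. rewrite Cmod_e2pi, im_RtoC, Rmult_0_r, Ropp_0, exp_0; reflexivity. Qed.

Lemma e2pi_conj z : Cconj (e2pi z) = e2pi (Copp (Cconj z)).
Proof. unfold e2pi; rewrite Cexp_conj; f_equal; apply C_eq; simpl; ring. Qed.

(** Two half lines with 0 in the first, the shape in which [coset_sum] runs over d. *)
Definition has_zsum (a : Z -> C) (l : C) : Prop :=
  exists l1 l2, has_csum (fun j => a (Z.of_nat j)) l1 /\
    has_csum (fun j => a (- Z.of_nat (S j))%Z) l2 /\ l = Cplus l1 l2.

Lemma has_zsum_ext a b l : (forall n, a n = b n) -> has_zsum a l -> has_zsum b l.
Proof.
  intros H (l1 & l2 & H1 & H2 & E); exists l1, l2; split; [|split; [|exact E]].
  - apply (has_csum_ext _ _ _ (fun j => H _) H1).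
  - apply (has_csum_ext _ _ _ (fun j => H _) H2).
Qed.

Lemma has_zsum_eq a l l' : has_zsum a l -> l = l' -> has_zsum a l'.
Proof. intros H <-; exact H. Qed.

Lemma has_zsum_plus a b l1 l2 : has_zsum a l1 -> has_zsum b l2 ->
  has_zsum (fun n => Cplus (a n) (b n)) (Cplus l1 l2).
Proof.
  intros (x1 & x2 & H1 & H2 & ->) (y1 & y2 & H3 & H4 & ->).
  exists (Cplus x1 y1), (Cplus x2 y2); split; [|split].
  - exact (has_csum_plus _ _ _ _ H1 H3).
  - exact (has_csum_plus _ _ _ _ H2 H4).
  - ring.
Qed.

Lemma has_zsum_scal z a l : has_zsum a l -> has_zsum (fun n => Cmult z (a n)) (Cmult z l).
Proof.
  intros (x1 & x2 & H1 & H2 & ->). exists (Cmult z x1), (Cmult z x2); split; [|split].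
  - exact (has_csum_scal z _ _ H1).
  - exact (has_csum_scal z _ _ H2).
  - ring.
Qed.

Lemma has_zsum_conj a l : has_zsum a l -> has_zsum (fun n => Cconj (a n)) (Cconj l).
Proof.
  intros (x1 & x2 & H1 & H2 & ->). exists (Cconj x1), (Cconj x2); split; [|split].
  - exact (has_csum_conj _ _ H1).
  - exact (has_csum_conj _ _ H2).
  - apply Cplus_conj.
Qed.

Lemma has_zsum_0 : has_zsum (fun _ => RtoC 0) (RtoC 0).
Proof. exists (RtoC 0), (RtoC 0); repeat split; try apply has_csum_0. ring. Qed.

Lemma has_zsum_fsum c (a : nat -> Z -> C) (l : nat -> C) :
  (forall d, (d < c)%nat -> has_zsum (a d) (l d)) ->
  has_zsum (fun n => fsum c (fun d => a d n)) (fsum c l).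
Proof.
  intros H; induction c as [|c IH]; simpl; [apply has_zsum_0|].
  apply has_zsum_plus; auto.
Qed.

Lemma CSeries_pair_eq a l : has_zsum a l ->
  Cplus (CSeries (fun j => a (Z.of_nat j))) (CSeries (fun j => a (- Z.of_nat (S j))%Z)) = l.
Proof.
  intros (x1 & x2 & H1 & H2 & ->). rewrite (CSeries_eq _ _ H1), (CSeries_eq _ _ H2); reflexivity.
Qed.

Lemma has_zsum_swap (a : Z -> nat -> C) (B : Z -> R) (D : nat -> R) r c :
  (forall i j, Cmod (a i j) <= B i * D j) ->
  (forall i, 0 <= B i) -> (forall j, 0 <= D j) ->
  ex_series (fun j => B (Z.of_nat j)) -> ex_series (fun j => B (- Z.of_nat (S j))%Z) ->
  ex_series D ->
  (forall i, has_csum (a i) (r i)) -> (forall j, has_zsum (fun i => a i j) (c j)) ->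
  has_zsum r (CSeries c) /\ has_csum c (CSeries c).
Proof.
  intros Ha HB0 HD0 HB1 HB2 HD Hr Hc.
  assert (G : forall s : nat -> Z, ex_series (fun j => B (s j)) ->
    exists x y, has_csum (fun j => r (s j)) x /\
      has_csum y x /\ forall j, has_csum (fun i => a (s i) j) (y j)).
  { intros s Hs.
    assert (Hcol : forall j, has_csum (fun i => a (s i) j) (CSeries (fun i => a (s i) j))).
    { intros j; apply has_csum_CSeries with (fun i => B (s i) * D j); [intros; apply Ha|].
      apply ex_series_scal_r, Hs. }
    assert (Hrow : has_csum (fun j => r (s j)) (CSeries (fun j => r (s j)))).
    { apply has_csum_CSeries with (fun i => B (s i) * Series D).
      - intros i; eapply has_csum_Cmod_le; [apply Hr|apply Ha|].
        exact (is_series_scal (B (s i)) _ _ (Series_correct _ HD)).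
      - apply ex_series_scal_r, Hs. }
    exists (CSeries (fun j => r (s j))), (fun j => CSeries (fun i => a (s i) j)).
    split; [exact Hrow|split; [|exact Hcol]].
    apply (has_csum_swap (fun i j => a (s i) j) (fun i => B (s i)) D (fun i => r (s i))); auto. }
  destruct (G (fun j => Z.of_nat j) HB1) as (x1 & y1 & H1 & H2 & H3).
  destruct (G (fun j => - Z.of_nat (S j))%Z HB2) as (x2 & y2 & H4 & H5 & H6).
  assert (HL : has_csum c (Cplus x1 x2)).
  { eapply has_csum_ext; [|apply (has_csum_plus _ _ _ _ H2 H5)].
    intros j; cbv beta. destruct (Hc j) as (z1 & z2 & K1 & K2 & ->).
    rewrite (has_csum_unique _ _ _ K1 (H3 j)), (has_csum_unique _ _ _ K2 (H6 j)); reflexivity. }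
  rewrite (CSeries_eq _ _ HL). split; [|exact HL].
  exists x1, x2; split; [exact H1|split; [exact H4|reflexivity]].
Qed.

Lemma ex_series_inv_sq : ex_series (fun j => / INR (S j) ^ 2).
Proof.
  apply ex_series_Rle with (fun j => 2 * (/ INR (S j) - / INR (S (S j)))).
  - intros j. assert (H := lt_0_INR (S j) ltac:(lia)).
    rewrite (S_INR (S j)). split; [left; apply Rinv_0_lt_compat, pow_lt, H|].
    assert (H1 : 1 <= INR (S j)) by (rewrite S_INR; generalize (pos_INR j); lra).
    replace (2 * (/ INR (S j) - / (INR (S j) + 1))) with (/ (INR (S j) * (INR (S j) + 1) / 2)).
    + set (x := INR (S j)) in *; apply Rinv_le_contravar; nra.
    + field; lra.
  - apply ex_series_scal_R. exists 1. apply is_series_rsum.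
    apply is_lim_seq_ext with (fun n => 1 - / INR (S n)).
    + induction n as [|n IH]; [simpl; field|]. cbn [rsum]; rewrite <- IH; ring.
    + replace (Finite 1) with (Finite (1 - 0)) by (f_equal; ring).
      apply is_lim_seq_minus'; [apply is_lim_seq_const|].
      apply (is_lim_seq_incr_1 (fun n => / INR n)).
      replace (Finite 0) with (Rbar_inv p_infty) by reflexivity.
      apply is_lim_seq_inv; [apply is_lim_seq_INR|discriminate].
Qed.

Lemma Im_le_Cmod_shift w (x : R) : 0 < Im w -> Im w <= Cmod (Cplus w (RtoC x)).
Proof.
  intros H. eapply Rle_trans; [|apply im_le_Cmod]. simpl. rewrite Rplus_0_r. apply Rle_abs.
Qed.

Lemma shift_neq_0 w (x : R) : Im w <> 0 -> Cplus w (RtoC x) <> RtoC 0.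
Proof. intros H E; apply (f_equal Im) in E; simpl in E; unfold Im in *; lra. Qed.

(** From |x| <= |w+x| + |w| and 1 <= |w+x|/Im w one gets 1 + |x| <= K |w+x| with K = 1 + (|w|+1)/Im
    w. *)
Lemma inv_sq_shift_le w (x : R) : 0 < Im w ->
  / Cmod (Cplus w (RtoC x)) ^ 2 <= (1 + (Cmod w + 1) / Im w) ^ 2 * / (1 + Rabs x) ^ 2.
Proof.
  intros H. set (y := Cmod (Cplus w (RtoC x))). set (K := 1 + (Cmod w + 1) / Im w).
  assert (Hy : Im w <= y) by (apply Im_le_Cmod_shift, H).
  assert (Hx : Rabs x <= y + Cmod w).
  { rewrite <- Cmod_R. replace (RtoC x) with (Cplus (Cplus w (RtoC x)) (Copp w)) by ring.
    eapply Rle_trans; [apply Cmod_triangle|]. rewrite Cmod_opp; unfold y; lra. }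
  assert (Hw := Cmod_ge_0 w). assert (Hax := Rabs_pos x).
  assert (HK : 1 + Rabs x <= K * y).
  { unfold K. rewrite Rmult_plus_distr_r, Rmult_1_l.
    apply Rle_trans with (y + (Cmod w + 1)); [lra|]. apply Rplus_le_compat_l.
    unfold Rdiv; rewrite Rmult_assoc. rewrite <- (Rmult_1_r (Cmod w + 1)) at 1.
    apply Rmult_le_compat_l; [lra|]. apply (Rmult_le_reg_l (Im w)); [exact H|].
    rewrite <- Rmult_assoc, Rinv_r by lra; lra. }
  assert (HK0 : 0 < K).
  { unfold K. assert (0 <= (Cmod w + 1) / Im w) by (apply Rdiv_le_0_compat; lra); lra. }
  apply (Rmult_le_reg_r (y ^ 2 * (1 + Rabs x) ^ 2)).
  { apply Rmult_lt_0_compat; apply pow_lt; lra. }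
  replace (/ y ^ 2 * (y ^ 2 * (1 + Rabs x) ^ 2)) with ((1 + Rabs x) ^ 2) by (field; lra).
  replace (K ^ 2 * / (1 + Rabs x) ^ 2 * (y ^ 2 * (1 + Rabs x) ^ 2)) with ((K * y) ^ 2) by (field; lra).
  apply pow_incr; lra.
Qed.

Lemma ex_series_inv_sq_shift_pos w : 0 < Im w ->
  ex_series (fun j => / Cmod (Cplus w (RtoC (IZR (Z.of_nat j)))) ^ 2).
Proof.
  intros H. apply ex_series_Rle with (fun j => (1 + (Cmod w + 1) / Im w) ^ 2 * / INR (S j) ^ 2).
  - intros j; split.
    + left; apply Rinv_0_lt_compat, pow_lt. generalize (Im_le_Cmod_shift w (IZR (Z.of_nat j)) H); lra.
    + eapply Rle_trans; [apply inv_sq_shift_le, H|]. right; f_equal; f_equal; f_equal.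
      rewrite <- INR_IZR_INZ, Rabs_pos_eq, S_INR by apply pos_INR; ring.
  - apply ex_series_scal_R, ex_series_inv_sq.
Qed.

Lemma ex_series_inv_sq_shift_neg w : 0 < Im w ->
  ex_series (fun j => / Cmod (Cplus w (RtoC (IZR (- Z.of_nat (S j))))) ^ 2).
Proof.
  intros H. apply ex_series_Rle with (fun j => (1 + (Cmod w + 1) / Im w) ^ 2 * / INR (S j) ^ 2).
  - intros j; split.
    + left; apply Rinv_0_lt_compat, pow_lt. generalize (Im_le_Cmod_shift w (IZR (- Z.of_nat (S j))) H); lra.
    + eapply Rle_trans; [apply inv_sq_shift_le, H|].
      apply Rmult_le_compat_l; [apply pow2_ge_0|].
      assert (0 < INR (S j)) by (apply lt_0_INR; lia).
      apply Rinv_le_contravar; [apply pow_lt; assumption|].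
      apply pow_incr. split; [lra|].
      rewrite opp_IZR, Rabs_Ropp, <- INR_IZR_INZ, Rabs_pos_eq; lra.
  - apply ex_series_scal_R, ex_series_inv_sq.
Qed.

Lemma has_csum_finite (a : nat -> C) N :
  has_csum (fun j => if Nat.ltb j N then a j else RtoC 0) (fsum N a).
Proof.
  induction N as [|N IH]; [exact has_csum_0|].
  simpl fsum. eapply has_csum_ext; [|apply (has_csum_plus _ _ _ _ IH (has_csum_single N (a N)))].
  intros j; cbv beta.
  destruct (Nat.ltb_spec j N), (Nat.ltb_spec j (S N)), (Nat.eqb_spec j N); subst; try lia; ring.
Qed.

Lemma fsum_app n p f : fsum (n + p) f = Cplus (fsum n f) (fsum p (fun i => f (n + i)%nat)).
Proof.
  induction p as [|p IH]; simpl; [rewrite Nat.add_0_r; ring|].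
  rewrite Nat.add_succ_r; simpl; rewrite IH; ring.
Qed.

Lemma fsum_rev n f : fsum n f = fsum n (fun i => f (n - 1 - i)%nat).
Proof.
  induction n as [|n IH]; [reflexivity|].
  rewrite (fsum_S n (fun i => f (S n - 1 - i)%nat)). simpl fsum at 1. rewrite IH, Cplus_comm.
  f_equal; [f_equal; lia|]. apply fsum_ext; intros; f_equal; lia.
Qed.

Lemma fsum_centered (T : Z -> C) n :
  fsum (2 * n + 1) (fun k => T (Z.of_nat k - Z.of_nat n)%Z)
  = Cplus (fsum (S n) (fun j => T (Z.of_nat j))) (fsum n (fun j => T (- Z.of_nat (S j))%Z)).
Proof.
  replace (2 * n + 1)%nat with (n + S n)%nat by lia. rewrite fsum_app, Cplus_comm. f_equal.
  - apply fsum_ext; intros; f_equal; lia.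
  - rewrite fsum_rev. apply fsum_ext; intros; f_equal; lia.
Qed.

(** Residues modulo 2n+1 are taken in the centred interval [-n, n], which exhausts Z while each
    fixed j keeps its representative; the bound is required there only. Padding by zeros makes the
    finite sums into series to which [tannery] applies, one index j carrying both j and -(j+1). *)
Lemma has_zsum_tannery (T : nat -> Z -> C) (g : Z -> C) (K : R) (S : nat -> C) (L w : C) :
  0 < Im w ->
  eventually (fun n => forall j, (- Z.of_nat n <= j <= Z.of_nat n)%Z ->
     Cmod (T n j) <= K * / Cmod (Cplus w (RtoC (IZR j))) ^ 2) ->
  (forall j, clim (fun n => T n j) (g j)) ->
  (forall n, fsum (2 * n + 1) (fun k => T n (Z.of_nat k - Z.of_nat n)%Z) = S n) ->
  clim S L -> has_zsum g L.
Proof.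
  intros Hw [n0 HT] Hl HS HL.
  assert (Hg : forall j, Cmod (g j) <= K * / Cmod (Cplus w (RtoC (IZR j))) ^ 2).
  { intros j. assert (Hj := clim_Cmod _ _ (Hl j)).
    set (M := K * / Cmod (Cplus w (RtoC (IZR j))) ^ 2) in *.
    assert (H1 : is_lim_seq (fun n => Cmod (Cminus (T n j) (g j)) + M) (0 + M))
      by (apply is_lim_seq_plus'; [exact Hj|apply is_lim_seq_const]).
    rewrite Rplus_0_l in H1.
    refine (is_lim_seq_le_loc (fun _ => Cmod (g j)) _ (Cmod (g j)) M _ (is_lim_seq_const _) H1).
    exists (max n0 (Z.abs_nat j)); intros n Hn.
    apply Rle_trans with (Cmod (Cminus (T n j) (g j)) + Cmod (T n j));
      [|specialize (HT n ltac:(lia) j ltac:(lia)); unfold M; lra].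
    rewrite <- (Cmod_opp (Cminus _ _)).
    eapply Rle_trans; [|apply Cmod_triangle]. right; f_equal; ring. }
  assert (E1 := ex_series_scal_R K _ (ex_series_inv_sq_shift_pos w Hw)).
  assert (E2 := ex_series_scal_R K _ (ex_series_inv_sq_shift_neg w Hw)).
  assert (G1 := has_csum_CSeries _ _ (fun j => Hg (Z.of_nat j)) E1).
  assert (G2 := has_csum_CSeries _ _ (fun j => Hg (- Z.of_nat (Datatypes.S j))%Z) E2).
  eexists _, _; split; [exact G1|split; [exact G2|]].
  apply (has_csum_unique (fun j => Cplus (g (Z.of_nat j)) (g (- Z.of_nat (Datatypes.S j))%Z)));
    [|apply has_csum_plus; assumption].
  assert (HK : forall x, 0 <= Cmod x) by apply Cmod_ge_0.
  apply (tannery (fun n j => Cplus (if Nat.ltb j (Datatypes.S n) then T n (Z.of_nat j) else RtoC 0)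
       (if Nat.ltb j n then T n (- Z.of_nat (Datatypes.S j))%Z else RtoC 0))
     _ (fun j => K * / Cmod (Cplus w (RtoC (IZR (Z.of_nat j)))) ^ 2 +
             K * / Cmod (Cplus w (RtoC (IZR (- Z.of_nat (Datatypes.S j))))) ^ 2) S L).
  - exists n0; intros n Hn j. eapply Rle_trans; [apply Cmod_triangle|].
    assert (P : forall x, 0 <= K * / Cmod (Cplus w (RtoC (IZR x))) ^ 2).
    { intros x; eapply Rle_trans; [apply HK|apply (Hg x)]. }
    apply Rplus_le_compat.
    + destruct (Nat.ltb_spec j (Datatypes.S n)); [apply HT; [exact Hn|lia]|rewrite Cmod_0; apply P].
    + destruct (Nat.ltb_spec j n); [apply HT; [exact Hn|lia]|rewrite Cmod_0; apply P].
  - exact (ex_series_plus _ _ E1 E2).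
  - intros j; apply clim_plus.
    + eapply clim_ext_loc, Hl. exists j; intros n Hn. destruct (Nat.ltb_spec j (Datatypes.S n)); [reflexivity|lia].
    + eapply clim_ext_loc, Hl. exists (Datatypes.S j); intros n Hn. destruct (Nat.ltb_spec j n); [reflexivity|lia].
  - exists O; intros n _. rewrite <- HS, fsum_centered.
    apply has_csum_plus.
    + apply (has_csum_finite (fun j => T n (Z.of_nat j))).
    + apply (has_csum_finite (fun j => T n (- Z.of_nat (Datatypes.S j))%Z)).
  - exact HL.
Qed.

(** |e^(a+ib) - 1|^2 = (e^a - 1)^2 + 4 e^a sin^2(b/2), where e^a - 1 >= a. For y = |b|/2 <= 9/4 the
    cubic lower bound of the sine gives sin y >= y (1 - 27/32) >= 3y/20. The window has to reach
    beyond pi, since centred residues bring Im z up to about pi, and to stay away from the zero at 2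
    pi i. *)
Lemma Cmod_Cexp_minus_1_ge z : 0 <= Re z -> Rabs (Im z) <= 9 / 2 ->
  3 / 20 * Cmod z <= Cmod (Cminus (Cexp z) (RtoC 1)).
Proof.
  intros Ha Hb. destruct z as [a b]; simpl in Ha, Hb.
  apply Rsqr_incr_0_var; [|apply Cmod_ge_0]; rewrite !Rsqr_pow2.
  rewrite Rpow_mult_distr, !Cmod2_alt. unfold Cexp; simpl Re; simpl Im.
  assert (Hea := exp_ineq1_le a). assert (Hp := exp_pos a).
  assert (Hcs := sin2_cos2 b); unfold Rsqr in Hcs.
  assert (Hc : cos b = 1 - 2 * sin (b / 2) * sin (b / 2)).
  { rewrite <- cos_2a_sin; f_equal; field. }
  assert (Hs : 3 / 20 * (3 / 20) * (b * b) <= 4 * (sin (b / 2) * sin (b / 2))).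
  { assert (Hy : Rabs b / 2 <= 4) by lra.
    assert (Hy0 : 0 <= Rabs b / 2) by (generalize (Rabs_pos b); lra).
    destruct (pre_sin_bound (Rabs b / 2) 0 Hy0 Hy) as [Hl _].
    unfold sin_approx, sin_term in Hl; simpl in Hl.
    set (y := Rabs b / 2) in *.
    assert (Hy2 : y <= 9 / 4) by (unfold y; lra).
    assert (Hl2 : 3 / 20 * y <= sin y).
    { eapply Rle_trans; [|exact Hl].
      apply Rle_trans with (y * (1 - y * y / 6)); [nra|right; field]. }
    replace (sin (b / 2) * sin (b / 2)) with (sin y * sin y).
    - replace (b * b) with (4 * (y * y)).
      + assert (0 <= 3 / 20 * y) by lra. nra.
      + unfold y. replace (b * b) with (Rabs b * Rabs b); [field|].
        rewrite <- Rabs_mult; apply Rabs_pos_eq; nra.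
    - unfold y, Rabs; destruct (Rcase_abs b); [|reflexivity].
      replace (- b / 2) with (- (b / 2)) by field. rewrite sin_neg; ring. }
  unfold Cminus, Cplus, Copp, RtoC; simpl.
  replace ((exp a * cos b + - (1)) * ((exp a * cos b + - (1)) * 1) +
     (exp a * sin b + - 0) * ((exp a * sin b + - 0) * 1))
    with (exp a * exp a * (sin b * sin b + cos b * cos b) - 2 * exp a * cos b + 1) by ring.
  rewrite Hcs, Hc. set (s2 := sin (b / 2) * sin (b / 2)) in *.
  replace (exp a * exp a * 1 - 2 * exp a * (1 - 2 * sin (b / 2) * sin (b / 2)) + 1)
    with ((exp a - 1) * (exp a - 1) + exp a * (4 * s2)) by (unfold s2; ring).
  assert (0 <= s2) by (unfold s2; nra).
  assert (a * a <= (exp a - 1) * (exp a - 1)) by nra.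
  assert (4 * s2 <= exp a * (4 * s2)) by nra.
  nra.
Qed.

Lemma e2pi_neq_1 (x : R) : 0 < x < 1 -> e2pi (RtoC x) <> RtoC 1.
Proof.
  intros Hx E. apply (f_equal Re) in E.
  replace (Re (e2pi (RtoC x))) with (cos (2 * (PI * x))) in E.
  2:{ unfold e2pi, Cexp; simpl. replace (0 * x - 2 * PI * 0) with 0 by ring.
      rewrite exp_0, Rmult_1_l; f_equal; ring. }
  simpl in E.
  rewrite cos_2a_sin in E.
  assert (Hs : 0 < sin (PI * x)).
  { assert (Hp := PI_RGT_0). apply sin_gt_0; nra. }
  nra.
Qed.

Lemma fsum_geom z n : z <> RtoC 1 -> Cpow z n = RtoC 1 -> fsum n (fun k => Cpow z k) = RtoC 0.
Proof.
  intros Hz Hn.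
  assert (E : Cmult (fsum n (fun k => Cpow z k)) (Cminus z (RtoC 1)) = Cminus (Cpow z n) (RtoC 1)).
  { clear; induction n as [|n IH]; simpl; [ring|]. rewrite Cmult_plus_distr_r, IH; ring. }
  assert (H1 : Cminus z (RtoC 1) <> RtoC 0) by (apply Cminus_eq_contra, Hz).
  transitivity (Cdiv (Cmult (fsum n (fun k => Cpow z k)) (Cminus z (RtoC 1))) (Cminus z (RtoC 1)));
    [field; exact H1|rewrite E, Hn; field; exact H1].
Qed.

Lemma fsum_const n z : fsum n (fun _ => z) = Cmult (RtoC (INR n)) z.
Proof.
  induction n as [|n IH]; [simpl; ring|]. rewrite S_INR, RtoC_plus; simpl fsum; rewrite IH; ring.
Qed.

Lemma fsum_roots_of_unity Q p : (0 < Q)%nat ->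
  fsum Q (fun k => Cpow (e2pi (RtoC (INR p / INR Q))) k)
  = if Nat.eqb (p mod Q) 0 then RtoC (INR Q) else RtoC 0.
Proof.
  intros HQ. assert (HQ' : 0 < INR Q) by (apply lt_0_INR, HQ).
  assert (Hp : INR p = INR Q * INR (p / Q) + INR (p mod Q)).
  { rewrite <- mult_INR, <- plus_INR; f_equal; apply Nat.div_mod_eq. }
  assert (E : e2pi (RtoC (INR p / INR Q)) = e2pi (RtoC (INR (p mod Q) / INR Q))).
  { rewrite Hp. replace ((INR Q * INR (p / Q) + INR (p mod Q)) / INR Q)
      with (INR (p / Q) + INR (p mod Q) / INR Q) by (field; lra).
    rewrite RtoC_plus, e2pi_plus, e2pi_INR; ring. }
  rewrite E. assert (Hm := Nat.mod_upper_bound p Q ltac:(lia)).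
  destruct (Nat.eqb_spec (p mod Q) 0) as [H0|H0].
  - rewrite H0. replace (INR 0 / INR Q) with (INR 0) by (simpl; field; lra).
    rewrite e2pi_INR. rewrite (fsum_ext Q _ (fun _ => RtoC 1)).
    + rewrite fsum_const; ring.
    + intros; apply Cpow_1_l.
  - apply fsum_geom.
    + apply e2pi_neq_1. assert (0 < INR (p mod Q)) by (apply lt_0_INR; lia).
      assert (INR (p mod Q) < INR Q) by (apply lt_INR, Hm).
      split; [apply Rdiv_lt_0_compat; assumption|].
      apply (Rmult_lt_reg_r (INR Q)); [assumption|]. unfold Rdiv; rewrite Rmult_assoc, Rinv_l; lra.
    + rewrite e2pi_pow, <- RtoC_mult.
      replace (INR Q * (INR (p mod Q) / INR Q)) with (INR (p mod Q)) by (field; lra).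
      apply e2pi_INR.
Qed.

Lemma Cmod_e2pi_lt_1 w : 0 < Im w -> Cmod (e2pi w) < 1.
Proof.
  intros H; rewrite Cmod_e2pi, <- exp_0. apply exp_increasing.
  assert (Hp := PI_RGT_0); nra.
Qed.

(** Each polylogarithm is expanded inside the unit disc; the sum over k of Q-th roots of unity kills
    every exponent not divisible by Q and multiplies the others by Q. An exponent Q l carries (Q
    l)^s, hence the factor Q^(s+1). The shift by n that centres the residues contributes e(-l n) =
    1. *)
Lemma Li_neg_distribution s n w : 0 < Im w ->
  let Q := INR (2 * n + 1) in
  fsum (2 * n + 1) (fun k => Li_neg s (e2pi (Cdiv (Cplus w (RtoC (IZR (Z.of_nat k - Z.of_nat n)))) (RtoC Q))))
  = Cmult (RtoC (Q ^ S s)) (Li_neg s (e2pi w)).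
Proof.
  intros Hw Q. assert (HQ : 0 < Q) by (apply lt_0_INR; lia).
  assert (HQc : RtoC Q <> RtoC 0) by (intros H; apply RtoC_inj in H; lra).
  assert (Hx : forall k : Z, Cmod (e2pi (Cdiv (Cplus w (RtoC (IZR k))) (RtoC Q))) < 1).
  { intros k; apply Cmod_e2pi_lt_1. rewrite Im_div_R by lra. simpl; rewrite Rplus_0_r.
    apply Rdiv_lt_0_compat; assumption. }
  set (f := fun i => fsum (2 * n + 1) (fun k => Cmult (RtoC (INR (S i) ^ s))
     (Cpow (e2pi (Cdiv (Cplus w (RtoC (IZR (Z.of_nat k - Z.of_nat n)))) (RtoC Q))) (S i)))).
  apply (has_csum_unique f).
  - apply has_csum_fsum; intros k _. apply has_csum_Li_neg, Hx.
  (* The series index i stands for the exponent i+1, so divisibility by Q = 2n+1 reads i mod Q =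
     2n. *)
  - eapply has_csum_ext; [|apply (has_csum_dilute (fun l => Cmult (RtoC (Q ^ S s))
      (Cmult (RtoC (INR (S l) ^ s)) (Cpow (e2pi w) (S l)))) _ (2 * n + 1) (2 * n)); [lia|]].
    2: apply (has_csum_scal (RtoC (Q ^ S s))), has_csum_Li_neg, Cmod_e2pi_lt_1, Hw.
    intros i; cbv beta. unfold f.
    set (z := e2pi (Cdiv (Cplus w (RtoC (- INR n))) (RtoC Q))).
    rewrite (fsum_ext _ _ (fun k => Cmult (Cmult (RtoC (INR (S i) ^ s)) (Cpow z (S i)))
       (Cpow (e2pi (RtoC (INR (S i) / Q))) k))).
    2:{ intros k _. rewrite <- Cmult_assoc; f_equal.
        unfold z; rewrite !e2pi_pow, <- e2pi_plus; f_equal.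
        rewrite minus_IZR, <- !INR_IZR_INZ, RtoC_minus, RtoC_opp.
        rewrite RtoC_div by lra. field; exact HQc. }
    rewrite fsum_scal. unfold Q; rewrite fsum_roots_of_unity by lia; fold Q.
    assert (E := Nat.div_mod_eq i (2 * n + 1)).
    assert (Hm := Nat.mod_upper_bound i (2 * n + 1) ltac:(lia)).
    set (q := (i / (2 * n + 1))%nat) in *; set (p := (i mod (2 * n + 1))%nat) in *.
    destruct (Nat.eqb_spec p (2 * n)) as [Hp|Hp].
    + assert (Hi : S i = ((2 * n + 1) * S q)%nat) by nia.
      rewrite Hi at 3. rewrite (Nat.mul_comm (2 * n + 1)), Nat.Div0.mod_mul. simpl Nat.eqb. cbv iota.
      rewrite Hi, mult_INR; fold Q. unfold z; rewrite !e2pi_pow.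
      rewrite !mult_INR; fold Q.
      replace (Cmult (RtoC (Q * INR (S q))) (Cdiv (Cplus w (RtoC (- INR n))) (RtoC Q)))
        with (Cplus (Cmult (RtoC (INR (S q))) w) (RtoC (IZR (- Z.of_nat (S q * n))))).
      2:{ rewrite opp_IZR, <- INR_IZR_INZ, mult_INR, !RtoC_opp, !RtoC_mult. field; exact HQc. }
      rewrite e2pi_plus, e2pi_IZR, Rpow_mult_distr, !RtoC_mult. simpl pow; rewrite RtoC_mult. ring.
    + assert (Hi : (S i mod (2 * n + 1) = S p)%nat).
      { symmetry; apply Nat.mod_unique with q; nia. }
      rewrite Hi. simpl Nat.eqb; cbv iota; ring.
Qed.

(** The remainder e^y - 1 - y is at most |y|^2 e^|y|; with y = th/Q and the factor Q in front it is
    of order 1/Q. *)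
Lemma clim_exp_difference (th : C) :
  clim (fun n => Cmult (RtoC (INR (2 * n + 1)))
          (Cminus (Cexp (Cdiv th (RtoC (INR (2 * n + 1))))) (RtoC 1))) th.
Proof.
  apply Cmod_clim.
  apply is_lim_seq_le_le with (u := fun _ => 0)
    (w := fun n => Cmod th ^ 2 * exp (Cmod th) * / INR (2 * n + 1)).
  - intros n; split; [apply Cmod_ge_0|].
    set (Q := INR (2 * n + 1)).
    assert (HQ : 1 <= Q).
    { unfold Q; rewrite plus_INR; simpl; generalize (pos_INR (n + (n + 0))); lra. }
    assert (HQc : RtoC Q <> RtoC 0) by (intros H; apply RtoC_inj in H; lra).
    set (y := Cdiv th (RtoC Q)).
    assert (Hy : Cmod y = Cmod th / Q).
    { unfold y; rewrite Cmod_div, Cmod_R, Rabs_pos_eq; auto; lra. }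
    assert (Hyt : Cmod y <= Cmod th).
    { rewrite Hy; unfold Rdiv. rewrite <- (Rmult_1_r (Cmod th)) at 2.
      apply Rmult_le_compat_l; [apply Cmod_ge_0|]. rewrite <- Rinv_1; apply Rinv_le_contravar; lra. }
    assert (Hr : Cmod (Cminus (Cminus (Cexp y) (RtoC 1)) y) <= Cmod y ^ 2 * exp (Cmod y)).
    { eapply has_csum_Cmod_le.
      - eapply has_csum_eq; [exact (has_csum_tail _ _ (has_csum_tail _ _ (has_csum_Cexp y)))|].
        simpl; field.
      - intros i; cbv beta. rewrite Cmod_div, Cmod_pow, Cmod_R, Rabs_pos_eq.
        2: apply pos_INR.
        2: intros H; apply RtoC_inj in H; revert H; apply INR_fact_neq_0.
        instantiate (1 := fun i => Cmod y ^ 2 * (Cmod y ^ i / INR (fact i))).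
        cbv beta. replace (Cmod y ^ S (S i) / INR (fact (S (S i))))
          with (Cmod y ^ 2 * (Cmod y ^ i / INR (fact (S (S i))))) by (simpl; unfold Rdiv; ring).
        apply Rmult_le_compat_l; [apply pow2_ge_0|].
        apply Rmult_le_compat_l; [apply pow_le, Cmod_ge_0|].
        apply Rinv_le_contravar; [apply INR_fact_lt_0|]. apply le_INR, fact_le; lia.
      - exact (is_series_scal (Cmod y ^ 2) _ _ (is_series_exp (Cmod y))). }
    replace (Cminus (Cmult (RtoC Q) (Cminus (Cexp y) (RtoC 1))) th)
      with (Cmult (RtoC Q) (Cminus (Cminus (Cexp y) (RtoC 1)) y)).
    2:{ assert (Eth : Cmult (RtoC Q) y = th) by (unfold y; field; exact HQc).
        rewrite <- Eth; ring. }
    rewrite Cmod_mult, Cmod_R, Rabs_pos_eq by lra.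
    apply Rle_trans with (Q * (Cmod y ^ 2 * exp (Cmod th))).
    + apply Rmult_le_compat_l; [lra|]. eapply Rle_trans; [exact Hr|].
      apply Rmult_le_compat_l; [apply pow2_ge_0|apply exp_le, Hyt].
    + rewrite Hy. right; field; lra.
  - apply is_lim_seq_const.
  - replace (Finite 0) with (Finite (Cmod th ^ 2 * exp (Cmod th) * 0)) by (f_equal; ring).
    apply is_lim_seq_mult'; [apply is_lim_seq_const|].
    replace (Finite 0) with (Rbar_inv p_infty) by reflexivity.
    apply (is_lim_seq_subseq (fun n => / INR n) _ (fun n => (2 * n + 1)%nat)).
    + intros P [N HN]; exists N; intros n Hn; apply HN; lia.
    + apply is_lim_seq_inv; [apply is_lim_seq_INR|discriminate].
Qed.

(** The variable u in which Li_{-n} is a polynomial without constant term; it has a simple pole at x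
    = 1. *)
Definition uval (x : C) : C := Cdiv x (Cminus (RtoC 1) x).

Definition two_pi_i : C := (0, 2 * PI).

Lemma two_pi_i_neq_0 : two_pi_i <> RtoC 0.
Proof. intros H; apply (f_equal Im) in H; simpl in H; generalize PI_RGT_0; lra. Qed.

Lemma uval_e2pi z : Im z <> 0 ->
  uval (e2pi z) = Cinv (Cminus (Cexp (Cmult (Copp two_pi_i) z)) (RtoC 1)).
Proof.
  intros Hz.
  replace (Cexp (Cmult (Copp two_pi_i) z)) with (Cinv (e2pi z)).
  2:{ unfold e2pi; rewrite <- Cexp_opp; f_equal; unfold two_pi_i; ring. }
  assert (H0 := e2pi_neq_0 z).
  assert (H1 : Cminus (RtoC 1) (e2pi z) <> RtoC 0).
  { apply Cminus_eq_contra; intros H. apply (f_equal Cmod) in H.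
    rewrite Cmod_1, Cmod_e2pi, <- exp_0 in H. apply exp_inv in H.
    assert (Hp := PI_RGT_0). apply Hz. nra. }
  unfold uval; field; repeat split; auto.
Qed.

Lemma clim_uval w j : 0 < Im w ->
  clim (fun n => Cdiv (uval (e2pi (Cdiv (Cplus w (RtoC (IZR j))) (RtoC (INR (2 * n + 1))))))
                  (RtoC (INR (2 * n + 1))))
    (Cinv (Cmult (Copp two_pi_i) (Cplus w (RtoC (IZR j))))).
Proof.
  intros Hw. set (th := Cmult (Copp two_pi_i) (Cplus w (RtoC (IZR j)))).
  assert (Hwj := shift_neq_0 w (IZR j) ltac:(lra)).
  assert (Hth : th <> RtoC 0).
  { apply Cmult_neq_0; [|exact Hwj]. intros H; apply two_pi_i_neq_0.
    transitivity (Copp (Copp two_pi_i)); [ring|rewrite H; ring]. }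
  eapply clim_ext; [|apply clim_inv, clim_exp_difference; exact Hth].
  intros n; cbv beta. set (Q := INR (2 * n + 1)).
  assert (HQ : 0 < Q) by (apply lt_0_INR; lia).
  assert (HQc : RtoC Q <> RtoC 0) by (intros H; apply RtoC_inj in H; lra).
  rewrite uval_e2pi.
  2:{ rewrite Im_div_R by lra. simpl; rewrite Rplus_0_r.
      apply Rgt_not_eq, Rdiv_lt_0_compat; assumption. }
  replace (Cmult (Copp two_pi_i) (Cdiv (Cplus w (RtoC (IZR j))) (RtoC Q))) with (Cdiv th (RtoC Q))
    by (unfold th, Cdiv; ring).
  assert (H1 : Cminus (Cexp (Cdiv th (RtoC Q))) (RtoC 1) <> RtoC 0).
  { apply Cminus_eq_contra; intros H. apply (f_equal Cmod) in H.
    rewrite Cmod_1, Cmod_Cexp, <- exp_0 in H. apply exp_inv in H. revert H.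
    rewrite Re_div_R by lra. unfold th, two_pi_i; simpl. unfold Im in Hw.
    assert (Hp := PI_RGT_0). intros H.
    assert (E : 2 * PI * snd w = 0).
    { transitivity (Q * ((- 0 * (fst w + IZR j) - - (2 * PI) * (snd w + 0)) / Q)); [field; lra|rewrite H; ring]. }
    nra. }
  field; split; assumption.
Qed.

Lemma Cmod_uval_le w : 0 < Im w ->
  eventually (fun n => forall j, (- Z.of_nat n <= j <= Z.of_nat n)%Z ->
    Cmod (uval (e2pi (Cdiv (Cplus w (RtoC (IZR j))) (RtoC (INR (2 * n + 1))))))
    <= 2 * INR (2 * n + 1) * / Cmod (Cplus w (RtoC (IZR j)))).
Proof.
  (* For Q = 2n+1 >= 16 |Re w| and |j| <= n one has 2 pi |Re w + j|/Q <= 2 pi (1/16 + 1/2) <= 9/2,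
     using pi <= 4: this is the strip of [Cmod_Cexp_minus_1_ge]. *)
  intros Hw. destruct (INR_unbounded (16 * Rabs (Re w))) as [n0 Hn0].
  exists n0; intros n Hn j Hj. set (Q := INR (2 * n + 1)).
  assert (HQ : 0 < Q) by (apply lt_0_INR; lia).
  assert (HQ2 : Q = 2 * INR n + 1) by (unfold Q; rewrite plus_INR, mult_INR; simpl; ring).
  assert (HQn : 16 * Rabs (Re w) <= Q).
  { apply le_INR in Hn. generalize (pos_INR n); lra. }
  assert (HQc : RtoC Q <> RtoC 0) by (intros H; apply RtoC_inj in H; lra).
  rewrite uval_e2pi.
  2:{ rewrite Im_div_R by lra. simpl; rewrite Rplus_0_r.
      apply Rgt_not_eq, Rdiv_lt_0_compat; assumption. }
  set (z := Cmult (Copp two_pi_i) (Cdiv (Cplus w (RtoC (IZR j))) (RtoC Q))).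
  assert (Hp := PI_RGT_0). assert (Hp4 := PI_4). assert (Hp3 := PI2_3_2).
  assert (Hrez : Re z = 2 * PI * (Im w / Q)).
  { unfold z, two_pi_i. transitivity (2 * PI * Im (Cdiv (Cplus w (RtoC (IZR j))) (RtoC Q))).
    - simpl; unfold Im; simpl; ring.
    - rewrite Im_div_R by lra; simpl; f_equal; unfold Rdiv; rewrite Rplus_0_r; reflexivity. }
  assert (Himz : Im z = - (2 * PI * ((Re w + IZR j) / Q))).
  { unfold z, two_pi_i. transitivity (- (2 * PI * Re (Cdiv (Cplus w (RtoC (IZR j))) (RtoC Q)))).
    - simpl; unfold Re; simpl; ring.
    - rewrite Re_div_R by lra; reflexivity. }
  assert (Hj' : Rabs (IZR j) <= INR n).
  { rewrite INR_IZR_INZ, <- abs_IZR. apply IZR_le; lia. }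
  assert (Hmz : Cmod z = 2 * PI * Cmod (Cplus w (RtoC (IZR j))) / Q).
  { unfold z. rewrite Cmod_mult, Cmod_opp, Cmod_div, Cmod_R, (Rabs_pos_eq Q) by (auto; lra).
    replace (Cmod two_pi_i) with (2 * PI); [field; lra|].
    replace two_pi_i with (Cmult (RtoC (2 * PI)) Ci) by (unfold two_pi_i; apply C_eq; simpl; ring).
    rewrite Cmod_mult, Cmod_R, Cmod_Ci, Rabs_pos_eq; lra. }
  assert (Hge : 3 / 20 * Cmod z <= Cmod (Cminus (Cexp z) (RtoC 1))).
  { apply Cmod_Cexp_minus_1_ge.
    - rewrite Hrez. apply Rmult_le_pos; [lra|]. apply Rlt_le, Rdiv_lt_0_compat; assumption.
    - rewrite Himz, Rabs_Ropp, Rabs_mult, (Rabs_pos_eq (2 * PI)) by lra.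
      unfold Rdiv at 1. rewrite Rabs_mult, Rabs_inv, (Rabs_pos_eq Q) by lra.
      apply (Rmult_le_reg_r Q); [exact HQ|].
      replace (2 * PI * (Rabs (Re w + IZR j) * / Q) * Q) with (2 * PI * Rabs (Re w + IZR j)) by (field; lra).
      assert (Ht := Rabs_triang (Re w) (IZR j)). assert (Hw0 := Rabs_pos (Re w)).
      assert (Hnn := pos_INR n).
      apply Rle_trans with (2 * PI * (Rabs (Re w) + INR n)); [apply Rmult_le_compat_l; lra|].
      nra. }
  assert (Hy : 0 < Cmod (Cplus w (RtoC (IZR j)))).
  { apply Cmod_gt_0, shift_neq_0; lra. }
  set (y := Cmod (Cplus w (RtoC (IZR j)))) in *.
  assert (Hlow : y / (2 * Q) <= Cmod (Cminus (Cexp z) (RtoC 1))).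
  { eapply Rle_trans; [|exact Hge]. rewrite Hmz.
    apply (Rmult_le_reg_r (2 * Q)); [lra|].
    replace (y / (2 * Q) * (2 * Q)) with y by (field; lra).
    replace (3 / 20 * (2 * PI * y / Q) * (2 * Q)) with (3 / 5 * PI * y) by (field; lra). nra. }
  assert (Hpos : 0 < y / (2 * Q)) by (apply Rdiv_lt_0_compat; lra).
  rewrite Cmod_inv by (apply Cmod_gt_0; lra).
  replace (2 * Q * / y) with (/ (y / (2 * Q))) by (field; lra).
  apply Rinv_le_contravar; assumption.
Qed.

Lemma clim_inv_modulus : clim (fun n => Cinv (RtoC (INR (2 * n + 1)))) (RtoC 0).
Proof.
  apply clim_ext with (fun n => RtoC (/ INR (2 * n + 1))).
  { intros n; apply RtoC_inv, not_0_INR; lia. }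
  split; simpl; [|apply is_lim_seq_const].
  replace (Finite 0) with (Rbar_inv p_infty) by reflexivity.
  apply (is_lim_seq_subseq (fun n => / INR n) _ (fun n => (n + (n + 0) + 1)%nat)).
  - intros P [N HN]; exists N; intros n Hn; apply HN; lia.
  - apply is_lim_seq_inv; [apply is_lim_seq_INR|discriminate].
Qed.

Lemma Cmod_shift_le_modulus w n j : (- Z.of_nat n <= j <= Z.of_nat n)%Z ->
  Cmod (Cplus w (RtoC (IZR j))) <= (Cmod w + 1) * INR (2 * n + 1).
Proof.
  intros Hj. eapply Rle_trans; [apply Cmod_triangle|]. rewrite Cmod_R.
  assert (Hj' : Rabs (IZR j) <= INR n).
  { rewrite INR_IZR_INZ, <- abs_IZR. apply IZR_le; lia. }
  rewrite plus_INR, mult_INR; simpl (INR 2); simpl (INR 1).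
  generalize (pos_INR n) (Cmod_ge_0 w); nra.
Qed.

(** The distribution relation is divided by Q^(s+2). Its right side no longer depends on Q, and each
    term on the left is a polynomial of degree s+2 in u/Q whose lower powers carry extra factors
    1/Q. As u/Q tends to 1/(-2 pi i (w+j)), only the leading coefficient (s+1)! survives. *)
Theorem lipschitz s w : 0 < Im w ->
  has_zsum (fun l => Cinv (Cpow (Cplus w (RtoC (IZR l))) (S (S s))))
    (Cmult (Cdiv (Cpow (Copp two_pi_i) (S (S s))) (RtoC (INR (fact (S s)))))
       (Li_neg (S s) (e2pi w))).
Proof.
  intros Hw.
  set (Qc := fun n => RtoC (INR (2 * n + 1))).
  assert (HQ : forall n, 0 < INR (2 * n + 1)) by (intros; apply lt_0_INR; lia).
  assert (HQc : forall n, Qc n <> RtoC 0).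
  { intros n H; apply RtoC_inj in H; specialize (HQ n); lra. }
  set (u := fun n j => uval (e2pi (Cdiv (Cplus w (RtoC (IZR j))) (Qc n)))).
  set (th := fun j => Cmult (Copp two_pi_i) (Cplus w (RtoC (IZR j)))).
  assert (Hn2 : Copp two_pi_i <> RtoC 0).
  { intros H; apply two_pi_i_neq_0. transitivity (Copp (Copp two_pi_i)); [ring|rewrite H; ring]. }
  assert (Hfact : RtoC (INR (fact (S s))) <> RtoC 0).
  { intros H; apply RtoC_inj in H; revert H; apply INR_fact_neq_0. }
  assert (Hfc : forall j, Cinv (Cpow (Cplus w (RtoC (IZR j))) (S (S s))) =
     Cmult (Cdiv (Cpow (Copp two_pi_i) (S (S s))) (RtoC (INR (fact (S s)))))
      (Cmult (RtoC (INR (fact (S s)))) (Cpow (Cinv (th j)) (S (S s))))).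
  { intros j. assert (Hwj := shift_neq_0 w (IZR j) ltac:(lra)).
    unfold th; rewrite Cpow_inv by (apply Cmult_neq_0; assumption).
    rewrite Cpow_mult_l. field; repeat split; auto using Cpow_nz. }
  eapply has_zsum_ext; [intros j; symmetry; apply Hfc|]. apply has_zsum_scal.
  set (C0 := Cmod w + 1). set (LL := rsum (S (S s)) (fun a => INR (licoef (S s) a))).
  apply (has_zsum_tannery (fun n j => Cdiv (Li_neg (S s) (e2pi (Cdiv (Cplus w (RtoC (IZR j))) (Qc n))))
      (Cpow (Qc n) (S (S s)))) _ (LL * ((2 * C0) ^ S (S s) * / Im w ^ s))
      (fun _ => Li_neg (S s) (e2pi w)) _ w Hw).
  - destruct (Cmod_uval_le w Hw) as [n0 Hn0]. exists n0; intros n Hn j Hj.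
    specialize (Hn0 n Hn j Hj). assert (HC := Cmod_shift_le_modulus w n j Hj).
    assert (Hv := Im_le_Cmod_shift w (IZR j) Hw).
    specialize (HQ n). set (Q := INR (2 * n + 1)) in *.
    set (y := Cmod (Cplus w (RtoC (IZR j)))) in *. fold C0 in HC.
    assert (HC0 : 1 <= C0) by (unfold C0; generalize (Cmod_ge_0 w); lra).
    (* The factor C0 makes B >= 1, because |w+j| <= C0 Q for the centred residues; all powers
       u^(a+1) are then bounded by B^(s+2). *)
    set (B := 2 * C0 * Q * / y).
    assert (HB : 1 <= B).
    { unfold B. apply (Rmult_le_reg_r y); [lra|].
      rewrite Rmult_assoc, Rinv_l by lra. nra. }
    assert (Hu : Cmod (u n j) <= B).
    { eapply Rle_trans; [exact Hn0|]. unfold B. apply Rmult_le_compat_r.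
      - left; apply Rinv_0_lt_compat; lra.
      - nra. }
    rewrite Cmod_div by (apply Cpow_nz, HQc).
    rewrite Cmod_pow. unfold Qc at 2; rewrite Cmod_R; fold Q; rewrite (Rabs_pos_eq Q) by lra.
    apply Rle_trans with (LL * B ^ S (S s) / Q ^ S (S s)).
    + unfold Rdiv; apply Rmult_le_compat_r; [left; apply Rinv_0_lt_compat, pow_lt; lra|].
      unfold Li_neg. unfold LL; rewrite Rmult_comm, <- rsum_scal. apply Cmod_fsum_le.
      intros a Ha. rewrite Cmod_mult, Cmod_R, Rabs_pos_eq, Rmult_comm by apply pos_INR.
      apply Rmult_le_compat_r; [apply pos_INR|]. rewrite Cmod_pow.
      apply Rle_trans with (B ^ S a); [apply pow_incr; split; [apply Cmod_ge_0|exact Hu]|].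
      apply Rle_pow; [exact HB|lia].
    + unfold B. rewrite !Rpow_mult_distr, pow_inv.
      replace (LL * ((2 ^ S (S s) * C0 ^ S (S s)) * Q ^ S (S s) * / y ^ S (S s)) / Q ^ S (S s))
        with (LL * (2 ^ S (S s) * C0 ^ S (S s)) * / y ^ S (S s)).
      2:{ field. split; apply pow_nonzero; lra. }
      rewrite <- !Rmult_assoc.
      replace (LL * 2 ^ S (S s) * C0 ^ S (S s) * / Im w ^ s * / y ^ 2)
        with (LL * 2 ^ S (S s) * C0 ^ S (S s) * (/ Im w ^ s * / y ^ 2)) by ring.
      apply Rmult_le_compat_l.
      * apply Rmult_le_pos; [apply Rmult_le_pos|]; try (apply pow_le; lra).
        unfold LL. rewrite <- (Rmult_0_r (INR (S (S s)))), <- rsum_const.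
        apply rsum_le; intros; apply pos_INR.
      * rewrite <- Rinv_mult. apply Rinv_le_contravar.
        -- apply Rmult_lt_0_compat; apply pow_lt; lra.
        -- replace (y ^ S (S s)) with (y ^ s * y ^ 2) by (simpl; ring).
           apply Rmult_le_compat_r; [apply pow2_ge_0|]. apply pow_incr; lra.
  (* The powers of 0 are the limits of the factors Q^-(s+1-a); since 0^0 = 1, only a = s+1
     contributes. *)
  - intros j. replace (Cmult (RtoC (INR (fact (S s)))) (Cpow (Cinv (th j)) (S (S s))))
      with (fsum (S (S s)) (fun a => Cmult (RtoC (INR (licoef (S s) a)))
         (Cmult (Cpow (Cinv (th j)) (S a)) (Cpow (RtoC 0) (S s - a))))).
    2:{ cbn [fsum]. rewrite (fsum_ext s _ (fun _ => RtoC 0)).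
        - rewrite fsum_0, licoef_diag. replace (S s - s)%nat with 1%nat by lia.
          rewrite Nat.sub_diag. simpl (Cpow (RtoC 0) 0). simpl (Cpow (RtoC 0) 1). ring.
        - intros a Ha. replace (S s - a)%nat with (S (s - a)) by lia. rewrite (Cpow_S (RtoC 0)). ring. }
    eapply clim_ext; [|apply clim_fsum; intros a _; apply clim_mult; [apply clim_const|
       apply clim_mult; [apply clim_pow, (clim_uval w j Hw)|apply clim_pow, clim_inv_modulus]]].
    intros n; cbv beta. fold (Qc n). unfold Li_neg.
    match goal with |- _ = Cdiv ?A ?B => change (Cdiv A B) with (Cmult A (Cinv B)) end.
    rewrite (Cmult_comm (fsum _ _)), <- fsum_scal. symmetry. apply fsum_ext; intros a Ha.
    fold (uval (e2pi (Cdiv (Cplus w (RtoC (IZR j))) (Qc n)))).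
    unfold Cdiv; rewrite Cpow_mult_l. specialize (HQc n).
    replace (S (S s)) with (S a + (S s - a))%nat by lia. rewrite Cpow_add_r, !Cpow_inv by exact HQc.
    replace (S a + (S s - a) - a)%nat with (S (S s) - a)%nat by lia.
    field. split; apply Cpow_nz, HQc.
  - intros n. unfold Cdiv at 1.
    rewrite (fsum_ext _ _ (fun k => Cmult (Cinv (Cpow (Qc n) (S (S s))))
       (Li_neg (S s) (e2pi (Cdiv (Cplus w (RtoC (IZR (Z.of_nat k - Z.of_nat n)))) (Qc n))))))
      by (intros; apply Cmult_comm).
    rewrite fsum_scal. unfold Qc at 2. rewrite (Li_neg_distribution (S s) n w Hw).
    rewrite RtoC_pow. fold (Qc n). specialize (HQc n). field. apply Cpow_nz, HQc.
  - apply clim_const.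
Qed.

Lemma Li_neg_0 x : Li_neg 0 x = uval x.
Proof. unfold Li_neg, uval; simpl; ring. Qed.

(** The case of exponent one. With x = e((w+j)/Q) and u = x/(1-x) one has u + conj u + 1 = (|x|^-2 -
    1)|u|^2. The first factor is O(1/Q) and |u| is O(Q/|w+j|), so after division by Q the terms are
    O(|w+j|^-2), which neither u nor conj u achieves alone. *)
Theorem lipschitz_conj_difference w : 0 < Im w ->
  has_zsum (fun l => Cminus (Cinv (Cplus w (RtoC (IZR l)))) (Cinv (Cplus (Cconj w) (RtoC (IZR l)))))
    (Cmult (Copp two_pi_i)
      (Cplus (RtoC 1) (Cplus (Li_neg 0 (e2pi w)) (Cconj (Li_neg 0 (e2pi w)))))).
Proof.
  intros Hw.
  set (Qc := fun n => RtoC (INR (2 * n + 1))).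
  assert (HQ : forall n, 0 < INR (2 * n + 1)) by (intros; apply lt_0_INR; lia).
  assert (HQc : forall n, Qc n <> RtoC 0).
  { intros n H; apply RtoC_inj in H; specialize (HQ n); lra. }
  set (u := fun n j => uval (e2pi (Cdiv (Cplus w (RtoC (IZR j))) (Qc n)))).
  set (th := fun j => Cmult (Copp two_pi_i) (Cplus w (RtoC (IZR j)))).
  assert (Hn2 : Copp two_pi_i <> RtoC 0).
  { intros H; apply two_pi_i_neq_0. transitivity (Copp (Copp two_pi_i)); [ring|rewrite H; ring]. }
  assert (Hth : forall j, th j <> RtoC 0).
  { intros j; apply Cmult_neq_0; [exact Hn2|apply shift_neq_0; lra]. }
  assert (Hfc : forall j, Cminus (Cinv (Cplus w (RtoC (IZR j)))) (Cinv (Cplus (Cconj w) (RtoC (IZR j))))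
    = Cmult (Copp two_pi_i) (Cplus (Cplus (Cinv (th j)) (Cconj (Cinv (th j)))) (RtoC 0))).
  { intros j. rewrite Cinv_conj by apply Hth.
    assert (Hwj := shift_neq_0 w (IZR j) ltac:(lra)).
    assert (Hwj' := shift_neq_0 (Cconj w) (IZR j) ltac:(simpl; unfold Im in Hw; lra)).
    unfold th. rewrite Cmult_conj, Cplus_conj.
    replace (Cconj (RtoC (IZR j))) with (RtoC (IZR j)) by (apply C_eq; simpl; ring).
    replace (Cconj (Copp two_pi_i)) with two_pi_i by (unfold two_pi_i; apply C_eq; simpl; ring).
    field; repeat split; auto using two_pi_i_neq_0. }
  eapply has_zsum_ext; [intros j; symmetry; apply Hfc|]. apply has_zsum_scal.
  (* Adding 1/Q changes no termwise limit, yet the 2n+1 copies sum to 1: the constant in the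
     formula. *)
  apply (has_zsum_tannery (fun n j => Cplus (Cplus (Cdiv (u n j) (Qc n)) (Cconj (Cdiv (u n j) (Qc n))))
      (Cinv (Qc n))) _ (16 * PI * Im w * exp (4 * PI * Im w))
      (fun _ => Cplus (RtoC 1) (Cplus (Li_neg 0 (e2pi w)) (Cconj (Li_neg 0 (e2pi w))))) _ w Hw).
  - destruct (Cmod_uval_le w Hw) as [n0 Hn0]. exists n0; intros n Hn j Hj.
    specialize (Hn0 n Hn j Hj). assert (Hv := Im_le_Cmod_shift w (IZR j) Hw).
    assert (HQ1 : 1 <= INR (2 * n + 1)).
    { rewrite plus_INR; generalize (pos_INR (2 * n)); simpl; lra. }
    specialize (HQ n). set (Q := INR (2 * n + 1)) in *.
    set (y := Cmod (Cplus w (RtoC (IZR j)))) in *.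
    assert (HQcQ : Qc n = RtoC Q) by reflexivity.
    set (x := e2pi (Cdiv (Cplus w (RtoC (IZR j))) (Qc n))).
    assert (Hx0 : x <> RtoC 0) by apply e2pi_neq_0.
    assert (Himz : Im (Cdiv (Cplus w (RtoC (IZR j))) (Qc n)) = Im w / Q).
    { rewrite HQcQ, Im_div_R by lra. simpl; unfold Rdiv; rewrite Rplus_0_r; reflexivity. }
    assert (Hxm : Cmod x = exp (- (2 * PI * (Im w / Q)))).
    { unfold x; rewrite Cmod_e2pi, Himz; reflexivity. }
    assert (Hx1 : Cmod x < 1).
    { apply Cmod_e2pi_lt_1. rewrite Himz; apply Rdiv_lt_0_compat; assumption. }
    assert (H1x : Cminus (RtoC 1) x <> RtoC 0).
    { apply Cminus_eq_contra; intros H; rewrite <- H, Cmod_1 in Hx1; lra. }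
    assert (Hxx : RtoC (Cmod x ^ 2) = Cmult x (Cconj x)) by apply Cmod2_conj.
    assert (Hcx : Cconj x <> RtoC 0) by (apply Cmod_gt_0; rewrite Cmod_conj; apply Cmod_gt_0, Hx0).
    assert (Hc1x : Cminus (RtoC 1) (Cconj x) <> RtoC 0).
    { apply Cminus_eq_contra; intros H. rewrite <- (Cmod_conj x), <- H, Cmod_1 in Hx1; lra. }
    assert (Hcu : Cconj (u n j) = Cdiv (Cconj x) (Cminus (RtoC 1) (Cconj x))).
    { unfold u, uval; fold x. rewrite Cdiv_conj, Cminus_conj by exact H1x. f_equal. f_equal.
      apply C_eq; simpl; ring. }
    assert (E : Cplus (Cplus (Cdiv (u n j) (Qc n)) (Cconj (Cdiv (u n j) (Qc n)))) (Cinv (Qc n))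
       = Cmult (RtoC ((/ Cmod x ^ 2 - 1) / Q)) (Cmult (u n j) (Cconj (u n j)))).
    { rewrite Cdiv_conj by apply HQc. rewrite HQcQ.
      replace (Cconj (RtoC Q)) with (RtoC Q) by (apply C_eq; simpl; ring).
      rewrite Hcu. unfold u, uval; fold x. specialize (HQc n); rewrite HQcQ in HQc.
      rewrite RtoC_div, RtoC_minus, RtoC_inv, Hxx.
      - field; repeat split; assumption.
      - apply pow_nonzero. rewrite Hxm; apply Rgt_not_eq, exp_pos.
      - lra. }
    rewrite E, !Cmod_mult, Cmod_conj, Cmod_R. fold (u n j) in Hn0.
    assert (Hex : 0 <= / Cmod x ^ 2 - 1 <= 4 * PI * (Im w / Q) * exp (4 * PI * Im w)).
    { rewrite Hxm. replace (exp (- (2 * PI * (Im w / Q))) ^ 2) with (exp (- (4 * PI * (Im w / Q)))).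
      2:{ simpl; rewrite Rmult_1_r, <- exp_plus; f_equal; ring. }
      rewrite <- exp_Ropp, Ropp_involutive. set (t := 4 * PI * (Im w / Q)).
      assert (Hiq : 0 < Im w / Q) by (apply Rdiv_lt_0_compat; assumption).
      assert (Hpi := PI_RGT_0).
      assert (Ht : 0 <= t) by (unfold t; nra).
      assert (Ht2 : t <= 4 * PI * Im w).
      { unfold t; apply Rmult_le_compat_l; [lra|]. unfold Rdiv.
        rewrite <- (Rmult_1_r (Im w)) at 2. apply Rmult_le_compat_l; [lra|].
        rewrite <- Rinv_1; apply Rinv_le_contravar; lra. }
      assert (He1 := exp_ineq1_le t). assert (He2 := exp_ineq1_le (- t)).
      split; [lra|]. apply Rle_trans with (t * exp t).
      - assert (Hee : exp (- t) * exp t = 1) by (rewrite <- exp_plus, Rplus_opp_l, exp_0; reflexivity).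
        assert (Hpt := exp_pos t). nra.
      - apply Rmult_le_compat_l; [exact Ht|apply exp_le, Ht2]. }
    rewrite Rabs_pos_eq by (apply Rdiv_le_0_compat; lra).
    apply Rle_trans with (4 * PI * (Im w / Q) * exp (4 * PI * Im w) / Q * ((2 * Q * / y) * (2 * Q * / y))).
    + apply Rmult_le_compat.
      * apply Rdiv_le_0_compat; lra.
      * apply Rmult_le_pos; apply Cmod_ge_0.
      * apply Rmult_le_compat_r; [left; apply Rinv_0_lt_compat; lra|apply Hex].
      * apply Rmult_le_compat; auto using Cmod_ge_0.
    + right; field; lra.
  - intros j. apply clim_plus; [|apply clim_inv_modulus].
    apply clim_plus; [|apply clim_conj]; apply (clim_uval w j Hw).
  - intros n. rewrite !fsum_plus.
    assert (D := Li_neg_distribution 0 n w Hw). cbv zeta in D. rewrite pow_1 in D. fold (Qc n) in D.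
    assert (D' : fsum (2 * n + 1) (fun k => Cdiv (u n (Z.of_nat k - Z.of_nat n)%Z) (Qc n)) = Li_neg 0 (e2pi w)).
    { rewrite (fsum_ext _ _ (fun k => Cmult (Cinv (Qc n))
        (Li_neg 0 (e2pi (Cdiv (Cplus w (RtoC (IZR (Z.of_nat k - Z.of_nat n)))) (Qc n)))))).
      - rewrite fsum_scal, D. specialize (HQc n). field; exact HQc.
      - intros k _. rewrite Li_neg_0. unfold u, Cdiv at 1. apply Cmult_comm. }
    rewrite <- fsum_conj, D', fsum_const. fold (Qc n). specialize (HQc n). field; exact HQc.
  - apply clim_const.
Qed.

(** * The Maass seed as a sum of Lipschitz-summable terms *)

Lemma RtoC_neq_0 x : x <> 0 -> RtoC x <> RtoC 0.
Proof. intros H E; apply RtoC_inj in E; auto. Qed.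

Lemma fact_neq_0_C n : RtoC (INR (fact n)) <> RtoC 0.
Proof. apply RtoC_neq_0, INR_fact_neq_0. Qed.

(* The inverse power minus its Taylor polynomial with [n] terms at the conjugate point. *)
Definition taylor_rest (M n : nat) (w : C) : C :=
  Cminus (Cinv (Cpow w (S M)))
    (fsum n (fun b => Cmult (RtoC (INR (bin (M + b) b)))
       (Cmult (Cpow (Cminus (Cconj w) w) b) (Cinv (Cpow (Cconj w) (S M + b)))))).

Lemma bin_diag n : bin n n = 1%nat.
Proof. induction n as [|n IH]; [reflexivity|]. rewrite bin_SS, IH, bin_gt; lia. Qed.

Lemma taylor_rest_S M n w : taylor_rest M (S n) w =
  Cminus (taylor_rest M n w) (Cmult (RtoC (INR (bin (M + n) n)))
       (Cmult (Cpow (Cminus (Cconj w) w) n) (Cinv (Cpow (Cconj w) (S M + n))))).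
Proof. unfold taylor_rest; cbn [fsum]; ring. Qed.

(** For M = 0 all binomials are 1 and the Taylor polynomial is a geometric sum with ratio 1 - w/conj
    w. *)
Lemma taylor_rest_0_mult n w : w <> RtoC 0 -> Cconj w <> RtoC 0 ->
  Cmult w (taylor_rest 0 n w) =
  Cmult (Cpow (Cminus (Cconj w) w) n) (Cinv (Cpow (Cconj w) n)).
Proof.
  intros Hw Hb; induction n as [|n IH].
  - unfold taylor_rest; simpl. field; assumption.
  - rewrite taylor_rest_S. simpl Nat.add; rewrite bin_diag.
    transitivity (Cminus (Cmult w (taylor_rest 0 n w)) (Cmult w (Cmult (RtoC (INR 1))
       (Cmult (Cpow (Cminus (Cconj w) w) n) (Cinv (Cpow (Cconj w) (S n))))))); [ring|].
    rewrite IH, !Cpow_S. simpl INR. assert (Hp := Cpow_nz _ n Hb). field; auto.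
Qed.

(** Multiplication by w lowers the exponent and, once a term is subtracted, lengthens the Taylor
    polynomial, by Pascal's rule. This is what allows the seed to be treated by induction on n. *)
Lemma taylor_rest_step M n w : w <> RtoC 0 -> Cconj w <> RtoC 0 ->
  Cminus (Cmult w (taylor_rest (S M) n w))
    (Cmult (RtoC (INR (bin (S M + n) n)))
       (Cmult (Cpow (Cminus (Cconj w) w) n) (Cinv (Cpow (Cconj w) (S M + n)))))
  = taylor_rest M (S n) w.
Proof.
  intros Hw Hb; induction n as [|n IH].
  - unfold taylor_rest; cbn [fsum]. rewrite !bin_0_r, !Nat.add_0_r, !(Cpow_S w). simpl INR.
    assert (Hp := Cpow_nz _ M Hw). assert (Hq := Cpow_nz _ (S M) Hb).
    change (Cpow (Cminus (Cconj w) w) 0) with (RtoC 1). field; auto.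
  - rewrite taylor_rest_S, (taylor_rest_S M (S n)), <- IH.
    replace (S M + S n)%nat with (S (S M + n)) by lia.
    replace (M + S n)%nat with (S M + n)%nat by lia.
    rewrite bin_SS, plus_INR, RtoC_plus.
    replace (S (S M) + n)%nat with (S (S M + n)) by lia.
    rewrite !(Cpow_S _ (S M + n)), !(Cpow_S _ n).
    assert (Hp := Cpow_nz _ (S M + n) Hb). field; auto.
Qed.

Definition exp_taylor (n : nat) (z : C) : C :=
  fsum n (fun j => Cdiv (Cpow z j) (RtoC (INR (fact j)))).

(** For n = 1-k, A = 2 pi i m/c^2 and w = tau + d/c this is the Maass seed slashed by a matrix with
    lower row (c, d), up to c^(-k) and a root of unity. The factor w^(-k) is written w^-1 w^n so
    that n = 0 makes sense and can start an induction. *)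
Definition seed_kernel (A : C) (n : nat) (w : C) : C :=
  Cmult (Cmult (Cinv w) (Cpow w n))
    (Cminus (Cexp (Cdiv A w))
       (Cmult (Cexp (Cdiv A (Cconj w))) (exp_taylor n (Cminus (Cdiv A w) (Cdiv A (Cconj w)))))).

(** Multiplying by w and subtracting a multiple of the exponential series of A/conj w adds one term
    to every Taylor polynomial, by [taylor_rest_step], and one term to the truncated exponential. *)
Lemma has_csum_seed_kernel A n w : w <> RtoC 0 -> Cconj w <> RtoC 0 ->
  has_csum (fun M => Cmult (Cdiv (Cpow A (M + n)) (RtoC (INR (fact (M + n))))) (taylor_rest M n w))
    (seed_kernel A n w).
Proof.
  intros Hw Hb; induction n as [|n IH].
  - eapply has_csum_eq; [eapply has_csum_ext; [|apply (has_csum_scal (Cinv w)), (has_csum_Cexp (Cdiv A w))]|].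
    + intros M; cbv beta. rewrite Nat.add_0_r. unfold taylor_rest, Cdiv; simpl fsum.
      rewrite Cpow_mult_l, Cpow_inv, (Cpow_S w) by exact Hw.
      assert (Hp := Cpow_nz _ M Hw). assert (Hf := fact_neq_0_C M). field; auto.
    + unfold seed_kernel, exp_taylor; simpl; ring.
  - assert (H1 := has_csum_scal w _ _ IH).
    assert (H2 := has_csum_scal (Copp (Cdiv (Cmult (Cpow (Cminus (Cconj w) w) n) (Cpow (Cdiv A (Cconj w)) n))
        (RtoC (INR (fact n))))) _ _ (has_csum_Cexp (Cdiv A (Cconj w)))).
    (* The entry M = 0 of the combination vanishes by [taylor_rest_0_mult]; dropping it turns the
       exponent (M+1) + n into M + (n+1). *)
    assert (H3 := has_csum_tail _ _ (has_csum_plus _ _ _ _ H1 H2)).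
    eapply has_csum_eq; [eapply has_csum_ext; [|exact H3]|].
    + intros M; cbv beta. rewrite <- (taylor_rest_step M n w Hw Hb).
      replace (M + S n)%nat with (S M + n)%nat by lia.
      assert (Hfn := fact_neq_0_C n). assert (HfM := fact_neq_0_C (S M)).
      assert (HfMn := fact_neq_0_C (S M + n)).
      assert (Hbf := f_equal (fun k => RtoC (INR k)) (bin_fact (S M) n)). cbv beta in Hbf.
      rewrite !mult_INR, !RtoC_mult in Hbf.
      replace (RtoC (INR (bin (S M + n) n))) with
        (Cdiv (RtoC (INR (fact (S M + n)))) (Cmult (RtoC (INR (fact (S M)))) (RtoC (INR (fact n)))))
        by (rewrite <- Hbf; field; auto).
      unfold Cdiv at 3 4 5 6. rewrite !Cpow_mult_l, !Cpow_inv by exact Hb.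
      rewrite (Cpow_add_r A (S M) n), (Cpow_add_r (Cconj w) (S M) n).
      assert (Hp1 := Cpow_nz _ (S M) Hb). assert (Hp2 := Cpow_nz _ n Hb).
      field; auto.
    + cbv beta. simpl Nat.add.
      replace (Cmult w (Cmult (Cdiv (Cpow A n) (RtoC (INR (fact n)))) (taylor_rest 0 n w)))
        with (Cmult (Cdiv (Cpow A n) (RtoC (INR (fact n)))) (Cmult w (taylor_rest 0 n w))) by ring.
      rewrite taylor_rest_0_mult by assumption.
      unfold seed_kernel, exp_taylor; simpl fsum.
      set (T := fsum n _). rewrite (Cpow_S w n).
      assert (E : Cmult (Cpow w n) (Cpow (Cminus (Cdiv A w) (Cdiv A (Cconj w))) n) =
        Cmult (Cpow (Cminus (Cconj w) w) n) (Cpow (Cdiv A (Cconj w)) n)).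
      { rewrite <- !Cpow_mult_l. f_equal. field; auto. }
      assert (Hfn := fact_neq_0_C n).
      transitivity (Cminus (Cmult (Cpow w n) (Cminus (Cexp (Cdiv A w)) (Cmult (Cexp (Cdiv A (Cconj w))) T)))
        (Cmult (Cdiv (Cexp (Cdiv A (Cconj w))) (RtoC (INR (fact n))))
          (Cmult (Cpow w n) (Cpow (Cminus (Cdiv A w) (Cdiv A (Cconj w))) n)))).
      2:{ field; auto. }
      rewrite E. unfold Cdiv at 8. rewrite Cpow_mult_l, Cpow_inv by exact Hb.
      simpl (Cpow _ 0). simpl (fact 0). simpl (INR 1).
      assert (Hp2 := Cpow_nz _ n Hb). unfold Cdiv. rewrite !Cpow_mult_l, !Cpow_inv by exact Hb.
      field; auto.
Qed.

Lemma bin_le_pow2 n k : (bin n k <= 2 ^ n)%nat.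
Proof.
  revert k; induction n as [|n IH]; intros [|k].
  - simpl; lia.
  - rewrite bin_gt by lia; lia.
  - rewrite bin_0_r. assert (H := Nat.pow_nonzero 2 (S n) ltac:(lia)); lia.
  - rewrite bin_SS. assert (H1 := IH k); assert (H2 := IH (S k)). simpl Nat.pow. lia.
Qed.

Lemma Cmod_conj_minus w : 0 < Im w -> Cmod (Cminus (Cconj w) w) = 2 * Im w.
Proof.
  intros H. replace (Cminus (Cconj w) w) with (Cmult (RtoC (2 * Im w)) (Copp Ci))
    by (apply C_eq; simpl; unfold Im; ring).
  rewrite Cmod_mult, Cmod_opp, Cmod_Ci, Cmod_R, Rabs_pos_eq; lra.
Qed.

Lemma inv_pow_le v y p : 0 < v -> v <= y -> / y ^ (p + 2) <= / v ^ p * / y ^ 2.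
Proof.
  intros Hv Hy. rewrite pow_add, <- Rinv_mult. apply Rinv_le_contravar.
  - apply Rmult_lt_0_compat; apply pow_lt; lra.
  - apply Rmult_le_compat_r; [apply pow2_ge_0|apply pow_incr; lra].
Qed.

(** Every term with exponent at least two is O(|w|^-2) by itself, and the growth (2/Im w)^M is
    harmless against the factorials to come. Exponent one occurs for M = 0 only, and there 1/w -
    1/conj w = (conj w - w)/|w|^2 is estimated as a unit. The 4^b collects 2^b from the binomial and
    2^b from the powers of conj w - w. *)
Lemma Cmod_taylor_rest_le M n w : 0 < Im w ->
  Cmod (taylor_rest M (S n) w)
  <= (2 / Im w) ^ M * (Im w * (1 + rsum (S n) (fun b => 4 ^ b))) * / Cmod w ^ 2.
Proof.
  intros Hw. set (v := Im w). set (y := Cmod w).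
  assert (Hv : 0 < v) by exact Hw.
  assert (Hy : v <= y) by (eapply Rle_trans; [apply Rle_abs|apply im_le_Cmod]).
  assert (Hw0 : w <> RtoC 0) by (apply Cmod_gt_0; fold y; lra).
  assert (Hb0 : Cconj w <> RtoC 0) by (apply Cmod_gt_0; rewrite Cmod_conj; fold y; lra).
  assert (Hy2 : 0 < / y ^ 2) by (apply Rinv_0_lt_compat, pow_lt; lra).
  assert (Hterm : forall b, (1 <= M + b)%nat ->
    Cmod (Cmult (RtoC (INR (bin (M + b) b)))
       (Cmult (Cpow (Cminus (Cconj w) w) b) (Cinv (Cpow (Cconj w) (S M + b)))))
    <= (2 / v) ^ M * v * / y ^ 2 * 4 ^ b).
  { intros b Hb. rewrite !Cmod_mult, Cmod_R, Cmod_pow, Cmod_inv, Cmod_pow, Cmod_conj by (apply Cpow_nz, Hb0).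
    rewrite Cmod_conj_minus by exact Hw. rewrite Rabs_pos_eq by apply pos_INR. fold v y.
    apply Rle_trans with (2 ^ (M + b) * ((2 * v) ^ b * (/ v ^ (M + b - 1) * / y ^ 2))).
    - apply Rmult_le_compat; [apply pos_INR| | |].
      + apply Rmult_le_pos; [apply pow_le; lra|]. left; apply Rinv_0_lt_compat, pow_lt; lra.
      + replace 2 with (INR 2) by (simpl; ring). rewrite <- pow_INR. apply le_INR, bin_le_pow2.
      + apply Rmult_le_compat_l; [apply pow_le; lra|].
        replace (S M + b)%nat with (M + b - 1 + 2)%nat by lia. apply inv_pow_le; assumption.
    - right. assert (Hvp : v ^ M * v ^ b = v ^ (M + b - 1) * v).
      { rewrite <- pow_add, <- (pow_1 v) at 1. rewrite pow_1.
        replace (M + b)%nat with (S (M + b - 1)) at 1 by lia. simpl; ring. }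
      assert (Hv1 : v ^ (M + b - 1) <> 0) by (apply pow_nonzero; lra).
      assert (HvM : v ^ M <> 0) by (apply pow_nonzero; lra).
      unfold Rdiv. rewrite !Rpow_mult_distr, pow_inv, pow_add.
      replace 4 with (2 * 2) by ring. rewrite Rpow_mult_distr.
      apply (Rmult_eq_reg_r (v ^ (M + b - 1) * v ^ M)); [|apply Rmult_integral_contrapositive; auto].
      transitivity (2 ^ M * 2 ^ b * 2 ^ b * / y ^ 2 * (v ^ M * v ^ b)); [field; split; [lra|exact Hv1]|].
      rewrite Hvp. field; split; [lra|exact HvM]. }
  set (K := (2 / v) ^ M * v * / y ^ 2).
  assert (HK : 0 <= K).
  { unfold K. apply Rmult_le_pos; [|lra]. apply Rmult_le_pos; [|lra]. apply pow_le.
    apply Rlt_le, Rdiv_lt_0_compat; lra. }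
  replace ((2 / v) ^ M * (v * (1 + rsum (S n) (fun b => 4 ^ b))) * / y ^ 2)
    with (K * (1 + rsum (S n) (fun b => 4 ^ b))) by (unfold K; ring).
  destruct M as [|M].
  - unfold taylor_rest. rewrite fsum_S.
    replace (Cminus (Cinv (Cpow w 1)) _) with
      (Cplus (Cdiv (Cminus (Cconj w) w) (Cmult w (Cconj w)))
        (Copp (fsum n (fun b => Cmult (RtoC (INR (bin (0 + S b) (S b))))
         (Cmult (Cpow (Cminus (Cconj w) w) (S b)) (Cinv (Cpow (Cconj w) (1 + S b)))))))).
    2:{ simpl (Cpow _ 0). simpl (INR (bin (0 + 0) 0)). rewrite Cpow_1_r, Nat.add_0_r, Cpow_1_r.
        set (F := fsum n _). field; auto. }
    eapply Rle_trans; [apply Cmod_triangle|]. rewrite Cmod_opp.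
    rewrite (rsum_S n). simpl (4 ^ 0).
    apply Rle_trans with (K * 2 + K * rsum n (fun b => 4 ^ S b)); [|right; ring].
    apply Rplus_le_compat.
    + rewrite Cmod_div, Cmod_mult, Cmod_conj, Cmod_conj_minus by (try assumption; apply Cmult_neq_0; assumption).
      fold v y. unfold K; right; simpl; field; lra.
    + rewrite <- rsum_scal. apply Cmod_fsum_le. intros b _. apply Hterm; lia.
  - unfold taylor_rest, Cminus. eapply Rle_trans; [apply Cmod_triangle|]. rewrite Cmod_opp.
    rewrite Rmult_plus_distr_l, Rmult_1_r. apply Rplus_le_compat.
    + rewrite Cmod_inv, Cmod_pow by (apply Cpow_nz, Hw0). fold y.
      replace (S (S M)) with (M + 2)%nat by lia.
      eapply Rle_trans; [apply (inv_pow_le v y M Hv Hy)|].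
      apply Rmult_le_compat_r; [lra|]. unfold Rdiv; rewrite Rpow_mult_distr, pow_inv.
      assert (Hvm : 0 < v ^ M) by (apply pow_lt; lra).
      assert (H2 : 1 <= 2 ^ S M) by (apply pow_R1_Rle; lra).
      apply (Rmult_le_reg_r (v ^ M)); [exact Hvm|]. rewrite Rinv_l by lra.
      replace (2 ^ S M * / v ^ S M * v * v ^ M) with (2 ^ S M); [exact H2|].
      simpl; field; split; lra.
    + rewrite <- rsum_scal. apply Cmod_fsum_le. intros b _. apply Hterm; lia.
Qed.

(** * The sum over translates and the incomplete gamma function *)

Definition gstar (n : nat) (y : R) : R := exp (- y) * rsum n (fun b => y ^ b / INR (fact b)).

Lemma lipschitz_conj s w : 0 < Im w ->
  has_zsum (fun l => Cinv (Cpow (Cplus (Cconj w) (RtoC (IZR l))) (S (S s))))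
    (Cmult (Cdiv (Cpow two_pi_i (S (S s))) (RtoC (INR (fact (S s)))))
       (Cconj (Li_neg (S s) (e2pi w)))).
Proof.
  intros Hw. assert (H := has_zsum_conj _ _ (lipschitz s w Hw)).
  eapply has_zsum_eq; [eapply has_zsum_ext, H|].
  - intros l; cbv beta. assert (Hn := shift_neq_0 w (IZR l) ltac:(lra)).
    rewrite Cinv_conj, Cpow_conj, Cplus_conj by (apply Cpow_nz, Hn).
    do 3 f_equal. apply C_eq; simpl; ring.
  - rewrite Cmult_conj, Cdiv_conj, Cpow_conj by apply fact_neq_0_C.
    replace (Cconj (Copp two_pi_i)) with two_pi_i by (unfold two_pi_i; apply C_eq; simpl; ring).
    replace (Cconj (RtoC (INR (fact (S s))))) with (RtoC (INR (fact (S s)))) by (apply C_eq; simpl; ring).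
    reflexivity.
Qed.

Lemma two_pi_i_conj_minus w :
  Cmult (Cminus (Cconj w) w) two_pi_i = RtoC (4 * PI * Im w).
Proof. unfold two_pi_i; apply C_eq; simpl; unfold Im; ring. Qed.

(** The source of the incomplete gamma function: (M+b)! cancels against the binomial, and (conj w -
    w) 2 pi i = 4 pi Im w, which leaves the terms y^b/b! of a truncated exponential in y = 4 pi Im
    w. *)
Lemma taylor_coef_eq M b w :
  Cmult (Cmult (RtoC (INR (bin (M + b) b))) (Cpow (Cminus (Cconj w) w) b))
     (Cdiv (Cpow two_pi_i (S M + b)) (RtoC (INR (fact (M + b)))))
  = Cmult (Cdiv (Cpow two_pi_i (S M)) (RtoC (INR (fact M))))
      (RtoC ((4 * PI * Im w) ^ b / INR (fact b))).
Proof.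
  assert (Hfn := fact_neq_0_C b). assert (HfM := fact_neq_0_C M).
  assert (HfMn := fact_neq_0_C (M + b)).
  assert (Hbf := f_equal (fun k => RtoC (INR k)) (bin_fact M b)). cbv beta in Hbf.
  rewrite !mult_INR, !RtoC_mult in Hbf.
  replace (RtoC (INR (bin (M + b) b))) with
    (Cdiv (RtoC (INR (fact (M + b)))) (Cmult (RtoC (INR (fact M))) (RtoC (INR (fact b)))))
    by (rewrite <- Hbf; field; auto).
  rewrite RtoC_div, RtoC_pow by apply INR_fact_neq_0.
  rewrite <- two_pi_i_conj_minus, Cpow_mult_l, Cpow_add_r. field; auto.
Qed.

(** The l-th power of conj(e(w)) is e^(-4 pi l v) e(-w)^l, v = Im w; this exponential and the sum
    over b of (4 pi l v)^b/b! combine to [gstar]. *)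
Lemma has_csum_nonholomorphic M n w : 0 < Im w ->
  has_csum (fun i => Cmult (Cmult (RtoC (gstar n (4 * PI * INR (S i) * Im w)))
                (Cpow (e2pi (Copp w)) (S i))) (RtoC (INR (S i) ^ M)))
    (fsum n (fun b => Cmult (RtoC ((4 * PI * Im w) ^ b / INR (fact b)))
                     (Cconj (Li_neg (M + b) (e2pi w))))).
Proof.
  intros Hw.
  eapply has_csum_ext; [|apply has_csum_fsum; intros b _; apply has_csum_scal, has_csum_conj,
     has_csum_Li_neg, Cmod_e2pi_lt_1, Hw].
  intros i; cbv beta.
  assert (E : Cconj (Cpow (e2pi w) (S i)) =
     Cmult (RtoC (exp (- (4 * PI * INR (S i) * Im w)))) (Cpow (e2pi (Copp w)) (S i))).
  { rewrite Cpow_conj, e2pi_conj, !e2pi_pow.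
    replace (RtoC (exp (- (4 * PI * INR (S i) * Im w)))) with
      (e2pi (Cmult (RtoC (INR (S i))) (0, 2 * Im w))).
    - rewrite <- e2pi_plus; f_equal. apply C_eq; simpl; unfold Im; ring.
    - unfold e2pi, Cexp; apply C_eq; simpl.
      + replace (0 * (match i with O => 1 | S _ => INR i + 1 end * (2 * Im w) + 0 * 0) + 2 * PI *
          (match i with O => 1 | S _ => INR i + 1 end * 0 - 0 * (2 * Im w))) with 0 by ring.
        rewrite cos_0, Rmult_1_r; f_equal; ring.
      + replace (0 * (match i with O => 1 | S _ => INR i + 1 end * (2 * Im w) + 0 * 0) + 2 * PI *
          (match i with O => 1 | S _ => INR i + 1 end * 0 - 0 * (2 * Im w))) with 0 by ring.
        rewrite sin_0; ring. }
  unfold gstar. rewrite RtoC_mult, <- fsum_RtoC.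
  set (Z := Cpow (e2pi (Copp w)) (S i)) in *. set (ex := exp _) in *.
  transitivity (Cmult (Cmult (Cmult (RtoC ex) Z) (RtoC (INR (S i) ^ M)))
    (fsum n (fun b => RtoC ((4 * PI * INR (S i) * Im w) ^ b / INR (fact b))))); [|ring].
  rewrite <- fsum_scal. apply fsum_ext; intros b _.
  rewrite Cmult_conj, E.
  replace (Cconj (RtoC (INR (S i) ^ (M + b)))) with (RtoC (INR (S i) ^ (M + b))) by (apply C_eq; simpl; ring).
  replace (4 * PI * INR (S i) * Im w) with ((4 * PI * Im w) * INR (S i)) by ring.
  unfold Rdiv. rewrite !Rpow_mult_distr, pow_add, !RtoC_mult. ring.
Qed.

Lemma Cconj_shift w (x : R) : Cconj (Cplus w (RtoC x)) = Cplus (Cconj w) (RtoC x).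
Proof. apply C_eq; simpl; ring. Qed.

(** For M >= 1 all exponents are at least two and are summed one by one. For M = 0 the leading term
    is taken together with 1/(w+l) by [lipschitz_conj_difference], whence the extra constant -2 pi
    i. *)
Lemma has_zsum_taylor_rest M n w : 0 < Im w ->
  has_zsum (fun l => taylor_rest M (S n) (Cplus w (RtoC (IZR l))))
   (Cplus (if Nat.eqb M 0 then Copp two_pi_i else RtoC 0)
     (Cminus (Cmult (Cdiv (Cpow (Copp two_pi_i) (S M)) (RtoC (INR (fact M)))) (Li_neg M (e2pi w)))
       (Cmult (Cdiv (Cpow two_pi_i (S M)) (RtoC (INR (fact M))))
         (fsum (S n) (fun b => Cmult (RtoC ((4 * PI * Im w) ^ b / INR (fact b)))
                     (Cconj (Li_neg (M + b) (e2pi w)))))))).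
Proof.
  intros Hw.
  assert (Hd : forall l : Z, Cminus (Cconj (Cplus w (RtoC (IZR l)))) (Cplus w (RtoC (IZR l))) = Cminus (Cconj w) w).
  { intros l; rewrite Cconj_shift; ring. }
  assert (Hterm : forall b, (1 <= M + b)%nat ->
    has_zsum (fun l => Cmult (RtoC (INR (bin (M + b) b)))
       (Cmult (Cpow (Cminus (Cconj (Cplus w (RtoC (IZR l)))) (Cplus w (RtoC (IZR l)))) b)
         (Cinv (Cpow (Cconj (Cplus w (RtoC (IZR l)))) (S M + b)))))
      (Cmult (Cdiv (Cpow two_pi_i (S M)) (RtoC (INR (fact M))))
        (Cmult (RtoC ((4 * PI * Im w) ^ b / INR (fact b))) (Cconj (Li_neg (M + b) (e2pi w)))))).
  { intros b Hb. assert (H := lipschitz_conj (M + b - 1) w Hw).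
    replace (S (S (M + b - 1))) with (S M + b)%nat in H by lia.
    replace (S (M + b - 1)) with (M + b)%nat in H by lia.
    apply (has_zsum_scal (Cmult (RtoC (INR (bin (M + b) b))) (Cpow (Cminus (Cconj w) w) b))) in H.
    eapply has_zsum_eq; [eapply has_zsum_ext, H|].
    - intros l; cbv beta. rewrite Hd, Cconj_shift. ring.
    - rewrite !Cmult_assoc, <- taylor_coef_eq. reflexivity. }
  destruct M as [|M].
  - assert (H1 := lipschitz_conj_difference w Hw).
    assert (H2 := has_zsum_fsum n _ _ (fun b _ => Hterm (S b) ltac:(lia))).
    apply (has_zsum_scal (RtoC (-1))) in H2.
    eapply has_zsum_eq; [eapply has_zsum_ext; [|exact (has_zsum_plus _ _ _ _ H1 H2)]|].
    + intros l; cbv beta. unfold taylor_rest. rewrite fsum_S, !Hd, Cconj_shift.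
      simpl (Cpow _ 0). simpl (INR (bin (0 + 0) 0)). rewrite !Nat.add_0_r, !Cpow_1_r. ring.
    + rewrite fsum_S. cbv beta. rewrite fsum_scal. simpl Nat.eqb; cbv iota.
      simpl ((4 * PI * Im w) ^ 0). simpl (fact 0). simpl (INR 1). rewrite Cpow_1_r, Cpow_1_r.
      simpl Nat.add. replace (1 / 1) with 1 by field.
      set (F := fsum n _). set (L := Li_neg 0 _). field.
  - assert (H1 := lipschitz M w Hw).
    assert (H2 := has_zsum_fsum (S n) _ _ (fun b _ => Hterm b ltac:(lia))).
    apply (has_zsum_scal (RtoC (-1))) in H2.
    eapply has_zsum_eq; [eapply has_zsum_ext; [|exact (has_zsum_plus _ _ _ _ H1 H2)]|].
    + intros l; cbv beta. unfold taylor_rest. ring.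
    + rewrite fsum_scal. simpl Nat.eqb; cbv iota. ring.
Qed.

(** Turns a series of polylogarithms Li_{-j}, as produced by termwise Lipschitz summation, into a
    series over the Fourier index i with Bessel coefficients. The majorant is the product of |b i|
    exp(|lam i| r) and |co j|/r^j. *)
Lemma has_csum_borel_swap (co : nat -> R) (b : nat -> C) (lam : nat -> R) r : 0 < r ->
  ex_series (fun j => Rabs (co j) * / r ^ S j) ->
  ex_series (fun i => Cmod (b i) * exp (Rabs (lam i) * r)) ->
  has_csum (fun j => Cmult (RtoC (co j / INR (fact j)))
              (CSeries (fun i => Cmult (b i) (RtoC (lam i ^ j)))))
    (CSeries (fun i => Cmult (b i) (borel co (lam i)))) /\
  has_csum (fun i => Cmult (b i) (borel co (lam i))) (CSeries (fun i => Cmult (b i) (borel co (lam i)))).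
Proof.
  intros Hr Hco Hb.
  set (B := fun i => Cmod (b i) * exp (Rabs (lam i) * r)).
  set (D := fun j => r * (Rabs (co j) * / r ^ S j)).
  assert (HD : ex_series D) by (apply ex_series_scal_R, Hco).
  assert (HB0 : forall i, 0 <= B i).
  { intros i; apply Rmult_le_pos; [apply Cmod_ge_0|left; apply exp_pos]. }
  assert (HD0 : forall j, 0 <= D j).
  { intros j; apply Rmult_le_pos; [lra|]. apply Rmult_le_pos; [apply Rabs_pos|].
    left; apply Rinv_0_lt_compat, pow_lt, Hr. }
  assert (Ha : forall i j, Cmod (Cmult (b i) (Cmult (RtoC (co j)) (RtoC (lam i ^ j / INR (fact j)))))
     <= B i * D j).
  { intros i j; rewrite Cmod_mult; unfold B, D; rewrite Rmult_assoc.
    apply Rmult_le_compat_l; [apply Cmod_ge_0|].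
    rewrite <- Rmult_assoc. apply borel_term_le, Hr. }
  assert (Hrow : forall i, has_csum (fun j => Cmult (b i) (Cmult (RtoC (co j)) (RtoC (lam i ^ j / INR (fact j)))))
     (Cmult (b i) (borel co (lam i)))).
  { intros i; apply has_csum_scal, has_csum_borel with r; assumption. }
  assert (Hr2 : has_csum (fun i => Cmult (b i) (borel co (lam i))) (CSeries (fun i => Cmult (b i) (borel co (lam i))))).
  { apply has_csum_CSeries with (fun i => B i * Series D).
    - intros i; eapply has_csum_Cmod_le; [apply Hrow|apply Ha|].
      exact (is_series_scal (B i) _ _ (Series_correct _ HD)).
    - apply ex_series_scal_r, Hb. }
  split; [|exact Hr2].
  refine (has_csum_swap _ B D _ _ _ Ha HB0 HD0 Hb HD Hrow _ Hr2).
  intros j. cbv beta.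
  assert (Hf := INR_fact_lt_0 j).
  assert (Hs : has_csum (fun i => Cmult (b i) (RtoC (lam i ^ j))) (CSeries (fun i => Cmult (b i) (RtoC (lam i ^ j))))).
  { apply has_csum_CSeries with (fun i => B i * (INR (fact j) * / r ^ j)).
    - intros i. rewrite Cmod_mult. unfold B; rewrite Rmult_assoc.
      apply Rmult_le_compat_l; [apply Cmod_ge_0|].
      assert (Hrj : 0 < r ^ j) by (apply pow_lt, Hr).
      assert (H := pow_fact_le_exp (Rabs (lam i) * r) j ltac:(apply Rmult_le_pos; [apply Rabs_pos|lra])).
      rewrite Cmod_R, <- RPow_abs. rewrite Rpow_mult_distr in H.
      apply (Rmult_le_reg_r (r ^ j * / INR (fact j))).
      { apply Rmult_lt_0_compat; [exact Hrj|apply Rinv_0_lt_compat, Hf]. }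
      replace (exp (Rabs (lam i) * r) * (INR (fact j) * / r ^ j) * (r ^ j * / INR (fact j)))
        with (exp (Rabs (lam i) * r)) by (field; lra).
      eapply Rle_trans; [|exact H]. right; field; lra.
    - apply ex_series_scal_r, Hb. }
  eapply has_csum_ext; [|apply has_csum_scal, Hs].
  intros i; cbv beta. unfold Rdiv. rewrite !RtoC_mult. ring.
Qed.

(** The coefficients of alpha^+ and alpha^- for eps = 1 and eps = -1, with n = 1-k and x = 2 pi
    sqrt(m)/c. The [borel] value at lam > 0 is lam^(-n/2) times I_n(2 x sqrt(lam)) for eps = 1 and
    J_n(2 x sqrt(lam)) for eps = -1; at lam = l the argument is the usual 4 pi sqrt(m l)/c. *)
Definition bessel_coef (eps x : R) (n j : nat) : R :=
  eps ^ j / INR (fact (j + n)) * x ^ (2 * j + n).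

Lemma bessel_coef_le eps x X n r j : Rabs eps <= 1 -> 0 <= x <= X -> 0 < r ->
  Rabs (bessel_coef eps x n j) * / r ^ S j <= x ^ n * / r * ((X ^ 2 / r) ^ j / INR (fact j)).
Proof.
  intros He Hx Hr. unfold bessel_coef, Rdiv. rewrite !Rabs_mult, Rabs_inv.
  rewrite (Rabs_pos_eq (INR _)) by apply pos_INR. rewrite (Rabs_pos_eq (x ^ _)) by (apply pow_le; lra).
  rewrite <- RPow_abs, Rpow_mult_distr, pow_inv, pow_add, pow_mult.
  assert (H1 : Rabs eps ^ j <= 1).
  { rewrite <- (pow1 j). apply pow_incr; split; [apply Rabs_pos|exact He]. }
  assert (H2 : / INR (fact (j + n)) <= / INR (fact j)).
  { apply Rinv_le_contravar; [apply INR_fact_lt_0|apply le_INR, fact_le; lia]. }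
  assert (H3 : (x ^ 2) ^ j <= (X ^ 2) ^ j).
  { apply pow_incr; split; [apply pow2_ge_0|apply pow_incr; exact Hx]. }
  assert (Hi1 : 0 < / INR (fact (j + n))) by (apply Rinv_0_lt_compat, INR_fact_lt_0).
  assert (Hrj : 0 < / r ^ j) by (apply Rinv_0_lt_compat, pow_lt, Hr).
  assert (Hri : 0 < / r) by (apply Rinv_0_lt_compat, Hr).
  assert (Hxn : 0 <= x ^ n) by (apply pow_le; lra).
  assert (Hx2 : 0 <= (x ^ 2) ^ j) by (apply pow_le, pow2_ge_0).
  replace (Rabs eps ^ j * / INR (fact (j + n)) * ((x ^ 2) ^ j * x ^ n) * / r ^ S j)
    with ((Rabs eps ^ j * (/ INR (fact (j + n)) * (x ^ 2) ^ j)) * (x ^ n * / r * / r ^ j)).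
  2:{ simpl; field; repeat split; try lra; [apply pow_nonzero; lra|apply INR_fact_neq_0]. }
  replace (x ^ n * / r * ((X ^ 2) ^ j * / r ^ j * / INR (fact j)))
    with ((1 * (/ INR (fact j) * (X ^ 2) ^ j)) * (x ^ n * / r * / r ^ j)) by ring.
  apply Rmult_le_compat_r.
  - apply Rmult_le_pos; [apply Rmult_le_pos|]; lra.
  - apply Rmult_le_compat; [apply pow_le, Rabs_pos|apply Rmult_le_pos; lra|exact H1|].
    apply Rmult_le_compat; lra.
Qed.

Lemma ex_series_bessel_coef eps x n r : Rabs eps <= 1 -> 0 <= x -> 0 < r ->
  ex_series (fun j => Rabs (bessel_coef eps x n j) * / r ^ S j).
Proof.
  intros He Hx Hr.
  apply ex_series_Rle with (fun j => x ^ n * / r * ((x ^ 2 / r) ^ j / INR (fact j))).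
  - intros j; split.
    + apply Rmult_le_pos; [apply Rabs_pos|left; apply Rinv_0_lt_compat, pow_lt, Hr].
    + apply bessel_coef_le; auto; lra.
  - apply ex_series_scal_R. eexists; apply is_series_exp.
Qed.

(** x^n is kept apart from a constant that depends on X only: with x of size 1/c and X a bound for
    all c, it provides the decay in c. *)
Lemma Cmod_bessel_le eps x X n r lam : Rabs eps <= 1 -> 0 <= x <= X -> 0 < r ->
  Cmod (borel (bessel_coef eps x n) lam) <= x ^ n * (exp (X ^ 2 / r) * exp (Rabs lam * r)).
Proof.
  intros He Hx Hr.
  apply Rle_trans with (exp (Rabs lam * r) * r * (x ^ n * / r * exp (X ^ 2 / r))).
  2:{ right; field; lra. }
  eapply Cmod_CSeries_le; [|apply is_series_scal_R, is_series_scal_R, is_series_exp].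
  intros j. eapply Rle_trans; [apply (borel_term_le r), Hr|].
  apply Rmult_le_compat_l; [apply Rmult_le_pos; [left; apply exp_pos|lra]|].
  apply bessel_coef_le; assumption.
Qed.

(** As t > 0 is arbitrary, the truncated exponential costs only an arbitrarily small part of the
    exponential decay. *)
Lemma exp_taylor_R_le n y t : 0 <= y -> 0 < t ->
  rsum n (fun b => y ^ b / INR (fact b)) <= rsum n (fun b => / t ^ b) * exp (t * y).
Proof.
  intros Hy Ht. rewrite Rmult_comm, <- rsum_scal. apply rsum_le; intros b _.
  assert (Htb : 0 < t ^ b) by (apply pow_lt, Ht).
  apply (Rmult_le_reg_r (t ^ b)); [exact Htb|].
  rewrite Rmult_assoc, Rinv_l, Rmult_1_r by lra.
  eapply Rle_trans; [|apply (pow_fact_le_exp (t * y) b); apply Rmult_le_pos; lra].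
  rewrite Rpow_mult_distr; right; field. apply INR_fact_neq_0.
Qed.

Lemma exp_INR_pow x n : exp (INR n * x) = exp x ^ n.
Proof.
  induction n as [|n IH]; [simpl; rewrite Rmult_0_l, exp_0; reflexivity|].
  rewrite S_INR, Rmult_plus_distr_r, exp_plus, IH, Rmult_1_l; simpl; ring.
Qed.

Lemma ex_series_exp_decay t : 0 < t -> ex_series (fun i => exp (- (t * INR (S i)))).
Proof.
  intros Ht. apply ex_series_ext with (fun i => exp (- t) * exp (- t) ^ i).
  - intros i. change (exp (- t) * exp (- t) ^ i) with (exp (- t) ^ S i).
    rewrite <- exp_INR_pow; f_equal; ring.
  - apply ex_series_scal_R, ex_series_geom. rewrite Rabs_pos_eq by (left; apply exp_pos).
    rewrite <- exp_0; apply exp_increasing; lra.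
Qed.

(** With l = i+1 and v = Im w, e(-w)^l grows like e^(2 pi l v) and [gstar] decays like e^(-4 pi l v)
    up to the loss t, so the product still decays for t < 1/2. *)
Lemma Cmod_gstar_e2pi_le n w i t : 0 < Im w -> 0 < t ->
  Cmod (Cmult (RtoC (gstar n (4 * PI * INR (S i) * Im w))) (Cpow (e2pi (Copp w)) (S i)))
  <= rsum n (fun b => / t ^ b) * exp (- ((2 * PI - 4 * PI * t) * Im w * INR (S i))).
Proof.
  intros Hw Ht. assert (Hpi := PI_RGT_0).
  assert (Hy : 0 <= 4 * PI * INR (S i) * Im w).
  { apply Rmult_le_pos; [apply Rmult_le_pos; [lra|apply pos_INR]|lra]. }
  rewrite Cmod_mult, Cmod_R, e2pi_pow, Cmod_e2pi. unfold gstar.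
  set (y := 4 * PI * INR (S i) * Im w) in *.
  assert (Hpos : 0 <= rsum n (fun b => y ^ b / INR (fact b))).
  { rewrite <- (Rmult_0_r (INR n)), <- rsum_const. apply rsum_le; intros.
    apply Rdiv_le_0_compat; [apply pow_le, Hy|apply INR_fact_lt_0]. }
  rewrite Rabs_pos_eq by (apply Rmult_le_pos; [left; apply exp_pos|exact Hpos]).
  rewrite im_scal_l. simpl Im. 
  apply Rle_trans with (exp (- y) * (rsum n (fun b => / t ^ b) * exp (t * y)) * exp (- (2 * PI * (INR (S i) * - Im w)))).
  - apply Rmult_le_compat_r; [left; apply exp_pos|]. apply Rmult_le_compat_l; [left; apply exp_pos|].
    apply exp_taylor_R_le; assumption.
  - right. transitivity (rsum n (fun b => / t ^ b) * (exp (- y) * exp (t * y) * exp (- (2 * PI * (INR (S i) * - Im w))))); [ring|].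
    rewrite <- !exp_plus. f_equal. f_equal. unfold y; ring.
Qed.

Lemma two_pi_i_sq : Cmult two_pi_i two_pi_i = RtoC (- (2 * PI) ^ 2).
Proof. unfold two_pi_i; apply C_eq; simpl; ring. Qed.

Lemma two_pi_i_even_pow h : Cpow two_pi_i (2 * h) = RtoC ((-1) ^ h * (2 * PI) ^ (2 * h)).
Proof.
  rewrite Cpow_mult_r, !pow_mult. simpl (Cpow two_pi_i 2).
  replace (Cmult two_pi_i (Cmult two_pi_i (RtoC 1))) with (RtoC (-1 * (2 * PI) ^ 2)).
  - rewrite <- RtoC_pow, Rpow_mult_distr; reflexivity.
  - rewrite Cmult_assoc, two_pi_i_sq, Cmult_1_r. f_equal; ring.
Qed.

Lemma Cmod_e2pi_pow w i : Cmod (Cpow (e2pi w) i) = exp (- (2 * PI * Im w * INR i)).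
Proof. rewrite e2pi_pow, Cmod_e2pi, im_scal_l; f_equal; ring. Qed.

(** * Fourier expansion of the sum over one residue class of d modulo c *)

Section Expansions.

Variables (h : nat) (cc r0 : R).
Hypotheses (Hcc : 0 < cc) (Hr0 : 0 < r0).

Let n0 : nat := S (2 * h).
Let x : R := 2 * PI * r0 / cc.

Let Hx : 0 <= x.
Proof.
  assert (Hpi := PI_RGT_0). unfold x. apply Rlt_le, Rdiv_lt_0_compat; [|exact Hcc].
  apply Rmult_lt_0_compat; lra.
Qed.

Let A : C := Cmult two_pi_i (RtoC (r0 ^ 2 / cc ^ 2)).

Let A_two_pi_i : Cmult A (Copp two_pi_i) = RtoC (x ^ 2).
Proof.
  unfold A. transitivity (Cmult (Copp (Cmult two_pi_i two_pi_i)) (RtoC (r0 ^ 2 / cc ^ 2))); [ring|].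
  rewrite two_pi_i_sq, <- RtoC_opp, <- RtoC_mult. f_equal. unfold x. field. lra.
Qed.

(** As n0 = 2h+1, A^(M+n0) splits into A^(M+1), which pairs with (-2 pi i)^(M+1) to give x^(2M+2),
    and A^(2h), whose even power of i leaves the sign (-1)^h. *)
Let A_pow M : Cmult (RtoC (cc ^ (2 * h))) (Cmult (Cpow A (M + n0)) (Cpow (Copp two_pi_i) (S M)))
  = RtoC ((-1) ^ h * r0 ^ n0 * (2 * PI / cc) * x ^ (2 * M + n0)).
Proof.
  unfold n0. replace (M + S (2 * h))%nat with (S M + 2 * h)%nat by lia.
  rewrite Cpow_add_r.
  transitivity (Cmult (RtoC (cc ^ (2 * h))) (Cmult (Cpow A (2 * h)) (Cpow (Cmult A (Copp two_pi_i)) (S M)))).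
  { rewrite (Cpow_mult_l A (Copp two_pi_i)). ring. }
  rewrite A_two_pi_i. unfold A. rewrite Cpow_mult_l, two_pi_i_even_pow, <- !RtoC_pow, <- !RtoC_mult.
  f_equal. replace (2 * M + S (2 * h))%nat with (2 * M + 2 * h + 1)%nat by lia.
  rewrite !pow_add, pow_1, <- pow_mult.
  replace (2 * S M)%nat with (2 * M + 2)%nat by lia. rewrite pow_add.
  replace (r0 ^ S (2 * h)) with (r0 * r0 ^ (2 * h)) by reflexivity.
  replace (x ^ 2) with (x * (2 * PI * r0 / cc)) by (unfold x; ring).
  replace (x ^ (2 * h)) with ((2 * PI) ^ (2 * h) * r0 ^ (2 * h) * / cc ^ (2 * h)).
  2:{ unfold x, Rdiv. rewrite !Rpow_mult_distr, pow_inv; reflexivity. }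
  replace ((r0 ^ 2 / cc ^ 2) ^ (2 * h)) with (r0 ^ (2 * h) * r0 ^ (2 * h) * (/ cc ^ (2 * h) * / cc ^ (2 * h))).
  2:{ replace (r0 ^ 2 / cc ^ 2) with (r0 * r0 * (/ cc * / cc)) by (field; lra).
      rewrite !Rpow_mult_distr, pow_inv; reflexivity. }
  assert (Hcp : cc ^ (2 * h) <> 0) by (apply pow_nonzero; lra).
  field. split; [exact Hcp|lra].
Qed.

Lemma has_zsum_maass_kernel w : 0 < Im w ->
  has_zsum (fun l => Cmult (RtoC (cc ^ (2 * h))) (seed_kernel A n0 (Cplus w (RtoC (IZR l)))))
    (Cmult (RtoC ((-1) ^ h * r0 ^ n0 * (2 * PI / cc)))
      (Cplus (RtoC (x ^ n0 / INR (fact n0)))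
       (Cplus (CSeries (fun i => Cmult (Cpow (e2pi w) (S i)) (borel (bessel_coef 1 x n0) (INR (S i)))))
        (CSeries (fun i => Cmult (Cmult (RtoC (gstar n0 (4 * PI * INR (S i) * Im w)))
                 (Cpow (e2pi (Copp w)) (S i))) (borel (bessel_coef (-1) x n0) (INR (S i)))))))).
Proof.
  intros Hw. set (v := Im w). assert (Hv : 0 < v) by exact Hw. assert (Hpi := PI_RGT_0).
  assert (Hwl : forall l : Z, 0 < Im (Cplus w (RtoC (IZR l)))) by (intros; simpl; unfold Im in Hw; lra).
  assert (Hn : forall l : Z, Cplus w (RtoC (IZR l)) <> RtoC 0) by (intros; apply shift_neq_0; lra).
  assert (Hnc : forall l : Z, Cconj (Cplus w (RtoC (IZR l))) <> RtoC 0).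
  { intros l; apply Cmod_gt_0; rewrite Cmod_conj; apply Cmod_gt_0, Hn. }
  set (K := v * (1 + rsum n0 (fun b => 4 ^ b))).
  assert (HK : 0 <= K).
  { unfold K. apply Rmult_le_pos; [lra|]. assert (0 <= rsum n0 (fun b => 4 ^ b)); [|lra].
    rewrite <- (Rmult_0_r (INR n0)), <- rsum_const. apply rsum_le; intros; apply pow_le; lra. }
  set (D := fun M => Cmod A ^ n0 * K * ((2 / v * Cmod A) ^ M / INR (fact M))).
  set (ZM := fun M => Cmult (Cdiv (Cpow A (M + n0)) (RtoC (INR (fact (M + n0)))))
     (Cplus (if Nat.eqb M 0 then Copp two_pi_i else RtoC 0)
     (Cminus (Cmult (Cdiv (Cpow (Copp two_pi_i) (S M)) (RtoC (INR (fact M)))) (Li_neg M (e2pi w)))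
       (Cmult (Cdiv (Cpow two_pi_i (S M)) (RtoC (INR (fact M))))
         (fsum n0 (fun b => Cmult (RtoC ((4 * PI * Im w) ^ b / INR (fact b)))
                     (Cconj (Li_neg (M + b) (e2pi w))))))))).
  destruct (has_zsum_swap
    (fun l M => Cmult (Cdiv (Cpow A (M + n0)) (RtoC (INR (fact (M + n0)))))
                  (taylor_rest M n0 (Cplus w (RtoC (IZR l)))))
    (fun l => / Cmod (Cplus w (RtoC (IZR l))) ^ 2) D
    (fun l => seed_kernel A n0 (Cplus w (RtoC (IZR l)))) ZM) as [HZ HC].
  - intros l M. rewrite Cmod_mult, Cmod_div, Cmod_pow, Cmod_R, Rabs_pos_eq.
    2: apply pos_INR.
    2: apply fact_neq_0_C.
    assert (Hb := Cmod_taylor_rest_le M (2 * h) _ (Hwl l)). fold n0 in Hb.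
    replace (Im (Cplus w (RtoC (IZR l)))) with v in Hb by (unfold v; simpl; unfold Im; ring).
    fold K in Hb. set (y2 := / Cmod (Cplus w (RtoC (IZR l))) ^ 2) in *.
    assert (Hy2 : 0 < y2).
    { apply Rinv_0_lt_compat, pow_lt, Cmod_gt_0, Hn. }
    apply Rle_trans with ((Cmod A ^ (M + n0) / INR (fact M)) * ((2 / v) ^ M * K * y2)).
    + apply Rmult_le_compat; [|apply Cmod_ge_0| |exact Hb].
      * apply Rdiv_le_0_compat; [apply pow_le, Cmod_ge_0|apply INR_fact_lt_0].
      * apply Rmult_le_compat_l; [apply pow_le, Cmod_ge_0|].
        apply Rinv_le_contravar; [apply INR_fact_lt_0|apply le_INR, fact_le; lia].
    + right. unfold D. rewrite pow_add, Rpow_mult_distr. unfold Rdiv; ring.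
  - intros l; left. apply Rinv_0_lt_compat, pow_lt, Cmod_gt_0, Hn.
  - intros M. unfold D. apply Rmult_le_pos; [apply Rmult_le_pos; [apply pow_le, Cmod_ge_0|exact HK]|].
    apply Rdiv_le_0_compat; [|apply INR_fact_lt_0]. apply pow_le.
    apply Rmult_le_pos; [apply Rlt_le, Rdiv_lt_0_compat; lra|apply Cmod_ge_0].
  - apply ex_series_inv_sq_shift_pos, Hw.
  - apply ex_series_inv_sq_shift_neg, Hw.
  - unfold D. apply ex_series_scal_R. eexists; apply is_series_exp.
  - intros l. apply has_csum_seed_kernel; auto.
  - intros M. apply has_zsum_scal. apply (has_zsum_taylor_rest M (2 * h) w Hw).
  - eapply has_zsum_eq; [exact (has_zsum_scal (RtoC (cc ^ (2 * h))) _ _ HZ)|].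
    apply (has_csum_unique (fun M => Cmult (RtoC (cc ^ (2 * h))) (ZM M))).
    { apply has_csum_scal, HC. }
    (* The radius pi v spends half of the decay rate 2 pi v of the powers of e(w) on the growth of
       the Bessel factors and leaves the other half for convergence. *)
    assert (Hr : 0 < PI * v) by (apply Rmult_lt_0_compat; assumption).
    destruct (has_csum_borel_swap (bessel_coef 1 x n0) (fun i => Cpow (e2pi w) (S i))
       (fun i => INR (S i)) (PI * v) Hr) as [S1 _].
    { apply ex_series_bessel_coef; [rewrite Rabs_R1; lra|exact Hx|exact Hr]. }
    { eapply ex_series_ext; [|apply (ex_series_exp_decay (PI * v) Hr)].
      intros i; cbv beta. rewrite Cmod_e2pi_pow, Rabs_pos_eq, <- exp_plus by apply pos_INR.
      f_equal. fold v; ring. }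
    destruct (has_csum_borel_swap (bessel_coef (-1) x n0)
       (fun i => Cmult (RtoC (gstar n0 (4 * PI * INR (S i) * Im w))) (Cpow (e2pi (Copp w)) (S i)))
       (fun i => INR (S i)) (PI * v) Hr) as [S2 _].
    { apply ex_series_bessel_coef; [rewrite Rabs_m1; lra|exact Hx|exact Hr]. }
    (* The choice t = 1/8 leaves the decay rate 3 pi v/2, of which pi v pays for the Bessel
       factor. *)
    { apply ex_series_Rle with (fun i => rsum n0 (fun b => / (/ 8) ^ b) * exp (- (PI * v / 2 * INR (S i)))).
      - intros i; split; [apply Rmult_le_pos; [apply Cmod_ge_0|left; apply exp_pos]|].
        eapply Rle_trans; [apply Rmult_le_compat_r; [left; apply exp_pos|
          apply (Cmod_gstar_e2pi_le n0 w i (/ 8)); [exact Hw|lra]]|].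
        rewrite Rmult_assoc, <- exp_plus, Rabs_pos_eq by apply pos_INR.
        right; f_equal; f_equal. fold v. field.
      - apply ex_series_scal_R, ex_series_exp_decay. lra. }
    (* The constant -2 pi i is present for M = 0 only and yields the term x^n0/n0!. *)
    eapply has_csum_ext; [|apply has_csum_scal; apply has_csum_plus;
       [apply (has_csum_single 0)|apply has_csum_plus; [exact S1|exact S2]]].
    intros M; cbv beta.
    rewrite (CSeries_eq (fun i => Cmult (Cpow (e2pi w) (S i)) (RtoC (INR (S i) ^ M))) (Li_neg M (e2pi w))).
    2:{ eapply has_csum_ext; [|apply has_csum_Li_neg, Cmod_e2pi_lt_1, Hw]. intros; apply Cmult_comm. }
    rewrite (CSeries_eq _ _ (has_csum_nonholomorphic M n0 w Hw)).
    set (F := fsum n0 _). unfold ZM. fold F.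
    assert (HA := A_pow M).
    assert (Hf1 := fact_neq_0_C M). assert (Hf2 := fact_neq_0_C (M + n0)).
    (* The sign (-1)^M between the two powers becomes the eps of [bessel_coef]: I-Bessel in the
       holomorphic part, J-Bessel in the other. *)
    replace (Cpow two_pi_i (S M)) with (Cmult (RtoC (- (-1) ^ M)) (Cpow (Copp two_pi_i) (S M))).
    2:{ replace two_pi_i with (Cmult (RtoC (-1)) (Copp two_pi_i)) at 2 by ring.
        rewrite (Cpow_mult_l (RtoC (-1))), <- RtoC_pow. f_equal. f_equal. simpl; ring. }
    transitivity (Cmult (Cmult (RtoC (cc ^ (2 * h))) (Cmult (Cpow A (M + n0)) (Cpow (Copp two_pi_i) (S M))))
      (Cplus (if Nat.eqb M 0 then Cinv (RtoC (INR (fact (M + n0)))) else RtoC 0)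
       (Cmult (Cinv (Cmult (RtoC (INR (fact (M + n0)))) (RtoC (INR (fact M)))))
          (Cplus (Li_neg M (e2pi w)) (Cmult (RtoC ((-1) ^ M)) F))))).
    + rewrite HA. set (KK := (-1) ^ h * r0 ^ n0 * (2 * PI / cc)).
      rewrite (RtoC_mult KK), <- (Cmult_assoc (RtoC KK)). f_equal.
      unfold bessel_coef. rewrite pow1.
      assert (Hf3 := INR_fact_neq_0 (M + n0)). assert (Hf4 := INR_fact_neq_0 M).
      replace (RtoC (1 / INR (fact (M + n0)) * x ^ (2 * M + n0) / INR (fact M))) with
        (Cmult (RtoC (x ^ (2 * M + n0))) (Cinv (Cmult (RtoC (INR (fact (M + n0)))) (RtoC (INR (fact M)))))).
      2:{ rewrite <- RtoC_mult, <- RtoC_inv, <- RtoC_mult; [f_equal; field; auto|].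
          apply Rmult_integral_contrapositive; auto. }
      replace (RtoC ((-1) ^ M / INR (fact (M + n0)) * x ^ (2 * M + n0) / INR (fact M))) with
        (Cmult (Cmult (RtoC (x ^ (2 * M + n0))) (Cinv (Cmult (RtoC (INR (fact (M + n0)))) (RtoC (INR (fact M))))))
          (RtoC ((-1) ^ M))).
      2:{ rewrite <- RtoC_mult, <- RtoC_inv, <- !RtoC_mult; [f_equal; field; auto|].
          apply Rmult_integral_contrapositive; auto. }
      destruct (Nat.eqb_spec M 0) as [->|HM].
      * simpl Nat.mul. simpl Nat.add. unfold Rdiv. rewrite (RtoC_mult (x ^ n0)), RtoC_inv by apply INR_fact_neq_0.
        ring.
      * ring.
    + destruct (Nat.eqb_spec M 0) as [->|HM].
      * rewrite Cpow_1_r. simpl ((-1) ^ 0). rewrite !RtoC_opp. field; auto.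
      * rewrite !RtoC_opp. field; auto.
Qed.

(** Here the exponent 2h+2 is at least two, so after expanding the exponential Lipschitz summation
    applies to each term. The sign of the index l = eps m is reversed in the Bessel coefficient: J
    for l > 0 and I for l < 0. *)
Lemma has_zsum_poincare_kernel (eps : R) w : 0 < Im w -> Rabs eps = 1 ->
  has_zsum (fun t => Cmult (RtoC (/ cc ^ S n0)) (Cmult (Cinv (Cpow (Cplus w (RtoC (IZR t))) (S n0)))
        (Cexp (Cdiv (Cmult (RtoC (- eps)) A) (Cplus w (RtoC (IZR t)))))))
    (Cmult (RtoC (- (-1) ^ h * (2 * PI / cc) / r0 ^ n0))
      (CSeries (fun i => Cmult (Cmult (RtoC (INR (S i) ^ n0)) (Cpow (e2pi w) (S i)))
          (borel (bessel_coef (- eps) x n0) (INR (S i)))))) /\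
  has_csum (fun i => Cmult (Cmult (RtoC (INR (S i) ^ n0)) (Cpow (e2pi w) (S i)))
          (borel (bessel_coef (- eps) x n0) (INR (S i))))
    (CSeries (fun i => Cmult (Cmult (RtoC (INR (S i) ^ n0)) (Cpow (e2pi w) (S i)))
          (borel (bessel_coef (- eps) x n0) (INR (S i))))).
Proof.
  intros Hw Heps. set (v := Im w). assert (Hv : 0 < v) by exact Hw. assert (Hpi := PI_RGT_0).
  assert (Hn : forall l : Z, Cplus w (RtoC (IZR l)) <> RtoC 0) by (intros; apply shift_neq_0; lra).
  set (Al := Cmult (RtoC (- eps)) A).
  set (ZM := fun j => Cmult (Cdiv (Cpow Al j) (RtoC (INR (fact j))))
     (Cmult (Cdiv (Cpow (Copp two_pi_i) (S n0 + j)) (RtoC (INR (fact (n0 + j))))) (Li_neg (n0 + j) (e2pi w)))).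
  set (D := fun j => / v ^ (2 * h) * ((Cmod Al / v) ^ j / INR (fact j))).
  assert (Hr : 0 < PI * v) by (apply Rmult_lt_0_compat; assumption).
  destruct (has_csum_borel_swap (bessel_coef (- eps) x n0)
     (fun i => Cmult (RtoC (INR (S i) ^ n0)) (Cpow (e2pi w) (S i)))
     (fun i => INR (S i)) (PI * v) Hr) as [S1 S2].
  { apply ex_series_bessel_coef; [rewrite Rabs_Ropp; lra|exact Hx|exact Hr]. }
  { eapply ex_series_ext; [|apply (ex_series_scal_R (exp (- (PI * v)))), (ex_series_poly_geom n0 (exp (- (PI * v))))].
    - intros i; cbv beta. rewrite Cmod_mult, Cmod_R, Cmod_e2pi_pow, !Rabs_pos_eq by (try apply pow_le; apply pos_INR).
      rewrite <- exp_INR_pow. 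
      replace (exp (- (PI * v)) * (INR (S i) ^ n0 * exp (INR i * - (PI * v))))
        with (INR (S i) ^ n0 * (exp (- (PI * v)) * exp (INR i * - (PI * v)))) by ring.
      rewrite Rmult_assoc, <- !exp_plus. f_equal; f_equal. rewrite S_INR; fold v; ring.
    - split; [left; apply exp_pos|]. rewrite <- exp_0; apply exp_increasing; lra. }
  split; [|exact S2].
  destruct (has_zsum_swap
    (fun l j => Cmult (Cdiv (Cpow Al j) (RtoC (INR (fact j)))) (Cinv (Cpow (Cplus w (RtoC (IZR l))) (S n0 + j))))
    (fun l => / Cmod (Cplus w (RtoC (IZR l))) ^ 2) D
    (fun l => Cmult (Cinv (Cpow (Cplus w (RtoC (IZR l))) (S n0))) (Cexp (Cdiv Al (Cplus w (RtoC (IZR l)))))) ZM) as [HZ HC].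
  - intros l j. rewrite Cmod_mult, Cmod_div, Cmod_pow, Cmod_R, Rabs_pos_eq.
    2: apply pos_INR.
    2: apply fact_neq_0_C.
    rewrite Cmod_inv, Cmod_pow by (apply Cpow_nz, Hn).
    replace (S n0 + j)%nat with (2 * h + j + 2)%nat by (unfold n0; lia).
    eapply Rle_trans; [apply Rmult_le_compat_l; [apply Rdiv_le_0_compat;
       [apply pow_le, Cmod_ge_0|apply INR_fact_lt_0]|apply (inv_pow_le v); [exact Hv|apply Im_le_Cmod_shift, Hw]]|].
    right. unfold D, Rdiv. rewrite pow_add, Rpow_mult_distr, pow_inv, Rinv_mult. ring.
  - intros l; left. apply Rinv_0_lt_compat, pow_lt, Cmod_gt_0, Hn.
  - intros M. unfold D. apply Rmult_le_pos; [left; apply Rinv_0_lt_compat, pow_lt, Hv|].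
    apply Rdiv_le_0_compat; [|apply INR_fact_lt_0]. apply pow_le, Rdiv_le_0_compat; [apply Cmod_ge_0|exact Hv].
  - apply ex_series_inv_sq_shift_pos, Hw.
  - apply ex_series_inv_sq_shift_neg, Hw.
  - unfold D. apply ex_series_scal_R. eexists; apply is_series_exp.
  - intros l. eapply has_csum_ext; [|apply has_csum_scal, has_csum_Cexp].
    intros j; cbv beta. assert (Hnl := Hn l). unfold Cdiv.
    rewrite Cpow_mult_l, Cpow_inv, Cpow_add_r by exact Hnl.
    assert (H1 := Cpow_nz _ (S n0) Hnl). assert (H2 := Cpow_nz _ j Hnl). assert (H3 := fact_neq_0_C j).
    field; auto.
  - intros j. apply has_zsum_scal. assert (HL := lipschitz (2 * h + j) w Hw).
    replace (S (S (2 * h + j))) with (S n0 + j)%nat in HL by (unfold n0; lia).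
    replace (S (2 * h + j)) with (n0 + j)%nat in HL by (unfold n0; lia). exact HL.
  - eapply has_zsum_eq; [exact (has_zsum_scal (RtoC (/ cc ^ S n0)) _ _ HZ)|].
    apply (has_csum_unique (fun M => Cmult (RtoC (/ cc ^ S n0)) (ZM M))).
    { apply has_csum_scal, HC. }
    eapply has_csum_ext; [|apply has_csum_scal; exact S1].
    intros j; cbv beta.
    rewrite (CSeries_eq _ (Li_neg (n0 + j) (e2pi w))).
    2:{ eapply has_csum_ext; [|apply has_csum_Li_neg, Cmod_e2pi_lt_1, Hw].
        intros; cbv beta. rewrite pow_add, RtoC_mult; ring. }
    unfold ZM. set (L := Li_neg _ _).
    assert (E : Cmult (Cpow Al j) (Cpow (Copp two_pi_i) (S n0 + j)) =
       RtoC ((- eps) ^ j * x ^ (2 * j) * (- (-1) ^ h * (2 * PI) ^ S n0))).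
    { rewrite Cpow_add_r. transitivity (Cmult (Cpow (Cmult Al (Copp two_pi_i)) j) (Cpow (Copp two_pi_i) (S n0))).
      { rewrite Cpow_mult_l; ring. }
      unfold Al. rewrite <- Cmult_assoc, A_two_pi_i, <- RtoC_mult, <- RtoC_pow.
      replace (S n0) with (2 * (S h))%nat by (unfold n0; lia).
      replace (Copp two_pi_i) with (Cmult (RtoC (-1)) two_pi_i) by ring.
      rewrite (Cpow_mult_l (RtoC (-1))), two_pi_i_even_pow, <- RtoC_pow, pow_1_even, <- !RtoC_mult.
      f_equal. rewrite Rpow_mult_distr, <- pow_mult. simpl ((-1) ^ S h). ring. }
    replace (n0 + j)%nat with (j + n0)%nat by lia.
    assert (Hf1 := INR_fact_neq_0 j). assert (Hf2 := INR_fact_neq_0 (j + n0)).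
    transitivity (Cmult (Cmult (RtoC (/ cc ^ S n0 / (INR (fact j) * INR (fact (j + n0)))))
       (Cmult (Cpow Al j) (Cpow (Copp two_pi_i) (S n0 + j)))) L).
    + rewrite E, Cmult_assoc, <- !RtoC_mult. f_equal. f_equal.
      unfold bessel_coef. rewrite pow_add.
      replace (x ^ n0) with ((2 * PI) ^ n0 * r0 ^ n0 * / cc ^ n0).
      2:{ unfold x, Rdiv. rewrite !Rpow_mult_distr, pow_inv; reflexivity. }
      assert (Hc1 : cc ^ n0 <> 0) by (apply pow_nonzero; lra).
      assert (Hr1 : r0 ^ n0 <> 0) by (apply pow_nonzero; lra).
      rewrite <- !(tech_pow_Rmult _ n0). field. repeat split; auto; lra.
    + assert (Hc1 : cc ^ S n0 <> 0) by (apply pow_nonzero; lra).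
      assert (Hf3 := fact_neq_0_C j). assert (Hf4 := fact_neq_0_C (j + n0)).
      unfold Rdiv; rewrite Rinv_mult, !RtoC_mult, !RtoC_inv by assumption.
      assert (Hc2 := RtoC_neq_0 _ Hc1). field; auto.
Qed.

End Expansions.

(** * Coset sums *)

Lemma fsum_pick c p (f : nat -> C) : (p < c)%nat ->
  fsum c (fun d => if Nat.eqb p d then f d else RtoC 0) = f p.
Proof.
  intros Hp.
  assert (G : forall n, fsum n (fun d => if Nat.eqb p d then f d else RtoC 0)
     = if Nat.ltb p n then f p else RtoC 0).
  { induction n as [|n IH]; [reflexivity|]. cbn [fsum]; rewrite IH.
    destruct (Nat.ltb_spec p n), (Nat.ltb_spec p (S n)), (Nat.eqb_spec p n); subst; try lia; ring. }
  rewrite G. destruct (Nat.ltb_spec p c); [reflexivity|lia].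
Qed.

Lemma has_zsum_residues c (a : Z -> C) (L : nat -> C) : (0 < c)%nat ->
  (forall d, (d < c)%nat -> has_zsum (fun l => a (Z.of_nat d + Z.of_nat c * l)%Z) (L d)) ->
  has_zsum a (fsum c L).
Proof.
  intros Hc H.
  assert (H1 : has_csum (fun j => a (Z.of_nat j))
     (fsum c (fun d => CSeries (fun l => a (Z.of_nat d + Z.of_nat c * Z.of_nat l)%Z)))).
  { eapply has_csum_ext; [|apply has_csum_fsum; intros d Hd;
      destruct (H d Hd) as (l1 & l2 & K1 & K2 & _);
      apply (has_csum_dilute (fun l => a (Z.of_nat d + Z.of_nat c * Z.of_nat l)%Z) _ c d Hd);
      rewrite (CSeries_eq _ _ K1); exact K1].
    intros j; cbv beta.
    rewrite (fsum_pick c (j mod c) (fun d => a (Z.of_nat d + Z.of_nat c * Z.of_nat (j / c))%Z))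
      by (apply Nat.mod_upper_bound; lia).
    f_equal. assert (E := Nat.div_mod_eq j c). nia. }
  assert (H2 : has_csum (fun j => a (- Z.of_nat (S j))%Z)
     (fsum c (fun d => CSeries (fun l => a (Z.of_nat d + Z.of_nat c * - Z.of_nat (S l))%Z)))).
  { eapply has_csum_ext; [|apply has_csum_fsum; intros d Hd;
      destruct (H d Hd) as (l1 & l2 & K1 & K2 & _);
      apply (has_csum_dilute (fun l => a (Z.of_nat d + Z.of_nat c * - Z.of_nat (S l))%Z) _ c (c - 1 - d)); [lia|];
      rewrite (CSeries_eq _ _ K2); exact K2].
    intros j; cbv beta.
    assert (Hm := Nat.mod_upper_bound j c ltac:(lia)).
    (* On the negative half line -(j+1) lies in the class c-1-(j mod c), at the translate -(j/c +
       1). *)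
    rewrite (fsum_ext c _ (fun d => if Nat.eqb (c - 1 - j mod c) d
       then a (Z.of_nat d + Z.of_nat c * - Z.of_nat (S (j / c)))%Z else RtoC 0)).
    2:{ intros d Hd. destruct (Nat.eqb_spec (j mod c) (c - 1 - d)), (Nat.eqb_spec (c - 1 - j mod c) d);
          try reflexivity; lia. }
    rewrite (fsum_pick c _ (fun d => a (Z.of_nat d + Z.of_nat c * - Z.of_nat (S (j / c)))%Z)) by lia.
    f_equal. assert (E := Nat.div_mod_eq j c). nia. }
  eexists _, _; split; [exact H1|split; [exact H2|]].
  rewrite <- fsum_plus. apply fsum_ext; intros d Hd.
  symmetry. exact (CSeries_pair_eq _ _ (H d Hd)).
Qed.

(** Links the divisibility test of [coset_sum] with the pairs of [sum_units]: the congruence d x = 1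
    modulo c already forces gcd(d, c) = 1, and writing it with [1 mod c] covers c = 1. *)
Lemma is_inv_pair_spec c d x (l : Z) : (0 < c)%nat -> (d < c)%nat ->
  Z.eqb ((Z.of_nat x * (Z.of_nat d + Z.of_nat c * l) - 1) mod Z.of_nat c) 0 = is_inv_pair c d x.
Proof.
  intros Hc Hd. unfold is_inv_pair.
  assert (E : ((Z.of_nat x * (Z.of_nat d + Z.of_nat c * l) - 1) mod Z.of_nat c
     = (Z.of_nat (d * x) - 1) mod Z.of_nat c)%Z).
  { rewrite <- (Z_mod_plus_full (Z.of_nat (d * x) - 1) (Z.of_nat x * l) (Z.of_nat c)). f_equal. lia. }
  rewrite E. clear E l.
  assert (Hiff : ((Z.of_nat (d * x) - 1) mod Z.of_nat c = 0)%Z <-> ((d * x) mod c = 1 mod c)%nat).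
  { rewrite <- (Nat2Z.inj_iff ((d * x) mod c)), !Nat2Z.inj_mod.
    change (Z.of_nat 1) with 1%Z. split; intros H.
    - apply Z.mod_divide in H; [|lia]. destruct H as [q Hq].
      replace (Z.of_nat (d * x)) with (1 + q * Z.of_nat c)%Z by lia. apply Z_mod_plus_full.
    - rewrite Zminus_mod, H, <- Zminus_mod. replace (1 - 1)%Z with 0%Z by lia. apply Z.mod_0_l; lia. }
  destruct (Nat.eqb_spec ((d * x) mod c) (1 mod c)) as [H|H].
  - rewrite Bool.andb_true_r. rewrite (proj2 (Z.eqb_eq _ _) (proj2 Hiff H)).
    symmetry; apply Nat.eqb_eq.
    apply Hiff in H. apply Z.mod_divide in H; [|lia]. destruct H as [q Hq].
    assert (G1 := Nat.gcd_divide_l d c). assert (G2 := Nat.gcd_divide_r d c).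
    set (g := Nat.gcd d c) in *. destruct G1 as [u Hu]. destruct G2 as [w Hw].
    assert (Hg : (Z.of_nat g * (Z.of_nat u * Z.of_nat x - q * Z.of_nat w) = 1)%Z).
    { transitivity (Z.of_nat (d * x) - q * Z.of_nat c)%Z; [rewrite Hu, Hw; lia|lia]. }
    apply Z.mul_eq_1 in Hg. lia.
  - rewrite Bool.andb_false_r. apply Z.eqb_neq. intros H'; apply H, Hiff, H'.
Qed.

Lemma is_inv_pair_gcd c d x : is_inv_pair c d x = true -> Nat.gcd d c = 1%nat.
Proof. unfold is_inv_pair; intros H; apply andb_prop in H as [H _]; apply Nat.eqb_eq, H. Qed.

(** The entry a is the inverse of d modulo c, so it depends on the class of d only and is shared by
    all translates d + c l. A summand of the form E a times g d is therefore summed by adding g over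
    translates first and then E over units. *)
Lemma has_zsum_coset (c : nat) (F : Z -> Z -> Z -> Z -> C) (E : nat -> C) (g : Z -> C) (L : nat -> C) :
  (0 < c)%nat ->
  (forall a d, (a < c)%nat -> ((Z.of_nat a * d - 1) mod Z.of_nat c = 0)%Z ->
     F (Z.of_nat a) ((Z.of_nat a * d - 1) / Z.of_nat c)%Z (Z.of_nat c) d = Cmult (E a) (g d)) ->
  (forall d, (d < c)%nat -> Nat.gcd d c = 1%nat ->
     has_zsum (fun l => g (Z.of_nat d + Z.of_nat c * l)%Z) (L d)) ->
  has_zsum (fun d => fsum (Z.to_nat (Z.of_nat c)) (fun a0 =>
      let a := Z.of_nat a0 in
      if Z.eqb ((a * d - 1) mod Z.of_nat c)%Z 0%Z
      then F a ((a * d - 1) / Z.of_nat c)%Z (Z.of_nat c) d else RtoC 0))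
    (sum_units c (fun d x => Cmult (E x) (L d))).
Proof.
  intros Hc HF HL. rewrite Nat2Z.id. unfold sum_units.
  apply has_zsum_residues; [exact Hc|]. intros d Hd. apply has_zsum_fsum; intros x Hx.
  cbv beta zeta. destruct (is_inv_pair c d x) eqn:Hp.
  - eapply has_zsum_ext; [|apply (has_zsum_scal (E x)), HL; [exact Hd|apply (is_inv_pair_gcd _ _ _ Hp)]].
    intros l; cbv beta. rewrite is_inv_pair_spec, Hp by assumption.
    symmetry; apply HF; [exact Hx|]. apply Z.eqb_eq. rewrite is_inv_pair_spec; assumption.
  - eapply has_zsum_ext; [|apply has_zsum_0].
    intros l; cbv beta. rewrite is_inv_pair_spec, Hp by assumption. reflexivity.
Qed.

Lemma Cpowz_of_nat z n : Cpowz z (Z.of_nat n) = Cpow z n.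
Proof. destruct n; [reflexivity|]. simpl. rewrite SuccNat2Pos.id_succ; reflexivity. Qed.

Lemma Cpowz_neg z n : Cpowz z (- Z.of_nat (S n)) = Cinv (Cpow z (S n)).
Proof. simpl. rewrite SuccNat2Pos.id_succ; reflexivity. Qed.

Lemma mobius_eq (a b d : Z) (c : nat) tau : (0 < c)%nat -> (a * d - b * Z.of_nat c = 1)%Z -> Im tau <> 0 ->
  let w := Cplus tau (RtoC (IZR d / INR c)) in
  Cplus (Cmult (RtoC (IZR (Z.of_nat c))) tau) (RtoC (IZR d)) = Cmult (RtoC (INR c)) w /\
  mobius a b (Z.of_nat c) d tau =
    Cminus (RtoC (IZR a / INR c)) (Cinv (Cmult (RtoC (INR c ^ 2)) w)).
Proof.
  intros Hc Hdet Ht w.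
  assert (Hc0 : INR c <> 0) by (apply not_0_INR; lia).
  assert (HcC := RtoC_neq_0 _ Hc0).
  assert (Hw : w <> RtoC 0) by (apply shift_neq_0, Ht).
  assert (E : Cplus (Cmult (RtoC (IZR (Z.of_nat c))) tau) (RtoC (IZR d)) = Cmult (RtoC (INR c)) w).
  { unfold w. rewrite <- INR_IZR_INZ, RtoC_div by exact Hc0. field; exact HcC. }
  split; [exact E|]. unfold mobius. rewrite E, RtoC_pow.
  assert (Hb : RtoC (IZR b) = Cdiv (Cminus (Cmult (RtoC (IZR a)) (RtoC (IZR d))) (RtoC 1)) (RtoC (INR c))).
  { rewrite <- RtoC_mult, <- RtoC_minus, <- RtoC_div by exact Hc0. f_equal.
    apply (f_equal IZR) in Hdet. rewrite minus_IZR, !mult_IZR, <- INR_IZR_INZ in Hdet.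
    field_simplify_eq; [lra|exact Hc0]. }
  rewrite Hb. rewrite RtoC_div by exact Hc0.
  assert (Etau : tau = Cminus w (Cdiv (RtoC (IZR d)) (RtoC (INR c)))).
  { unfold w; rewrite RtoC_div by exact Hc0; field; exact HcC. }
  rewrite Etau at 1. field; auto.
Qed.

Lemma slash_qpow n (l a b d : Z) (c : nat) tau : (0 < c)%nat -> (a * d - b * Z.of_nat c = 1)%Z -> Im tau <> 0 ->
  let w := Cplus tau (RtoC (IZR d / INR c)) in
  slash (Z.of_nat (S n)) (qpow l) a b (Z.of_nat c) d tau =
  Cmult (e2pi (RtoC (IZR l * IZR a / INR c)))
    (Cmult (RtoC (/ INR c ^ S n)) (Cmult (Cinv (Cpow w (S n)))
      (Cexp (Cdiv (Copp (Cmult two_pi_i (RtoC (IZR l / INR c ^ 2)))) w)))).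
Proof.
  intros Hc Hdet Ht w. destruct (mobius_eq a b d c tau Hc Hdet Ht) as [E1 E2]. fold w in E1, E2.
  assert (Hc0 : INR c <> 0) by (apply not_0_INR; lia).
  assert (HcC := RtoC_neq_0 _ Hc0).
  assert (Hw : w <> RtoC 0) by (apply shift_neq_0, Ht).
  unfold slash. rewrite E1, E2, Cpowz_neg, Cpow_mult_l. unfold qpow.
  replace (Cmult (RtoC (IZR l)) (Cminus (RtoC (IZR a / INR c)) (Cinv (Cmult (RtoC (INR c ^ 2)) w))))
    with (Cplus (RtoC (IZR l * IZR a / INR c)) (Cmult (RtoC (IZR l)) (Copp (Cinv (Cmult (RtoC (INR c ^ 2)) w))))).
  2:{ unfold Rdiv; rewrite !RtoC_mult; ring. }
  rewrite e2pi_plus.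
  replace (e2pi (Cmult (RtoC (IZR l)) (Copp (Cinv (Cmult (RtoC (INR c ^ 2)) w)))))
    with (Cexp (Cdiv (Copp (Cmult two_pi_i (RtoC (IZR l / INR c ^ 2)))) w)).
  2:{ unfold e2pi; fold two_pi_i. f_equal. rewrite RtoC_div, RtoC_pow by (apply pow_nonzero, Hc0). field; auto. }
  assert (H1 := Cpow_nz _ (S n) HcC). assert (H2 := Cpow_nz _ (S n) Hw).
  rewrite RtoC_inv, RtoC_pow by (apply pow_nonzero, Hc0). field; auto.
Qed.

Lemma sum_f_R0_rsum (a : nat -> R) n : sum_f_R0 a n = rsum (S n) a.
Proof. rewrite <- sum_n_Reals; apply rsum_sum_n. Qed.

Lemma GammaInc_gstar n y : GammaInc (S n) y = INR (fact n) * gstar (S n) y.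
Proof.
  unfold GammaInc, gstar. replace (S n - 1)%nat with n by lia.
  rewrite sum_f_R0_rsum; ring.
Qed.

Lemma GammaStar_gstar n y : GammaStar (S n) y = gstar (S n) y.
Proof.
  unfold GammaStar. rewrite GammaInc_gstar. replace (S n - 1)%nat with n by lia.
  field. apply INR_fact_neq_0.
Qed.

(** With X = A/w one has A/conj w = - conj X, so the argument of the truncated exponential is 2 Re X
    = 4 pi m Im(gamma tau), the variable of the incomplete gamma function in the seed. *)
Lemma slash_maass_seed h (m : nat) (a b d : Z) (c : nat) tau :
  (0 < c)%nat -> (a * d - b * Z.of_nat c = 1)%Z -> 0 < Im tau ->
  let k := (- Z.of_nat (2 * h))%Z in
  let w := Cplus tau (RtoC (IZR d / INR c)) in
  slash k (maass_seed k m) a b (Z.of_nat c) d tau =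
  Cmult (e2pi (RtoC (- INR m * IZR a / INR c)))
    (Cmult (RtoC (INR c ^ (2 * h)))
       (seed_kernel (Cmult two_pi_i (RtoC (INR m / INR c ^ 2))) (S (2 * h)) w)).
Proof.
  intros Hc Hdet Ht k w. destruct (mobius_eq a b d c tau Hc Hdet ltac:(lra)) as [E1 E2]. fold w in E1, E2.
  assert (Hc0 : INR c <> 0) by (apply not_0_INR; lia).
  assert (HcC := RtoC_neq_0 _ Hc0).
  assert (Hw : w <> RtoC 0) by (apply shift_neq_0; lra).
  assert (Hwb : Cconj w <> RtoC 0) by (apply Cmod_gt_0; rewrite Cmod_conj; apply Cmod_gt_0, Hw).
  set (A := Cmult two_pi_i (RtoC (INR m / INR c ^ 2))).
  unfold slash. rewrite E1, E2. replace (- k)%Z with (Z.of_nat (2 * h)) by (unfold k; lia).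
  rewrite Cpowz_of_nat, Cpow_mult_l. unfold maass_seed.
  replace (Z.to_nat (1 - k)) with (S (2 * h)) by (unfold k; lia). rewrite GammaStar_gstar.
  set (g := Cminus (RtoC (IZR a / INR c)) (Cinv (Cmult (RtoC (INR c ^ 2)) w))).
  set (y := 4 * PI * INR m * Im g).
  set (X := Cdiv A w).
  assert (HX : X = Cmult two_pi_i (Cmult (RtoC (INR m)) (Cinv (Cmult (RtoC (INR c ^ 2)) w)))).
  { unfold X, A. rewrite RtoC_div, !RtoC_pow by (apply pow_nonzero, Hc0). field; auto. }
  assert (HY : Cdiv A (Cconj w) = Copp (Cconj X)).
  { unfold X. rewrite Cdiv_conj by exact Hw. unfold A. rewrite Cmult_conj.
    replace (Cconj two_pi_i) with (Copp two_pi_i) by (unfold two_pi_i; apply C_eq; simpl; ring).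
    replace (Cconj (RtoC (INR m / INR c ^ 2))) with (RtoC (INR m / INR c ^ 2)) by (apply C_eq; simpl; ring).
    unfold Cdiv; ring. }
  assert (Hy : Cminus X (Copp (Cconj X)) = RtoC y).
  { unfold y, g. rewrite HX. set (z := Cinv _). unfold two_pi_i. apply C_eq; simpl; unfold Im; simpl; ring. }
  assert (HeY : Cexp (Copp (Cconj X)) = Cmult (Cexp X) (RtoC (exp (- y)))).
  { replace (Copp (Cconj X)) with (Cplus X (Copp (RtoC y))) by (rewrite <- Hy; ring).
    rewrite Cexp_plus. f_equal. unfold Cexp; apply C_eq; simpl; rewrite Ropp_0; rewrite ?cos_0, ?sin_0; ring. }
  unfold seed_kernel. fold X. rewrite HY, Hy, HeY.
  replace (qpow (- Z.of_nat m) g) with (Cmult (e2pi (RtoC (- INR m * IZR a / INR c))) (Cexp X)).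
  2:{ unfold qpow. rewrite opp_IZR, <- INR_IZR_INZ.
      replace (Cmult (RtoC (- INR m)) g) with (Cplus (RtoC (- INR m * IZR a / INR c))
         (Cmult (RtoC (INR m)) (Cinv (Cmult (RtoC (INR c ^ 2)) w)))).
      2:{ unfold g. unfold Rdiv. rewrite !RtoC_mult, RtoC_opp. ring. }
      rewrite e2pi_plus. f_equal. rewrite HX. unfold e2pi; fold two_pi_i. reflexivity. }
  replace (exp_taylor (S (2 * h)) (RtoC y)) with (RtoC (rsum (S (2 * h)) (fun j => y ^ j / INR (fact j)))).
  2:{ unfold exp_taylor. rewrite <- fsum_RtoC. apply fsum_ext; intros j _.
      rewrite RtoC_div, RtoC_pow by apply INR_fact_neq_0. reflexivity. }
  unfold gstar. rewrite RtoC_minus, RtoC_mult, RtoC_pow, (Cpow_S w).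
  field. exact Hw.
Qed.

(** * Evaluation of the contour integrals *)

Definition laurent (co : nat -> R) (s : C) : C :=
  CSeries (fun j => Cmult (RtoC (co j)) (Cinv (Cpow s (S j)))).

Lemma Cmod_Cexp_circle_le r th : 0 < r -> Cmod (Cexp (circle r th)) <= exp r.
Proof.
  intros Hr; rewrite Cmod_Cexp; apply exp_le.
  eapply Rle_trans; [apply Rle_abs|]. rewrite <- (Cmod_circle r th Hr) at 2. apply re_le_Cmod.
Qed.

Lemma Cmod_Cexp_circle_ge r th : 0 < r -> exp (- r) <= Cmod (Cexp (circle r th)).
Proof.
  intros Hr; rewrite Cmod_Cexp; apply exp_le.
  assert (H := re_le_Cmod (circle r th)). rewrite Cmod_circle in H by exact Hr.
  apply Rabs_le_between in H; lra.
Qed.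

Lemma Cexp_scal_INR n s : Cexp (Cmult (RtoC (INR n)) s) = Cpow (Cexp s) n.
Proof. symmetry; apply Cexp_pow. Qed.

Lemma Cexp_scal_opp_INR n s : Cexp (Cmult (RtoC (- INR n)) s) = Cpow (Cinv (Cexp s)) n.
Proof.
  rewrite <- Cexp_opp, Cexp_pow; f_equal. rewrite RtoC_opp; ring.
Qed.

Lemma ex_series_geom_scaled (b : nat -> R) z r lam :
  0 <= z -> z * exp r < 1 -> (forall n, Rabs (lam n) <= INR (S n)) -> 0 < r ->
  (forall n, 0 <= b n <= z ^ n) -> ex_series (fun n => b n * exp (Rabs (lam n) * r)).
Proof.
  intros Hz Hzr Hl Hr Hb. assert (He := exp_pos r).
  apply ex_series_Rle with (fun n => exp r * (z * exp r) ^ n).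
  - intros n; split; [apply Rmult_le_pos; [apply Hb|left; apply exp_pos]|].
    rewrite Rpow_mult_distr. replace (exp r * (z ^ n * exp r ^ n)) with (z ^ n * exp r ^ S n) by (simpl; ring).
    apply Rmult_le_compat; [apply Hb|left; apply exp_pos|apply Hb|].
    rewrite <- exp_INR_pow. apply exp_le. apply Rmult_le_compat_r; [lra|apply Hl].
  - apply ex_series_scal_R, ex_series_geom. rewrite Rabs_pos_eq; [exact Hzr|]. apply Rmult_le_pos; lra.
Qed.

Lemma contour_geom_inside co r Z : 0 < r -> Cmod Z * exp r < 1 ->
  ex_series (fun j => Rabs (co j) * / r ^ S j) ->
  contour r (fun s => Cdiv (Cmult (laurent co s) (Cexp s)) (Cminus (RtoC 1) (Cmult (Cexp s) Z)))
  = CSeries (fun n => Cmult (Cpow Z n) (borel co (INR (S n)))).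
Proof.
  intros Hr HZ Hco. apply contour_eq.
  eapply is_contour_ext; [|apply (is_contour_laurent_series r co (fun n => Cpow Z n) (fun n => INR (S n)) Hr Hco)].
  - intros th; cbv beta. fold (laurent co (circle r th)). unfold Cdiv. rewrite <- Cmult_assoc. f_equal.
    apply CSeries_eq. eapply has_csum_ext; [|apply (has_csum_scal (Cexp (circle r th))), has_csum_geom].
    + intros n; cbv beta. rewrite Cexp_scal_INR, Cpow_mult_l, Cpow_S. ring.
    + rewrite Cmod_mult. eapply Rle_lt_trans; [|exact HZ]. rewrite Rmult_comm.
      apply Rmult_le_compat_l; [apply Cmod_ge_0|apply Cmod_Cexp_circle_le, Hr].
  - apply (ex_series_geom_scaled _ (Cmod Z)); auto using Cmod_ge_0.
    + intros n; rewrite Rabs_pos_eq; [lra|apply pos_INR].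
    + intros n; rewrite Cmod_pow; split; [apply pow_le, Cmod_ge_0|lra].
Qed.

(** Outside the unit disc e^s/(1 - e^s Z) is minus the sum over n >= 0 of Z^(-n-1) e^(-n s). The
    index n = 0 carries no exponential and later yields the constant term. *)
Lemma contour_geom_outside co r Z : 0 < r -> exp r < Cmod Z ->
  ex_series (fun j => Rabs (co j) * / r ^ S j) ->
  contour r (fun s => Cdiv (Cmult (laurent co s) (Cexp s)) (Cminus (RtoC 1) (Cmult (Cexp s) Z)))
  = CSeries (fun n => Cmult (Copp (Cpow (Cinv Z) (S n))) (borel co (- INR n))).
Proof.
  intros Hr HZ Hco. assert (He := exp_pos r).
  assert (HZ0 : Z <> RtoC 0) by (apply Cmod_gt_0; lra).
  assert (HZi : Cmod (Cinv Z) * exp r < 1).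
  { rewrite Cmod_inv by exact HZ0. apply (Rmult_lt_reg_l (Cmod Z)); [lra|].
    rewrite <- Rmult_assoc, Rinv_r by lra. lra. }
  apply contour_eq.
  eapply is_contour_ext; [|apply (is_contour_laurent_series r co (fun n => Copp (Cpow (Cinv Z) (S n))) (fun n => - INR n) Hr Hco)].
  - intros th; cbv beta. fold (laurent co (circle r th)). unfold Cdiv. rewrite <- Cmult_assoc. f_equal.
    set (E := Cexp (circle r th)).
    assert (HE : E <> RtoC 0) by apply Cexp_neq_0.
    assert (Hlt : Cmod (Cmult (Cinv E) (Cinv Z)) < 1).
    { rewrite Cmod_mult. eapply Rle_lt_trans; [|exact HZi]. rewrite Rmult_comm.
      apply Rmult_le_compat_l; [apply Cmod_ge_0|]. rewrite Cmod_inv by exact HE.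
      rewrite <- (Rinv_inv (exp r)), <- exp_Ropp. apply Rinv_le_contravar; [apply exp_pos|].
      apply Cmod_Cexp_circle_ge, Hr. }
    assert (HEZ : Cminus (Cmult E Z) (RtoC 1) <> RtoC 0).
    { apply Cminus_eq_contra; intros H. 
      replace (Cmult (Cinv E) (Cinv Z)) with (Cinv (Cmult E Z)) in Hlt by (field; auto).
      rewrite H, Cmod_inv, Cmod_1 in Hlt by apply C1_nz. lra. }
    assert (HEZ' : Cminus (RtoC 1) (Cmult E Z) <> RtoC 0).
    { intros H; apply HEZ. transitivity (Copp (Cminus (RtoC 1) (Cmult E Z))); [ring|rewrite H; ring]. }
    apply CSeries_eq. eapply has_csum_eq; [eapply has_csum_ext; [|apply (has_csum_scal (Copp (Cinv Z))), has_csum_geom, Hlt]|].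
    + intros n; cbv beta. rewrite Cexp_scal_opp_INR, Cpow_mult_l, Cpow_S. fold E. ring.
    + field; repeat split; auto.
  - apply (ex_series_geom_scaled _ (Cmod (Cinv Z))); auto using Cmod_ge_0.
    + intros n; rewrite Rabs_Ropp, Rabs_pos_eq, S_INR; [lra|apply pos_INR].
    + intros n; rewrite Cmod_opp, Cmod_pow; split; [apply pow_le, Cmod_ge_0|].
      simpl. rewrite <- (Rmult_1_l (Cmod (Cinv Z) ^ n)) at 2.
      apply Rmult_le_compat_r; [apply pow_le, Cmod_ge_0|].
      assert (1 <= exp r) by (rewrite <- exp_0; apply exp_le; lra).
      assert (H0 := Cmod_ge_0 (Cinv Z)). nra.
Qed.

Lemma ex_series_poly_geom_scaled p z r : 0 <= z -> z * exp r < 1 ->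
  ex_series (fun i => INR (S i) ^ p * z ^ S i * exp (Rabs (INR (S i)) * r)).
Proof.
  intros Hz Hzr. assert (He := exp_pos r).
  eapply ex_series_ext; [|apply (ex_series_scal_R (z * exp r)), (ex_series_poly_geom p (z * exp r))].
  - intros i; cbv beta. rewrite Rabs_pos_eq, exp_INR_pow, Rpow_mult_distr by apply pos_INR. simpl; ring.
  - split; [apply Rmult_le_pos; lra|exact Hzr].
Qed.

Lemma contour_Li_inside co r p Z : 0 < r -> Cmod Z * exp r < 1 ->
  ex_series (fun j => Rabs (co j) * / r ^ S j) ->
  contour r (fun s => Cmult (laurent co s) (Li_neg p (Cmult (Cexp s) Z)))
  = CSeries (fun i => Cmult (Cmult (RtoC (INR (S i) ^ p)) (Cpow Z (S i))) (borel co (INR (S i)))).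
Proof.
  intros Hr HZ Hco. apply contour_eq.
  eapply is_contour_ext; [|apply (is_contour_laurent_series r co
     (fun i => Cmult (RtoC (INR (S i) ^ p)) (Cpow Z (S i))) (fun i => INR (S i)) Hr Hco)].
  - intros th; cbv beta. fold (laurent co (circle r th)). f_equal.
    apply CSeries_eq. eapply has_csum_ext; [|apply has_csum_Li_neg].
    + intros n; cbv beta. rewrite Cexp_scal_INR, Cpow_mult_l. ring.
    + rewrite Cmod_mult. eapply Rle_lt_trans; [|exact HZ]. rewrite Rmult_comm.
      apply Rmult_le_compat_l; [apply Cmod_ge_0|apply Cmod_Cexp_circle_le, Hr].
  - eapply ex_series_ext; [|apply (ex_series_poly_geom_scaled p (Cmod Z) r); [apply Cmod_ge_0|exact HZ]].
    intros i; cbv beta. rewrite Cmod_mult, Cmod_R, Cmod_pow, (Rabs_pos_eq (_ ^ _)); [reflexivity|apply pow_le, pos_INR].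
Qed.

Lemma contour_Li_outside co r p Z : Nat.Odd p -> 0 < r -> exp r < Cmod Z ->
  ex_series (fun j => Rabs (co j) * / r ^ S j) ->
  contour r (fun s => Cmult (laurent co s) (Li_neg p (Cmult (Cexp s) Z)))
  = CSeries (fun i => Cmult (Cmult (RtoC (INR (S i) ^ p)) (Cpow (Cinv Z) (S i))) (borel co (- INR (S i)))).
Proof.
  intros Hp Hr HZ Hco. assert (He := exp_pos r).
  assert (HZ0 : Z <> RtoC 0) by (apply Cmod_gt_0; lra).
  assert (HZi : Cmod (Cinv Z) * exp r < 1).
  { rewrite Cmod_inv by exact HZ0. apply (Rmult_lt_reg_l (Cmod Z)); [lra|].
    rewrite <- Rmult_assoc, Rinv_r by lra. lra. }
  apply contour_eq.
  eapply is_contour_ext; [|apply (is_contour_laurent_series r co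
     (fun i => Cmult (RtoC (INR (S i) ^ p)) (Cpow (Cinv Z) (S i))) (fun i => - INR (S i)) Hr Hco)].
  - intros th; cbv beta. fold (laurent co (circle r th)). f_equal.
    apply CSeries_eq. eapply has_csum_ext; [|apply has_csum_Li_neg_inv; [exact Hp|]].
    + intros n; cbv beta. rewrite Cexp_scal_opp_INR.
      replace (Cinv (Cmult (Cexp (circle r th)) Z)) with (Cmult (Cinv (Cexp (circle r th))) (Cinv Z))
        by (field; split; [exact HZ0|apply Cexp_neq_0]).
      rewrite Cpow_mult_l. ring.
    + rewrite Cmod_mult. assert (H := Cmod_Cexp_circle_ge r th Hr).
      apply Rlt_le_trans with (exp (- r) * Cmod Z).
      * rewrite exp_Ropp. apply (Rmult_lt_reg_l (exp r)); [exact He|].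
        rewrite <- Rmult_assoc, Rinv_r by lra. lra.
      * apply Rmult_le_compat_r; [lra|exact H].
  - eapply ex_series_ext; [|apply (ex_series_poly_geom_scaled p (Cmod (Cinv Z)) r); [apply Cmod_ge_0|exact HZi]].
    intros i; cbv beta. rewrite Cmod_mult, Cmod_R, Cmod_pow, (Rabs_pos_eq (_ ^ _)), Rabs_Ropp; [reflexivity|apply pow_le, pos_INR].
Qed.

(** Negating lam exchanges the I- and J-Bessel functions. Accordingly alpha^+ leads to I above and
    to J below the real axis, and alpha^- the other way round. *)
Lemma borel_bessel_opp eps x n lam :
  borel (bessel_coef eps x n) (- lam) = borel (bessel_coef (- eps) x n) lam.
Proof.
  apply CSeries_ext; intros j. rewrite <- !RtoC_mult. f_equal. unfold bessel_coef.
  replace (- lam) with (-1 * lam) by ring. replace (- eps) with (-1 * eps) by ring.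
  rewrite !Rpow_mult_distr. unfold Rdiv; ring.
Qed.

(** * The incomplete gamma integral *)

Lemma is_derive_gstar n y : is_derive (gstar (S n)) y (- (y ^ n * exp (- y) / INR (fact n))).
Proof.
  induction n as [|n IH].
  - apply is_derive_ext with (fun y => exp (- y)).
    + intros t; unfold gstar; simpl; field.
    + auto_derive; [auto|]. simpl; field.
  - apply is_derive_ext with (fun y => gstar (S n) y + exp (- y) * (y ^ S n / INR (fact (S n)))).
    + intros t. match goal with |- ?a = ?b => change (@eq R a b) end. unfold gstar; cbn [rsum]; ring.
    + evar_last.
      * apply (is_derive_plus (gstar (S n)) (fun y => exp (- y) * (y ^ S n / INR (fact (S n))))); [exact IH|].
        auto_derive; [auto|reflexivity].
      * simpl. change (match n with O => 1 | S _ => INR n + 1 end) with (INR (S n)).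
        replace (INR (fact n + n * fact n)) with (INR (S n) * INR (fact n))
          by (rewrite <- mult_INR; reflexivity).
        assert (H1 := INR_fact_neq_0 n). assert (H2 := not_0_INR (S n) ltac:(lia)).
        unfold plus; simpl. field; auto.
Qed.

Lemma is_RInt_gamma n lam T : 0 < lam -> 1 <= T ->
  is_RInt (fun t => t ^ n * exp (- (lam * t))) 1 T
    (INR (fact n) / lam ^ S n * (gstar (S n) lam - gstar (S n) (lam * T))).
Proof.
  intros Hl HT.
  assert (H1 := INR_fact_neq_0 n). assert (H2 := pow_nonzero lam (S n) ltac:(lra)).
  evar_last.
  - apply (is_RInt_derive (V := R_CompleteNormedModule)
      (fun t => - (INR (fact n) / lam ^ S n * gstar (S n) (lam * t)))).
    + intros t _. evar_last.
      * apply (is_derive_opp (fun t => INR (fact n) / lam ^ S n * gstar (S n) (lam * t))).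
        apply (is_derive_scal (fun t => gstar (S n) (lam * t)) t (INR (fact n) / lam ^ S n)).
        apply (is_derive_comp (gstar (S n)) (fun t => lam * t) t); [apply is_derive_gstar|].
        auto_derive; [auto|reflexivity].
      * unfold opp, scal; simpl; unfold mult; simpl. rewrite Rpow_mult_distr.
        assert (H3 := pow_nonzero lam n ltac:(lra)). assert (H4 : lam <> 0) by lra. simpl. field; auto.
    + intros u _; apply (ex_derive_continuous (V := R_NormedModule)); auto_derive; auto.
  - unfold minus, plus, opp; simpl. rewrite Rmult_1_r. ring.
Qed.

Lemma gstar_nonneg n y : 0 <= y -> 0 <= gstar n y.
Proof.
  intros Hy. unfold gstar. apply Rmult_le_pos; [left; apply exp_pos|].
  rewrite <- (Rmult_0_r (INR n)), <- rsum_const. apply rsum_le; intros.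
  apply Rdiv_le_0_compat; [apply pow_le, Hy|apply INR_fact_lt_0].
Qed.

Lemma gstar_le n y t : 0 <= y -> 0 < t ->
  gstar n y <= rsum n (fun b => / t ^ b) * exp (- ((1 - t) * y)).
Proof.
  intros Hy Ht. unfold gstar.
  eapply Rle_trans; [apply Rmult_le_compat_l; [left; apply exp_pos|apply (exp_taylor_R_le n y t Hy Ht)]|].
  right. rewrite Rmult_comm, Rmult_assoc, <- exp_plus. f_equal. f_equal. ring.
Qed.

(* The series converges uniformly on each [1, T] and the remainder decays exponentially in [T]. *)
Lemma is_RInt_gen_gamma_series (n : nat) (b : nat -> C) (mu t0 : R) : 0 < mu -> 0 < t0 < 1 ->
  ex_series (fun i => Cmod (b i) * exp (- ((1 - t0) * (mu * INR (S i))))) ->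
  @is_RInt_gen C_R_NormedModule
    (fun t => Cmult (RtoC (t ^ n)) (CSeries (fun i => Cmult (b i) (RtoC (exp (- (mu * INR (S i) * t)))))))
    (at_point 1) (Rbar_locally p_infty)
    (CSeries (fun i => Cmult (b i) (RtoC (INR (fact n) / (mu * INR (S i)) ^ S n * gstar (S n) (mu * INR (S i)))))).
Proof.
  intros Hmu Ht0 Hex.
  assert (Hl : forall i, 0 < mu * INR (S i)).
  { intros i; apply Rmult_lt_0_compat; [exact Hmu|apply lt_0_INR; lia]. }
  assert (Hmul : forall i, mu <= mu * INR (S i)).
  { intros i. rewrite <- (Rmult_1_r mu) at 1. apply Rmult_le_compat_l; [lra|].
    rewrite S_INR; generalize (pos_INR i); lra. }
  set (lam := fun i => mu * INR (S i)) in *.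
  set (fcoef := fun i => INR (fact n) / lam i ^ S n).
  assert (Hfc : forall i, 0 <= fcoef i <= INR (fact n) / mu ^ S n).
  { intros i; split; [apply Rdiv_le_0_compat; [apply pos_INR|apply pow_lt, Hl]|].
    apply Rmult_le_compat_l; [apply pos_INR|]. apply Rinv_le_contravar; [apply pow_lt, Hmu|].
    apply pow_incr; split; [lra|apply Hmul]. }
  set (SK := rsum (S n) (fun j => / t0 ^ j)).
  assert (HSK : 0 <= SK).
  { unfold SK. rewrite <- (Rmult_0_r (INR (S n))), <- rsum_const. apply rsum_le; intros.
    left; apply Rinv_0_lt_compat, pow_lt; lra. }
  set (K := INR (fact n) / mu ^ S n * SK).
  assert (HK : 0 <= K).
  { apply Rmult_le_pos; [|exact HSK]. apply Rdiv_le_0_compat; [apply pos_INR|apply pow_lt, Hmu]. }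
  (* T is split as (T-1) + 1: the part T-1, taken at the lowest frequency mu, gives decay uniform in
     i, and the part 1 keeps the frequency of i and gives summability. *)
  assert (Hrem : forall T i, 1 <= T -> Cmod (Cmult (b i) (RtoC (fcoef i * gstar (S n) (lam i * T))))
     <= K * exp (- ((1 - t0) * (mu * (T - 1)))) * (Cmod (b i) * exp (- ((1 - t0) * (mu * INR (S i)))))).
  { intros T i HT. assert (HlT : 0 <= lam i * T) by (apply Rmult_le_pos; [left; apply Hl|lra]).
    rewrite Cmod_mult, Cmod_R, Rabs_pos_eq.
    2: apply Rmult_le_pos; [apply Hfc|apply gstar_nonneg, HlT].
    apply Rle_trans with (Cmod (b i) * (INR (fact n) / mu ^ S n * (SK * exp (- ((1 - t0) * (lam i * T)))))).
    - apply Rmult_le_compat_l; [apply Cmod_ge_0|].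
      apply Rmult_le_compat; [apply Hfc|apply gstar_nonneg, HlT|apply Hfc|].
      apply gstar_le; [exact HlT|lra].
    - replace (K * exp (- ((1 - t0) * (mu * (T - 1)))) * (Cmod (b i) * exp (- ((1 - t0) * (mu * INR (S i))))))
        with (Cmod (b i) * (INR (fact n) / mu ^ S n * (SK *
          (exp (- ((1 - t0) * (mu * (T - 1)))) * exp (- ((1 - t0) * (mu * INR (S i)))))))) by (unfold K; ring).
      rewrite <- exp_plus. fold (lam i).
      apply Rmult_le_compat_l; [apply Cmod_ge_0|].
      apply Rmult_le_compat_l; [apply Rdiv_le_0_compat; [apply pos_INR|apply pow_lt, Hmu]|].
      apply Rmult_le_compat_l; [exact HSK|]. apply exp_le.
      assert (H1 : mu * (T - 1) <= lam i * (T - 1)) by (apply Rmult_le_compat_r; [lra|apply Hmul]).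
      assert (H2 : 0 < 1 - t0) by lra. nra. }
  assert (Hsum : forall T, 1 <= T -> has_csum (fun i => Cmult (b i) (RtoC (fcoef i * gstar (S n) (lam i * T))))
      (CSeries (fun i => Cmult (b i) (RtoC (fcoef i * gstar (S n) (lam i * T)))))).
  { intros T HT. eapply has_csum_CSeries; [intros i; apply (Hrem T i HT)|]. apply ex_series_scal_R, Hex. }
  set (Rem := fun T => CSeries (fun i => Cmult (b i) (RtoC (fcoef i * gstar (S n) (lam i * T))))) in *.
  set (I0 := CSeries _).
  assert (HI0 : I0 = Rem 1).
  { apply CSeries_ext; intros i. rewrite Rmult_1_r; reflexivity. }
  set (f := fun t => Cmult (RtoC (t ^ n)) (CSeries (fun i => Cmult (b i) (RtoC (exp (- (mu * INR (S i) * t))))))).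
  assert (HT : forall T, 1 < T -> @is_RInt C_R_NormedModule f 1 T (Cminus I0 (Rem T))).
  (* Freezing t outside [1, T] provides the majorant on the whole line that [is_CInt_CSeries] asks
     for. *)
  { intros T HT1. set (clamp := fun t => Rmax 1 (Rmin t T)).
    assert (Hcl : forall t, 1 <= clamp t <= T).
    { intros t; unfold clamp; split; [apply Rmax_l|]. apply Rmax_lub; [lra|apply Rmin_r]. }
    assert (Hcl2 : forall t, 1 < t < T -> clamp t = t).
    { intros t Ht; unfold clamp. rewrite Rmin_left, Rmax_right; lra. }
    assert (HS : is_CInt (fun t => CSeries (fun i => Cmult (b i) (RtoC (clamp t ^ n * exp (- (lam i * clamp t)))))) 1 T
      (CSeries (fun i => Cmult (b i) (RtoC (fcoef i * (gstar (S n) (lam i) - gstar (S n) (lam i * T))))))).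
    { apply is_CInt_CSeries with (fun i => T ^ n * (Cmod (b i) * exp (- ((1 - t0) * (mu * INR (S i)))))).
      - intros i. apply is_CInt_scal. assert (HG := is_RInt_gamma n (lam i) T (Hl i) ltac:(lra)). split; simpl.
        + eapply is_RInt_ext, HG. rewrite Rmin_left, Rmax_right by lra.
          intros t Ht. simpl. rewrite Hcl2 by exact Ht. reflexivity.
        + assert (H := is_RInt_const (V := R_NormedModule) 1 T 0).
          unfold scal in H; simpl in H; unfold mult in H; simpl in H. rewrite Rmult_0_r in H; exact H.
      - intros i t. rewrite Cmod_mult, Cmod_R. specialize (Hcl t).
        rewrite Rabs_pos_eq by (apply Rmult_le_pos; [apply pow_le; lra|left; apply exp_pos]).
        replace (T ^ n * (Cmod (b i) * exp (- ((1 - t0) * (mu * INR (S i))))))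
          with (Cmod (b i) * (T ^ n * exp (- ((1 - t0) * (mu * INR (S i)))))) by ring.
        apply Rmult_le_compat_l; [apply Cmod_ge_0|].
        apply Rmult_le_compat; [apply pow_le; lra|left; apply exp_pos|apply pow_incr; lra|].
        apply exp_le. fold (lam i). assert (Hli : 0 < lam i) by apply Hl.
        assert (lam i <= lam i * clamp t) by (rewrite <- (Rmult_1_r (lam i)) at 1; apply Rmult_le_compat_l; lra).
        nra.
      - apply ex_series_scal_R, Hex. }
    replace (Cminus I0 (Rem T)) with
      (CSeries (fun i => Cmult (b i) (RtoC (fcoef i * (gstar (S n) (lam i) - gstar (S n) (lam i * T)))))).
    2:{ apply CSeries_eq. rewrite HI0.
        eapply has_csum_ext; [|apply (has_csum_plus _ _ _ _ (Hsum 1 ltac:(lra)) (has_csum_opp _ _ (Hsum T ltac:(lra))))].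
        intros i; cbv beta. rewrite Rmult_1_r, Rmult_minus_distr_l, RtoC_minus. ring. }
    eapply is_RInt_ext, is_CInt_is_RInt, HS.
    rewrite Rmin_left, Rmax_right by lra. intros t Ht. unfold f.
    rewrite Hcl2 by exact Ht.
    assert (Hs : has_csum (fun i => Cmult (b i) (RtoC (exp (- (mu * INR (S i) * t)))))
       (CSeries (fun i => Cmult (b i) (RtoC (exp (- (mu * INR (S i) * t))))))).
    { apply has_csum_CSeries with (2 := Hex). intros i. rewrite Cmod_mult, Cmod_R, Rabs_pos_eq by (left; apply exp_pos).
      apply Rmult_le_compat_l; [apply Cmod_ge_0|]. apply exp_le. specialize (Hl i). unfold lam in Hl. nra. }
    apply CSeries_eq. eapply has_csum_ext; [|apply (has_csum_scal (RtoC (t ^ n))), Hs].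
    intros i; cbv beta. unfold lam. rewrite RtoC_mult. ring. }
  assert (Hdec : forall eps : posreal, exists T0, 1 <= T0 /\ forall T, T0 < T -> Cmod (Rem T) < eps).
  { intros eps. destruct Hex as [B HB]. assert (Heps := cond_pos eps).
    set (KB := K * Rabs B). set (s0 := (1 - t0) * mu).
    assert (HKB : 0 <= KB) by (apply Rmult_le_pos; [exact HK|apply Rabs_pos]).
    assert (Hs0 : 0 < s0) by (apply Rmult_lt_0_compat; lra).
    (* Chosen so that the elementary bound exp y >= 1 + y already gives KB exp(-y) < eps. *)
    exists (1 + KB / (eps * s0)).
    assert (HT0 : 0 <= KB / (eps * s0)).
    { apply Rdiv_le_0_compat; [exact HKB|apply Rmult_lt_0_compat; assumption]. }
    split; [lra|]. intros T HTT.
    set (y := s0 * (T - 1)).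
    assert (Hy : KB / eps < y).
    { unfold y. replace (KB / eps) with (s0 * (KB / (eps * s0))) by (field; lra).
      apply Rmult_lt_compat_l; lra. }
    assert (HyK : KB < eps * (1 + y)).
    { apply Rlt_trans with (eps * y).
      - replace KB with (eps * (KB / eps)) by (field; lra). apply Rmult_lt_compat_l; assumption.
      - apply Rmult_lt_compat_l; lra. }
    assert (Hy0 : 0 <= KB / eps) by (apply Rdiv_le_0_compat; assumption).
    apply Rle_lt_trans with (KB * exp (- y)).
    - eapply Rle_trans; [apply (Cmod_CSeries_le _ _ _ (fun i => Hrem T i ltac:(lra)) (is_series_scal_R _ _ _ HB))|].
      unfold KB, y, s0. replace ((1 - t0) * mu * (T - 1)) with ((1 - t0) * (mu * (T - 1))) by ring.
      set (ex := exp _). assert (Hex0 : 0 < ex) by apply exp_pos.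
      replace (K * Rabs B * ex) with (K * ex * Rabs B) by ring.
      apply Rmult_le_compat_l; [apply Rmult_le_pos; lra|apply Rle_abs].
    - rewrite exp_Ropp. assert (He := exp_ineq1_le y).
      apply (Rmult_lt_reg_r (exp y)); [apply exp_pos|].
      rewrite Rmult_assoc, Rinv_l by (apply Rgt_not_eq, exp_pos).
      assert (eps * (1 + y) <= eps * exp y) by (apply Rmult_le_compat_l; lra). lra. }
  intros P [eps HP]. destruct (Hdec eps) as [T0 [HT0 HD]].
  apply Filter_prod with (fun a => a = 1) (fun b => T0 < b).
  - reflexivity.
  - exists T0; auto.
  - intros a T -> HTT. exists (Cminus I0 (Rem T)). split; [apply HT; lra|].
    apply HP. specialize (HD T HTT).
    assert (H1 := re_le_Cmod (Rem T)). assert (H2 := im_le_Cmod (Rem T)).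
    split; [change (Rabs (Re I0 + - Re (Rem T) - Re I0) < eps)|change (Rabs (Im I0 + - Im (Rem T) - Im I0) < eps)].
    + replace (Re I0 + - Re (Rem T) - Re I0) with (- Re (Rem T)) by ring. rewrite Rabs_Ropp; lra.
    + replace (Im I0 + - Im (Rem T) - Im I0) with (- Im (Rem T)) by ring. rewrite Rabs_Ropp; lra.
Qed.

(** * Evaluation of phi^+ and phi^- *)

Definition bessel_arg (m c : nat) : R := 2 * PI * sqrt (INR m) / INR c.

Lemma bessel_arg_nonneg m c : (0 < c)%nat -> 0 <= bessel_arg m c.
Proof.
  intros Hc. apply Rdiv_le_0_compat; [|apply lt_0_INR, Hc].
  apply Rmult_le_pos; [generalize PI_RGT_0; lra|apply sqrt_pos].
Qed.

Lemma alpha_plus_laurent h m c s :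
  alpha_plus (- Z.of_nat (2 * h)) m c s = laurent (bessel_coef 1 (bessel_arg m c) (S (2 * h))) s.
Proof.
  apply CSeries_ext; intros j. f_equal. f_equal. unfold bessel_coef, bessel_arg.
  replace (Z.to_nat (Z.of_nat j + 1 - - Z.of_nat (2 * h))) with (j + S (2 * h))%nat by lia.
  replace (Z.to_nat (2 * Z.of_nat j + 1 - - Z.of_nat (2 * h))) with (2 * j + S (2 * h))%nat by lia.
  rewrite pow1; unfold Rdiv; rewrite Rmult_1_l; reflexivity.
Qed.

Lemma alpha_minus_laurent h m c s :
  alpha_minus (- Z.of_nat (2 * h)) m c s = laurent (bessel_coef (-1) (bessel_arg m c) (S (2 * h))) s.
Proof.
  apply CSeries_ext; intros j. f_equal. f_equal. unfold bessel_coef, bessel_arg.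
  replace (Z.to_nat (Z.of_nat j + 1 - - Z.of_nat (2 * h))) with (j + S (2 * h))%nat by lia.
  replace (Z.to_nat (2 * Z.of_nat j + 1 - - Z.of_nat (2 * h))) with (2 * j + S (2 * h))%nat by lia.
  reflexivity.
Qed.

Definition cusp_shift (c d : nat) (tau : C) : C := Cplus tau (RtoC (INR d / INR c)).

Lemma Im_cusp_shift c d tau : Im (cusp_shift c d tau) = Im tau.
Proof. unfold cusp_shift; simpl; unfold Im; ring. Qed.

Lemma zeta_qpow c d tau :
  Cmult (zeta c (Z.of_nat d)) (qpow 1 tau) = e2pi (cusp_shift c d tau).
Proof.
  unfold zeta, qpow. rewrite <- e2pi_plus, <- INR_IZR_INZ. f_equal. unfold cusp_shift; ring.
Qed.

Lemma contour_ext r f g : (forall s, f s = g s) -> contour r f = contour r g.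
Proof. intros H; unfold contour. f_equal. apply RInt_ext. intros; cbv zeta; rewrite H; reflexivity. Qed.

Lemma phi_plus_contour h m r c d tau :
  phi_plus (- Z.of_nat (2 * h)) m r c d tau =
  contour r (fun s => Cdiv (Cmult (laurent (bessel_coef 1 (bessel_arg m c) (S (2 * h))) s) (Cexp s))
    (Cminus (RtoC 1) (Cmult (Cexp s) (e2pi (cusp_shift c d tau))))).
Proof.
  apply contour_ext; intros s. rewrite alpha_plus_laurent, <- zeta_qpow, Cmult_assoc. reflexivity.
Qed.

Lemma has_csum_e2pi_bessel eps x n r w : Rabs eps <= 1 -> 0 <= x -> 0 < r < 2 * PI * Im w ->
  has_csum (fun i => Cmult (Cpow (e2pi w) (S i)) (borel (bessel_coef eps x n) (INR (S i))))
    (CSeries (fun i => Cmult (Cpow (e2pi w) (S i)) (borel (bessel_coef eps x n) (INR (S i))))).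
Proof.
  intros He Hx Hr.
  apply has_csum_CSeries with (fun i => x ^ n * exp (x ^ 2 / r) * exp (- ((2 * PI * Im w - r) * INR (S i)))).
  - intros i. rewrite Cmod_mult, Cmod_e2pi_pow.
    eapply Rle_trans; [apply Rmult_le_compat_l; [left; apply exp_pos|
      apply (Cmod_bessel_le eps x x n r); [exact He|lra|lra]]|].
    right. rewrite Rabs_pos_eq by apply pos_INR.
    replace (exp (- ((2 * PI * Im w - r) * INR (S i))))
      with (exp (- (2 * PI * Im w * INR (S i))) * exp (INR (S i) * r)); [ring|].
    rewrite <- exp_plus; f_equal; ring.
  - apply ex_series_scal_R, ex_series_exp_decay; lra.
Qed.

Lemma phi_plus_upper h m r c d tau : (0 < c)%nat -> 0 < r < 2 * PI * Im tau ->
  let w := cusp_shift c d tau in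
  Cmult (e2pi w) (phi_plus (- Z.of_nat (2 * h)) m r c d tau) =
  CSeries (fun i => Cmult (Cpow (e2pi w) (S i))
     (borel (bessel_coef 1 (bessel_arg m c) (S (2 * h))) (INR (S i)))).
Proof.
  intros Hc Hr w.
  assert (Hx := bessel_arg_nonneg m c Hc).
  assert (HZ : Cmod (e2pi w) * exp r < 1).
  { rewrite Cmod_e2pi, <- exp_plus, <- exp_0. apply exp_increasing. unfold w; rewrite Im_cusp_shift; lra. }
  rewrite phi_plus_contour, contour_geom_inside; [|lra|exact HZ|apply ex_series_bessel_coef; [rewrite Rabs_R1; lra|exact Hx|lra]].
  fold w. symmetry. apply CSeries_eq.
  assert (Hs := has_csum_e2pi_bessel 1 (bessel_arg m c) (S (2 * h)) r w ltac:(rewrite Rabs_R1; lra) Hx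
     ltac:(unfold w; rewrite Im_cusp_shift; lra)).
  assert (Hz0 := e2pi_neq_0 w).
  assert (Hs' : has_csum (fun n => Cmult (Cpow (e2pi w) n)
     (borel (bessel_coef 1 (bessel_arg m c) (S (2 * h))) (INR (S n))))
    (CSeries (fun n => Cmult (Cpow (e2pi w) n)
     (borel (bessel_coef 1 (bessel_arg m c) (S (2 * h))) (INR (S n)))))).
  { assert (H1 := has_csum_scal (Cinv (e2pi w)) _ _ Hs).
    eapply has_csum_ext in H1; [rewrite (CSeries_eq _ _ H1); exact H1|].
    intros n; cbv beta; rewrite Cpow_S. field; exact Hz0. }
  eapply has_csum_ext; [|apply (has_csum_scal (e2pi w)), Hs'].
  intros i; cbv beta; rewrite Cpow_S; ring.
Qed.

Lemma borel_0 co : borel co 0 = RtoC (co O).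
Proof.
  apply CSeries_eq. eapply has_csum_ext; [|apply (has_csum_single 0)].
  intros [|j]; cbv beta.
  - simpl. rewrite <- RtoC_mult; f_equal; field.
  - simpl Nat.eqb; cbv iota. rewrite pow_i by lia. unfold Rdiv; rewrite Rmult_0_l; ring.
Qed.

(** The expansion outside the unit disc begins with exponent 0. Its first term is minus the constant
    from which a^+(0) is built, and the remaining exponents are negative, which turns I-Bessel into
    J-Bessel. *)
Lemma phi_plus_lower h m r c d tau : (0 < c)%nat -> 0 < r < 2 * PI * - Im tau ->
  let w := cusp_shift c d tau in
  Cmult (e2pi w) (phi_plus (- Z.of_nat (2 * h)) m r c d tau) =
  Copp (Cplus (RtoC (bessel_arg m c ^ S (2 * h) / INR (fact (S (2 * h)))))
    (CSeries (fun i => Cmult (Cpow (e2pi (Copp w)) (S i))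
     (borel (bessel_coef (-1) (bessel_arg m c) (S (2 * h))) (INR (S i)))))).
Proof.
  intros Hc Hr w.
  assert (Hx := bessel_arg_nonneg m c Hc).
  assert (HZ : exp r < Cmod (e2pi w)).
  { rewrite Cmod_e2pi. apply exp_increasing. unfold w; rewrite Im_cusp_shift; lra. }
  assert (Hz0 := e2pi_neq_0 w).
  rewrite phi_plus_contour, contour_geom_outside; [|lra|exact HZ|apply ex_series_bessel_coef; [rewrite Rabs_R1; lra|exact Hx|lra]].
  fold w.
  assert (Hs := has_csum_e2pi_bessel (-1) (bessel_arg m c) (S (2 * h)) r (Copp w) ltac:(rewrite Rabs_m1; lra) Hx
     ltac:(change (Im (Copp w)) with (- Im w); unfold w; rewrite Im_cusp_shift; lra)).
  set (F := fun n => Cmult (Cpow (e2pi (Copp w)) n) (borel (bessel_coef 1 (bessel_arg m c) (S (2 * h))) (- INR n))).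
  assert (HF0 : F O = RtoC (bessel_arg m c ^ S (2 * h) / INR (fact (S (2 * h))))).
  { unfold F. simpl (INR 0). rewrite Ropp_0, borel_0. simpl (Cpow _ 0).
    rewrite Cmult_1_l. f_equal. unfold bessel_coef. change (0 + S (2 * h))%nat with (S (2 * h)).
    change (2 * 0 + S (2 * h))%nat with (S (2 * h)). rewrite pow_O. unfold Rdiv; ring. }
  assert (HF : has_csum F (Cplus (F O) (CSeries (fun i => Cmult (Cpow (e2pi (Copp w)) (S i))
     (borel (bessel_coef (-1) (bessel_arg m c) (S (2 * h))) (INR (S i))))))).
  { apply has_csum_cons. eapply has_csum_ext, Hs. intros i; unfold F.
    rewrite borel_bessel_opp. reflexivity. }
  rewrite HF0 in HF.
  rewrite (CSeries_eq _ (Cmult (Copp (Cinv (e2pi w))) (Cplus (RtoC (bessel_arg m c ^ S (2 * h) / INR (fact (S (2 * h)))))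
    (CSeries (fun i => Cmult (Cpow (e2pi (Copp w)) (S i))
     (borel (bessel_coef (-1) (bessel_arg m c) (S (2 * h))) (INR (S i)))))))).
  - set (G := Cplus _ _). field; exact Hz0.
  - eapply has_csum_ext; [|apply (has_csum_scal (Copp (Cinv (e2pi w)))), HF].
    intros n; unfold F. rewrite e2pi_opp, Cpow_S. ring.
Qed.

(** * The integral over t in phi^-, for both half-planes at once *)

Section PhiMinus.

Variables (h : nat) (v r : R) (Z : C) (beta : nat -> C) (Cb : R).
Hypotheses (Hr : 0 < r < 2 * PI * v) (HZ : Cmod Z = exp (2 * PI * v))
  (Hbeta : forall i, Cmod (beta i) <= Cb * exp (INR (S i) * r)).

Let Hpi := PI_RGT_0.
Let Hv : 0 < v.
Proof. nra. Qed.

(** The l-th power of Z has size e^(2 pi v l) and beta grows with rate r, against the decay rate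
    (1-t0) 4 pi v of the gamma factor. Of the surplus 2 pi v - r one half pays for the loss 4 pi v
    t0, and the other half is the remaining rate theta. *)
Let theta := (2 * PI * v - r) / 2.
Let t0 := theta / (4 * PI * v).

Let Htheta : 0 < theta.
Proof. unfold theta; lra. Qed.

Let Ht0 : 0 < t0 < 1.
Proof.
  assert (Hpv : 0 < PI * v) by (apply Rmult_lt_0_compat; [exact Hpi|exact Hv]).
  unfold t0; split; [apply Rdiv_lt_0_compat; [exact Htheta|lra]|].
  apply (Rmult_lt_reg_r (4 * PI * v)); [lra|]. unfold Rdiv; rewrite Rmult_assoc, Rinv_l by lra.
  unfold theta; lra.
Qed.

Let weight_bound i : Cmod (Cmult (Cpow Z (S i)) (beta i)) * exp (- ((1 - t0) * (4 * PI * v * INR (S i))))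
  <= Cb * exp (- (theta * INR (S i))).
Proof.
  rewrite Cmod_mult, Cmod_pow, HZ, <- exp_INR_pow.
  eapply Rle_trans; [apply Rmult_le_compat_r; [left; apply exp_pos|]; apply Rmult_le_compat_l;
    [left; apply exp_pos|apply Hbeta]|].
  right. replace (exp (INR (S i) * (2 * PI * v)) * (Cb * exp (INR (S i) * r)) * exp (- ((1 - t0) * (4 * PI * v * INR (S i)))))
    with (Cb * (exp (INR (S i) * (2 * PI * v)) * exp (INR (S i) * r) * exp (- ((1 - t0) * (4 * PI * v * INR (S i)))))) by ring.
  rewrite <- !exp_plus. f_equal. f_equal. unfold t0, theta. field. split; lra.
Qed.

Lemma Cmod_gamma_term_le i :
  Cmod (Cmult (Cmult (RtoC (gstar (S (2 * h)) (4 * PI * INR (S i) * v))) (Cpow Z (S i))) (beta i))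
  <= rsum (S (2 * h)) (fun b => / t0 ^ b) * (Cb * exp (- (theta * INR (S i)))).
Proof.
  assert (Hy : 0 <= 4 * PI * v * INR (S i)).
  { apply Rmult_le_pos; [|apply pos_INR]. apply Rmult_le_pos; [lra|left; exact Hv]. }
  rewrite <- Cmult_assoc, Cmod_mult, Cmod_R.
  replace (4 * PI * INR (S i) * v) with (4 * PI * v * INR (S i)) by ring.
  rewrite Rabs_pos_eq by (apply gstar_nonneg, Hy).
  assert (HSK : 0 <= rsum (S (2 * h)) (fun j => / t0 ^ j)).
  { rewrite <- (Rmult_0_r (INR (S (2 * h)))), <- rsum_const. apply rsum_le; intros.
    left; apply Rinv_0_lt_compat, pow_lt; apply Ht0. }
  eapply Rle_trans; [apply Rmult_le_compat_r; [apply Cmod_ge_0|apply (gstar_le _ _ t0 Hy); apply Ht0]|].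
  rewrite Rmult_assoc. apply Rmult_le_compat_l; [exact HSK|].
  rewrite Rmult_comm. apply weight_bound.
Qed.

Lemma has_csum_gamma_terms :
  has_csum (fun i => Cmult (Cmult (RtoC (gstar (S (2 * h)) (4 * PI * INR (S i) * v))) (Cpow Z (S i))) (beta i))
   (CSeries (fun i => Cmult (Cmult (RtoC (gstar (S (2 * h)) (4 * PI * INR (S i) * v))) (Cpow Z (S i))) (beta i))).
Proof.
  eapply has_csum_CSeries; [exact Cmod_gamma_term_le|].
  apply ex_series_scal_R, ex_series_scal_R, ex_series_exp_decay, Htheta.
Qed.

Lemma is_RInt_gen_phi_minus :
  @is_RInt_gen C_R_NormedModule
    (fun t => Cmult (RtoC (t ^ (2 * h))) (CSeries (fun i =>
       Cmult (Cmult (Cmult (RtoC (INR (S i) ^ S (2 * h))) (Cpow Z (S i))) (beta i))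
         (RtoC (exp (- (4 * PI * v * INR (S i) * t)))))))
    (at_point 1) (Rbar_locally p_infty)
    (Cmult (RtoC (INR (fact (2 * h)) / (4 * PI * v) ^ S (2 * h)))
      (CSeries (fun i => Cmult (Cmult (RtoC (gstar (S (2 * h)) (4 * PI * INR (S i) * v))) (Cpow Z (S i))) (beta i)))).
Proof.
  assert (Hpv : 0 < 4 * PI * v) by (apply Rmult_lt_0_compat; [lra|exact Hv]).
  assert (H := is_RInt_gen_gamma_series (2 * h)
    (fun i => Cmult (Cmult (RtoC (INR (S i) ^ S (2 * h))) (Cpow Z (S i))) (beta i)) (4 * PI * v) t0 Hpv Ht0).
  rewrite <- (CSeries_eq _ _ (has_csum_scal (RtoC (INR (fact (2 * h)) / (4 * PI * v) ^ S (2 * h))) _ _ has_csum_gamma_terms)).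
  assert (E : forall i, Cmult (Cmult (Cmult (RtoC (INR (S i) ^ S (2 * h))) (Cpow Z (S i))) (beta i))
     (RtoC (INR (fact (2 * h)) / (4 * PI * v * INR (S i)) ^ S (2 * h) * gstar (S (2 * h)) (4 * PI * v * INR (S i)))) =
     Cmult (RtoC (INR (fact (2 * h)) / (4 * PI * v) ^ S (2 * h)))
      (Cmult (Cmult (RtoC (gstar (S (2 * h)) (4 * PI * INR (S i) * v))) (Cpow Z (S i))) (beta i))).
  { intros i. replace (4 * PI * INR (S i) * v) with (4 * PI * v * INR (S i)) by ring.
    set (g := gstar _ _). set (p := S (2 * h)).
    assert (H1 : INR (S i) ^ p <> 0) by (apply pow_nonzero, not_0_INR; lia).
    assert (H2 : (4 * PI * v) ^ p <> 0) by (apply pow_nonzero; lra).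
    rewrite Rpow_mult_distr.
    replace (RtoC (INR (fact (2 * h)) / ((4 * PI * v) ^ p * INR (S i) ^ p) * g)) with
      (Cmult (RtoC (INR (fact (2 * h)) / (4 * PI * v) ^ p)) (Cmult (RtoC (/ INR (S i) ^ p)) (RtoC g))).
    2:{ rewrite <- !RtoC_mult; f_equal; field; auto. }
    rewrite RtoC_inv by exact H1. assert (H3 := RtoC_neq_0 _ H1). field; exact H3. }
  rewrite <- (CSeries_ext _ _ E). apply H.
  apply ex_series_Rle with (fun i => Cb * (INR (S i) ^ S (2 * h) * exp (- (theta * INR (S i))))).
  - intros i; split; [apply Rmult_le_pos; [apply Cmod_ge_0|left; apply exp_pos]|].
    rewrite <- Cmult_assoc, Cmod_mult, Cmod_R, Rabs_pos_eq, Rmult_assoc by (apply pow_le, pos_INR).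
    replace (Cb * (INR (S i) ^ S (2 * h) * exp (- (theta * INR (S i))))) with
      (INR (S i) ^ S (2 * h) * (Cb * exp (- (theta * INR (S i))))) by ring.
    apply Rmult_le_compat_l; [apply pow_le, pos_INR|apply weight_bound].
  - apply ex_series_scal_R.
    apply ex_series_ext with (fun i => exp (- theta) * (INR (S i) ^ S (2 * h) * exp (- theta) ^ i)).
    + intros i. rewrite <- exp_INR_pow.
      replace (exp (- theta) * (INR (S i) ^ S (2 * h) * exp (INR i * - theta))) with
        (INR (S i) ^ S (2 * h) * (exp (- theta) * exp (INR i * - theta))) by ring.
      rewrite <- exp_plus. f_equal; f_equal. rewrite S_INR; ring.
    + apply ex_series_scal_R, ex_series_poly_geom. split; [left; apply exp_pos|].
      rewrite <- exp_0; apply exp_increasing; lra.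
Qed.

End PhiMinus.

Lemma phi_minus_integrand_contour h m r c d tau t :
  phi_minus_integrand (- Z.of_nat (2 * h)) m r c d tau t =
  Cmult (RtoC (t ^ (2 * h))) (contour r (fun s =>
    Cmult (laurent (bessel_coef (-1) (bessel_arg m c) (S (2 * h))) s)
      (Li_neg (S (2 * h)) (Cmult (Cexp s) (Cmult (RtoC (exp (- (4 * PI * Im tau * t))))
         (e2pi (Copp (cusp_shift c d tau)))))))).
Proof.
  unfold phi_minus_integrand. f_equal; [f_equal; f_equal; lia|].
  apply contour_ext; intros s. rewrite alpha_minus_laurent.
  replace (Z.to_nat (1 - - Z.of_nat (2 * h))) with (S (2 * h)) by lia. f_equal. f_equal.
  replace (Cexp (Cminus s (RtoC (4 * PI * Im tau * t)))) with
    (Cmult (Cexp s) (RtoC (exp (- (4 * PI * Im tau * t))))).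
  2:{ unfold Cminus. rewrite Cexp_plus. f_equal. unfold Cexp; apply C_eq; simpl; rewrite Ropp_0, ?cos_0, ?sin_0; ring. }
  unfold zeta, qpow. rewrite <- !Cmult_assoc. do 2 f_equal. rewrite <- e2pi_plus. f_equal.
  rewrite opp_IZR, <- INR_IZR_INZ. unfold cusp_shift, Rdiv. rewrite !RtoC_mult, !RtoC_opp. ring.
Qed.

Lemma is_RInt_gen_ext_ge (f g : R -> C) l : (forall t, 1 < t -> f t = g t) ->
  @is_RInt_gen C_R_NormedModule f (at_point 1) (Rbar_locally p_infty) l ->
  @is_RInt_gen C_R_NormedModule g (at_point 1) (Rbar_locally p_infty) l.
Proof.
  intros H. apply (is_RInt_gen_ext (V := C_R_NormedModule)).
  apply Filter_prod with (fun a => a = 1) (fun b => 1 < b).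
  - reflexivity.
  - exists 1; auto.
  - intros a b -> Hb; simpl. rewrite Rmin_left, Rmax_right by lra. intros t Ht; apply H; lra.
Qed.

Definition gamma_sum (n : nat) (v eps x : R) (Z : C) : C :=
  CSeries (fun i => Cmult (Cmult (RtoC (gstar n (4 * PI * INR (S i) * v))) (Cpow Z (S i)))
     (borel (bessel_coef eps x n) (INR (S i)))).

Lemma bessel_exp_bound eps x n r : Rabs eps <= 1 -> 0 <= x -> 0 < r -> forall i,
  Cmod (borel (bessel_coef eps x n) (INR (S i))) <= x ^ n * exp (x ^ 2 / r) * exp (INR (S i) * r).
Proof.
  intros He Hx Hr i. eapply Rle_trans; [apply (Cmod_bessel_le eps x x n r); [exact He|lra|exact Hr]|].
  rewrite Rabs_pos_eq by apply pos_INR. right; ring.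
Qed.

(** For t > 1 the factor e^(-4 pi v t) outweighs |e(-w)| = e^(2 pi v), and r < 2 pi v leaves room
    for e^s: the polylogarithm is expanded inside the unit disc along the whole contour. *)
Lemma is_RInt_gen_phi_minus_upper h m r c d tau : (0 < c)%nat -> 0 < r < 2 * PI * Im tau ->
  @is_RInt_gen C_R_NormedModule (phi_minus_integrand (- Z.of_nat (2 * h)) m r c d tau)
    (at_point 1) (Rbar_locally p_infty)
    (Cmult (RtoC (INR (fact (2 * h)) / (4 * PI * Im tau) ^ S (2 * h)))
      (gamma_sum (S (2 * h)) (Im tau) (-1) (bessel_arg m c) (e2pi (Copp (cusp_shift c d tau))))).
Proof.
  intros Hc Hr. assert (Hx := bessel_arg_nonneg m c Hc).
  set (w := cusp_shift c d tau). assert (Hpi := PI_RGT_0).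
  assert (Hv : 0 < Im tau) by nra.
  assert (HZ : Cmod (e2pi (Copp w)) = exp (2 * PI * Im tau)).
  { rewrite Cmod_e2pi; f_equal. replace (Im (Copp w)) with (- Im w) by reflexivity.
    unfold w; rewrite Im_cusp_shift; ring. }
  eapply is_RInt_gen_ext_ge; [|apply (is_RInt_gen_phi_minus h (Im tau) r (e2pi (Copp w))
    (fun i => borel (bessel_coef (-1) (bessel_arg m c) (S (2 * h))) (INR (S i))) _ Hr HZ
    (bessel_exp_bound (-1) (bessel_arg m c) (S (2 * h)) r ltac:(rewrite Rabs_m1; lra) Hx ltac:(lra)))].
  intros t Ht; cbv beta. rewrite phi_minus_integrand_contour. f_equal.
  rewrite contour_Li_inside.
  - apply CSeries_ext; intros i. fold w. rewrite Cpow_mult_l, <- RtoC_pow, <- exp_INR_pow.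
    replace (INR (S i) * - (4 * PI * Im tau * t)) with (- (4 * PI * Im tau * INR (S i) * t)) by ring. ring.
  - lra.
  - fold w. rewrite Cmod_mult, HZ, Cmod_R, Rabs_pos_eq, <- !exp_plus, <- exp_0 by (left; apply exp_pos).
    apply exp_increasing. assert (0 < PI * Im tau) by (apply Rmult_lt_0_compat; assumption). nra.
  - apply ex_series_bessel_coef; [rewrite Rabs_m1; lra|exact Hx|lra].
Qed.

(** For v < 0 the argument of the polylogarithm stays outside the unit disc. Its inversion, with 1-k
    odd, and the exchange of J and I bring the integral into the form of the upper half-plane with
    -v in place of v. *)
Lemma is_RInt_gen_phi_minus_lower h m r c d tau : (0 < c)%nat -> 0 < r < 2 * PI * - Im tau ->
  @is_RInt_gen C_R_NormedModule (phi_minus_integrand (- Z.of_nat (2 * h)) m r c d tau)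
    (at_point 1) (Rbar_locally p_infty)
    (Cmult (RtoC (INR (fact (2 * h)) / (4 * PI * - Im tau) ^ S (2 * h)))
      (gamma_sum (S (2 * h)) (- Im tau) 1 (bessel_arg m c) (e2pi (cusp_shift c d tau)))).
Proof.
  intros Hc Hr. assert (Hx := bessel_arg_nonneg m c Hc).
  set (w := cusp_shift c d tau). assert (Hpi := PI_RGT_0).
  assert (Hv : 0 < - Im tau) by nra.
  assert (HZ : Cmod (e2pi w) = exp (2 * PI * - Im tau)).
  { rewrite Cmod_e2pi; f_equal. unfold w; rewrite Im_cusp_shift; ring. }
  eapply is_RInt_gen_ext_ge; [|apply (is_RInt_gen_phi_minus h (- Im tau) r (e2pi w)
    (fun i => borel (bessel_coef 1 (bessel_arg m c) (S (2 * h))) (INR (S i))) _ Hr HZ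
    (bessel_exp_bound 1 (bessel_arg m c) (S (2 * h)) r ltac:(rewrite Rabs_R1; lra) Hx ltac:(lra)))].
  intros t Ht; cbv beta. rewrite phi_minus_integrand_contour. f_equal. fold w.
  assert (Hi : Cinv (Cmult (RtoC (exp (- (4 * PI * Im tau * t)))) (e2pi (Copp w))) =
     Cmult (RtoC (exp (- (4 * PI * - Im tau * t)))) (e2pi w)).
  { rewrite e2pi_opp. replace (- (4 * PI * - Im tau * t)) with (- - (4 * PI * Im tau * t)) by ring.
    rewrite (exp_Ropp (- _)), RtoC_inv by (apply Rgt_not_eq, exp_pos).
    assert (H1 := e2pi_neq_0 w).
    assert (H2 := RtoC_neq_0 _ (Rgt_not_eq _ _ (exp_pos (- (4 * PI * Im tau * t))))). field; auto. }
  rewrite contour_Li_outside.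
  - apply CSeries_ext; intros i. rewrite Hi, Cpow_mult_l, <- RtoC_pow, <- exp_INR_pow, borel_bessel_opp.
    replace (INR (S i) * - (4 * PI * - Im tau * t)) with (- (4 * PI * - Im tau * INR (S i) * t)) by ring.
    replace (- -1) with 1 by ring. ring.
  - exists h; lia.
  - lra.
  - rewrite Cmod_mult, e2pi_opp, Cmod_inv, HZ, Cmod_R, Rabs_pos_eq, <- exp_Ropp, <- exp_plus
      by (try apply e2pi_neq_0; left; apply exp_pos).
    apply exp_increasing. assert (0 < PI * - Im tau) by (apply Rmult_lt_0_compat; assumption). nra.
  - apply ex_series_bessel_coef; [rewrite Rabs_m1; lra|exact Hx|lra].
Qed.

(** * Sums over units and over the level *)

Lemma sum_units_ext c f g :
  (forall d x, (d < c)%nat -> (x < c)%nat -> Nat.gcd d c = 1%nat -> f d x = g d x) ->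
  sum_units c f = sum_units c g.
Proof.
  intros H. apply fsum_ext; intros d Hd. apply fsum_ext; intros x Hx.
  destruct (is_inv_pair c d x) eqn:E; [|reflexivity].
  apply H; auto. apply (is_inv_pair_gcd _ _ _ E).
Qed.

Lemma sum_units_scal c z f : sum_units c (fun d x => Cmult z (f d x)) = Cmult z (sum_units c f).
Proof.
  unfold sum_units. rewrite <- fsum_scal. apply fsum_ext; intros d _. rewrite <- fsum_scal.
  apply fsum_ext; intros x _. destruct (is_inv_pair c d x); ring.
Qed.

Lemma sum_units_plus c f g :
  sum_units c (fun d x => Cplus (f d x) (g d x)) = Cplus (sum_units c f) (sum_units c g).
Proof.
  unfold sum_units. rewrite <- fsum_plus. apply fsum_ext; intros d _. rewrite <- fsum_plus.
  apply fsum_ext; intros x _. destruct (is_inv_pair c d x); ring.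
Qed.

Lemma sum_units_conj c f : Cconj (sum_units c f) = sum_units c (fun d x => Cconj (f d x)).
Proof.
  unfold sum_units. rewrite fsum_conj. apply fsum_ext; intros d _. rewrite fsum_conj.
  apply fsum_ext; intros x _. destruct (is_inv_pair c d x); [reflexivity|].
  apply C_eq; simpl; ring.
Qed.

Lemma has_csum_sum_units c (f : nat -> nat -> nat -> C) L :
  (forall d x, (d < c)%nat -> (x < c)%nat -> Nat.gcd d c = 1%nat -> has_csum (fun i => f i d x) (L d x)) ->
  has_csum (fun i => sum_units c (f i)) (sum_units c L).
Proof.
  intros H. apply has_csum_fsum; intros d Hd. apply has_csum_fsum; intros x Hx.
  destruct (is_inv_pair c d x) eqn:E; [|apply has_csum_0].
  apply H; auto. apply (is_inv_pair_gcd _ _ _ E).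
Qed.

Lemma Cmod_sum_units_le c f B : 0 <= B ->
  (forall d x, (d < c)%nat -> (x < c)%nat -> Nat.gcd d c = 1%nat -> Cmod (f d x) <= B) ->
  Cmod (sum_units c f) <= INR c ^ 2 * B.
Proof.
  intros HB H. eapply Rle_trans; [apply (Cmod_fsum_le c _ (fun _ => INR c * B))|].
  - intros d Hd. eapply Rle_trans; [apply (Cmod_fsum_le c _ (fun _ => B))|rewrite rsum_const; lra].
    intros x Hx. destruct (is_inv_pair c d x) eqn:E; [|rewrite Cmod_0; exact HB].
    apply H; auto. apply (is_inv_pair_gcd _ _ _ E).
  - rewrite rsum_const; simpl; lra.
Qed.

Lemma fsum_neg_mod c g : (0 < c)%nat -> fsum c g = fsum c (fun d => g ((c - d) mod c)%nat).
Proof.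
  intros Hc. destruct c as [|c]; [lia|]. rewrite !fsum_S, Nat.sub_0_r, Nat.Div0.mod_same. f_equal.
  rewrite fsum_rev. apply fsum_ext; intros i Hi. f_equal. rewrite Nat.mod_small; lia.
Qed.

Lemma neg_mod_eq c x : (0 < c)%nat -> (x < c)%nat ->
  exists t : Z, Z.of_nat ((c - x) mod c) = (t * Z.of_nat c - Z.of_nat x)%Z.
Proof.
  intros Hc Hx. destruct (Nat.eq_dec x 0) as [->|H0].
  - exists 0%Z. rewrite Nat.sub_0_r, Nat.Div0.mod_same; lia.
  - exists 1%Z. rewrite Nat.mod_small; lia.
Qed.

Lemma is_inv_pair_neg c d x : (0 < c)%nat -> (d < c)%nat -> (x < c)%nat ->
  is_inv_pair c ((c - d) mod c) ((c - x) mod c) = is_inv_pair c d x.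
Proof.
  intros Hc Hd Hx.
  assert (Hd' := Nat.mod_upper_bound (c - d) c ltac:(lia)).
  rewrite <- (is_inv_pair_spec c _ _ 0 Hc Hd'), <- (is_inv_pair_spec c d x 0 Hc Hd).
  destruct (neg_mod_eq c d Hc Hd) as [t Ht]. destruct (neg_mod_eq c x Hc Hx) as [u Hu].
  rewrite Ht, Hu. f_equal.
  rewrite <- (Z_mod_plus_full (Z.of_nat x * (Z.of_nat d + Z.of_nat c * 0) - 1)
    (u * t * Z.of_nat c - u * Z.of_nat d - t * Z.of_nat x) (Z.of_nat c)). f_equal. ring.
Qed.

Lemma sum_units_neg c f : (0 < c)%nat ->
  sum_units c f = sum_units c (fun d x => f ((c - d) mod c)%nat ((c - x) mod c)%nat).
Proof.
  intros Hc. unfold sum_units. rewrite (fsum_neg_mod c) by exact Hc.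
  apply fsum_ext; intros d Hd. rewrite (fsum_neg_mod c) by exact Hc.
  apply fsum_ext; intros x Hx. rewrite is_inv_pair_neg by assumption. reflexivity.
Qed.

(** Negating d negates its inverse modulo c, and this permutes the units. *)
Lemma Kloosterman_neg a b c : (0 < c)%nat ->
  Kloosterman a b c = sum_units c (fun d x => e2pi (RtoC (- ((IZR a * INR x + IZR b * INR d) / INR c)))).
Proof.
  intros Hc. unfold Kloosterman. rewrite sum_units_neg by exact Hc.
  assert (Hc0 : INR c <> 0) by (apply not_0_INR; lia).
  apply sum_units_ext; intros d x Hd Hx _.
  destruct (neg_mod_eq c d Hc Hd) as [t Ht]. destruct (neg_mod_eq c x Hc Hx) as [u Hu].
  rewrite (INR_IZR_INZ ((c - d) mod c)), (INR_IZR_INZ ((c - x) mod c)), Ht, Hu.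
  rewrite !minus_IZR, !mult_IZR, <- !INR_IZR_INZ.
  replace ((IZR a * (IZR u * INR c - INR x) + IZR b * (IZR t * INR c - INR d)) / INR c)
    with (IZR (a * u + b * t) + - ((IZR a * INR x + IZR b * INR d) / INR c)).
  2:{ rewrite plus_IZR, !mult_IZR. field; exact Hc0. }
  rewrite RtoC_plus, e2pi_plus, e2pi_IZR. ring.
Qed.

(** Makes the complex conjugation in the non-holomorphic Eichler integral disappear. *)
Lemma Kloosterman_real a b c : (0 < c)%nat -> Cconj (Kloosterman a b c) = Kloosterman a b c.
Proof.
  intros Hc. rewrite (Kloosterman_neg a b c Hc) at 2. unfold Kloosterman. rewrite sum_units_conj.
  apply sum_units_ext; intros d x _ _ _. rewrite e2pi_conj. f_equal. apply C_eq; simpl; ring.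
Qed.

Lemma borel_real co lam r : 0 < r -> ex_series (fun j => Rabs (co j) * / r ^ S j) ->
  Cconj (borel co lam) = borel co lam.
Proof.
  intros Hr Hco. assert (H := has_csum_borel r co lam Hr Hco).
  apply has_csum_conj in H. rewrite <- (CSeries_eq _ _ H). apply CSeries_ext; intros j.
  rewrite <- RtoC_mult. apply C_eq; simpl; ring.
Qed.

Lemma level_ge N n : (1 <= N)%nat -> 1 <= INR (S n) <= INR (N * S n).
Proof.
  intros HN. split; [rewrite S_INR; generalize (pos_INR n); lra|]. apply le_INR. nia.
Qed.

Lemma inv_pow_level_le N n p : (1 <= N)%nat -> (2 <= p)%nat -> / INR (N * S n) ^ p <= / INR (S n) ^ 2.
Proof.
  intros HN Hp. destruct (level_ge N n HN) as [H1 H2].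
  apply Rinv_le_contravar; [apply pow_lt; lra|].
  apply Rle_trans with (INR (N * S n) ^ 2); [apply pow_incr; lra|apply Rle_pow; [lra|exact Hp]].
Qed.

Definition bessel_max (m : nat) : R := 2 * PI * sqrt (INR m).

Lemma bessel_max_nonneg m : 0 <= bessel_max m.
Proof. unfold bessel_max. apply Rmult_le_pos; [generalize PI_RGT_0; lra|apply sqrt_pos]. Qed.

Lemma bessel_arg_le N m n : (1 <= N)%nat -> 0 <= bessel_arg m (N * S n) <= bessel_max m.
Proof.
  intros HN. destruct (level_ge N n HN) as [H1 H2]. split; [apply bessel_arg_nonneg; lia|].
  unfold bessel_arg. fold (bessel_max m). unfold Rdiv. rewrite <- (Rmult_1_r (bessel_max m)) at 2.
  apply Rmult_le_compat_l; [apply bessel_max_nonneg|]. rewrite <- Rinv_1. apply Rinv_le_contravar; lra.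
Qed.

(** Trivial bound: at most c^2 pairs, the factor 1/c, and (bessel_max/c)^(2h+1) leave c^(-2h), which
    h >= 1 makes summable over the multiples c of N. *)
Lemma Cmod_level_term_le N h m n f K : (1 <= N)%nat -> (1 <= h)%nat -> 0 <= K ->
  let c := (N * S n)%nat in
  (forall d x, (d < c)%nat -> (x < c)%nat -> Nat.gcd d c = 1%nat ->
     Cmod (f d x) <= bessel_arg m c ^ S (2 * h) * K) ->
  Cmod (Cmult (RtoC (/ INR c)) (sum_units c f)) <= bessel_max m ^ S (2 * h) * K * / INR (S n) ^ 2.
Proof.
  intros HN Hh HK c Hf. destruct (level_ge N n HN) as [H1 H2]. fold c in H2.
  assert (Hx := bessel_arg_nonneg m c ltac:(unfold c; lia)).
  rewrite Cmod_mult, Cmod_R, Rabs_pos_eq by (left; apply Rinv_0_lt_compat; lra).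
  eapply Rle_trans; [apply Rmult_le_compat_l; [left; apply Rinv_0_lt_compat; lra|
    apply (Cmod_sum_units_le c f _ ltac:(apply Rmult_le_pos; [apply pow_le, Hx|exact HK]) Hf)]|].
  apply Rle_trans with (bessel_max m ^ S (2 * h) * K * / INR c ^ (2 * h)).
  - right. unfold bessel_arg; fold (bessel_max m). unfold Rdiv. rewrite Rpow_mult_distr, pow_inv.
    assert (Hc0 : INR c ^ (2 * h) <> 0) by (apply pow_nonzero; lra).
    rewrite <- (tech_pow_Rmult (INR c) (2 * h)). field. split; [exact Hc0|lra].
  - apply Rmult_le_compat_l; [apply Rmult_le_pos; [apply pow_le, bessel_max_nonneg|exact HK]|].
    apply inv_pow_level_le; [exact HN|lia].
Qed.

Definition hol_sum (n : nat) (eps x : R) (Z : C) : C :=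
  CSeries (fun i => Cmult (Cpow Z (S i)) (borel (bessel_coef eps x n) (INR (S i)))).

(** The constant depends on w through Im w only, hence serves all c and all d. *)
Lemma Cmod_hol_sum_le n eps X v r : Rabs eps <= 1 -> 0 < r < 2 * PI * v ->
  exists K, 0 <= K /\ forall x w, 0 <= x <= X -> Im w = v -> Cmod (hol_sum n eps x (e2pi w)) <= x ^ n * K.
Proof.
  intros He Hr. set (D := fun i => exp (X ^ 2 / r) * exp (- ((2 * PI * v - r) * INR (S i)))).
  assert (HD : ex_series D) by (apply ex_series_scal_R, ex_series_exp_decay; lra).
  exists (Series D). split.
  - rewrite <- (Rmult_0_l (Series D)), <- Series_scal_l. apply Series_le; [|exact HD].
    intros i. rewrite Rmult_0_l. assert (0 <= D i); [|lra].
    apply Rmult_le_pos; left; apply exp_pos.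
  - intros x w Hx Hw. apply Cmod_CSeries_le with (fun i => x ^ n * D i).
    + intros i. rewrite Cmod_mult, Cmod_e2pi_pow, Hw.
      eapply Rle_trans; [apply Rmult_le_compat_l; [left; apply exp_pos|
        apply (Cmod_bessel_le eps x X n r); [exact He|exact Hx|lra]]|].
      right. rewrite Rabs_pos_eq by apply pos_INR. unfold D.
      replace (exp (- ((2 * PI * v - r) * INR (S i))))
        with (exp (- (2 * PI * v * INR (S i))) * exp (INR (S i) * r)); [ring|].
      rewrite <- exp_plus; f_equal; ring.
    + apply is_series_scal_R, Series_correct, HD.
Qed.

Lemma Cmod_gamma_sum_le h eps X v r : Rabs eps <= 1 -> 0 < r < 2 * PI * v ->
  exists K, 0 <= K /\ forall x Z, 0 <= x <= X -> Cmod Z = exp (2 * PI * v) ->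
    Cmod (gamma_sum (S (2 * h)) v eps x Z) <= x ^ S (2 * h) * K.
Proof.
  intros He Hr. set (theta := (2 * PI * v - r) / 2). set (t0 := theta / (4 * PI * v)).
  assert (Hpi := PI_RGT_0). assert (Hv : 0 < v) by nra.
  assert (Hpv : 0 < PI * v) by (apply Rmult_lt_0_compat; assumption).
  assert (Hth : 0 < theta) by (unfold theta; lra).
  assert (Ht0 : 0 < t0) by (apply Rdiv_lt_0_compat; lra).
  set (SK := rsum (S (2 * h)) (fun b => / t0 ^ b)).
  assert (HSK : 0 <= SK).
  { unfold SK. rewrite <- (Rmult_0_r (INR (S (2 * h)))), <- rsum_const. apply rsum_le; intros.
    left; apply Rinv_0_lt_compat, pow_lt; assumption. }
  set (D := fun i => SK * (exp (X ^ 2 / r) * exp (- (theta * INR (S i))))).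
  assert (HD : ex_series D) by (apply ex_series_scal_R, ex_series_scal_R, ex_series_exp_decay, Hth).
  exists (Series D). split.
  - rewrite <- (Rmult_0_l (Series D)), <- Series_scal_l. apply Series_le; [|exact HD].
    intros i. rewrite Rmult_0_l. assert (0 <= D i); [|lra].
    apply Rmult_le_pos; [exact HSK|]. apply Rmult_le_pos; left; apply exp_pos.
  - intros x Z Hx HZ. apply Cmod_CSeries_le with (fun i => x ^ S (2 * h) * D i).
    + intros i. eapply Rle_trans; [apply (Cmod_gamma_term_le h v r Z
        (fun i => borel (bessel_coef eps x (S (2 * h))) (INR (S i))) (x ^ S (2 * h) * exp (X ^ 2 / r)) Hr HZ)|].
      * intros j. eapply Rle_trans; [apply (Cmod_bessel_le eps x X _ r); [exact He|exact Hx|lra]|].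
        rewrite Rabs_pos_eq by apply pos_INR. right; ring.
      * unfold D, SK, t0, theta. right; ring.
    + apply is_series_scal_R, Series_correct, HD.
Qed.

(** * Fourier coefficients of Poincare series *)

(* Index [i] stands for the Fourier coefficient of index [i + 1]. *)
Definition kloosterman_bessel (N h m : nat) (l : Z) (eps : R) (i : nat) : C :=
  sum_mult N (fun c => Cmult (RtoC (/ INR c)) (Cmult (Kloosterman l (Z.of_nat (S i)) c)
     (borel (bessel_coef eps (bessel_arg m c) (S (2 * h))) (INR (S i))))).

(** Exchanges the sum over the Fourier index i with the sum over c. The weights kap are left free so
    that the Poincare series and both Eichler integrals are instances, and sigma chooses between (d,
    x) and (-d, -x) in the Kloosterman sum to fit the characters at hand. *)
Lemma kloosterman_bessel_swap N h m l eps sigma (kap : nat -> C) rho :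
  (1 <= N)%nat -> (1 <= h)%nat -> Rabs eps <= 1 -> sigma = 1 \/ sigma = -1 -> 0 < rho ->
  ex_series (fun i => Cmod (kap i) * exp (INR (S i) * rho)) ->
  exists L, has_csum (fun i => Cmult (kap i) (kloosterman_bessel N h m l eps i)) L /\
   has_csum (fun n => let c := (N * S n)%nat in
     Cmult (RtoC (/ INR c)) (sum_units c (fun d x =>
        Cmult (e2pi (RtoC (sigma * (IZR l * INR x / INR c))))
          (CSeries (fun i => Cmult (Cmult (kap i) (Cpow (e2pi (RtoC (sigma * (INR d / INR c)))) (S i)))
             (borel (bessel_coef eps (bessel_arg m c) (S (2 * h))) (INR (S i)))))))) L.
Proof.
  intros HN Hh He Hs Hrho Hk.
  set (X := bessel_max m). set (n0 := S (2 * h)).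
  set (bet := fun n i => borel (bessel_coef eps (bessel_arg m (N * S n)) n0) (INR (S i))).
  set (a := fun n i => Cmult (kap i) (Cmult (RtoC (/ INR (N * S n)))
      (Cmult (Kloosterman l (Z.of_nat (S i)) (N * S n)) (bet n i)))).
  set (B := fun i => Cmod (kap i) * exp (INR (S i) * rho)).
  set (D := fun n => X ^ n0 * exp (X ^ 2 / rho) * / INR (S n) ^ 2).
  assert (HX : 0 <= X) by apply bessel_max_nonneg.
  assert (HD0 : forall n, 0 <= D n).
  { intros n; unfold D. apply Rmult_le_pos; [apply Rmult_le_pos; [apply pow_le, HX|left; apply exp_pos]|].
    left; apply Rinv_0_lt_compat, pow_lt, lt_0_INR; lia. }
  assert (HB0 : forall i, 0 <= B i).
  { intros i; apply Rmult_le_pos; [apply Cmod_ge_0|left; apply exp_pos]. }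
  assert (HD : ex_series D) by (apply ex_series_scal_R, ex_series_inv_sq).
  assert (Hbet : forall n i, Cmod (bet n i) <= bessel_arg m (N * S n) ^ n0 * (exp (X ^ 2 / rho) * exp (INR (S i) * rho))).
  { intros n i. eapply Rle_trans; [apply (Cmod_bessel_le eps _ X n0 rho); [exact He|apply bessel_arg_le, HN|exact Hrho]|].
    rewrite Rabs_pos_eq by apply pos_INR. lra. }
  assert (Hterm : forall n i, Cmod (Cmult (RtoC (/ INR (N * S n))) (Cmult (Kloosterman l (Z.of_nat (S i)) (N * S n)) (bet n i)))
     <= exp (INR (S i) * rho) * D n).
  { intros n i. unfold Kloosterman. rewrite (Cmult_comm (sum_units _ _)), <- sum_units_scal.
    eapply Rle_trans; [apply (Cmod_level_term_le N h m n _ (exp (X ^ 2 / rho) * exp (INR (S i) * rho)) HN Hh)|].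
    - apply Rmult_le_pos; left; apply exp_pos.
    - intros d x _ _ _. rewrite Cmod_mult, Cmod_e2pi_R, Rmult_1_r. apply Hbet.
    - unfold D, X, n0; right; ring. }
  assert (Ha : forall i n, Cmod (a n i) <= B i * D n).
  { intros i n. unfold a, B; rewrite Cmod_mult, Rmult_assoc.
    apply Rmult_le_compat_l; [apply Cmod_ge_0|apply Hterm]. }
  assert (Hcol : forall i, has_csum (fun n => a n i) (Cmult (kap i) (kloosterman_bessel N h m l eps i))).
  { intros i. apply has_csum_scal.
    apply (has_csum_CSeries (fun n => Cmult (RtoC (/ INR (N * S n)))
      (Cmult (Kloosterman l (Z.of_nat (S i)) (N * S n)) (bet n i)))) with (fun n => exp (INR (S i) * rho) * D n); [intros; apply Hterm|].
    apply ex_series_scal_R, HD. }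
  assert (HL : has_csum (fun i => Cmult (kap i) (kloosterman_bessel N h m l eps i))
     (CSeries (fun i => Cmult (kap i) (kloosterman_bessel N h m l eps i)))).
  { apply has_csum_CSeries with (fun i => B i * Series D).
    - intros i; eapply has_csum_Cmod_le; [apply Hcol|intros n; apply Ha|].
      apply is_series_scal_R, Series_correct, HD.
    - apply ex_series_scal_r, Hk. }
  eexists; split; [exact HL|].
  refine (has_csum_swap (fun i n => a n i) B D _ _ _ Ha HB0 HD0 Hk HD Hcol _ HL).
  intros n; cbv beta zeta. set (c := (N * S n)%nat).
  assert (Hc : (0 < c)%nat) by (unfold c; lia).
  assert (Hc0 : INR c <> 0) by (apply not_0_INR; lia).
  assert (HKl : forall i, Kloosterman l (Z.of_nat (S i)) c =
     sum_units c (fun d x => Cmult (e2pi (RtoC (sigma * (IZR l * INR x / INR c))))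
        (Cpow (e2pi (RtoC (sigma * (INR d / INR c)))) (S i)))).
  { intros i. destruct Hs as [-> | ->]; [unfold Kloosterman|rewrite (Kloosterman_neg l _ c Hc)];
      apply sum_units_ext; intros d x _ _ _; rewrite e2pi_pow, <- e2pi_plus; f_equal;
      rewrite <- RtoC_mult, <- RtoC_plus, <- INR_IZR_INZ; f_equal; field; exact Hc0. }
  eapply has_csum_ext; [|apply has_csum_scal; apply has_csum_sum_units; intros d x _ _ _;
    apply has_csum_scal; apply has_csum_CSeries with (fun i => bessel_arg m c ^ n0 * exp (X ^ 2 / rho) * B i)].
  - intros i; cbv beta. unfold a. fold c. rewrite HKl.
    transitivity (Cmult (RtoC (/ INR c)) (Cmult (Cmult (kap i) (bet n i)) (sum_units c (fun d x =>
      Cmult (e2pi (RtoC (sigma * (IZR l * INR x / INR c)))) (Cpow (e2pi (RtoC (sigma * (INR d / INR c)))) (S i)))))); [|ring].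
    rewrite <- (sum_units_scal c (Cmult (kap i) (bet n i))). f_equal.
    apply sum_units_ext; intros d x _ _ _. unfold bet; fold c. ring.
  - intros i. rewrite !Cmod_mult, Cmod_pow, Cmod_e2pi_R, pow1, Rmult_1_r. unfold B.
    replace (bessel_arg m c ^ n0 * exp (X ^ 2 / rho) * (Cmod (kap i) * exp (INR (S i) * rho)))
      with (Cmod (kap i) * (bessel_arg m c ^ n0 * (exp (X ^ 2 / rho) * exp (INR (S i) * rho)))) by ring.
    apply Rmult_le_compat_l; [apply Cmod_ge_0|]. apply (Hbet n i).
  - apply ex_series_scal_R, Hk.
Qed.

Lemma kloosterman_bessel_real N h m l eps i : (1 <= N)%nat -> (1 <= h)%nat -> Rabs eps <= 1 ->
  Cconj (kloosterman_bessel N h m l eps i) = kloosterman_bessel N h m l eps i.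
Proof.
  intros HN Hh He. unfold kloosterman_bessel, sum_mult.
  set (f := fun n => Cmult _ _).
  assert (Hf : forall n, Cconj (f n) = f n).
  { intros n; unfold f. rewrite !Cmult_conj, Kloosterman_real by lia.
    rewrite (borel_real _ _ 1); [|lra|apply ex_series_bessel_coef; [exact He|apply bessel_arg_nonneg; lia|lra]].
    f_equal. apply C_eq; simpl; ring. }
  apply C_eq; [reflexivity|]. change (- Series (fun n => Im (f n)) = Series (fun n => Im (f n))).
  rewrite <- Series_opp. apply Series_ext; intros n. rewrite <- im_conj, Hf. reflexivity.
Qed.

Lemma coset_sum_eq N F (L : nat -> C) :
  (forall n, has_zsum (fun d => fsum (Z.to_nat (Z.of_nat (N * S n))) (fun a0 =>
      let a := Z.of_nat a0 in
      if Z.eqb ((a * d - 1) mod Z.of_nat (N * S n))%Z 0%Z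
      then F a ((a * d - 1) / Z.of_nat (N * S n))%Z (Z.of_nat (N * S n)) d else RtoC 0)) (L n)) ->
  coset_sum N F = Cplus (F 1%Z 0%Z 0%Z 1%Z) (CSeries L).
Proof.
  intros H. unfold coset_sum. f_equal. apply CSeries_ext; intros n. exact (CSeries_pair_eq _ _ (H n)).
Qed.

Lemma det_of_mod (a d : Z) (c : nat) : (0 < c)%nat -> ((a * d - 1) mod Z.of_nat c = 0)%Z ->
  (a * d - (a * d - 1) / Z.of_nat c * Z.of_nat c = 1)%Z.
Proof.
  intros Hc H. assert (E := Z.div_mod (a * d - 1) (Z.of_nat c) ltac:(lia)). lia.
Qed.

Lemma cusp_shift_Z (c d : nat) (l : Z) tau : (0 < c)%nat ->
  Cplus tau (RtoC (IZR (Z.of_nat d + Z.of_nat c * l) / INR c)) = Cplus (cusp_shift c d tau) (RtoC (IZR l)).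
Proof.
  intros Hc. unfold cusp_shift. rewrite <- Cplus_assoc, <- RtoC_plus. f_equal. f_equal.
  rewrite plus_IZR, mult_IZR, <- !INR_IZR_INZ. field. apply not_0_INR; lia.
Qed.

Lemma slash_identity kappa f tau : slash kappa f 1 0 0 1 tau = f tau.
Proof.
  unfold slash. replace (Cplus (Cmult (RtoC 0) tau) (RtoC 1)) with (RtoC 1) by ring.
  replace (mobius 1 0 0 1 tau) with tau.
  - replace (Cpowz (RtoC 1) (- kappa)) with (RtoC 1); [ring|].
    unfold Cpowz. destruct (- kappa)%Z; rewrite ?Cpow_1_l; [reflexivity|reflexivity|].
    field; apply C1_nz.
  - unfold mobius. field.
Qed.

Lemma qpow_pow (n : nat) tau : qpow (Z.of_nat n) tau = Cpow (e2pi tau) n.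
Proof. unfold qpow. rewrite e2pi_pow, INR_IZR_INZ; reflexivity. Qed.

Lemma sqrt_INR_pos m : (1 <= m)%nat -> 0 < sqrt (INR m).
Proof. intros H; apply sqrt_lt_R0, lt_0_INR; lia. Qed.

Lemma sqrt_INR_sq m : sqrt (INR m) ^ 2 = INR m.
Proof. apply pow2_sqrt, pos_INR. Qed.

(** This is 2 pi (-1)^(kappa/2) m^(-(kappa-1)/2) for kappa = 2h+2. The power n^((kappa-1)/2) of the
    classical coefficient arises from n^(kappa-1) and the n^(-(kappa-1)/2) hidden in [borel]. *)
Definition poincare_factor (h m : nat) : R := - (-1) ^ h * (2 * PI) / sqrt (INR m) ^ S (2 * h).

Lemma poincare_expansion N h m (l : Z) (eps : R) tau :
  (1 <= N)%nat -> (1 <= h)%nat -> (1 <= m)%nat -> Rabs eps = 1 -> IZR l = eps * INR m -> 0 < Im tau ->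
  has_csum (fun i => Cmult (RtoC (poincare_factor h m))
      (Cmult (Cmult (RtoC (INR (S i) ^ S (2 * h))) (Cpow (e2pi tau) (S i)))
        (kloosterman_bessel N h m l (- eps) i)))
    (Cminus (poincare N (Z.of_nat (S (S (2 * h)))) l tau) (qpow l tau)).
Proof.
  intros HN Hh Hm He Hl Ht. set (n0 := S (2 * h)). assert (Hpi := PI_RGT_0).
  assert (Hr0 := sqrt_INR_pos m Hm). set (r0 := sqrt (INR m)) in *.
  set (kap := fun i => Cmult (RtoC (INR (S i) ^ n0)) (Cpow (e2pi tau) (S i))).
  assert (Hpv : 0 < PI * Im tau) by (apply Rmult_lt_0_compat; assumption).
  destruct (kloosterman_bessel_swap N h m l (- eps) 1 kap (PI * Im tau) HN Hh) as [L [HL1 HL2]].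
  { rewrite Rabs_Ropp; lra. }
  { left; reflexivity. }
  { exact Hpv. }
  { eapply ex_series_ext; [|apply (ex_series_scal_R (exp (- (PI * Im tau)))),
      (ex_series_poly_geom n0 (exp (- (PI * Im tau))))].
    - intros i; cbv beta. unfold kap. rewrite Cmod_mult, Cmod_R, Cmod_e2pi_pow, Rabs_pos_eq by (apply pow_le, pos_INR).
      rewrite <- exp_INR_pow.
      replace (exp (- (PI * Im tau)) * (INR (S i) ^ n0 * exp (INR i * - (PI * Im tau)))) with
        (INR (S i) ^ n0 * (exp (- (PI * Im tau)) * exp (INR i * - (PI * Im tau)))) by ring.
      rewrite Rmult_assoc, <- !exp_plus. f_equal; f_equal. rewrite S_INR; ring.
    - split; [left; apply exp_pos|]. rewrite <- exp_0; apply exp_increasing; lra. }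
  replace (Cminus (poincare N (Z.of_nat (S n0)) l tau) (qpow l tau)) with (Cmult (RtoC (poincare_factor h m)) L).
  { apply has_csum_scal. exact HL1. }
  unfold poincare.
  rewrite (coset_sum_eq N _ (fun n => Cmult (RtoC (poincare_factor h m)) (let c := (N * S n)%nat in
     Cmult (RtoC (/ INR c)) (sum_units c (fun d x =>
        Cmult (e2pi (RtoC (1 * (IZR l * INR x / INR c))))
          (CSeries (fun i => Cmult (Cmult (kap i) (Cpow (e2pi (RtoC (1 * (INR d / INR c)))) (S i)))
             (borel (bessel_coef (- eps) (bessel_arg m c) (S (2 * h))) (INR (S i)))))))))).
  - rewrite (CSeries_eq _ _ (has_csum_scal (RtoC (poincare_factor h m)) _ _ HL2)).
    rewrite slash_identity. ring.
  - intros n. set (c := (N * S n)%nat). cbv zeta.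
    assert (Hc : (0 < c)%nat) by (unfold c; lia).
    assert (Hc0 : 0 < INR c) by (apply lt_0_INR, Hc).
    eapply has_zsum_eq.
    + apply (has_zsum_coset c (fun a b c d => slash (Z.of_nat (S n0)) (qpow l) a b c d tau)
        (fun x => e2pi (RtoC (IZR l * INR x / INR c)))
        (fun d => let w := Cplus tau (RtoC (IZR d / INR c)) in
          (Cmult (RtoC (/ INR c ^ S n0)) (Cmult (Cinv (Cpow w (S n0)))
            (Cexp (Cdiv (Cmult (RtoC (- eps)) (Cmult two_pi_i (RtoC (r0 ^ 2 / INR c ^ 2)))) w)))))
        (fun d => Cmult (RtoC (- (-1) ^ h * (2 * PI / INR c) / r0 ^ n0))
          (CSeries (fun i => Cmult (Cmult (RtoC (INR (S i) ^ n0)) (Cpow (e2pi (cusp_shift c d tau)) (S i)))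
            (borel (bessel_coef (- eps) (bessel_arg m c) n0) (INR (S i)))))) Hc).
      * intros a d Ha Hmod. cbv zeta. rewrite (slash_qpow n0 l _ _ d c tau Hc (det_of_mod _ _ _ Hc Hmod)) by lra.
        rewrite <- INR_IZR_INZ. do 5 f_equal. rewrite Hl. unfold r0. rewrite sqrt_INR_sq.
        unfold Rdiv. rewrite !RtoC_mult, RtoC_opp. ring.
      * intros d Hd _. assert (Hw : 0 < Im (cusp_shift c d tau)) by (rewrite Im_cusp_shift; exact Ht).
        destruct (has_zsum_poincare_kernel h (INR c) r0 Hc0 Hr0 eps (cusp_shift c d tau) Hw He) as [H _].
        eapply has_zsum_ext, H. intros t; cbv beta zeta. rewrite cusp_shift_Z by exact Hc. reflexivity.
    + rewrite <- !sum_units_scal. apply sum_units_ext; intros d x _ _ _.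
      rewrite !Rmult_1_l. unfold poincare_factor. fold r0 n0.
      replace (RtoC (- (-1) ^ h * (2 * PI / INR c) / r0 ^ n0)) with
        (Cmult (RtoC (- (-1) ^ h * (2 * PI) / r0 ^ n0)) (RtoC (/ INR c))).
      2:{ rewrite <- RtoC_mult. f_equal. field. split; [lra|apply pow_nonzero; lra]. }
      set (S1 := CSeries _). set (S2 := CSeries _).
      replace S2 with S1; [ring|]. apply CSeries_ext; intros i.
      f_equal. unfold kap. rewrite <- Cmult_assoc. f_equal. rewrite <- Cpow_mult_l, <- e2pi_plus. reflexivity.
Qed.

Lemma qpow_add a b tau : Cmult (qpow a tau) (qpow b tau) = qpow (a + b) tau.
Proof. unfold qpow. rewrite <- e2pi_plus, plus_IZR, RtoC_plus. f_equal; ring. Qed.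

Lemma qpow_height_one p u :
  qpow p (u, 1) = Cmult (RtoC (exp (- (2 * PI * IZR p)))) (Cexp (0, IZR p * (2 * PI / 1 * u))).
Proof.
  unfold qpow, e2pi.
  replace (Cmult (0, 2 * PI) (Cmult (RtoC (IZR p)) (u, 1))) with
    (Cplus (RtoC (- (2 * PI * IZR p))) (0, IZR p * (2 * PI / 1 * u))) by (apply C_eq; simpl; field).
  rewrite Cexp_plus. f_equal. unfold Cexp; apply C_eq; simpl; rewrite ?cos_0, ?sin_0; ring.
Qed.

Lemma is_CInt_qpow p : is_CInt (fun u => qpow p (u, 1)) 0 1 (if Z.eqb p 0 then RtoC 1 else RtoC 0).
Proof.
  assert (H := is_CInt_scal (RtoC (exp (- (2 * PI * IZR p)))) _ _ _ _ (is_CInt_Cexp_period p 1 R1_neq_R0)).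
  eapply is_CInt_ext in H; [|intros u; symmetry; apply qpow_height_one].
  destruct (Z.eqb_spec p 0) as [Hp|Hp]; [|rewrite Cmult_0_r in H; exact H].
  replace (IZR p) with 0 in H by (rewrite Hp; reflexivity).
  rewrite Rmult_0_r, Ropp_0, exp_0, Cmult_1_r in H. exact H.
Qed.

(** At height one |q^n| is independent of u, so absolute convergence at u = 0 provides the majorant
    for termwise integration, and orthogonality picks one index. As a i belongs to q^(i+1), the
    index is n-1. *)
Lemma fourier_coeff_series (f : C -> C) (l : Z) (a : nat -> C) (n : Z) :
  (forall u, has_csum (fun i => Cmult (a i) (Cpow (e2pi (u, 1)) (S i))) (Cminus (f (u, 1)) (qpow l (u, 1)))) ->
  fourier_coeff f n = Cplus (if Z.eqb l n then RtoC 1 else RtoC 0)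
     (if Z.ltb 0 n then a (Z.to_nat (n - 1)) else RtoC 0).
Proof.
  intros Hf. unfold fourier_coeff. apply is_CInt_RInt.
  assert (Hmod : forall i u, Cmod (Cmult (a i) (qpow (Z.of_nat (S i) - n) (u, 1))) =
     Cmod (Cmult (a i) (Cpow (e2pi (0, 1)) (S i))) * exp (2 * PI * IZR n)).
  { intros i u. rewrite !Cmod_mult, Cmod_e2pi_pow, qpow_height_one, Cmod_mult, Cmod_R, Cmod_Cexp.
    simpl Re. simpl Im. rewrite exp_0, Rmult_1_r, Rabs_pos_eq, (Rmult_assoc (Cmod (a i))), <- exp_plus
      by (left; apply exp_pos).
    f_equal; f_equal. rewrite minus_IZR, <- INR_IZR_INZ. ring. }
  assert (H := is_CInt_plus _ _ _ _ _ _ (is_CInt_qpow (l - n))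
    (is_CInt_CSeries (fun i u => Cmult (a i) (qpow (Z.of_nat (S i) - n) (u, 1)))
      (fun i => Cmult (a i) (if Z.eqb (Z.of_nat (S i) - n) 0 then RtoC 1 else RtoC 0))
      (fun i => Cmod (Cmult (a i) (Cpow (e2pi (0, 1)) (S i))) * exp (2 * PI * IZR n)) 0 1
      (fun i => is_CInt_scal (a i) _ _ _ _ (is_CInt_qpow (Z.of_nat (S i) - n)))
      (fun i u => Req_le _ _ (Hmod i u))
      (ex_series_scal_r _ _ (proj1 (Hf 0))))).
  replace (Cplus (if Z.eqb l n then RtoC 1 else RtoC 0) (if Z.ltb 0 n then a (Z.to_nat (n - 1)) else RtoC 0)) with
    (Cplus (if Z.eqb (l - n) 0 then RtoC 1 else RtoC 0)
      (CSeries (fun i => Cmult (a i) (if Z.eqb (Z.of_nat (S i) - n) 0 then RtoC 1 else RtoC 0)))).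
  - eapply is_CInt_ext, H. intros u; cbv beta.
    transitivity (Cmult (qpow (- n) (u, 1)) (Cplus (qpow l (u, 1)) (Cminus (f (u, 1)) (qpow l (u, 1))))); [|ring].
    rewrite Cmult_plus_distr_l. f_equal.
    + rewrite qpow_add. f_equal; lia.
    + apply CSeries_eq. eapply has_csum_ext; [|apply has_csum_scal, Hf].
      intros i; cbv beta. rewrite <- qpow_pow. replace (Z.of_nat (S i) - n)%Z with (- n + Z.of_nat (S i))%Z by lia.
      rewrite <- qpow_add. ring.
  - f_equal.
    + destruct (Z.eqb_spec (l - n) 0), (Z.eqb_spec l n); try lia; reflexivity.
    + apply CSeries_eq. destruct (Z.ltb_spec 0 n) as [Hn|Hn].
      * eapply has_csum_ext; [|apply (has_csum_single (Z.to_nat (n - 1)))].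
        intros i; cbv beta. destruct (Nat.eqb_spec i (Z.to_nat (n - 1))), (Z.eqb_spec (Z.of_nat (S i) - n) 0); subst; try lia; ring.
      * eapply has_csum_ext; [|apply has_csum_0].
        intros i; cbv beta. destruct (Z.eqb_spec (Z.of_nat (S i) - n) 0); [lia|]. ring.
Qed.

Lemma fourier_coeff_poincare N h m (l : Z) (eps : R) (n : Z) :
  (1 <= N)%nat -> (1 <= h)%nat -> (1 <= m)%nat -> Rabs eps = 1 -> IZR l = eps * INR m ->
  fourier_coeff (poincare N (Z.of_nat (S (S (2 * h)))) l) n =
  Cplus (if Z.eqb l n then RtoC 1 else RtoC 0)
    (if Z.ltb 0 n then Cmult (RtoC (poincare_factor h m * IZR n ^ S (2 * h)))
       (kloosterman_bessel N h m l (- eps) (Z.to_nat (n - 1))) else RtoC 0).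
Proof.
  intros HN Hh Hm He Hl.
  rewrite (fourier_coeff_series _ l (fun i => Cmult (RtoC (poincare_factor h m * INR (S i) ^ S (2 * h)))
     (kloosterman_bessel N h m l (- eps) i))).
  - f_equal. destruct (Z.ltb_spec 0 n); [|reflexivity].
    replace (INR (S (Z.to_nat (n - 1)))) with (IZR n); [reflexivity|]. rewrite INR_IZR_INZ. f_equal; lia.
  - intros u. eapply has_csum_ext; [|apply (poincare_expansion N h m l eps (u, 1) HN Hh Hm He Hl); simpl; lra].
    intros i; cbv beta. rewrite RtoC_mult. ring.
Qed.

(** * The identities in the two half-planes *)

Definition inv_char (m c x : nat) : C := e2pi (RtoC (- INR m * INR x / INR c)).

Lemma Cmod_inv_char m c x : Cmod (inv_char m c x) = 1.
Proof. apply Cmod_e2pi_R. Qed.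

(** The common shape of the c-th terms of H^+, of H^-, of the constant term and of both Eichler
    integrals; comparing them is thereby reduced to comparing f and the prefactors. *)
Definition level_mean (c : nat) (m : nat) (f : nat -> C) : C :=
  Cmult (RtoC (/ INR c)) (sum_units c (fun d x => Cmult (inv_char m c x) (f d))).

Lemma level_mean_scal c m z f : level_mean c m (fun d => Cmult z (f d)) = Cmult z (level_mean c m f).
Proof.
  unfold level_mean. transitivity (Cmult (RtoC (/ INR c)) (Cmult z (sum_units c (fun d x => Cmult (inv_char m c x) (f d))))); [|ring].
  f_equal. rewrite <- sum_units_scal. apply sum_units_ext; intros; ring.
Qed.

Lemma level_mean_plus c m f g :
  level_mean c m (fun d => Cplus (f d) (g d)) = Cplus (level_mean c m f) (level_mean c m g).
Proof.
  unfold level_mean. rewrite <- Cmult_plus_distr_l. f_equal. rewrite <- sum_units_plus.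
  apply sum_units_ext; intros; ring.
Qed.

Lemma has_csum_level_mean N h m (f : nat -> nat -> C) K : (1 <= N)%nat -> (1 <= h)%nat -> 0 <= K ->
  (forall n d, Cmod (f n d) <= bessel_arg m (N * S n) ^ S (2 * h) * K) ->
  has_csum (fun n => level_mean (N * S n) m (f n)) (CSeries (fun n => level_mean (N * S n) m (f n))).
Proof.
  intros HN Hh HK Hf.
  apply has_csum_CSeries with (fun n => bessel_max m ^ S (2 * h) * K * / INR (S n) ^ 2).
  - intros n. apply Cmod_level_term_le; [exact HN|exact Hh|exact HK|].
    intros d x _ _ _. rewrite Cmod_mult, Cmod_inv_char, Rmult_1_l. apply Hf.
  - apply ex_series_scal_R, ex_series_inv_sq.
Qed.

Lemma powerRZ_m1 h : powerRZ (-1) (- Z.of_nat h) = (-1) ^ h.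
Proof.
  rewrite powerRZ_neg, <- pow_powerRZ by lra. f_equal. field.
Qed.

Section Main.

Variables (N h m : nat).
Hypotheses (HN : (1 <= N)%nat) (Hh : (1 <= h)%nat) (Hm : (1 <= m)%nat).

Let k : Z := (- Z.of_nat (2 * h))%Z.
Let n0 : nat := S (2 * h).
Let r0 : R := sqrt (INR m).
(** Equals 2 pi (-1)^(k/2) m^((1-k)/2), the prefactor shared by H^+ and H^-. *)
Let Cp : R := 2 * PI * (-1) ^ h * r0 ^ n0.

Let Hr0 : 0 < r0.
Proof. apply sqrt_INR_pos, Hm. Qed.

Let Hr0m : INR m = r0 ^ 2.
Proof. symmetry; apply sqrt_INR_sq. Qed.

Let k_half : (k / 2 = - Z.of_nat h)%Z.
Proof.
  unfold k. replace (- Z.of_nat (2 * h))%Z with (- Z.of_nat h * 2)%Z by lia. apply Z.div_mul; lia.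
Qed.

Let one_k : Z.to_nat (1 - k) = n0.
Proof. unfold k, n0; lia. Qed.

Let two_k : Z.to_nat (2 - k) = S n0.
Proof. unfold k, n0; lia. Qed.

Let opp_k : Z.to_nat (- k) = (2 * h)%nat.
Proof. unfold k; lia. Qed.

Let Rpower_half : Rpower (INR m) ((1 - IZR k) / 2) = r0 ^ n0.
Proof.
  assert (Hm0 : 0 < INR m) by (apply lt_0_INR; lia).
  replace ((1 - IZR k) / 2) with (/ 2 * INR n0).
  2:{ unfold k, n0. rewrite opp_IZR, <- INR_IZR_INZ, S_INR. field. }
  rewrite <- Rpower_mult, Rpower_sqrt by exact Hm0. apply Rpower_pow, Hr0.
Qed.

Let constant_term c : C := RtoC (bessel_arg m c ^ n0 / INR (fact n0)).

Let aplus0_factor : R := (2 * PI) ^ S n0 * (- (-1) ^ h) * (- INR m) ^ n0 / INR (fact n0).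

(** x^n0/n0! is the [borel] value at 0, so a^+(0) is the coefficient of index zero that the
    holomorphic expansion lacks. Half of m^(1-k) goes into [Cp] and half into x^n0; the sign of
    (-m)^n0, n0 odd, cancels the extra one in (-1)^(k/2+1). *)
Let aplus0_term_eq c : (0 < c)%nat ->
  Cmult (RtoC aplus0_factor) (aplus0_term k m c)
  = Cmult (RtoC Cp) (level_mean c m (fun _ => constant_term c)).
Proof.
  intros Hc. assert (Hc0 : INR c <> 0) by (apply not_0_INR; lia).
  unfold aplus0_term, level_mean. rewrite two_k. unfold Kloosterman.
  rewrite (sum_units_ext c (fun d x => e2pi _) (fun d x => inv_char m c x)).
  2:{ intros d x _ _ _. unfold inv_char. rewrite opp_IZR, <- INR_IZR_INZ. do 3 f_equal. ring. }
  rewrite (sum_units_ext c (fun d x => Cmult _ _) (fun d x => Cmult (constant_term c) (inv_char m c x))).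
  2:{ intros; apply Cmult_comm. }
  rewrite sum_units_scal. set (SU := sum_units _ _).
  assert (Hcn : INR c ^ S n0 <> 0) by (apply pow_nonzero, Hc0).
  unfold Cdiv. rewrite <- RtoC_inv by exact Hcn.
  transitivity (Cmult (RtoC (aplus0_factor * / INR c ^ S n0)) SU); [rewrite RtoC_mult; ring|].
  transitivity (Cmult (RtoC (Cp * (/ INR c * (bessel_arg m c ^ n0 / INR (fact n0))))) SU);
    [|unfold constant_term; rewrite !RtoC_mult; ring].
  f_equal. f_equal. unfold aplus0_factor, Cp, bessel_arg. fold r0. rewrite Hr0m.
  assert (Hodd : (- r0 ^ 2) ^ n0 = - (r0 ^ n0 * r0 ^ n0)).
  { replace (- r0 ^ 2) with (-1 * (r0 * r0)) by ring. rewrite !Rpow_mult_distr.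
    replace ((-1) ^ n0) with (-1); [ring|]. unfold n0. symmetry; apply pow_1_odd. }
  rewrite Hodd. unfold Rdiv. rewrite !Rpow_mult_distr, pow_inv, <- !(tech_pow_Rmult _ n0).
  assert (Hf := INR_fact_neq_0 n0). assert (Hcn' : INR c ^ n0 <> 0) by (apply pow_nonzero, Hc0).
  field. auto.
Qed.

Let has_csum_constant : has_csum (fun n => level_mean (N * S n) m (fun _ => constant_term (N * S n)))
  (CSeries (fun n => level_mean (N * S n) m (fun _ => constant_term (N * S n)))).
Proof.
  apply (has_csum_level_mean N h m (fun n _ => constant_term (N * S n)) (/ INR (fact n0)) HN Hh).
  - left; apply Rinv_0_lt_compat, INR_fact_lt_0.
  - intros n _. unfold constant_term. rewrite Cmod_R, Rabs_pos_eq; [apply Rle_refl|].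
    apply Rdiv_le_0_compat; [|apply INR_fact_lt_0]. apply pow_le, bessel_arg_nonneg; lia.
Qed.

Lemma has_csum_aplus0_term : has_csum (fun n => aplus0_term k m (N * S n))
  (CSeries (fun n => aplus0_term k m (N * S n))).
Proof.
  apply has_csum_CSeries with (fun n => / INR (S n) ^ 2); [|apply ex_series_inv_sq].
  intros n. destruct (level_ge N n HN) as [H1 H2]. set (c := (N * S n)%nat) in *.
  unfold aplus0_term. rewrite two_k.
  assert (Hcn : 0 < INR c ^ S n0) by (apply pow_lt; lra).
  rewrite Cmod_div, Cmod_R, Rabs_pos_eq by (try (apply RtoC_neq_0); lra).
  apply Rle_trans with (INR c ^ 2 * 1 / INR c ^ S n0).
  - apply Rmult_le_compat_r; [left; apply Rinv_0_lt_compat, Hcn|].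
    apply Cmod_sum_units_le; [lra|]. intros; rewrite Cmod_e2pi_R; lra.
  - apply Rle_trans with (/ INR c ^ (2 * h)); [|apply inv_pow_level_le; [exact HN|lia]].
    right. replace (S n0) with (2 * h + 2)%nat by (unfold n0; lia). rewrite pow_add.
    assert (INR c ^ (2 * h) <> 0) by (apply pow_nonzero; lra). field. split; (assumption || lra).
Qed.

Let aplus0_eq : aplus0 N k m =
  Cmult (RtoC Cp) (CSeries (fun n => level_mean (N * S n) m (fun _ => constant_term (N * S n)))).
Proof.
  unfold aplus0, sum_mult.
  replace (powerRZ (-1) (k / 2 + 1)) with (- (-1) ^ h).
  2:{ rewrite k_half. replace (- Z.of_nat h + 1)%Z with (- Z.of_nat (h - 1))%Z by lia. rewrite powerRZ_m1.
      replace h with (S (h - 1)) at 1 by lia. simpl; ring. }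
  rewrite one_k, two_k. fold aplus0_factor.
  rewrite <- (CSeries_eq _ _ (has_csum_scal (RtoC aplus0_factor) _ _ has_csum_aplus0_term)).
  rewrite <- (CSeries_eq _ _ (has_csum_scal (RtoC Cp) _ _ has_csum_constant)).
  apply CSeries_ext; intros n. apply aplus0_term_eq; lia.
Qed.

Let Hplus_term_level r tau c (f : nat -> C) :
  (forall d, (d < c)%nat -> Nat.gcd d c = 1%nat ->
     Cmult (e2pi (cusp_shift c d tau)) (phi_plus k m r c d tau) = f d) -> (0 < c)%nat ->
  Hplus_term k m r tau c = level_mean c m f.
Proof.
  intros Hf Hc. unfold Hplus_term, level_mean. f_equal. apply sum_units_ext; intros d x Hd _ Hg.
  rewrite <- (Hf d Hd Hg), Cmult_assoc. f_equal. unfold inv_char, qpow, cusp_shift.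
  rewrite <- !e2pi_plus. f_equal. unfold Rdiv. rewrite Rmult_plus_distr_r, RtoC_plus. ring.
Qed.

Let Hminus_term_level r tau c (f : nat -> C) :
  (forall d, (d < c)%nat -> Nat.gcd d c = 1%nat -> phi_minus k m r c d tau = f d) ->
  Hminus_term k m r tau c = level_mean c m f.
Proof.
  intros Hf. unfold Hminus_term, level_mean. f_equal. apply sum_units_ext; intros d x Hd _ Hg.
  rewrite (Hf d Hd Hg). reflexivity.
Qed.

Let phi_minus_eq r c d tau l :
  @is_RInt_gen C_R_NormedModule (phi_minus_integrand k m r c d tau) (at_point 1) (Rbar_locally p_infty) l ->
  phi_minus k m r c d tau = l.
Proof. intros H. apply (is_RInt_gen_unique (V := C_R_CompleteNormedModule)); exact H. Qed.

Let hol_upper tau c d := hol_sum n0 1 (bessel_arg m c) (e2pi (cusp_shift c d tau)).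
Let gam_upper tau c d := gamma_sum n0 (Im tau) (-1) (bessel_arg m c) (e2pi (Copp (cusp_shift c d tau))).
Let hol_lower tau c d := hol_sum n0 (-1) (bessel_arg m c) (e2pi (Copp (cusp_shift c d tau))).
Let gam_lower tau c d := gamma_sum n0 (- Im tau) 1 (bessel_arg m c) (e2pi (cusp_shift c d tau)).

Let m1_le : Rabs (-1) <= 1.
Proof. rewrite Rabs_m1; lra. Qed.

Let one_le : Rabs 1 <= 1.
Proof. rewrite Rabs_R1; lra. Qed.

Let has_csum_hol_upper tau r : 0 < r < 2 * PI * Im tau ->
  has_csum (fun n => level_mean (N * S n) m (hol_upper tau (N * S n)))
   (CSeries (fun n => level_mean (N * S n) m (hol_upper tau (N * S n)))).
Proof.
  intros Hr. destruct (Cmod_hol_sum_le n0 1 (bessel_max m) (Im tau) r one_le Hr) as [K [HK HB]].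
  apply has_csum_level_mean with h K; auto. intros n d. apply HB; [apply bessel_arg_le, HN|apply Im_cusp_shift].
Qed.

Let has_csum_hol_lower tau r : 0 < r < 2 * PI * - Im tau ->
  has_csum (fun n => level_mean (N * S n) m (hol_lower tau (N * S n)))
   (CSeries (fun n => level_mean (N * S n) m (hol_lower tau (N * S n)))).
Proof.
  intros Hr. destruct (Cmod_hol_sum_le n0 (-1) (bessel_max m) (- Im tau) r m1_le Hr) as [K [HK HB]].
  apply has_csum_level_mean with h K; auto. intros n d. apply HB; [apply bessel_arg_le, HN|].
  change (- Im (cusp_shift (N * S n) d tau) = - Im tau). rewrite Im_cusp_shift; reflexivity.
Qed.

Let has_csum_gam_upper tau r : 0 < r < 2 * PI * Im tau ->
  has_csum (fun n => level_mean (N * S n) m (gam_upper tau (N * S n)))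
   (CSeries (fun n => level_mean (N * S n) m (gam_upper tau (N * S n)))).
Proof.
  intros Hr. destruct (Cmod_gamma_sum_le h (-1) (bessel_max m) (Im tau) r m1_le Hr) as [K [HK HB]].
  apply has_csum_level_mean with h K; auto. intros n d. apply HB; [apply bessel_arg_le, HN|].
  rewrite Cmod_e2pi. f_equal. change (Im (Copp (cusp_shift (N * S n) d tau))) with (- Im (cusp_shift (N * S n) d tau)).
  rewrite Im_cusp_shift; ring.
Qed.

Let has_csum_gam_lower tau r : 0 < r < 2 * PI * - Im tau ->
  has_csum (fun n => level_mean (N * S n) m (gam_lower tau (N * S n)))
   (CSeries (fun n => level_mean (N * S n) m (gam_lower tau (N * S n)))).
Proof.
  intros Hr. destruct (Cmod_gamma_sum_le h 1 (bessel_max m) (- Im tau) r one_le Hr) as [K [HK HB]].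
  apply has_csum_level_mean with h K; auto. intros n d. apply HB; [apply bessel_arg_le, HN|].
  rewrite Cmod_e2pi. f_equal. rewrite Im_cusp_shift; ring.
Qed.

Let Hplus_upper tau r n : 0 < r < 2 * PI * Im tau ->
  Hplus_term k m r tau (N * S n) = level_mean (N * S n) m (hol_upper tau (N * S n)).
Proof.
  intros Hr. apply Hplus_term_level; [|lia]. intros d _ _. apply (phi_plus_upper h m r _ d tau); [lia|exact Hr].
Qed.

Let Hplus_lower tau r n : 0 < r < 2 * PI * - Im tau ->
  Hplus_term k m r tau (N * S n) = Copp (Cplus (level_mean (N * S n) m (fun _ => constant_term (N * S n)))
     (level_mean (N * S n) m (hol_lower tau (N * S n)))).
Proof.
  intros Hr. rewrite <- level_mean_plus.
  rewrite (Hplus_term_level r tau (N * S n) (fun d => Cmult (RtoC (-1))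
     (Cplus (constant_term (N * S n)) (hol_lower tau (N * S n) d)))).
  - rewrite level_mean_scal. ring.
  - intros d _ _. unfold k. rewrite (phi_plus_lower h m r _ d tau); [|lia|exact Hr].
    fold n0. unfold constant_term, hol_lower, hol_sum. ring.
  - lia.
Qed.

Let Hminus_upper tau r n : 0 < r < 2 * PI * Im tau ->
  Hminus_term k m r tau (N * S n) =
  Cmult (RtoC (INR (fact (2 * h)) / (4 * PI * Im tau) ^ n0)) (level_mean (N * S n) m (gam_upper tau (N * S n))).
Proof.
  intros Hr. rewrite <- level_mean_scal. apply Hminus_term_level. intros d _ _.
  apply phi_minus_eq. apply is_RInt_gen_phi_minus_upper; [lia|exact Hr].
Qed.

Let Hminus_lower tau r n : 0 < r < 2 * PI * - Im tau ->
  Hminus_term k m r tau (N * S n) =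
  Cmult (RtoC (INR (fact (2 * h)) / (4 * PI * - Im tau) ^ n0)) (level_mean (N * S n) m (gam_lower tau (N * S n))).
Proof.
  intros Hr. rewrite <- level_mean_scal. apply Hminus_term_level. intros d _ _.
  apply phi_minus_eq. apply is_RInt_gen_phi_minus_lower; [lia|exact Hr].
Qed.

Lemma ex_Cseries_terms tau r : 0 < r < 2 * PI * Rabs (Im tau) ->
  ex_Cseries (fun n => Hplus_term k m r tau (N * S n)) /\
  (forall c d : nat, (0 < c)%nat ->
     @ex_RInt_gen C_R_NormedModule (phi_minus_integrand k m r c d tau) (at_point 1) (Rbar_locally p_infty)) /\
  ex_Cseries (fun n => Hminus_term k m r tau (N * S n)).
Proof.
  intros Hr. unfold Rabs in Hr. destruct (Rcase_abs (Im tau)) as [Hv|Hv].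
  - split; [|split].
    + eapply ex_Cseries_has_csum. eapply has_csum_ext; [intros n; symmetry; apply (Hplus_lower tau r n Hr)|].
      apply has_csum_opp, has_csum_plus; [exact has_csum_constant|exact (has_csum_hol_lower tau r Hr)].
    + intros c d Hc. eexists. apply (is_RInt_gen_phi_minus_lower h m r c d tau Hc Hr).
    + eapply ex_Cseries_has_csum. eapply has_csum_ext; [intros n; symmetry; apply (Hminus_lower tau r n Hr)|].
      apply has_csum_scal, (has_csum_gam_lower tau r Hr).
  - split; [|split].
    + eapply ex_Cseries_has_csum. eapply has_csum_ext; [intros n; symmetry; apply (Hplus_upper tau r n Hr)|].
      exact (has_csum_hol_upper tau r Hr).
    + intros c d Hc. eexists. apply (is_RInt_gen_phi_minus_upper h m r c d tau Hc Hr).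
    + eapply ex_Cseries_has_csum. eapply has_csum_ext; [intros n; symmetry; apply (Hminus_upper tau r n Hr)|].
      apply has_csum_scal, (has_csum_gam_upper tau r Hr).
Qed.

(** The identity coset gives the full seed, whose two summands are the leading terms of H^+ and H^-.
    For each c the remaining cosets give the constant, the holomorphic and the gamma sum with the
    one prefactor [Cp]; the normalisation (4 pi v)^(1-k)/(-k)! of H^- cancels the constant of the
    gamma integral. *)
Theorem Hkm_upper tau r : 0 < r < 2 * PI * Im tau -> Hkm N k m r tau = maass_poincare N k m tau.
Proof.
  intros Hr. assert (Hpi := PI_RGT_0). assert (Hv : 0 < Im tau) by nra.
  set (P1 := fun n => level_mean (N * S n) m (fun _ => constant_term (N * S n))).
  set (P2 := fun n => level_mean (N * S n) m (hol_upper tau (N * S n))).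
  set (P3 := fun n => level_mean (N * S n) m (gam_upper tau (N * S n))).
  assert (S1 : has_csum P1 (CSeries P1)) by exact has_csum_constant.
  assert (S2 : has_csum P2 (CSeries P2)) by exact (has_csum_hol_upper tau r Hr).
  assert (S3 : has_csum P3 (CSeries P3)) by exact (has_csum_gam_upper tau r Hr).
  assert (ES := has_csum_scal (RtoC Cp) _ _ (has_csum_plus _ _ _ _ S1 (has_csum_plus _ _ _ _ S2 S3))).
  unfold maass_poincare.
  rewrite (coset_sum_eq N _ (fun n => Cmult (RtoC Cp) (Cplus (P1 n) (Cplus (P2 n) (P3 n))))).
  - rewrite (CSeries_eq _ _ ES), slash_identity.
    unfold Hkm, Hplus, Hminus. rewrite aplus0_eq. fold P1.
    unfold sum_mult. rewrite (CSeries_ext _ _ (fun n => Hplus_upper tau r n Hr)). fold P2.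
    rewrite (CSeries_ext _ _ (fun n => Hminus_upper tau r n Hr)).
    rewrite (CSeries_eq _ _ (has_csum_scal _ _ _ S3)).
    rewrite k_half, powerRZ_m1, Rpower_half, one_k, opp_k.
    unfold maass_seed. rewrite one_k.
    replace (2 * PI * (-1) ^ h * r0 ^ n0) with Cp by reflexivity.
    assert (Hpv : (4 * PI * Im tau) ^ n0 <> 0).
    { apply pow_nonzero. assert (0 < PI * Im tau) by (apply Rmult_lt_0_compat; assumption). lra. }
    assert (Hf := INR_fact_neq_0 (2 * h)).
    replace (Cmult (RtoC (2 * PI * (-1) ^ h * (4 * PI * Im tau) ^ n0 / INR (fact (2 * h)) * r0 ^ n0))
        (Cmult (RtoC (INR (fact (2 * h)) / (4 * PI * Im tau) ^ n0)) (CSeries P3)))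
      with (Cmult (RtoC Cp) (CSeries P3)).
    2:{ rewrite Cmult_assoc, <- RtoC_mult. f_equal. f_equal. unfold Cp. field; auto. }
    rewrite RtoC_minus. ring.
  - intros n. set (c := (N * S n)%nat). assert (Hc : (0 < c)%nat) by (unfold c; lia).
    assert (Hc0 : 0 < INR c) by (apply lt_0_INR, Hc).
    eapply has_zsum_eq.
    + apply (has_zsum_coset c (fun a b c d => slash k (maass_seed k m) a b c d tau)
        (fun x => inv_char m c x)
        (fun d => Cmult (RtoC (INR c ^ (2 * h)))
           (seed_kernel (Cmult two_pi_i (RtoC (r0 ^ 2 / INR c ^ 2))) n0 (Cplus tau (RtoC (IZR d / INR c)))))
        (fun d => Cmult (RtoC ((-1) ^ h * r0 ^ n0 * (2 * PI / INR c)))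
           (Cplus (constant_term c) (Cplus (hol_upper tau c d) (gam_upper tau c d)))) Hc).
      * intros a d Ha Hmod. unfold k.
        rewrite (slash_maass_seed h m _ _ d c tau Hc (det_of_mod _ _ _ Hc Hmod) Hv).
        unfold inv_char. rewrite <- INR_IZR_INZ, <- Hr0m. reflexivity.
      * intros d Hd _. assert (Hw : 0 < Im (cusp_shift c d tau)) by (rewrite Im_cusp_shift; exact Hv).
        assert (H := has_zsum_maass_kernel h (INR c) r0 Hc0 Hr0 (cusp_shift c d tau) Hw).
        rewrite Im_cusp_shift in H.
        eapply has_zsum_ext, H. intros t; cbv beta. rewrite cusp_shift_Z by exact Hc. reflexivity.
    + unfold P1, P2, P3. fold c. rewrite <- !level_mean_plus, <- level_mean_scal. unfold level_mean.
      rewrite <- sum_units_scal. apply sum_units_ext; intros d x _ _ _.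
      set (T := Cplus _ _).
      replace (RtoC ((-1) ^ h * r0 ^ n0 * (2 * PI / INR c))) with (Cmult (RtoC (/ INR c)) (RtoC Cp)); [ring|].
      rewrite <- RtoC_mult. f_equal. unfold Cp. field. lra.
Qed.

Let n_weight (i : nat) : 0 < INR (S i) ^ n0.
Proof. apply pow_lt, lt_0_INR; lia. Qed.

Let kappa_eq : (2 - k)%Z = Z.of_nat (S n0).
Proof. unfold k, n0; lia. Qed.

Let kappa_pred : (2 - k - 1)%Z = Z.of_nat n0.
Proof. unfold k, n0; lia. Qed.

Let factor_m : INR m ^ n0 * poincare_factor h m = - Cp.
Proof.
  unfold poincare_factor, Cp. fold r0 n0. rewrite Hr0m. replace (r0 ^ 2) with (r0 * r0) by ring.
  rewrite Rpow_mult_distr. field. apply pow_nonzero; lra.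
Qed.

(** Division by n^(kappa-1) removes the weight n^n0 of the Fourier coefficients and leaves the sum
    occurring in H^+. The Kronecker term at n = m gives q^(-m). With l = m the characters of
    [level_mean] require sigma = -1. *)
Let eichler_lower tau : Im tau < 0 ->
  eichler (2 - k) (poincare N (2 - k) (Z.of_nat m)) (Copp tau) =
  Cplus (Cdiv (qpow (- Z.of_nat m) tau) (RtoC (INR m ^ n0)))
    (Cmult (RtoC (poincare_factor h m)) (CSeries (fun n => level_mean (N * S n) m (hol_lower tau (N * S n))))).
Proof.
  intros Hv. assert (Hpi := PI_RGT_0).
  assert (Hpv : 0 < PI * - Im tau) by (apply Rmult_lt_0_compat; lra).
  destruct (kloosterman_bessel_swap N h m (Z.of_nat m) (-1) (-1) (fun i => Cpow (e2pi (Copp tau)) (S i))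
    (PI * - Im tau) HN Hh m1_le) as [L [HL1 HL2]].
  { right; reflexivity. }
  { exact Hpv. }
  { eapply ex_series_ext; [|apply (ex_series_exp_decay (PI * - Im tau) Hpv)].
    intros i; cbv beta. rewrite Cmod_e2pi_pow, <- exp_plus. f_equal.
    change (Im (Copp tau)) with (- Im tau). ring. }
  assert (HLeq : CSeries (fun n => level_mean (N * S n) m (hol_lower tau (N * S n))) = L).
  { rewrite <- (CSeries_eq _ _ HL2). apply CSeries_ext; intros n. cbv zeta. unfold level_mean. f_equal.
    apply sum_units_ext; intros d x _ _ _. f_equal.
    - unfold inv_char. f_equal. f_equal. rewrite <- INR_IZR_INZ. unfold Rdiv; ring.
    - unfold hol_lower, hol_sum. apply CSeries_ext; intros i. f_equal. rewrite <- Cpow_mult_l, <- e2pi_plus.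
      f_equal. f_equal. unfold cusp_shift. rewrite RtoC_mult. ring. }
  rewrite HLeq. clear HLeq HL2.
  unfold eichler, sum_nonzero. rewrite kappa_pred, kappa_eq.
  assert (Hfc := fourier_coeff_poincare N h m (Z.of_nat m) 1). fold n0 in Hfc.
  assert (Hfc' := fun n => Hfc n HN Hh Hm Rabs_R1 ltac:(rewrite <- INR_IZR_INZ; ring)). clear Hfc.
  rewrite (CSeries_eq (fun j => Cmult (Cdiv (fourier_coeff _ (- Z.of_nat (S j))) _) _) (RtoC 0)).
  2:{ eapply has_csum_ext; [|apply has_csum_0]. intros j; cbv beta. rewrite Hfc'.
      destruct (Z.eqb_spec (Z.of_nat m) (- Z.of_nat (S j))); [lia|].
      destruct (Z.ltb_spec 0 (- Z.of_nat (S j))); [lia|]. unfold Cdiv; ring. }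
  rewrite Cplus_0_r. apply CSeries_eq.
  eapply has_csum_ext; [|apply has_csum_plus; [apply (has_csum_single (m - 1))|apply (has_csum_scal (RtoC (poincare_factor h m))), HL1]].
  intros j; cbv beta. rewrite Hfc', <- pow_powerRZ, <- INR_IZR_INZ.
  destruct (Z.ltb_spec 0 (Z.of_nat (S j))); [|lia].
  replace (Z.to_nat (Z.of_nat (S j) - 1)) with j by lia.
  assert (Hn := RtoC_neq_0 _ (Rgt_not_eq _ _ (n_weight j))).
  rewrite qpow_pow, RtoC_mult. replace (Ropp 1) with (-1) by ring.
  destruct (Nat.eqb_spec j (m - 1)) as [Hj|Hj], (Z.eqb_spec (Z.of_nat m) (Z.of_nat (S j))); try lia.
  - replace (INR m) with (INR (S j)) by (f_equal; lia).
    replace (qpow (- Z.of_nat m) tau) with (Cpow (e2pi (Copp tau)) (S j)).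
    + field. exact Hn.
    + rewrite <- qpow_pow. unfold qpow. rewrite opp_IZR, RtoC_opp. f_equal.
      replace (Z.of_nat (S j)) with (Z.of_nat m) by lia. ring.
  - field. exact Hn.
Qed.

(** The principal part q^(-m) of the Poincare series enters at n = -m, with gamma argument 4 pi (-m)
    Im(-tau) = 4 pi m Im tau < 0, where the finite-sum form of the incomplete gamma function is
    essential; the odd power n^n0 reverses the sign. With l = -m the characters require sigma =
    1. *)
Let nh_eichler_lower tau : Im tau < 0 ->
  nh_eichler (2 - k) (poincare N (2 - k) (- Z.of_nat m)) (Copp tau) =
  Cmult (RtoC (- (INR (fact (2 * h)) / (4 * PI) ^ n0)))
   (Cminus (Cmult (RtoC (poincare_factor h m)) (CSeries (fun n => level_mean (N * S n) m (gam_lower tau (N * S n)))))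
     (Cmult (RtoC (GammaStar n0 (4 * PI * INR m * Im tau) / INR m ^ n0)) (qpow (- Z.of_nat m) tau))).
Proof.
  intros Hv. assert (Hpi := PI_RGT_0).
  assert (Hpv : 0 < PI * - Im tau) by (apply Rmult_lt_0_compat; lra).
  destruct (kloosterman_bessel_swap N h m (- Z.of_nat m) 1 1
    (fun i => Cmult (RtoC (gstar n0 (4 * PI * INR (S i) * - Im tau))) (Cpow (e2pi tau) (S i)))
    (PI * - Im tau) HN Hh one_le) as [L [HL1 HL2]].
  { left; reflexivity. }
  { exact Hpv. }
  { apply ex_series_Rle with (fun i => rsum n0 (fun b => / (/ 8) ^ b) * exp (- (PI * - Im tau / 2 * INR (S i)))).
    - intros i; split; [apply Rmult_le_pos; [apply Cmod_ge_0|left; apply exp_pos]|].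
      assert (Hb := Cmod_gstar_e2pi_le n0 (Copp tau) i (/ 8)).
      change (Im (Copp tau)) with (- Im tau) in Hb. replace (Copp (Copp tau)) with tau in Hb by ring.
      eapply Rle_trans; [apply Rmult_le_compat_r; [left; apply exp_pos|apply Hb; lra]|].
      rewrite Rmult_assoc, <- exp_plus. right; f_equal; f_equal. field.
    - apply ex_series_scal_R, ex_series_exp_decay. lra. }
  assert (HLeq : CSeries (fun n => level_mean (N * S n) m (gam_lower tau (N * S n))) = L).
  { rewrite <- (CSeries_eq _ _ HL2). apply CSeries_ext; intros n. cbv zeta. unfold level_mean. f_equal.
    apply sum_units_ext; intros d x _ _ _. f_equal.
    - unfold inv_char. f_equal. f_equal. rewrite opp_IZR, <- INR_IZR_INZ. unfold Rdiv; ring.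
    - unfold gam_lower, gamma_sum. apply CSeries_ext; intros i. f_equal. rewrite <- Cmult_assoc. f_equal.
      rewrite <- Cpow_mult_l, <- e2pi_plus. f_equal. f_equal. unfold cusp_shift. rewrite Rmult_1_l. reflexivity. }
  rewrite HLeq. clear HLeq HL2.
  unfold nh_eichler, sum_nonzero. rewrite kappa_pred, Nat2Z.id.
  replace (1 - (2 - k))%Z with (- Z.of_nat n0)%Z by (unfold k, n0; lia). rewrite kappa_eq.
  assert (Hfc := fourier_coeff_poincare N h m (- Z.of_nat m) (-1)). fold n0 in Hfc.
  assert (Hfc' := fun n => Hfc n HN Hh Hm Rabs_m1 ltac:(rewrite opp_IZR, <- INR_IZR_INZ; ring)). clear Hfc.
  assert (Hf := INR_fact_neq_0 (2 * h)).
  rewrite (CSeries_eq (fun j => Cmult (Cmult (Cdiv (Cconj (fourier_coeff _ (Z.of_nat (S j)))) _) _) _)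
    (Cmult (RtoC (INR (fact (2 * h)) * poincare_factor h m)) L)).
  2:{ eapply has_csum_ext; [|apply (has_csum_scal (RtoC (INR (fact (2 * h)) * poincare_factor h m))), HL1].
      intros j; cbv beta. rewrite Hfc', <- pow_powerRZ, <- INR_IZR_INZ.
      destruct (Z.ltb_spec 0 (Z.of_nat (S j))); [|lia].
      destruct (Z.eqb_spec (- Z.of_nat m) (Z.of_nat (S j))); [lia|].
      replace (Z.to_nat (Z.of_nat (S j) - 1)) with j by lia.
      replace (Ropp (-1)) with 1 by ring.
      rewrite Cplus_0_l, Cmult_conj, kloosterman_bessel_real by auto.
      replace (Cconj (RtoC (poincare_factor h m * INR (S j) ^ n0))) with (RtoC (poincare_factor h m * INR (S j) ^ n0))
        by (apply C_eq; simpl; ring).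
      change (GammaInc n0) with (GammaInc (S (2 * h))). rewrite GammaInc_gstar. fold n0.
      change (Im (Copp tau)) with (- Im tau).
      replace (qpow (- Z.of_nat (S j)) (Copp tau)) with (Cpow (e2pi tau) (S j)).
      2:{ rewrite <- qpow_pow. unfold qpow. rewrite opp_IZR, RtoC_opp. f_equal. ring. }
      assert (Hn := RtoC_neq_0 _ (Rgt_not_eq _ _ (n_weight j))).
      rewrite !RtoC_mult. field. exact Hn. }
  assert (Hm0 : 0 < INR m) by (apply lt_0_INR; lia).
  assert (Hmn : INR m ^ n0 <> 0) by (apply pow_nonzero; lra).
  rewrite (CSeries_eq (fun j => Cmult (Cmult (Cdiv (Cconj (fourier_coeff _ (- Z.of_nat (S j)))) _) _) _)
    (Copp (Cmult (RtoC (INR (fact (2 * h)) * (GammaStar n0 (4 * PI * INR m * Im tau) / INR m ^ n0))) (qpow (- Z.of_nat m) tau)))).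
  2:{ eapply has_csum_ext; [|apply (has_csum_single (m - 1))]. intros j; cbv beta. rewrite Hfc'.
      destruct (Z.ltb_spec 0 (- Z.of_nat (S j))); [lia|].
      destruct (Nat.eqb_spec j (m - 1)) as [Hj|Hj], (Z.eqb_spec (- Z.of_nat m) (- Z.of_nat (S j))); try lia.
      - replace (S j) with m by lia. rewrite <- pow_powerRZ, opp_IZR, <- INR_IZR_INZ.
        change (Im (Copp tau)) with (- Im tau).
        replace (4 * PI * - INR m * - Im tau) with (4 * PI * INR m * Im tau) by ring.
        change (GammaStar n0) with (GammaStar (S (2 * h))). change (GammaInc n0) with (GammaInc (S (2 * h))).
        rewrite GammaStar_gstar, GammaInc_gstar. fold n0.
        replace ((- INR m) ^ n0) with (- INR m ^ n0).
        2:{ replace (- INR m) with (-1 * INR m) by ring. rewrite Rpow_mult_distr.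
            replace ((-1) ^ n0) with (-1); [ring|]. unfold n0; symmetry; apply pow_1_odd. }
        replace (qpow (- - Z.of_nat m) (Copp tau)) with (qpow (- Z.of_nat m) tau).
        2:{ unfold qpow. rewrite !opp_IZR, !RtoC_opp. f_equal. ring. }
        replace (Cconj (Cplus (RtoC 1) (RtoC 0))) with (RtoC 1) by (apply C_eq; simpl; ring).
        assert (HmC := RtoC_neq_0 _ Hmn).
        unfold Rdiv. rewrite !RtoC_mult, RtoC_inv, RtoC_opp by exact Hmn. field. exact HmC.
      - replace (Cconj (Cplus (RtoC 0) (RtoC 0))) with (RtoC 0) by (apply C_eq; simpl; ring).
        unfold Cdiv. ring. }
  rewrite powerRZ_neg, <- pow_powerRZ, pow_inv by lra.
  assert (H4 : (4 * PI) ^ n0 <> 0) by (apply pow_nonzero; lra).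
  replace (RtoC (- (INR (fact (2 * h)) / (4 * PI) ^ n0))) with
    (Cmult (RtoC (- / (4 * PI) ^ n0)) (RtoC (INR (fact (2 * h))))).
  2:{ rewrite <- RtoC_mult. f_equal. field. exact H4. }
  rewrite !(RtoC_mult (INR (fact (2 * h)))). ring.
Qed.

(** a^+(0) cancels against the constant of [phi_plus_lower]. Since m^(1-k) times [poincare_factor]
    is -Cp, the two remaining sums match including their signs, and the terms in q^(-m) agree
    separately. *)
Theorem Hkm_lower tau r : 0 < r < 2 * PI * - Im tau ->
  Hkm N k m r tau =
  Cmult (RtoC (INR m ^ Z.to_nat (1 - k)))
    (Cminus (eichler (2 - k) (poincare N (2 - k) (Z.of_nat m)) (Copp tau))
       (Cmult (RtoC (powerRZ (4 * PI) (1 - k) / INR (fact (Z.to_nat (- k)))))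
          (nh_eichler (2 - k) (poincare N (2 - k) (- Z.of_nat m)) (Copp tau)))).
Proof.
  intros Hr. assert (Hpi := PI_RGT_0). assert (Hv : Im tau < 0) by nra.
  rewrite (eichler_lower tau Hv), (nh_eichler_lower tau Hv).
  set (P1 := fun n => level_mean (N * S n) m (fun _ => constant_term (N * S n))).
  set (P2 := fun n => level_mean (N * S n) m (hol_lower tau (N * S n))).
  set (P3 := fun n => level_mean (N * S n) m (gam_lower tau (N * S n))).
  assert (S1 : has_csum P1 (CSeries P1)) by exact has_csum_constant.
  assert (S2 : has_csum P2 (CSeries P2)) by exact (has_csum_hol_lower tau r Hr).
  assert (S3 : has_csum P3 (CSeries P3)) by exact (has_csum_gam_lower tau r Hr).
  unfold Hkm, Hplus, Hminus. rewrite aplus0_eq. fold P1.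
  unfold sum_mult. rewrite (CSeries_ext _ (fun n => Copp (Cplus (P1 n) (P2 n))) (fun n => Hplus_lower tau r n Hr)).
  rewrite (CSeries_eq _ _ (has_csum_opp _ _ (has_csum_plus _ _ _ _ S1 S2))).
  rewrite (CSeries_ext _ _ (fun n => Hminus_lower tau r n Hr)).
  rewrite (CSeries_eq _ _ (has_csum_scal _ _ _ S3)).
  rewrite k_half, powerRZ_m1, Rpower_half, one_k, opp_k.
  replace (2 * PI * (-1) ^ h * r0 ^ n0) with Cp by reflexivity.
  replace (powerRZ (4 * PI) (1 - k)) with ((4 * PI) ^ n0).
  2:{ rewrite pow_powerRZ. f_equal. unfold k, n0; lia. }
  assert (Hf := INR_fact_neq_0 (2 * h)).
  assert (Hm0 : 0 < INR m) by (apply lt_0_INR; lia).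
  assert (Hmn : INR m ^ n0 <> 0) by (apply pow_nonzero; lra).
  assert (H4 : (4 * PI) ^ n0 <> 0) by (apply pow_nonzero; lra).
  assert (Hpv : (4 * PI * - Im tau) ^ n0 <> 0).
  { apply pow_nonzero. assert (0 < PI * - Im tau) by (apply Rmult_lt_0_compat; lra). lra. }
  (* n0 is odd and Im tau negative, so (4 pi v)^n0 differs in sign from the power of 4 pi |v| that
     the gamma integral produces. *)
  replace (Cmult (RtoC (2 * PI * (-1) ^ h * (4 * PI * Im tau) ^ n0 / INR (fact (2 * h)) * r0 ^ n0))
      (Cmult (RtoC (INR (fact (2 * h)) / (4 * PI * - Im tau) ^ n0)) (CSeries P3)))
    with (Copp (Cmult (RtoC Cp) (CSeries P3))).
  2:{ rewrite Cmult_assoc, <- RtoC_mult.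
      replace (2 * PI * (-1) ^ h * (4 * PI * Im tau) ^ n0 / INR (fact (2 * h)) * r0 ^ n0 *
        (INR (fact (2 * h)) / (4 * PI * - Im tau) ^ n0)) with (- Cp); [rewrite RtoC_opp; ring|].
      replace (4 * PI * Im tau) with (-1 * (4 * PI * - Im tau)) by ring.
      rewrite (Rpow_mult_distr (-1)). replace ((-1) ^ n0) with (-1) by (unfold n0; symmetry; apply pow_1_odd).
      unfold Cp. field; auto. }
  set (q := qpow (- Z.of_nat m) tau). set (G := GammaStar _ _).
  replace (Cmult (RtoC ((4 * PI) ^ n0 / INR (fact (2 * h)))) (Cmult (RtoC (- (INR (fact (2 * h)) / (4 * PI) ^ n0)))
     (Cminus (Cmult (RtoC (poincare_factor h m)) (CSeries P3)) (Cmult (RtoC (G / INR m ^ n0)) q))))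
    with (Copp (Cminus (Cmult (RtoC (poincare_factor h m)) (CSeries P3)) (Cmult (RtoC (G / INR m ^ n0)) q))).
  2:{ rewrite Cmult_assoc, <- RtoC_mult.
      replace ((4 * PI) ^ n0 / INR (fact (2 * h)) * - (INR (fact (2 * h)) / (4 * PI) ^ n0)) with (-1) by (field; auto).
      ring. }
  assert (EF : Cmult (RtoC (INR m ^ n0)) (RtoC (poincare_factor h m)) = Copp (RtoC Cp))
    by (rewrite <- RtoC_mult, factor_m, RtoC_opp; reflexivity).
  assert (HmC := RtoC_neq_0 _ Hmn).
  transitivity (Cminus (Cplus q (Cmult (Cmult (RtoC (INR m ^ n0)) (RtoC (poincare_factor h m))) (Cplus (CSeries P2) (CSeries P3))))
    (Cmult (RtoC G) q)).
  - rewrite EF. ring.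
  - unfold Rdiv. rewrite RtoC_mult, RtoC_inv by exact Hmn. field. exact HmC.
Qed.

End Main.

Theorem theorem1p1 :
  forall (N : nat) (k : Z) (m : nat),
    (1 <= N)%nat -> (k <= -2)%Z -> Z.Even k -> (1 <= m)%nat ->
    forall (tau : C), Im tau <> 0 ->
    forall (r : R), 0 < r < 2 * PI * Rabs (Im tau) ->
      (* convergence of H_{k,m}(tau) *)
      ex_Cseries (fun n => aplus0_term k m (N * S n)) /\
      ex_Cseries (fun n => Hplus_term k m r tau (N * S n)) /\
      (forall c d : nat, (0 < c)%nat -> Nat.divide N c -> (d < c)%nat ->
         Nat.gcd d c = 1%nat ->
         @ex_RInt_gen C_R_NormedModule (phi_minus_integrand k m r c d tau)
            (at_point 1) (Rbar_locally p_infty)) /\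
      ex_Cseries (fun n => Hminus_term k m r tau (N * S n)) /\
      (* tau in the upper half-plane *)
      (0 < Im tau -> Hkm N k m r tau = maass_poincare N k m tau) /\
      (* tau in the lower half-plane *)
      (Im tau < 0 ->
         Hkm N k m r tau =
         Cmult (RtoC (INR m ^ Z.to_nat (1 - k)))
           (Cminus (eichler (2 - k) (poincare N (2 - k) (Z.of_nat m)) (Copp tau))
                   (Cmult (RtoC (powerRZ (4 * PI) (1 - k) / INR (fact (Z.to_nat (- k)))))
                          (nh_eichler (2 - k) (poincare N (2 - k) (- Z.of_nat m)) (Copp tau))))).
Proof.
  intros N k m HN Hk [j Hj] Hm tau Ht r Hr.
  assert (Ek : k = (- Z.of_nat (2 * Z.to_nat (- j)))%Z) by lia.
  assert (Hh : (1 <= Z.to_nat (- j))%nat) by lia.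
  rewrite Ek. destruct (ex_Cseries_terms N (Z.to_nat (- j)) m HN Hh Hm tau r Hr) as (H1 & H2 & H3).
  repeat split.
  - exact (ex_Cseries_has_csum _ _ (has_csum_aplus0_term N (Z.to_nat (- j)) m HN Hh Hm)).
  - exact H1.
  - intros c d Hc _ _ _. apply H2, Hc.
  - exact H3.
  - intros Hv. rewrite Rabs_pos_eq in Hr by lra. apply Hkm_upper; assumption.
  - intros Hv. rewrite Rabs_left in Hr by lra. apply Hkm_lower; assumption.
Qed.
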